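(* Let $s\in(0,1]$, $l>0$ and $d>0$. Then there exists $\tau\in(1,2]$ such that, for every size function $\sigma(\varepsilon)>0$ satisfying, as $\varepsilon\to0$, $\sigma(\varepsilon)/\varepsilon\le C$ for a fixed $C>0$ and $\varepsilon^\tau/\sigma(\varepsilon)\to 0$, there exist $\varepsilon_0>0$ and a (large) constant $L>0$ such that for every $\varepsilon\in(0,\varepsilon_0)$ the gSQG equation has a travelling-wave solution, $l$-periodic in $x_2$, of the form $\vartheta_\varepsilon(x,t)=\vartheta_{0,\varepsilon}(x-tW_\varepsilon\boldsymbol e_2)$ with $W_\varepsilon\in\mathbb R$, where $\vartheta_{0,\varepsilon}\in C^1(\mathbb R^2)$ is symmetric with respect to each line $x_2=kl$, $k\in\mathbb Z$, and has the form $$\vartheta_{0,\varepsilon}(x)=\sum_{k\in\mathbb Z}\vartheta_{1,\varepsilon}(x+kl\boldsymbol e_2)-\sum_{k\in\mathbb Z}\vartheta_{2,\varepsilon}(x+kl\boldsymbol e_2),$$ with $\mathrm{supp}(\vartheta_{1,\varepsilon})\subset B_{L\varepsilon}((-d,0))$ and $\mathrm{supp}(\vartheta_{2,\varepsilon})\subset B_{L\sigma(\varepsilon)}((d,0))$. The speed satisfies $$W_\varepsilon=\mathcal C_s\lim_{N\to\infty}\sum_{|k|\le N}\frac{2d}{(4d^2+k^2l^2)^{2-s}}+o_\varepsilon(1)\qquad\text{as }\varepsilon\to0.$$ Moreover, in the sense of measures, $$\vartheta_{0,\varepsilon}(x)\rightharpoonup\sum_{k\in\mathbb Z}\boldsymbol\delta_{(-d,kl)}(x)-\sum_{k\in\mathbb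 Z}\boldsymbol\delta_{(d,kl)}(x)\qquad\text{as }\varepsilon\to0.$$
   Context: The generalized surface quasi-geostrophic (gSQG) equation with parameter $0<s\le1$ is $$\partial_t\vartheta+\mathbf v\cdot\nabla\vartheta=0,\qquad \mathbf v=\nabla^\perp\psi,\qquad \psi=(-\Delta)^{-s}\vartheta\qquad\text{in }\mathbb R^2,$$ where $\nabla^\perp=(\partial_{x_2},-\partial_{x_1})$ and $(-\Delta)^{-s}\vartheta(x)=\int_{\mathbb R^2}G_s(x-y)\vartheta(y)\,dy$, with $G_s(x)=\frac1{2\pi}\ln\frac1{|x|}$ if $s=1$ and $G_s(x)=c_s|x|^{2s-2}$, $c_s=\frac{\Gamma(1-s)}{2^{2s}\pi\Gamma(s)}$, if $0<s<1$. The case $s=1$ is the 2D incompressible Euler equation in vorticity form. For functions that are $l$-periodic in $x_2$, the stream function is understood through the periodized kernel $\sum_{k\in\mathbb Z}G_s(x+kl\boldsymbol e_2)$ acting on one period $\mathbb R\times(-l/2,l/2)$, the sum over periods being taken as the limit of the symmetric partial sums $|k|\le N$ of the combined contribution of the positive and negative vortices. A function $\vartheta_0(x-t\mathbf U)$ is a travelling-wave solution when $(\nabla^\perp\psi_0-\mathbf U)\cdot\nabla\vartheta_0=0$ in $\mathbb R^2$, with $\psi_0=(-\Delta)^{-s}\vartheta_0$. Constants: $\mathcal C_s=\frac1{2\pi}$ if $s=1$, and $\mathcal C_s=(2-2s)c_s$ if $0<s<1$. $\boldsymbol e_2=(0,1)$; $B_r(z)$ is the open disc of radius $r$ centred at $z$;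 $\boldsymbol\delta_z$ is the Dirac measure at $z$; $o_\varepsilon(1)$ denotes a quantity tending to $0$ as $\varepsilon\to0$. The functions $\vartheta_{1,\varepsilon},\vartheta_{2,\varepsilon}$ belong to $C^1(\mathbb R^2)$. *)

(* Defs.v *)
From HB Require Import structures.
From mathcomp Require Import all_boot all_order all_algebra.
From mathcomp Require Import all_classical all_reals all_analysis.
Import Order.TTheory GRing.Theory Num.Theory.
Import numFieldNormedType.Exports.

Set Implicit Arguments.
Unset Strict Implicit.
Unset Printing Implicit Defensive.

Local Open Scope classical_set_scope.
Local Open Scope ring_scope.

Section gSQG.
Variable R : realType.

(* The plane is R * R: its topology, differentials and product sigma-algebra
   are the usual ones, but the library norm on a product is the sup norm, so
   the Euclidean norm and discs are defined separately. *)
Notation plane := (R * R)%type.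

Definition e1 : plane := (1, 0).
Definition e2 : plane := (0, 1).
Definition leb2 :
    {measure set (measurableTypeR R * measurableTypeR R) -> \bar R} :=
  (@lebesgue_measure R \x @lebesgue_measure R)%E.

Definition dot (x y : plane) : R := x.1 * y.1 + x.2 * y.2.
Definition enorm (x : plane) : R := Num.sqrt (dot x x).
Definition disc (z : plane) (r : R) : set plane := [set x | enorm (x - z) < r].

Definition supp (f : plane -> R) : set plane := closure [set x | f x != 0].

Definition grad (f : plane -> R) (x : plane) : plane := ('D_e1 f x, 'D_e2 f x).
Definition gradperp (f : plane -> R) (x : plane) : plane :=
  ('D_e2 f x, - 'D_e1 f x).

Definition C1 (f : plane -> R) : Prop :=
  [/\ forall x, differentiable f x, continuous ('D_e1 f)
    & continuous ('D_e2 f)].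

(* Only used at z > 0, where Euler's integral converges. *)
Definition Gamma (z : R) : R :=
  \int[lebesgue_measure]_(t in `]0, +oo[) (t `^ (z - 1) * expR (- t)).

Definition c_ (s : R) : R := Gamma (1 - s) / (2 `^ (2 * s) * pi * Gamma s).

(* The value at the origin is irrelevant (null set). *)
Definition G (s : R) (x : plane) : R :=
  if s == 1 then (2 * pi)^-1 * ln (enorm x)^-1
  else c_ s * enorm x `^ (2 * s - 2).

Definition Cs (s : R) : R :=
  if s == 1 then (2 * pi)^-1 else (2 - 2 * s) * c_ s.

(* Sum of F k over the integers k with |k| <= N. *)
Definition symsum (N : nat) (F : int -> R) : R :=
  \sum_(j < N.*2.+1) F ((j : nat)%:Z - N%:Z).

Definition shift2 (l : R) (k : int) (x : plane) : plane :=
  x + (k%:~R * l) *: e2.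

Definition strip (l : R) : set plane := [set y | - (l / 2) < y.2 < l / 2].

Definition perG (s l : R) (N : nat) (x : plane) : R :=
  symsum N (fun k => G s (shift2 l k x)).

(* psi = (-Delta)^(-s) theta for theta l-periodic in x_2. Convergence of the
   symmetric partial sums is part of the definition; as theta carries both
   signs, it can hold even where the periodized kernel itself diverges. *)
Definition stream_function (s l : R) (theta psi : plane -> R) : Prop :=
  forall x,
    (forall N, leb2.-integrable (strip l)
      (fun y => (perG s l N (x - y) * theta y)%:E)) /\
    (\int[leb2]_(y in strip l) (perG s l N (x - y) * theta y)) @[N --> \oo]
      --> psi x.

(* theta0 (x - t U) is a travelling wave of the gSQG equation. *)
Definition travelling_wave (s l : R) (theta0 : plane -> R) (U : plane) : Prop :=
  exists psi0 : plane -> R,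
    [/\ stream_function s l theta0 psi0,
        forall x, differentiable psi0 x
      & forall x, dot (gradperp psi0 x - U) (grad theta0 x) = 0].

Definition periodic2 (l : R) (f : plane -> R) : Prop :=
  forall x, f (x + l *: e2) = f x.

(* Invariance under reflection across the line x_2 = a. *)
Definition symmetric2 (a : R) (f : plane -> R) : Prop :=
  forall x : plane, f (x.1, 2 * a - x.2) = f x.

(* The finitely supported sum \sum_(_ \in _) is the full sum whenever f has
   bounded support and l <> 0: then only finitely many k contribute at each x. *)
Definition periodize (l : R) (f : plane -> R) (x : plane) : R :=
  \sum_(k \in [set: int]) f (shift2 l k x).

Definition test_function (phi : plane -> R) : Prop :=
  continuous phi /\ compact (supp phi).

(* Integral of a compactly supported phi against
   \sum_k delta_(a, kl); only finitely many terms are nonzero when l <> 0. *)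
Definition int_dirac_row (l a : R) (phi : plane -> R) : R :=
  \sum_(k \in [set: int]) \int[\d_((a, k%:~R * l) : plane)]_x phi x.

(* Convergence in the sense of measures, i.e. tested on C_c, of the measures
   theta eps dx to \sum_k delta_(a, kl) - \sum_k delta_(b, kl). *)
Definition cvg_dirac_rows (l a b : R) (theta : R -> plane -> R) : Prop :=
  forall phi, test_function phi ->
    (\int[leb2]_x (theta eps x * phi x)) @[eps --> 0^'+]
      --> int_dirac_row l a phi - int_dirac_row l b phi.

End gSQG.

Arguments e1 {R}.
Arguments e2 {R}.

(* Main.v *)
(** The second row is taken to be the mirror image of the first in the axis
    [x_1 = 0], so only one vortex has to be found, and [tau = 2] is no
    restriction: a vortex of radius [r = min eps (sigma eps)] fits in both discs.

    Near [(-d, 0)] the stream function of the street is the potential of the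
    vortex plus the integral of an image kernel [H], which is bounded and
    Lipschitz; translating both arguments by [t e_1] changes [H] by
    [- 2 t W_0 + O(r t)], where [W_0] is the limit speed. The vortex is
    [Lam * smoothstep p], where [p] maximizes
    [1/2 <vort, (G + H + W_0 (x_1 + y_1) - M x_1 y_1 - mu) vort> - <vort, V> - Lam * \int entropy p]
    among the Lipschitz functions [0 <= p <= 1] supported in a box and even in
    [x_2]. The constant [mu] plays the role of a mass constraint, and the wall
    [V] keeps [p] away from the boundary of the box. The potential of a
    [K]-Lipschitz density has Lipschitz constant at most [eta K + C_eta] with
    [eta] arbitrarily small, so for large [K] the Lipschitz constraint is
    inactive, and [p] is a function of the stream function.

    A maximizer concentrates: each of its points carries a fixed fraction of the
    mass at a small distance, and a gap in the support would let the pieces gain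
    energy by moving closer to each other. Hence the support has diameter
    [O(r)] with a small constant. Comparing with translates, the term
    [M x_1 y_1] puts the centre of mass [X] within [r / 16] of the origin, so
    that the wall is not felt; the term itself becomes the correction [- M X]
    of the speed [W_0]. *)

Require Import Defs.
From HB Require Import structures.
From mathcomp Require Import all_boot all_order all_algebra.
From mathcomp Require Import all_classical all_reals all_analysis.
From mathcomp Require Import measurable_realfun ring lra zify.
Import Order.TTheory GRing.Theory Num.Theory.
Import numFieldNormedType.Exports.
Local Open Scope classical_set_scope.
Local Open Scope ring_scope.
Set Implicit Arguments.
Unset Strict Implicit.
Unset Printing Implicit Defensive.

(** * Integration over the plane *)

(** For $s \le 1/2$ the gradient of the kernel is not locally integrable, so a bounded density need
    not have a Lipschitz potential. Differences of potentials are therefore put on the density: this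
    uses only the integrability of the kernel, and costs a multiple of the Lipschitz constant of the
    density that becomes small once a regular part is split off. Hence Lipschitz bounds are built
    into the variational class, where the Euler-Lagrange map sends [K]-Lipschitz densities to
    [K]-Lipschitz densities. The class is also compact for pointwise convergence, which gives
    maximizers.

    The scales are fixed in a definite order: the mass fraction [be] and the number [N] depend on
    [s] only; then [r] is taken small; last comes the core radius [a], so small that the
    self-interaction [gam s (a ^+ 2)] dominates all bounded terms. The level [mu] is half of a fixed
    fraction of this self-interaction. It enters the kernel as an additive constant and so leaves
    its Lipschitz constant alone, which is the only quantity opposing the contraction of the
    support. The attraction gains a factor of order $1/r$ and wins for small [r]. *)

Section preserving_map.
Context d (T : measurableType d) (R : realType) (mu : {measure set T -> \bar R}).
Variables (phi : T -> T) (mphi : measurable_fun setT phi).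
Hypothesis phiP : forall A, measurable A -> mu (phi @^-1` A) = mu A.

Lemma ge0_integral_preserving (f : T -> \bar R) : measurable_fun setT f ->
  (forall x, (0 <= f x)%E) -> (\int[mu]_x f (phi x) = \int[mu]_x f x)%E.
Proof.
move=> mf f0.
have E1 := @ge0_integral_pushforward _ _ _ _ R phi mphi mu setT f measurableT mf (fun _ _ => f0 _).
rewrite preimage_setT in E1; rewrite -[LHS]E1.
by apply: eq_measure_integral => A mB _; exact: phiP.
Qed.

Lemma integrable_preserving (F : T -> R) :
  mu.-integrable setT (EFin \o F) ->
  mu.-integrable setT (EFin \o (fun x => F (phi x))) /\
  \int[mu]_x F (phi x) = \int[mu]_x F x.
Proof.
move=> iF; have mEF := measurable_int _ iF.
have mF : measurable_fun setT F by exact/measurable_EFinP.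
have iFp : mu.-integrable setT (EFin \o (fun x => F (phi x))).
  apply/integrableP; split.
    by apply/measurable_EFinP; exact: (measurableT_comp mF mphi).
  move/integrableP: iF => [_].
  rewrite -(@ge0_integral_preserving (fun x => `|(EFin \o F) x|%E)) //.
  exact: measurableT_comp.
split=> //; rewrite /Rintegral; congr fine.
have iFp' : mu.-integrable (phi @^-1` setT) ((EFin \o F) \o phi).
  by rewrite preimage_setT.
have E1 := @integral_pushforward _ _ _ _ R phi mphi mu setT (EFin \o F) mEF iFp' measurableT.
rewrite preimage_setT in E1; rewrite -[LHS]E1.
by apply: eq_measure_integral => A mB _; exact: phiP.
Qed.

End preserving_map.

Section plane_integral.
Variable R : realType.
Notation mR := (measurableTypeR R).
Notation plane := (mR * mR)%type.
Notation leb := (@lebesgue_measure R).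
Notation leb2 := (@leb2 R).

Lemma lebesgue_measure_shift (h : R) (A : set R) : measurable A ->
  leb ((fun x => x + h) @^-1` A) = leb A.
Proof.
have ms : measurable_fun [set: mR] (fun x : mR => (x + h : mR)).
  exact: measurable_funD.
pose s : {mfun mR >-> mR} := HB.pack (fun x : mR => (x + h : mR)) (isMeasurableFun.Build _ _ _ _ _ ms).
move=> mA; apply/esym.
apply: (@lebesgue_measure_unique R (pushforward leb s)) => // X.
move=> [[a b] _ <-] /=.
rewrite /pushforward /=.
have -> : (fun x : R => x + h) @^-1` `]a, b] = `]a - h, b - h]%classic.
  by apply/seteqP; split=> x /=; rewrite !in_itv /= ltrBlDr lerBrDr.
rewrite !lebesgue_measure_itv /= !lte_fin ltrD2r.
by case: ifP => // _; congr (_%:E); ring.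
Qed.

Lemma lebesgue_measure_opp (A : set R) : measurable A ->
  leb (-%R @^-1` A) = leb A.
Proof. by move=> mA; rewrite -[RHS]lebesgue_measureN. Qed.

Lemma leb2X (A B : set mR) : measurable A -> measurable B ->
  leb2 (A `*` B) = (leb A * leb B)%E.
Proof. by move=> mA mB; exact: (@product_measure1E _ _ _ _ R leb leb A B mA mB). Qed.

(** A measure on the plane is determined by its values on rectangles, so one-dimensional
    measure-preserving maps suffice; shifts and reflections are products of such maps. *)
Lemma leb2_map (f g : mR -> mR) :
  measurable_fun setT f -> measurable_fun setT g ->
  (forall A : set mR, measurable A -> leb (f @^-1` A) = leb A) ->
  (forall A : set mR, measurable A -> leb (g @^-1` A) = leb A) ->
  forall A : set plane, measurable A ->
  leb2 ((fun x => (f x.1, g x.2)) @^-1` A) = leb2 A.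
Proof.
move=> mf mg lf lg.
have ms : measurable_fun [set: plane] (fun x : plane => (f x.1, g x.2) : plane).
  by apply: measurable_fun_pair; apply: measurableT_comp.
pose s : {mfun plane >-> plane} := HB.pack (fun x : plane => (f x.1, g x.2) : plane) (isMeasurableFun.Build _ _ _ _ _ ms).
move=> A mA; apply/esym.
apply: (@product_measure_unique _ _ _ _ _ leb leb (pushforward leb2 s)) => // X Y mX mY.
have E : leb2 ((f @^-1` X) `*` (g @^-1` Y)) = (leb X * leb Y)%E.
  rewrite leb2X ?lf ?lg //.
  - by rewrite -[X in measurable X]setTI; exact: mf.
  - by rewrite -[X in measurable X]setTI; exact: mg.
exact: E.
Qed.

Implicit Types (F H : plane -> R) (x z h : plane).

(** Wrapped in an inductive type so that integrability over the plane is not unfolded; [igP]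
    converts it. *)
Inductive ig (F : plane -> R) : Prop :=
  Ig of leb2.-integrable setT (EFin \o F).
Definition I (F : plane -> R) : R := \int[leb2]_x F x.

Lemma I_E F : I F = fine (\int[leb2]_x (F x)%:E)%E.
Proof. by []. Qed.

Lemma igP F : ig F <-> leb2.-integrable setT (EFin \o F).
Proof. by split=> [[]|]. Qed.

Lemma ig_measurable F : ig F -> measurable_fun setT F.
Proof. by case=> /measurable_int/measurable_EFinP. Qed.

Lemma I_shift F (h : plane) : ig F ->
  ig (fun x => F (x + h)) /\ I (fun x => F (x + h)) = I F.
Proof.
move=> /igP iF; suff [] : leb2.-integrable setT (EFin \o (fun x => F (x + h))) /\ I (fun x => F (x + h)) = I F by move=> /igP.
apply: (@integrable_preserving _ _ _ leb2 (fun x : plane => (x.1 + h.1, x.2 + h.2))).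
- by apply: measurable_fun_pair; apply: measurable_funD.
- apply: (@leb2_map (fun t => t + h.1) (fun t => t + h.2)); try (by apply: measurable_funD); exact: lebesgue_measure_shift.
- exact: iF.
Qed.

Lemma I_refl1 F : ig F ->
  ig (fun x => F (- x.1, x.2)) /\ I (fun x => F (- x.1, x.2)) = I F.
Proof.
move=> /igP iF; suff [] : leb2.-integrable setT (EFin \o (fun x => F (- x.1, x.2))) /\ I (fun x => F (- x.1, x.2)) = I F by move=> /igP.
apply: (@integrable_preserving _ _ _ leb2 (fun x : plane => (- x.1, x.2))).
- by apply: measurable_fun_pair => //; apply: measurableT_comp.
- apply: (@leb2_map -%R id) => // A mA; exact: lebesgue_measure_opp.
- exact: iF.
Qed.

Lemma I_refl2 F : ig F ->
  ig (fun x => F (x.1, - x.2)) /\ I (fun x => F (x.1, - x.2)) = I F.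
Proof.
move=> /igP iF; suff [] : leb2.-integrable setT (EFin \o (fun x => F (x.1, - x.2))) /\ I (fun x => F (x.1, - x.2)) = I F by move=> /igP.
apply: (@integrable_preserving _ _ _ leb2 (fun x : plane => (x.1, - x.2))).
- by apply: measurable_fun_pair => //; apply: measurableT_comp.
- apply: (@leb2_map id -%R) => // A mA; exact: lebesgue_measure_opp.
- exact: iF.
Qed.

Lemma I_subx F (x : plane) : ig F ->
  ig (fun y => F (x - y)) /\ I (fun y => F (x - y)) = I F.
Proof.
move=> iF.
have [i1 e1] := I_shift x iF.
have [i2 e2] := I_refl1 i1.
have [i3 e3] := I_refl2 i2.
split.
  by move: i3; congr ig; apply/funext=> y /=; congr F; rewrite addrC.
rewrite -e1 -e2 -e3; congr I; apply/funext=> y /=; congr F; rewrite addrC.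
by [].
Qed.

Lemma igD F H : ig F -> ig H -> ig (fun x => F x + H x).
Proof. by move=> /igP iF /igP iH; apply/igP; exact: (integrableD measurableT iF iH). Qed.
Lemma igB F H : ig F -> ig H -> ig (fun x => F x - H x).
Proof. by move=> /igP iF /igP iH; apply/igP; exact: (integrableB measurableT iF iH). Qed.
Lemma igZ c F : ig F -> ig (fun x => c * F x).
Proof. by move=> /igP iF; apply/igP; exact: (integrableZl measurableT c iF). Qed.
Lemma ig_le F H : measurable_fun setT F -> ig H ->
  (forall x, `|F x| <= H x) -> ig F.
Proof.
move=> mF /igP iH FH; apply/igP; apply: (le_integrable measurableT _ _ iH).
- exact/measurable_EFinP.
- move=> x _ /=; rewrite lee_fin; apply: le_trans (FH x) _; exact: ler_norm.
Qed.
Lemma ig_abs F : ig F -> ig (fun x => `|F x|).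
Proof.
move=> iF; have := iF => /igP iF'; apply/igP; apply: (le_integrable measurableT _ _ iF').
- apply/measurable_EFinP; apply: measurableT_comp => //; exact: ig_measurable.
- by move=> x _ /=; rewrite normr_id.
Qed.
Lemma ID F H : ig F -> ig H -> I (fun x => F x + H x) = I F + I H.
Proof. by move=> /igP iF /igP iH; exact: RintegralD. Qed.
Lemma IB F H : ig F -> ig H -> I (fun x => F x - H x) = I F - I H.
Proof. by move=> /igP iF /igP iH; exact: RintegralB. Qed.
Lemma IZ c F : ig F -> I (fun x => c * F x) = c * I F.
Proof. by move=> /igP iF; exact: RintegralZl. Qed.
Lemma I_mono F H : ig F -> ig H -> (forall x, F x <= H x) -> I F <= I H.
Proof. by move=> /igP iF /igP iH FH; apply: le_Rintegral. Qed.
Lemma I_ge0 F : (forall x, 0 <= F x) -> 0 <= I F.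
Proof. by move=> F0; apply: Rintegral_ge0. Qed.
Lemma I_abs F : ig F -> `|I F| <= I (fun x => `|F x|).
Proof. by move=> /igP iF; apply: le_normr_Rintegral. Qed.
Lemma I0 : I (fun=> 0) = 0.
Proof. by rewrite /I Rintegral_cst // mul0r. Qed.

Definition box (z : plane) (r : R) : set plane :=
  `[z.1 - r, z.1 + r]%classic `*` `[z.2 - r, z.2 + r]%classic.

Lemma boxP z r (x : plane) :
  box z r x <-> `|x.1 - z.1| <= r /\ `|x.2 - z.2| <= r.
Proof.
by rewrite /box /= !in_itv /= !ler_distl.
Qed.

Lemma measurable_box z r : measurable (box z r).
Proof. by apply: measurableX; exact: measurable_itv. Qed.

Lemma leb2_box z r : 0 <= r -> leb2 (box z r) = ((2 * r) ^+ 2)%:E.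
Proof.
move=> r0; rewrite /box leb2X //.
rewrite !lebesgue_measure_itv /= !lte_fin.
have H (a : R) : (if a - r < a + r then ((a + r)%:E - (a - r)%:E)%E else 0%E) = (2 * r)%:E.
  case: ifP => h; first by rewrite -EFinB; congr (_%:E); ring.
  by congr (_%:E); move/negbT: h; rewrite -leNgt; lra.
by rewrite !H -EFinM expr2.
Qed.

Lemma ig_indic_box z r : 0 <= r -> ig (\1_(box z r)).
Proof.
move=> r0; apply/igP/integrableP; split.
  apply/measurable_EFinP; apply: measurable_indic; exact: measurable_box.
rewrite (eq_integral (EFin \o \1_(box z r))); last first.
  by move=> x _ /=; rewrite ger0_norm // indicE; case: (_ \in _).
rewrite integral_indic //; last exact: measurable_box.
by rewrite setIT [X in (X < _)%E](leb2_box z r0) ltry.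
Qed.

Lemma I_indic_box z r : 0 <= r -> I (\1_(box z r)) = (2 * r) ^+ 2.
Proof.
move=> r0; rewrite /I /Rintegral integral_indic //; last exact: measurable_box.
by rewrite setIT [X in fine X](leb2_box z r0).
Qed.

Lemma ig_bounded z r C F : 0 <= r -> measurable_fun setT F ->
  (forall x, `|F x| <= C) -> (forall x, ~ box z r x -> F x = 0) -> ig F.
Proof.
move=> r0 mF FC F0; apply: (ig_le mF (igZ C (ig_indic_box z r0))) => x.
rewrite indicE; case: (asboolP (box z r x)) => bx.
  by rewrite mem_set // mulr1.
by rewrite memNset // mulr0 F0 // normr0.
Qed.

Lemma I_bounded z r C F : 0 <= r -> measurable_fun setT F ->
  (forall x, `|F x| <= C) -> (forall x, ~ box z r x -> F x = 0) ->
  `|I F| <= C * (2 * r) ^+ 2.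
Proof.
move=> r0 mF FC F0; have iF := ig_bounded r0 mF FC F0.
apply: le_trans (I_abs iF) _.
rewrite -(I_indic_box z r0) -IZ; last exact: ig_indic_box.
apply: I_mono; [exact: ig_abs|exact/igZ/ig_indic_box|move=> x].
rewrite indicE; case: (asboolP (box z r x)) => bx.
  by rewrite mem_set // mulr1.
by rewrite memNset // mulr0 F0 // normr0.
Qed.

(** The value of a kernel at the origin is a convention. Majorants absorb it by the indicator of a
    point, which costs nothing after integration. *)
Lemma I_point x : ig (\1_[set x]) /\ I (\1_[set x]) = 0.
Proof.
have xE : [set x] = [set x.1] `*` [set x.2].
  by apply/seteqP; split=> [y ->|[a b] [/= -> ->]] //; rewrite -surjective_pairing.
have mx : measurable [set x : plane] by rewrite xE; apply: measurableX.
have e : leb2 [set x] = 0%E.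
  rewrite xE.
  by rewrite leb2X // !lebesgue_measure_set1 mule0.
split.
  apply/igP/integrableP; split.
    by apply/measurable_EFinP; apply: measurable_indic.
  rewrite (eq_integral (EFin \o \1_[set x])); last first.
    by move=> y _ /=; rewrite ger0_norm // indicE; case: (_ \in _).
  by rewrite integral_indic // setIT [X in (X < _)%E]e.
by rewrite /I /Rintegral integral_indic // setIT [X in fine X]e.
Qed.

End plane_integral.
Global Opaque I.

(** * Euler's integral *)

Section one_dim.
Variable R : realType.
Notation leb := (@lebesgue_measure R).

Lemma derivable_power (a x : R) : 0 < x -> derivable (fun t => t `^ a) x 1.
Proof. by move=> x0; have [] := is_derive1_powR a x0. Qed.

Lemma continuous_power (a x : R) : 0 < x -> {for x, continuous (fun t : R => t `^ a)}.
Proof.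
move=> x0; apply: (@differentiable_continuous _ R^o R^o).
by apply/derivable1_diffP; exact: derivable_power.
Qed.

Lemma integral_power_Icc (a u b : R) : 0 < a -> 0 < u -> u < b ->
  (\int[leb]_(x in `[u, b]) (x `^ (a - 1))%:E = (b `^ a / a)%:E - (u `^ a / a)%:E)%E.
Proof.
move=> a0 u0 ub.
have dF (x : R) : 0 < x -> is_derive x 1 (fun x : R => x `^ a / a) (x `^ (a - 1)).
  move=> x0.
  have D := is_derive1_powR a x0.
  have := @is_deriveZ _ _ _ (fun x : R => x `^ a) a^-1 x 1 _ D.
  have -> : a^-1 *: (a * x `^ (a - 1)) = x `^ (a - 1).
    by rewrite /GRing.scale /= mulrA mulVf ?mul1r // gt_eqF.
  by congr is_derive; apply/funext => t; rewrite /= [RHS]mulrC.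
have cF (x : R) : 0 < x -> {for x, continuous (fun x : R => x `^ a / a)}.
  move=> x0; apply: (@differentiable_continuous _ R^o R^o).
  by apply/derivable1_diffP; case: (dF x x0).
rewrite (@continuous_FTC2 _ _ (fun x => x `^ a / a)) //.
- apply: continuous_in_subspaceT => x; rewrite inE /= in_itv /= => /andP[ux _].
  by apply: continuous_power; exact: lt_le_trans ux.
- split.
  + move=> x; rewrite in_itv /= => /andP[ux _].
    by case: (dF x (lt_trans u0 ux)).
  + by apply: cvg_at_right_filter; exact: cF.
  + by apply: cvg_at_left_filter; apply: cF; exact: lt_trans ub.
- move=> x; rewrite in_itv /= => /andP[ux _].
  by rewrite derive1E; case: (dF x (lt_trans u0 ux)).
Qed.

Lemma integral_power_Ioc (a b : R) : 0 < a -> 0 < b ->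
  (\int[leb]_(x in `]0%R, b]) (x `^ (a - 1))%:E <= (b `^ a / a)%:E)%E.
Proof.
move=> a0 b0.
(* Monotone convergence along intervals away from the singularity; [n.+2] keeps the left end
   strictly below [b]. *)
pose F n := `[b / n.+2%:R, b]%classic.
have UF : \bigcup_n F n = `]0, b]%classic.
  apply/seteqP; split=> x /=.
    move=> [n _]; rewrite /F /= !in_itv /= => /andP[h ->]; rewrite andbT.
    by apply: lt_le_trans h; rewrite divr_gt0.
  rewrite in_itv /= => /andP[x0 xb].
  have [n hn] : exists n, b / n.+2%:R <= x.
    exists (Num.truncn (b / x)); rewrite ler_pdivrMr // mulrC -ler_pdivrMr //.
    apply: ltW; apply: lt_le_trans (truncnS_gt _) _.
    by rewrite ler_nat.
  by exists n => //; rewrite /F /= in_itv /= hn xb.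
rewrite -UF.
have ndF : nondecreasing_seq F.
  apply/nondecreasing_seqP => n; rewrite subsetEset /F => x /=.
  rewrite !in_itv /= => /andP[h ->]; rewrite andbT; apply: le_trans h.
  by rewrite ler_pM2l // lef_pV2 ?posrE // ler_nat.
have mf (D : set R) : measurable_fun D (fun x : R => (x `^ (a - 1))%:E).
  by apply/measurable_EFinP; apply: measurable_funTS; exact: measurable_powR.
have C := @ge0_nondecreasing_set_cvg_integral _ (measurableTypeR R) R F (fun x => (x `^ (a - 1))%:E) leb ndF
  (fun i => measurable_itv _) (fun i => mf _) (fun _ _ _ => powR_ge0 _ _).
have -> := esym (cvg_lim (@ereal_hausdorff R) C).
apply: lime_le; first by apply/cvg_ex; eexists; exact: C.
near=> n; rewrite integral_power_Icc //.
- by rewrite -EFinB lee_fin gerBl divr_ge0 // ?powR_ge0 // ltW.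
- by rewrite divr_gt0.
- by rewrite ltr_pdivrMr // ltr_pMr // ltr1n.
Unshelve. all: by end_near. Qed.

(** An infinite integral would be read as the real number [0], so finiteness has to be proved too:
    near [0] the integrand is below $t^{z-1}$, beyond [1] below the exponential density. *)
Lemma Gamma_gt0 (z : R) : 0 < z -> z <= 1 -> 0 < Gamma z.
Proof.
move=> z0 z1; rewrite /Gamma /Rintegral.
set f := fun t : R => t `^ (z - 1) * expR (- t).
have f0 (t : R) : 0 <= f t by rewrite mulr_ge0 ?powR_ge0 ?expR_ge0.
have mf (D : set (measurableTypeR R)) : measurable_fun D (fun t : measurableTypeR R => (f t)%:E).
  apply/measurable_EFinP; apply: measurable_funTS; apply: measurable_funM.
    exact: measurable_powR.
  by apply: measurableT_comp => //; exact: measurable_expR.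
apply: fine_gt0; apply/andP; split.
- have h12 : (0 < \int[leb]_(t in `[1%R, 2%R]) (f t)%:E)%E.
    have c0 : 0 < (2 : R) `^ (z - 1) * expR (- 2) by rewrite mulr_gt0 ?powR_gt0 ?expR_gt0.
    apply: (@lt_le_trans _ _ (\int[leb]_(t in `[1%R, 2%R]) (2 `^ (z - 1) * expR (- 2))%:E)%E).
      have e : leb `[1%R, 2%R]%classic = 1%:E.
        by rewrite lebesgue_measure_itv /= lte_fin ltr1n -EFinB; congr (_%:E); lra.
      by rewrite integral_cst // [X in (_ < _ * X)%E]e mule1 lte_fin.
    apply: ge0_le_integral => //.
    move=> x; rewrite /= in_itv /= => /andP[x1 x2]; rewrite lee_fin /f.
    apply: ler_pM; rewrite ?powR_ge0 ?expR_ge0 //; last by rewrite ler_expR lerN2.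
    have -> : z - 1 = - (1 - z) by ring.
    rewrite !powRN lef_pV2 ?posrE ?powR_gt0 //; last lra.
    apply: ge0_ler_powR; rewrite ?nnegrE; lra.
  apply: lt_le_trans h12 _; apply: ge0_subset_integral => //.
  - by move=> x _; rewrite lee_fin.
  - by move=> x /=; rewrite !in_itv /= andbT => /andP[x1 _]; lra.
- have -> : `]0%R, +oo[%classic = `]0%R, 1%R] `|` `]1%R, +oo[ :> set R.
    apply/seteqP; split=> x /=; rewrite !in_itv /= !andbT.
      by move=> x0; case: (leP x 1) => h; [left|right]; rewrite ?x0 ?h.
    by case=> [/andP[]//|]; apply: lt_trans.
  rewrite ge0_integral_setU //; last first.
    apply/disj_setPS => x /= []; rewrite !in_itv /= andbT => /andP[_ h1] h2.
    by move: (lt_le_trans h2 h1); rewrite ltxx.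
    by move=> x _; rewrite lee_fin; exact: f0.
  apply: lte_add_pinfty.
  - apply: (@le_lt_trans _ _ (\int[leb]_(t in `]0%R, 1%R]) (t `^ (z - 1))%:E)%E).
      apply: ge0_le_integral => //; try exact: mf.
      + by move=> x _; rewrite lee_fin; exact: f0.
      + by apply/measurable_EFinP; apply: measurable_funTS; exact: measurable_powR.
      move=> x; rewrite /= in_itv /= => /andP[x0 x1]; rewrite lee_fin /f.
      by rewrite ler_piMr ?powR_ge0 // -expR0 ler_expR oppr_le0 ltW.
    by apply: le_lt_trans (integral_power_Ioc _ _) _ => //; rewrite ltry.
  - apply: (@le_lt_trans _ _ (\int[leb]_t (exponential_pdf 1 t)%:E)%E); last first.
      by rewrite integral_exponential_pdf // ltry.
    rewrite [leLHS]integral_mkcond.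
    apply: ge0_le_integral => //.
    + by move=> x _; apply: erestrict_ge0 => y _; rewrite lee_fin; exact: f0.
    + by apply: (measurable_restrictT _ _).1 => //; exact: mf.
    + by apply/measurable_EFinP; exact: measurable_exponential_pdf.
    move=> x _; rewrite /patch; case: ifPn => [|_]; last by rewrite lee_fin exponential_pdf_ge0.
    rewrite inE /= in_itv /= andbT => x1.
    rewrite lee_fin exponential_pdfE; last by apply: ltW; exact: lt_trans ltr01 x1.
    rewrite /f mul1r mulN1r ler_piMl ?expR_ge0 //.
    have -> : z - 1 = - (1 - z) by ring.
    rewrite powRN invf_le1 ?powR_gt0 //; last exact: lt_trans ltr01 x1.
    rewrite -[leLHS](powRr0 x); apply: ler_powR; lra.
Qed.

End one_dim.

(** * The radial profile of the kernel *)

Section gam.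
Variable R : realType.
Variable s : R.
Hypotheses (s0 : 0 < s) (s1 : s <= 1).

Local Ltac slra := move: s0 s1; lra.

(** The kernel as a function of the squared distance, which is a polynomial in the coordinates (see
    [G_gam]). The logarithm of the norm is half that of its square. *)
Definition gam (t : R) : R :=
  if s == 1 then - ((4 * pi)^-1 * ln t) else c_ s * t `^ (s - 1).
(** Normalized so that the derivative of [gam] is $-\kappa t^{s-2}$ both for [s = 1] and for
    [s < 1]. *)
Definition kap : R := Cs s / 2.
Definition dgam (t : R) : R := - (kap * t `^ (s - 2)).

Lemma c_gt0 : s != 1 -> 0 < c_ s.
Proof.
move=> sn1; have s1' : s < 1 by rewrite lt_neqAle sn1.
rewrite /c_; apply: divr_gt0.
  by apply: Gamma_gt0; [rewrite subr_gt0|rewrite gerBl ltW].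
by rewrite !mulr_gt0 ?powR_gt0 ?pi_gt0 // Gamma_gt0.
Qed.

Lemma kap_gt0 : 0 < kap.
Proof.
rewrite /kap /Cs; case: ifPn => [_|sn1].
  by rewrite divr_gt0 // invr_gt0 mulr_gt0 // pi_gt0.
have s1' : s < 1 by rewrite lt_neqAle sn1.
apply: divr_gt0 => //; apply: mulr_gt0; [lra | exact: c_gt0].
Qed.

Lemma is_derive_gam (t : R) : 0 < t -> is_derive t 1 gam (dgam t).
Proof.
move=> t0; rewrite /gam /dgam /kap /Cs; case: eqVneq => [->|sn1].
  have D := is_derive1_ln t0.
  have D2 := @is_deriveZ _ _ _ (@ln R) (- (4 * pi)^-1) t 1 _ D.
  have -> : - ((2 * pi)^-1 / 2 * t `^ (1 - 2)) = - (4 * pi)^-1 *: t^-1.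
    rewrite /GRing.scale /=.
    have -> : 1 - 2 = - 1 :> R by lra.
    rewrite powR_inv1 ?ltW // mulNr; congr (- (_ * _)).
    by rewrite -invfM; congr (_^-1); ring.
  move: D2; congr is_derive; apply/funext => x /=.
  by rewrite /GRing.scale /= mulNr.
have D := is_derive1_powR (s - 1) t0.
have D2 := @is_deriveZ _ _ _ (fun t : R => t `^ (s - 1)) (c_ s) t 1 _ D.
have e : - ((2 - 2 * s) * c_ s / 2 * t `^ (s - 2)) = c_ s *: ((s - 1) * t `^ (s - 1 - 1)).
  rewrite /GRing.scale /=.
  have -> : s - 1 - 1 = s - 2 by ring.
  by field.
by rewrite e; exact: D2.
Qed.

Lemma gam_mvt (t u : R) : 0 < t -> t <= u ->
  exists2 x, t <= x <= u & gam t - gam u = kap * x `^ (s - 2) * (u - t).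
Proof.
move=> t0 tu.
have [||x] := @MVT_segment R gam dgam t u tu.
- move=> x; rewrite in_itv /= => /andP[tx _]; apply: is_derive_gam; exact: lt_trans tx.
- apply: continuous_in_subspaceT => x; rewrite inE /= in_itv /= => /andP[tx _].
  apply: (@differentiable_continuous _ R^o R^o); apply/derivable1_diffP.
  by case: (is_derive_gam (lt_le_trans t0 tx)).
rewrite in_itv /= => txu e; exists x => //.
by rewrite -[LHS]opprB e /dgam mulNr opprK.
Qed.

Lemma powRN_anti (x y a : R) : 0 < x -> x <= y -> 0 <= a -> y `^ (- a) <= x `^ (- a).
Proof.
move=> x0 xy a0; have y0 := lt_le_trans x0 xy.
rewrite !powRN lef_pV2 ?posrE ?powR_gt0 //.
by apply: ge0_ler_powR; rewrite ?nnegrE // ltW.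
Qed.

Lemma powS2_anti (x y : R) : 0 < x -> x <= y -> y `^ (s - 2) <= x `^ (s - 2).
Proof.
move=> x0 xy; have -> : s - 2 = - (2 - s) by ring.
by apply: powRN_anti => //; slra.
Qed.

Lemma gam_bounds (t u : R) : 0 < t -> t <= u ->
  kap * u `^ (s - 2) * (u - t) <= gam t - gam u <= kap * t `^ (s - 2) * (u - t).
Proof.
move=> t0 tu; have [x /andP[tx xu] ->] := gam_mvt t0 tu.
have k0 := ltW kap_gt0; have ut : 0 <= u - t by rewrite subr_ge0.
have x0 := lt_le_trans t0 tx.
by apply/andP; split; apply: ler_wpM2r => //; apply: ler_wpM2l => //; apply: powS2_anti.
Qed.

Lemma gam_anti (t u : R) : 0 < t -> t <= u -> gam u <= gam t.
Proof.
move=> t0 tu; have /andP[h _] := gam_bounds t0 tu.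
rewrite -subr_ge0; apply: le_trans h; apply: mulr_ge0; last by rewrite subr_ge0.
by apply: mulr_ge0; [apply: ltW; exact: kap_gt0|exact: powR_ge0].
Qed.

Lemma gam_lip (m t u : R) : 0 < m -> m <= t -> m <= u ->
  `|gam t - gam u| <= kap * m `^ (s - 2) * `|t - u|.
Proof.
move=> m0; wlog tu : t u / t <= u.
  move=> H mt mu; case: (leP t u) => [/H|/ltW ut]; first exact.
  by rewrite distrC [X in _ * X]distrC; exact: H.
move=> mt mu; have t0 := lt_le_trans m0 mt.
rewrite ger0_norm ?subr_ge0 ?gam_anti // distrC ger0_norm ?subr_ge0 //.
have /andP[_ h] := gam_bounds t0 tu; apply: le_trans h _.
apply: ler_wpM2r; first by rewrite subr_ge0.
by apply: ler_wpM2l; [apply: ltW; exact: kap_gt0|exact: powS2_anti].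
Qed.

Lemma dgam_lip (m t u : R) : 0 < m -> m <= t -> m <= u ->
  `|dgam t - dgam u| <= 2 * kap * m `^ (s - 3) * `|t - u|.
Proof.
move=> m0; wlog tu : t u / t <= u.
  move=> H mt mu; case: (leP t u) => [/H|/ltW ut]; first exact.
  by rewrite distrC [X in _ * X]distrC; exact: H.
move=> mt mu; have t0 := lt_le_trans m0 mt.
have [||x] := @MVT_segment R (fun t => t `^ (s - 2)) (fun t => (s - 2) * t `^ (s - 2 - 1)) t u tu.
- move=> x; rewrite in_itv /= => /andP[tx _]; apply: is_derive1_powR; exact: lt_trans tx.
- apply: continuous_in_subspaceT => x; rewrite inE /= in_itv /= => /andP[tx _].
  by apply: continuous_power; exact: lt_le_trans tx.
rewrite in_itv /= => /andP[tx xu] e.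
have -> : dgam t - dgam u = kap * (u `^ (s - 2) - t `^ (s - 2)) by rewrite /dgam; ring.
have -> : s - 3 = - (3 - s) by ring.
have xm : x `^ (s - 2 - 1) <= m `^ (- (3 - s)).
  have -> : s - 2 - 1 = - (3 - s) by ring.
  by apply: powRN_anti => //; [exact: le_trans tx|slra].
have k0 := kap_gt0.
rewrite /= in e; rewrite normrM (gtr0_norm k0) e !normrM (ger0_norm (powR_ge0 _ _)) (distrC u t).
set D : R := `|t - u|; set X : R := x `^ _; set M : R := m `^ _.
have -> : 2 * kap * M * D = kap * (2 * M * D) by ring.
rewrite ler_pM2l //.
have s2 : `|s - 2| <= 2 by rewrite ler0_norm; slra.
apply: ler_wpM2r; first exact: normr_ge0.
apply: ler_pM => //; exact: powR_ge0.
Qed.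

(** The derivative is taken at a third point [v], and the error is measured by the distances to it.
    This quantitative strict differentiability passes to regularized kernels and to periodic
    sums. *)
Lemma gam_C11 (m t u v : R) : 0 < m -> m <= t -> m <= u -> m <= v ->
  `|gam t - gam u - dgam v * (t - u)| <=
  2 * kap * m `^ (s - 3) * `|t - u| * (`|t - v| + `|u - v|).
Proof.
move=> m0; wlog tu : t u / t <= u.
  move=> H mt mu mv; case: (leP t u) => [/H|/ltW ut]; first exact.
  have -> : gam t - gam u - dgam v * (t - u) = - (gam u - gam t - dgam v * (u - t)) by ring.
  by rewrite normrN (distrC t u) (addrC `|t - v|); exact: H.
move=> mt mu mv; have t0 := lt_le_trans m0 mt.
have [x /andP[tx xu] e] := gam_mvt t0 tu.
have -> : gam t - gam u - dgam v * (t - u) = (dgam x - dgam v) * (t - u).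
  by rewrite e /dgam; ring.
rewrite normrM mulrAC; apply: ler_wpM2r => //.
apply: le_trans (dgam_lip m0 (le_trans mt tx) mv) _.
apply: ler_wpM2l; first by apply: mulr_ge0; [apply: mulr_ge0 => //; apply: ltW; exact: kap_gt0 | exact: powR_ge0].
have : v - x <= `|t - v| by rewrite distrC; apply: le_trans (ler_norm _); lra.
have : x - v <= `|u - v| by apply: le_trans (ler_norm _); lra.
have := normr_ge0 (t - v); have := normr_ge0 (u - v).
by move=> *; rewrite ler_norml; apply/andP; split; lra.
Qed.

Lemma gam_ge0 (t : R) : 0 < t -> t <= 1 -> 0 <= gam t.
Proof.
move=> t0 t1; rewrite /gam; case: eqVneq => [_|sn1].
  by rewrite oppr_ge0 mulr_ge0_le0 ?ln_le0 // invr_ge0 mulr_ge0 // pi_ge0.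
by apply: mulr_ge0; [apply: ltW; exact: c_gt0 | exact: powR_ge0].
Qed.

(* [gam t = O(t ^ - sing_exp)] at 0; for [s = 1] any exponent in (0, 1) absorbs the
   logarithm. *)
Definition sing_exp : R := if s == 1 then 2^-1 else 1 - s.

Lemma sing_exp_gt0 : 0 < sing_exp.
Proof. by rewrite /sing_exp; case: eqVneq => // sn1; rewrite subr_gt0 lt_neqAle sn1. Qed.
Lemma sing_exp_lt1 : sing_exp < 1.
Proof. by rewrite /sing_exp; case: eqVneq => [_|sn1]; slra. Qed.

Lemma gam_growth (t u : R) : 0 < t -> t <= 4 * u -> u <= expR (-1) ->
  gam t <= 4 * gam u * (u / t) `^ sing_exp.
Proof.
move=> t0 tu ue; have u0 : 0 < u by lra.
have ut0 : 0 < u / t by rewrite divr_gt0.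
have u1 : u <= 1 by apply: le_trans ue _; rewrite -[leRHS]expR0 ler_expR; lra.
rewrite /sing_exp; case: (eqVneq s 1) => [s1'|sn1]; last first.
  rewrite /gam (negbTE sn1).
  have := c_gt0 sn1; move: (c_ s) => c c0.
  have -> : t `^ (s - 1) = u `^ (s - 1) * (u / t) `^ (1 - s).
    rewrite (powRM _ (ltW u0)) ?invr_ge0 ?ltW // mulrA -powRD; last first.
      by rewrite (gt_eqF u0) implybT.
    have -> : s - 1 + (1 - s) = 0 by ring.
    rewrite powRr0 mul1r -[in RHS]powR_inv1 ?ltW // -powRrM; congr (_ `^ _); ring.
  rewrite -!mulrA ler_peMl //; last lra.
  by apply: mulr_ge0; [exact: ltW | apply: mulr_ge0; exact: powR_ge0].
rewrite /gam s1' eqxx powR12_sqrt ?(ltW ut0) //.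
have p0 : 0 < pi :> R := pi_gt0 R.
set k : R := (4 * pi)^-1; have k0 : 0 < k by rewrite invr_gt0 mulr_gt0.
have lnu : ln u <= - 1 by rewrite -ler_expR lnK ?posrE.
set y := Num.sqrt (u / t).
have y0 : 0 < y by rewrite sqrtr_gt0.
have yy : y * y = u / t by rewrite -expr2 sqr_sqrtr // ltW.
have ut4 : 1 / 4 <= u / t by rewrite ler_pdivlMr //; lra.
have yh : 1 / 2 <= y.
  by rewrite leNgt; apply/negP => h; move: ut4; rewrite -yy; nra.
have lnt : ln t = ln u - 2 * ln y.
  have -> : ln u = ln (u / t * t) by rewrite divfK // gt_eqF.
  rewrite lnM ?posrE //; have -> : ln (u / t) = 2 * ln y; last by ring.
  by rewrite -(sqr_sqrtr (ltW ut0)) -/y expr2 lnM ?posrE //; ring.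
have lny := ln_sublinear y0.
rewrite lnt -subr_ge0.
(* Both summands are nonnegative: [ln u <= -1] and [1 / 2 <= y] settle the first, $\ln y < y$ and
   [1 / 2 <= y] the second. *)
have -> : 4 * - (k * ln u) * y - - (k * (ln u - 2 * ln y)) =
  k * ((- ln u - 1) * (4 * y - 1) + (4 * y - 1 - 2 * ln y)) by ring.
apply: mulr_ge0; first exact: ltW.
apply: addr_ge0; last lra.
by apply: mulr_ge0; lra.
Qed.

(** The unbounded self-interaction is what lets a small enough core dominate every bounded part of
    the energy. *)
Lemma gam_large (M : R) : exists2 u, 0 < u & forall t, 0 < t -> t <= u -> M <= gam t.
Proof.
have [u u0 hu] : exists2 u, 0 < u & M <= gam u; last first.
  by exists u => // t t0 tu; apply: le_trans hu _; exact: gam_anti.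
rewrite /gam; case: (eqVneq s 1) => [s1'|sn1].
  exists (expR (- (4 * pi * M))); first exact: expR_gt0.
  rewrite expRK mulrN opprK mulrA mulVf ?mul1r // gt_eqF // mulr_gt0 //.
  exact: pi_gt0.
have c0 := c_gt0 sn1; have s1' : s < 1 by rewrite lt_neqAle sn1.
set N := Num.max M 1 / c_ s.
have N0 : 0 < N by rewrite divr_gt0 // lt_max ltr01 orbT.
exists (N `^ (- (1 - s)^-1)); first exact: powR_gt0.
rewrite -powRrM.
have -> : - (1 - s)^-1 * (s - 1) = 1 by field; rewrite subr_eq0 eq_sym.
by rewrite powRr1 ?(ltW N0) // /N mulrCA divff ?gt_eqF // mulr1 le_max lexx.
Qed.

Lemma measurable_gam : measurable_fun [set: measurableTypeR R] (gam : measurableTypeR R -> R).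
Proof.
rewrite /gam; case: (s == 1).
  apply: (@measurableT_comp _ _ _ _ _ _ (-%R : measurableTypeR R -> measurableTypeR R)) => //.
  by apply: measurable_funM => //; exact: measurable_ln.
by apply: measurable_funM => //; exact: measurable_powR.
Qed.

Lemma Gs_gam (x : R * R) : x != 0 -> G s x = gam (dot x x).
Proof.
move=> x0.
have d0 : 0 < dot x x.
  rewrite /dot lt_neqAle; apply/andP; split; last by rewrite addr_ge0 // -expr2 sqr_ge0.
  apply: contra x0; rewrite eq_sym -!expr2 paddr_eq0 ?sqr_ge0 // !sqrf_eq0.
  by case: x => a b /= /andP[/eqP-> /eqP->].
rewrite /G /gam /enorm; case: ifPn => [_|sn1].
  rewrite lnV ?posrE ?sqrtr_gt0 // -powR12_sqrt ?(ltW d0) // ln_powR.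
  rewrite mulrN mulrA -invfM; congr (- (_^-1 * _)); ring.
rewrite -powR12_sqrt ?(ltW d0) // -powRrM; congr (_ * _ `^ _); by field.
Qed.

(** The conventions for the logarithm and for negative powers at [0] give the value [0], the same as
    for [gam]; hence [G_gam] holds without exception. *)
Lemma Gs_0 : G s (0 : R * R) = 0.
Proof.
rewrite /G /enorm /dot /= mulr0 addr0 sqrtr0 invr0 ln0 // mulr0.
case: ifPn => // sn1.
rewrite powR0 ?mulr0 //.
by rewrite (_ : 2 * s - 2 = 2 * (s - 1)) ?mulf_neq0 ?subr_eq0 //; ring.
Qed.

Lemma Cs_kap : Cs s = 2 * kap.
Proof. by rewrite /kap mulrC divfK. Qed.

End gam.
Global Opaque kap.

(** * An integrable majorant of the singularity *)

Section singular_bound.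
Variable R : realType.
Notation mR := (measurableTypeR R).
Notation plane := (mR * mR)%type.
Notation leb := (@lebesgue_measure R).
Notation leb2 := (@leb2 R).
Implicit Types (x y z w : plane).

(** The norm for all Lipschitz and differentiability estimates: it splits along the coordinates and
    is invariant under reflections in the axes. *)
Definition l1 x : R := `|x.1| + `|x.2|.

Lemma l1_ge0 x : 0 <= l1 x. Proof. by rewrite addr_ge0. Qed.
Lemma l1_triangle x y : l1 (x + y) <= l1 x + l1 y.
Proof. by rewrite /l1 /= addrACA lerD // ler_normD. Qed.
Lemma l1N x : l1 (- x) = l1 x.
Proof. by rewrite /l1 /= !normrN. Qed.
Lemma l1B x y : l1 (x - y) = l1 (y - x).
Proof. by rewrite -l1N opprB. Qed.
Lemma l1_0 : l1 0 = 0. Proof. by rewrite /l1 /= normr0 addr0. Qed.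

Lemma n2E x : dot x x = x.1 ^+ 2 + x.2 ^+ 2. Proof. by rewrite /dot -!expr2. Qed.
Lemma n2_ge0 x : 0 <= dot x x. Proof. by rewrite n2E addr_ge0 ?sqr_ge0. Qed.
Lemma n2_eq0 x : dot x x = 0 -> x = 0.
Proof.
rewrite n2E => /eqP; rewrite paddr_eq0 ?sqr_ge0 // !sqrf_eq0.
by case: x => a b /= /andP[/eqP-> /eqP->].
Qed.
Lemma n2_gt0 x : x != 0 -> 0 < dot x x.
Proof.
move=> x0; rewrite lt_neqAle n2_ge0 andbT eq_sym.
by apply: contra x0 => /eqP/n2_eq0 ->.
Qed.
Lemma n2_le_l1 x : dot x x <= l1 x ^+ 2.
Proof.
rewrite n2E /l1 -(real_normK (num_real x.1)) -(real_normK (num_real x.2)).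
by have := normr_ge0 x.1; have := normr_ge0 x.2; nra.
Qed.
Variable q : R.
Hypotheses (q0 : 0 < q) (q1 : q < 1).

Lemma powR_div (u t : R) : 0 <= u -> 0 < t -> u `^ q * t `^ (- q) = (u / t) `^ q.
Proof.
move=> u0 t0; rewrite powRM ?invr_ge0 ?(ltW t0) // -powR_inv1 ?(ltW t0) //.
by rewrite -powRrM mulN1r.
Qed.

(* [(w_1^2 + w_2^2)^-q <= |w_1|^-q |w_2|^-q] reduces integrability in the plane to
   one dimension. *)
Definition half_power (b t : R) : R := \1_(`]0, b]%classic : set R) t * (b `^ q * t `^ (- q)).

Lemma half_power_ge0 b t : 0 <= half_power b t.
Proof. by rewrite /half_power !mulr_ge0 ?powR_ge0 // indicE; case: (_ \in _). Qed.

Lemma measurable_half_power b : measurable_fun [set: mR] (half_power b : mR -> R).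
Proof.
apply: measurable_funM; first exact: measurable_indic.
by apply: measurable_funM => //; exact: measurable_powR.
Qed.

Lemma int_half_power (b : R) : 0 < b -> (\int[leb]_t (half_power b t)%:E <= (b / (1 - q))%:E)%E.
Proof.
move=> b0.
have -> : (\int[leb]_t (half_power b t)%:E = \int[leb]_(t in `]0%R, b]) (b `^ q * t `^ ((1 - q) - 1))%:E)%E.
  rewrite [RHS]integral_mkcond; apply: eq_integral => t _.
  rewrite /patch /half_power indicE; case: ifPn => [|_]; last by rewrite mul0r.
  rewrite inE /= in_itv /= => /andP[t0 tb]; rewrite mul1r; congr (_%:E).
  by have -> : 1 - q - 1 = - q by ring.
under eq_integral do rewrite EFinM.
rewrite ge0_integralZl //; last 3 first.
- by apply/measurable_EFinP; apply: measurable_funTS; exact: measurable_powR.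
- by move=> t _; rewrite lee_fin powR_ge0.
- by rewrite lee_fin powR_ge0.
have q1' : 0 < 1 - q by rewrite subr_gt0.
apply: (@le_trans _ _ ((b `^ q)%:E * (b `^ (1 - q) / (1 - q))%:E)%E).
  by apply: lee_wpmul2l; [rewrite lee_fin powR_ge0|exact: integral_power_Ioc].
rewrite -EFinM lee_fin mulrA -powRD ?(gt_eqF b0) ?implybT //.
have -> : q + (1 - q) = 1 by ring.
by rewrite powRr1 // ltW.
Qed.

Definition two_sided_power (b t : R) : R := half_power b t + half_power b (- t).

Lemma measurable_two_sided_power b : measurable_fun [set: mR] (two_sided_power b : mR -> R).
Proof.
apply: measurable_funD; first exact: measurable_half_power.
by apply: measurableT_comp => //; exact: measurable_half_power.
Qed.

Lemma int_two_sided_power (b : R) : 0 < b -> (\int[leb]_t (two_sided_power b t)%:E <= (2 * b / (1 - q))%:E)%E.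
Proof.
move=> b0.
under eq_integral do rewrite EFinD.
have m1 : measurable_fun [set: mR] (fun t : mR => (half_power b t)%:E).
  by apply/measurable_EFinP; exact: measurable_half_power.
rewrite ge0_integralD //; last 3 first.
- by move=> t _; rewrite lee_fin half_power_ge0.
- by move=> t _; rewrite lee_fin half_power_ge0.
- by apply/measurable_EFinP; apply: measurableT_comp => //; exact: measurable_half_power.
have -> : (\int[leb]_t (half_power b (- t))%:E = \int[leb]_t (half_power b t)%:E)%E.
  apply: (@ge0_integral_preserving _ mR R leb (-%R) _ _ (fun t => (half_power b t)%:E)) => //.
  - exact: lebesgue_measure_opp.
  - by move=> t; rewrite lee_fin half_power_ge0.
have -> : 2 * b / (1 - q) = b / (1 - q) + b / (1 - q) by ring.
by rewrite EFinD leeD // int_half_power.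
Qed.

(** Scaled to equal [1] at distance [b], so that its integral is at most [b ^+ 2] times a constant
    independent of [b]. *)
Definition sing_major (b : R) w : R := \1_(box 0 b) w * ((b ^+ 2) `^ q * (dot w w) `^ (- q)).

Lemma sing_major_ge0 b w : 0 <= sing_major b w.
Proof. by rewrite /sing_major !mulr_ge0 ?powR_ge0 // indicE; case: (_ \in _). Qed.

Lemma measurable_n2 : measurable_fun [set: plane] (fun w : plane => dot w w : mR).
Proof. by apply: measurable_funD; apply: measurable_funM. Qed.

Lemma measurable_sing_major b : measurable_fun [set: plane] (sing_major b : plane -> mR).
Proof.
apply: measurable_funM; first by apply: measurable_indic; exact: measurable_box.
apply: measurable_funM => //.
apply: (@measurableT_comp _ _ _ _ _ _ (fun x : mR => x `^ (- q) : mR)); last exact: measurable_n2.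
exact: measurable_powR.
Qed.

(** From $w_1^2+w_2^2 \ge |w_1||w_2|$. The axes are excluded because [half_power] vanishes at [0];
    they form a null set. *)
Lemma sing_major_le (b : R) w : 0 < b -> w.1 != 0 -> w.2 != 0 -> sing_major b w <= two_sided_power b w.1 * two_sided_power b w.2.
Proof.
move=> b0 w1 w2; rewrite /sing_major indicE; case: (asboolP (box 0 b w)) => bx; last first.
  by rewrite memNset // mul0r mulr_ge0 // /two_sided_power addr_ge0 ?half_power_ge0.
rewrite mem_set // mul1r.
have P2E (t : R) : t != 0 -> `|t| <= b -> two_sided_power b t = (b / `|t|) `^ q.
  move=> t0 tb; rewrite -powR_div ?(ltW b0) ?normr_gt0 //; rewrite /two_sided_power /half_power !indicE.
  case: (ltgtP t 0) t0 => // h _.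
  - rewrite memNset ?mul0r ?add0r; last by rewrite /= in_itv /= (lt_gtF h).
    by rewrite mem_set ?mul1r ?ltr0_norm //= in_itv /= oppr_gt0 h -(ltr0_norm h).
  - rewrite mem_set ?mul1r; last by rewrite /= in_itv /= h -(gtr0_norm h).
    by rewrite memNset ?mul0r ?addr0 ?gtr0_norm //= in_itv /= oppr_gt0 (lt_gtF h).
have [b1 b2] := (boxP 0 b w).1 bx; rewrite /= !subr0 in b1 b2.
have n0 : 0 < dot w w by apply: n2_gt0; apply: contra w1 => /eqP ->.
rewrite powR_div ?sqr_ge0 // !P2E // -powRM ?divr_ge0 ?normr_ge0 ?(ltW b0) //.
have n1 : 0 < `|w.1| by rewrite normr_gt0.
have n2 : 0 < `|w.2| by rewrite normr_gt0.
apply: ge0_ler_powR; rewrite ?nnegrE ?(ltW q0) //.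
- by rewrite divr_ge0 ?sqr_ge0 // n2_ge0.
- by rewrite mulr_ge0 // divr_ge0 // ltW.
rewrite mulrACA -invfM -expr2 ler_pM2l ?exprn_gt0 //.
rewrite lef_pV2 ?posrE ?mulr_gt0 //.
rewrite n2E -(real_normK (num_real w.1)) -(real_normK (num_real w.2)).
have := sqr_ge0 (`|w.1| - `|w.2|); nra.
Qed.

Definition sing_mass : R := (2 / (1 - q)) ^+ 2.

Lemma int_sing_major (b : R) : 0 < b -> ig (sing_major b) /\ I (sing_major b) <= sing_mass * b ^+ 2.
Proof.
move=> b0.
pose f w : \bar R := (two_sided_power b w.1 * two_sided_power b w.2)%:E.
have P20 t : 0 <= two_sided_power b t by rewrite addr_ge0 ?half_power_ge0.
have f0 w : (0 <= f w)%E by rewrite lee_fin mulr_ge0.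
have mf : measurable_fun [set: plane] f.
  apply/measurable_EFinP; apply: measurable_funM;
    by apply: (measurableT_comp (@measurable_two_sided_power b)).
have h : (\int[leb2]_w (sing_major b w)%:E <= (sing_mass * b ^+ 2)%:E)%E.
  apply: (@le_trans _ _ (\int[leb2]_w f w)%E).
    apply: ae_ge0_le_integral => //.
    - by move=> w _; rewrite lee_fin sing_major_ge0.
    - by apply/measurable_EFinP; exact: measurable_sing_major.
    exists (([set 0] `*` setT) `|` (setT `*` [set 0])); split.
    - by apply: measurableU; apply: measurableX.
    - have eA : leb2 ([set 0] `*` setT) = 0%E by rewrite leb2X // lebesgue_measure_set1 mul0e.
      have eB : leb2 (setT `*` [set 0]) = 0%E by rewrite leb2X // lebesgue_measure_set1 mule0.
      by rewrite -[RHS]eA; apply: measureU0 => //; apply: measurableX.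
    - move=> w /=; apply: contra_notP => /not_orP[/= h1 h2] _.
      rewrite lee_fin; apply: sing_major_le => //; apply/eqP => h.
      + by apply: h1; split.
      + by apply: h2; split.
  have e1 := @fubini_tonelli1 _ _ mR mR R leb leb f mf f0.
  rewrite [X in (X <= _)%E](_ : _ = \int[leb]_x fubini_F leb f x)%E; last exact: e1.
  have e2 (t : mR) : fubini_F leb f t = ((two_sided_power b t)%:E * \int[leb]_u (two_sided_power b u)%:E)%E.
    rewrite /fubini_F -ge0_integralZl //.
    - by apply/measurable_EFinP; exact: measurable_two_sided_power.
    - by move=> u _; rewrite lee_fin.
    - by rewrite lee_fin.
  under eq_integral do rewrite e2.
  have i0 : (0 <= \int[leb]_u (two_sided_power b u)%:E)%E by apply: integral_ge0 => u _; rewrite lee_fin.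
  rewrite ge0_integralZr //; last 2 first.
  - by apply/measurable_EFinP; exact: measurable_two_sided_power.
  - by move=> u _; rewrite lee_fin.
  have -> : (sing_mass * b ^+ 2)%:E = ((2 * b / (1 - q))%:E * (2 * b / (1 - q))%:E)%E.
    by rewrite -EFinM; congr (_%:E); rewrite /sing_mass; ring.
  by apply: lee_pmul => //; exact: int_two_sided_power.
have igS : ig (sing_major b).
  apply/igP/integrableP; split; first by apply/measurable_EFinP; exact: measurable_sing_major.
  under eq_integral do rewrite /= ger0_norm ?sing_major_ge0 //.
  by apply: le_lt_trans h _; rewrite ltry.
split=> //; rewrite I_E -lee_fin fineK //.
by apply: integrable_fin_num; [|exact/igP].
Qed.

End singular_bound.

(** * Splitting the kernel *)

Section kernel.
Variable R : realType.
Notation mR := (measurableTypeR R).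
Notation plane := (mR * mR)%type.
Implicit Types (x y z w : plane).

Lemma box_n2 (b : R) w : box 0 b w -> dot w w <= 2 * b ^+ 2.
Proof.
move=> /boxP; rewrite /= !subr0 => -[h1 h2].
rewrite n2E -(real_normK (num_real w.1)) -(real_normK (num_real w.2)).
by have := normr_ge0 w.1; have := normr_ge0 w.2; nra.
Qed.

Lemma nbox_n2 (b : R) w : 0 <= b -> ~ box 0 b w -> b ^+ 2 <= dot w w.
Proof.
move=> b0 nb; rewrite leNgt; apply/negP => h; apply: nb; apply/boxP.
rewrite /= !subr0; rewrite n2E -(real_normK (num_real w.1)) -(real_normK (num_real w.2)) in h.
by split; rewrite leNgt; apply/negP => h2; have := normr_ge0 w.1; have := normr_ge0 w.2; nra.
Qed.

Lemma indic_ge0 (A : set plane) w : 0 <= \1_A w :> R.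
Proof. by rewrite indicE; case: (_ \in _). Qed.

Lemma measurable_subx x : measurable_fun [set: plane] (fun y : plane => x - y : plane).
Proof.
by apply: measurable_fun_pair; apply: measurable_funB.
Qed.

(** The majorant has a singular part, a bounded part, and a point indicator for the conventional
    value at the origin; the last one leaves no trace in the bound. *)
Lemma kernel_bound (q : R) (q0 : 0 < q) (q1 : q < 1) (k F : plane -> R)
  (c M N b T r C : R) (z x : plane) :
  measurable_fun [set: plane] (k : plane -> mR) -> 0 < b -> 0 <= c -> 0 <= M -> 0 <= N ->
  0 <= r -> 0 <= C ->
  (forall w, dot w w <= T -> `|k w| <= c * sing_major q b w + M + N * \1_[set (0 : plane)] w) ->
  (forall y, box z r y -> dot (x - y) (x - y) <= T) ->
  measurable_fun [set: plane] (F : plane -> mR) -> (forall y, `|F y| <= C) ->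
  (forall y, ~ box z r y -> F y = 0) ->
  ig (fun y => k (x - y) * F y) /\
  I (fun y => `|k (x - y) * F y|) <= C * (c * (sing_mass q * b ^+ 2) + M * (2 * r) ^+ 2).
Proof.
move=> mk b0 c0 M0 N0 r0 C0 kT xT mF FC F0.
have a1 : 0 <= C * c by exact: mulr_ge0.
have a2 : 0 <= C * M by exact: mulr_ge0.
have a3 : 0 <= C * N by exact: mulr_ge0.
have [iS SL] := int_sing_major q0 q1 b0.
have [iS' eS] := I_subx x iS.
have [i0 e0] := I_point (0 : plane).
have [i0' e0'] := I_subx x i0.
have iB := ig_indic_box z r0.
pose H y := (C * c) * sing_major q b (x - y) + (C * M) * \1_(box z r) y + (C * N) * \1_[set (0 : plane)] (x - y).
have iH : ig H by apply: igD; [apply: igD|]; exact: igZ.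
have mkx : measurable_fun [set: plane] (fun y : plane => k (x - y) * F y : mR).
  apply: measurable_funM; last exact: mF.
  exact: (measurableT_comp mk (measurable_subx x)).
have {mk mF mkx} iK0 : (forall y, `|k (x - y) * F y| <= H y) -> ig (fun y => k (x - y) * F y).
  by move=> kH; exact: ig_le mkx iH kH.
have kH y : `|k (x - y) * F y| <= H y.
  rewrite /H normrM; case: (asboolP (box z r y)) => by_; last first.
    rewrite (F0 _ by_) normr0 mulr0.
    exact: (addr_ge0 (addr_ge0 (mulr_ge0 a1 (sing_major_ge0 _ _ _)) (mulr_ge0 a2 (indic_ge0 _ _)))
      (mulr_ge0 a3 (indic_ge0 _ _))).
  rewrite [\1_(box z r) y]indicE mem_set; last exact: by_.
  rewrite mulr1; apply: (@le_trans _ _ (`|k (x - y)| * C)); first exact: (ler_wpM2l (normr_ge0 _) (FC y)).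
  have := kT _ (xT _ by_) => /(ler_wpM2r C0) h; apply: le_trans h _.
  by rewrite le_eqVlt; apply/orP; left; apply/eqP; ring.
have iK := iK0 kH.
split; first exact: iK.
apply: le_trans (I_mono (ig_abs iK) iH kH) _.
rewrite /H (ID (F := fun y => (C * c) * sing_major q b (x - y) + (C * M) * \1_(box z r) y)); last 2 first.
- by apply: igD; exact: igZ.
- exact: igZ.
rewrite (ID (igZ _ iS') (igZ _ iB)) (IZ _ iS') (IZ _ iB) (IZ _ i0') eS e0' e0 (I_indic_box z r0).
have -> : C * (c * (sing_mass q * b ^+ 2) + M * (2 * r) ^+ 2) =
  (C * c) * (sing_mass q * b ^+ 2) + C * M * (2 * r) ^+ 2 by ring.
by rewrite mulr0 addr0 lerD2r; exact: (ler_wpM2l a1 SL).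
Qed.

Variable s : R.
Hypotheses (s0 : 0 < s) (s1 : s <= 1).
Notation gam := (gam s).
Notation dgam := (dgam s).
Notation q := (sing_exp s).
Let q0 : 0 < q. Proof. exact: sing_exp_gt0. Qed.
Let q1 : q < 1. Proof. exact: sing_exp_lt1. Qed.

Lemma gam0 : gam 0 = 0.
Proof.
rewrite /gam; case: ifPn => [_|sn1]; first by rewrite ln0 // mulr0 oppr0.
by rewrite powR0 ?mulr0 // subr_eq0.
Qed.

Lemma G_gam x : G s x = gam (dot x x).
Proof.
have [->|x0] := eqVneq x 0; last exact: Gs_gam.
by rewrite Gs_0 // /dot /= mulr0 addr0 gam0.
Qed.

Lemma measurable_G : measurable_fun [set: plane] (G s : plane -> mR).
Proof.
have -> : G s = (gam : R -> R) \o (fun w : plane => dot w w) by apply/funext => x; rewrite G_gam.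
exact: (measurableT_comp (@measurable_gam R s) (@measurable_n2 R)).
Qed.

Lemma expRN1_half : expR (-1) <= 2^-1 :> R.
Proof.
rewrite expRN lef_pV2 ?posrE ?expR_gt0 //; apply: le_trans (expR_ge1Dx _); lra.
Qed.

Lemma G_near (b : R) w : 0 < b -> b ^+ 2 <= expR (-1) -> box 0 b w -> w != 0 ->
  0 <= G s w <= 4 * gam (b ^+ 2) * sing_major q b w.
Proof.
move=> b0 be bw w0; have n0 := n2_gt0 w0; have nb := box_n2 bw.
have e2 := expRN1_half; have b2 : 0 < b ^+ 2 by rewrite exprn_gt0.
rewrite G_gam; apply/andP; split.
  by apply: gam_ge0 => //; lra.
rewrite /sing_major indicE mem_set // mul1r powR_div ?(ltW b2) //.
by apply: gam_growth => //; lra.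
Qed.

(** Up to this half-side the kernel is nonnegative on the box and [gam_growth] applies. *)
Definition b0 : R := expR (-1).
Lemma b0_gt0 : 0 < b0. Proof. exact: expR_gt0. Qed.
Lemma b0_e (b : R) : 0 < b -> b <= b0 -> b ^+ 2 <= expR (-1).
Proof. by have := expRN1_half; rewrite /b0 => e bb h; nra. Qed.

Lemma gam_sq_ge0 (b : R) : 0 < b -> b <= b0 -> 0 <= gam (b ^+ 2).
Proof.
move=> bb h; apply: gam_ge0 => //; first exact: exprn_gt0.
by apply: le_trans (b0_e bb h) _; have := expRN1_half; lra.
Qed.

Lemma G_major (T : R) : exists (c M : R), [/\ 0 <= c, 0 <= M &
  forall w, dot w w <= T -> `|G s w| <= c * sing_major q b0 w + M].
Proof.
exists (4 * gam (b0 ^+ 2)), (`|gam T| + `|gam (b0 ^+ 2)|).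
have g0 := gam_sq_ge0 b0_gt0 (lexx _).
split; [by rewrite mulr_ge0|by rewrite addr_ge0|move=> w wT].
have [->|w0] := eqVneq w 0.
  by rewrite Gs_0 // normr0 addr_ge0 ?addr_ge0 // mulr_ge0 ?sing_major_ge0 // mulr_ge0.
case: (asboolP (box 0 b0 w)) => bw.
  have /andP[h1 h2] := G_near b0_gt0 (b0_e b0_gt0 (lexx _)) bw w0.
  by rewrite ger0_norm //; apply: le_trans h2 _; rewrite lerDl addr_ge0.
have n0 := n2_gt0 w0; have nb := nbox_n2 (ltW b0_gt0) bw.
rewrite G_gam.
have h1 : gam (dot w w) <= gam (b0 ^+ 2) by apply: gam_anti => //; rewrite exprn_gt0 ?b0_gt0.
have h2 : gam T <= gam (dot w w) by apply: gam_anti.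
apply: (@le_trans _ _ (`|gam T| + `|gam (b0 ^+ 2)|)); last first.
  by rewrite lerDr mulr_ge0 ?sing_major_ge0 // mulr_ge0.
rewrite ler_norml; apply/andP; split.
  have := ler_norm (- gam T); rewrite normrN; have := normr_ge0 (gam (b0 ^+ 2)); lra.
have := ler_norm (gam (b0 ^+ 2)); have := normr_ge0 (gam T); lra.
Qed.

Lemma G_pot_bound (T r : R) : 0 <= r -> exists2 K, 0 <= K &
  forall (x z : plane) (C : R) (F : plane -> R), 0 <= C ->
  (forall y, box z r y -> dot (x - y) (x - y) <= T) ->
  measurable_fun [set: plane] (F : plane -> mR) -> (forall y, `|F y| <= C) ->
  (forall y, ~ box z r y -> F y = 0) ->
  ig (fun y => G s (x - y) * F y) /\ I (fun y => `|G s (x - y) * F y|) <= C * K.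
Proof.
move=> r0; have [c [M [c0 M0 H]]] := G_major T.
exists (c * (sing_mass q * b0 ^+ 2) + M * (2 * r) ^+ 2).
  by apply: addr_ge0; apply: mulr_ge0 => //; rewrite ?sqr_ge0 // mulr_ge0 ?sqr_ge0.
move=> x z C F C0 xT mF FC F0.
apply: (kernel_bound q0 q1 (N := 0) (T := T) (z := z) measurable_G b0_gt0) => //.
by move=> w wT; rewrite mul0r addr0; exact: H.
Qed.

(** For [e > 0] this part has a Lipschitz gradient on bounded sets, while the remainder [Gsing] is
    small in $L^1$ for small [e]. *)
Definition Greg (e : R) w : R := gam (dot w w + e).
Definition Gsing (e : R) w : R := G s w - Greg e w.

Lemma measurable_Greg e : measurable_fun [set: plane] (Greg e : plane -> mR).
Proof.
apply: (measurableT_comp (@measurable_gam R s)).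
by apply: measurable_funD => //; exact: measurable_n2.
Qed.

Lemma measurable_Gsing e : measurable_fun [set: plane] (Gsing e : plane -> mR).
Proof. by apply: measurable_funB; [exact: measurable_G|exact: measurable_Greg]. Qed.

(** By [gam_growth] the product is $O(t^{1-q})$ with $t = b^2$, and the exponent is positive. *)
Lemma gam_b2_small (eta : R) : 0 < eta ->
  exists b : R, [/\ 0 < b, b <= b0 & gam (b ^+ 2) * b ^+ 2 <= eta].
Proof.
move=> eta0; have g0 := gam_sq_ge0 b0_gt0 (lexx _).
have bb0 := b0_gt0; have bb2 : 0 < b0 ^+ 2 by rewrite exprn_gt0.
pose A : R := 4 * gam (b0 ^+ 2) * (b0 ^+ 2) `^ q + 1.
have A0 : 0 < A by rewrite ltr_wpDl // !mulr_ge0 ?powR_ge0.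
have q1' : 0 < 1 - q by rewrite subr_gt0.
pose t : R := Num.min (b0 ^+ 2) ((eta / A) `^ (1 - q)^-1).
have t0 : 0 < t by rewrite lt_min bb2 powR_gt0 // divr_gt0.
exists (Num.sqrt t); split; first by rewrite sqrtr_gt0.
  by rewrite -[leRHS](ger0_norm (ltW bb0)) -sqrtr_sqr; apply: ler_wsqrtr; rewrite ge_min lexx.
rewrite sqr_sqrtr ?(ltW t0) //.
have tb : t <= b0 ^+ 2 by rewrite ge_min lexx.
have h : gam t <= 4 * gam (b0 ^+ 2) * (b0 ^+ 2 / t) `^ q.
  by apply: gam_growth => //; [lra|exact: b0_e].
have e1 : t `^ (1 - q) = t `^ (- q) * t.
  rewrite -[X in _ * X](powRr1 (ltW t0)) -powRD ?(gt_eqF t0) ?implybT //.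
  by rewrite addrC.
have h2 : gam t * t <= A * t `^ (1 - q).
  apply: (@le_trans _ _ (4 * gam (b0 ^+ 2) * (b0 ^+ 2) `^ q * t `^ (1 - q))).
    rewrite e1 !mulrA; apply: ler_wpM2r; first exact: ltW.
    by rewrite -mulrA powR_div ?(ltW bb2).
  by apply: ler_wpM2r; [exact: powR_ge0|rewrite lerDl].
apply: le_trans h2 _; rewrite -ler_pdivlMl // mulrC.
have -> : eta / A = ((eta / A) `^ (1 - q)^-1) `^ (1 - q).
  by rewrite -powRrM mulVf ?gt_eqF // powRr1 // ltW // divr_gt0.
by apply: ge0_ler_powR; rewrite ?nnegrE ?powR_ge0 ?(ltW t0) ?(ltW q1') // ge_min lexx orbT.
Qed.

(** First a box of half-side [b] is chosen on which the singular majorant costs at most half of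
    [eta]; then [e] is so small that outside this box the mean value theorem pays the other half. *)
Lemma Gsing_small (T r eta : R) : 0 <= r -> 0 < eta -> exists2 e, 0 < e <= 1 &
  forall (x z : plane) (C : R) (F : plane -> R), 0 <= C ->
  (forall y, box z r y -> dot (x - y) (x - y) <= T) ->
  measurable_fun [set: plane] (F : plane -> mR) -> (forall y, `|F y| <= C) ->
  (forall y, ~ box z r y -> F y = 0) ->
  ig (fun y => Gsing e (x - y) * F y) /\ I (fun y => `|Gsing e (x - y) * F y|) <= C * eta.
Proof.
move=> r0 eta0.
have Cq0 : 0 < sing_mass q by rewrite exprn_gt0 // divr_gt0 // subr_gt0.
have [b [bb bb0 hb]] : exists b : R, [/\ 0 < b, b <= b0 & gam (b ^+ 2) * b ^+ 2 <= eta / (8 * sing_mass q)].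
  by apply: gam_b2_small; rewrite divr_gt0 // mulr_gt0.
have b2 : 0 < b ^+ 2 by rewrite exprn_gt0.
have kp := kap_gt0 s0 s1.
pose K : R := kap s * (b ^+ 2) `^ (s - 2).
have K0 : 0 < K by rewrite mulr_gt0 // powR_gt0.
(* The second entry keeps [dot w w + e] at most [1] on the box, so that [Greg] is nonnegative there
   and [Gsing] is below [G]. *)
pose e : R := Num.min 1 (Num.min (1 - 2 * b ^+ 2) (eta / (2 * K * ((2 * r) ^+ 2 + 1)))).
have r2 : 0 < (2 * r) ^+ 2 + 1 by rewrite ltr_wpDl ?sqr_ge0.
have be := b0_e bb bb0; have ee := expRN1_half.
have b22 : 0 < 1 - 2 * b ^+ 2.
  have := bb; have := bb0; have : b0 <= 2^-1 := expRN1_half; have := b0_gt0; nra.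
have e1 : 0 < e.
  by rewrite /e !lt_min ltr01 b22 divr_gt0 // mulr_gt0 // mulr_gt0.
have e2 : e <= 1 by rewrite /e ge_min lexx.
have e3 : e <= 1 - 2 * b ^+ 2 by rewrite /e !ge_min lexx orbT.
have e4 : K * e * (2 * r) ^+ 2 <= eta / 2.
  have h : e <= eta / (2 * K * ((2 * r) ^+ 2 + 1)) by rewrite /e !ge_min lexx !orbT.
  rewrite ler_pdivlMr in h; last by rewrite mulr_gt0 // mulr_gt0.
  have := sqr_ge0 (2 * r); have := mulr_gt0 K0 e1; nra.
exists e; first by rewrite e1.
move=> x z C F C0 xT mF FC F0.
have g0 := gam_sq_ge0 bb bb0.
have [|||ig1 I1] := @kernel_bound q q0 q1 (Gsing e) F (4 * gam (b ^+ 2)) (K * e) `|gam e| b T r C z x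
  (measurable_Gsing e) bb _ _ (normr_ge0 _) r0 C0 _ xT mF FC F0.
- by rewrite mulr_ge0.
- by rewrite mulr_ge0 // ltW.
- move=> w wT; rewrite /Gsing /Greg.
  have [->|w0] := eqVneq w 0.
    rewrite Gs_0 // {1}/dot /= mulr0 addr0 !add0r normrN indicE mem_set // mulr1 lerDr.
    by apply: addr_ge0; apply: mulr_ge0; rewrite ?sing_major_ge0 ?(ltW K0) ?(ltW e1) //; exact: mulr_ge0.
  have n0 := n2_gt0 w0.
  rewrite indicE memNset ?mulr0 ?addr0; last by move=> /= h; rewrite h eqxx in w0.
  have gd : 0 <= gam (dot w w) - gam (dot w w + e).
    by rewrite subr_ge0; apply: gam_anti => //; rewrite lerDl ltW.
  rewrite G_gam ger0_norm //.
  case: (asboolP (box 0 b w)) => bw.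
    have /andP[h1 h2] := G_near bb be bw w0.
    have h3 : 0 <= gam (dot w w + e).
      apply: gam_ge0 => //; first by rewrite addr_gt0.
      by have := box_n2 bw; lra.
    have : 0 <= K * e by rewrite mulr_ge0 // ltW.
    rewrite G_gam in h2; lra.
  have nb := nbox_n2 (ltW bb) bw.
  have le1 : dot w w <= dot w w + e by rewrite lerDl ltW.
  have /andP[_ h] := gam_bounds s0 s1 n0 le1.
  apply: (@le_trans _ _ (K * e)); last by rewrite lerDr mulr_ge0 ?sing_major_ge0 // mulr_ge0.
  apply: le_trans h _; rewrite addrAC subrr add0r; apply: ler_wpM2r; first exact: ltW.
  by rewrite ler_pM2l //; exact: powS2_anti.
split=> //; apply: le_trans I1 _; apply: ler_wpM2l => //.
rewrite ler_pdivlMr in hb; last by rewrite mulr_gt0.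
by move: hb e4; lra.
Qed.

Definition gradG (e : R) x : plane := (2 * dgam (dot x x + e) * x.1, 2 * dgam (dot x x + e) * x.2).

Lemma n2B_bound (T : R) y z : l1 y <= T -> l1 z <= T ->
  `|dot y y - dot z z| <= 2 * T * l1 (y - z).
Proof.
rewrite /l1 => yT zT.
have -> : dot y y - dot z z = (y.1 + z.1) * (y.1 - z.1) + (y.2 + z.2) * (y.2 - z.2).
  by rewrite /dot; ring.
apply: le_trans (ler_normD _ _) _; rewrite !normrM mulrDr /=.
have h1 := ler_normD y.1 z.1; have h2 := ler_normD y.2 z.2.
have := normr_ge0 y.1; have := normr_ge0 y.2; have := normr_ge0 z.1; have := normr_ge0 z.2.
by move=> *; apply: lerD; apply: ler_wpM2r => //; lra.
Qed.

Lemma greg_lip (m e T : R) y z : 0 < m -> m <= dot y y + e -> m <= dot z z + e ->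
  l1 y <= T -> l1 z <= T ->
  `|Greg e y - Greg e z| <= kap s * m `^ (s - 2) * (2 * T) * l1 (y - z).
Proof.
move=> m0 my mz yT zT; apply: le_trans (gam_lip s0 s1 m0 my mz) _.
have -> : dot y y + e - (dot z z + e) = dot y y - dot z z by ring.
rewrite -[leRHS]mulrA; apply: ler_wpM2l; last exact: n2B_bound.
by apply: mulr_ge0; [apply: ltW; exact: kap_gt0|exact: powR_ge0].
Qed.

Lemma l1_product_bound (A B A' B' D D' P Q : R) :
  0 <= A -> 0 <= B -> 0 <= A' -> 0 <= B' -> 0 <= D -> 0 <= D' ->
  P <= A + B -> Q <= A' + B' ->
  P * D + Q * D' <= 2 * ((D + D') * (A + A' + (B + B'))).
Proof.
move=> A0 B0' A'0 B'0 D0 D'0 PA QA.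
apply: (@le_trans _ _ ((A + B) * D + (A' + B') * D')); first by apply: lerD; apply: ler_wpM2r.
nra.
Qed.

(** The two terms of the constant come from the second derivative of [gam] and from that of the
    squared distance. *)
Lemma greg_C11 (m e T : R) x y z : 0 < m -> m <= dot x x + e -> m <= dot y y + e ->
  m <= dot z z + e -> l1 x <= T -> l1 y <= T -> l1 z <= T ->
  `|Greg e y - Greg e z - dot (gradG e x) (y - z)| <=
  (8 * kap s * m `^ (s - 3) * T ^+ 2 + 2 * kap s * m `^ (s - 2)) *
  (l1 (y - z) * (l1 (y - x) + l1 (z - x))).
Proof.
move=> m0 mx my mz xT yT zT.
have kp := kap_gt0 s0 s1.
have T0 : 0 <= T by apply: le_trans xT; exact: l1_ge0.
set t := dot y y + e; set u := dot z z + e; set v := dot x x + e.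
have E : Greg e y - Greg e z - dot (gradG e x) (y - z) =
  (gam t - gam u - dgam v * (t - u)) +
  dgam v * ((y.1 + z.1 - 2 * x.1) * (y.1 - z.1) + (y.2 + z.2 - 2 * x.2) * (y.2 - z.2)).
  by rewrite /Greg /gradG /t /u /v /dot /=; ring.
rewrite E [leRHS]mulrDl; apply: le_trans (ler_normD _ _) _; apply: lerD.
  apply: le_trans (gam_C11 s0 s1 m0 my mz mx) _.
  have tu : `|t - u| <= 2 * T * l1 (y - z).
    by rewrite /t /u (_ : _ - _ = dot y y - dot z z); [exact: n2B_bound|ring].
  have tv : `|t - v| <= 2 * T * l1 (y - x).
    by rewrite /t /v (_ : _ - _ = dot y y - dot x x); [exact: n2B_bound|ring].
  have uv : `|u - v| <= 2 * T * l1 (z - x).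
    by rewrite /u /v (_ : _ - _ = dot z z - dot x x); [exact: n2B_bound|ring].
  have -> : 8 * kap s * m `^ (s - 3) * T ^+ 2 * (l1 (y - z) * (l1 (y - x) + l1 (z - x))) =
    2 * kap s * m `^ (s - 3) * ((2 * T * l1 (y - z)) * (2 * T * l1 (y - x) + 2 * T * l1 (z - x))) by ring.
  rewrite -[leLHS]mulrA; apply: ler_wpM2l.
    by apply: mulr_ge0; [apply: mulr_ge0 => //; exact: ltW|exact: powR_ge0].
  by apply: ler_pM; [exact: normr_ge0|exact: addr_ge0|exact: tu|exact: lerD].
have dv : `|dgam v| <= kap s * m `^ (s - 2).
  rewrite /dgam normrN ger0_norm; last by apply: mulr_ge0; [exact: ltW|exact: powR_ge0].
  by rewrite ler_pM2l //; exact: powS2_anti.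
have -> : 2 * kap s * m `^ (s - 2) * (l1 (y - z) * (l1 (y - x) + l1 (z - x))) =
  kap s * m `^ (s - 2) * (2 * (l1 (y - z) * (l1 (y - x) + l1 (z - x)))) by ring.
rewrite normrM; apply: ler_pM => //.
have a1 : `|y.1 + z.1 - 2 * x.1| <= `|y.1 - x.1| + `|z.1 - x.1|.
  by rewrite (_ : _ - _ = (y.1 - x.1) + (z.1 - x.1)); [exact: ler_normD|ring].
have a2 : `|y.2 + z.2 - 2 * x.2| <= `|y.2 - x.2| + `|z.2 - x.2|.
  by rewrite (_ : _ - _ = (y.2 - x.2) + (z.2 - x.2)); [exact: ler_normD|ring].
apply: le_trans (ler_normD _ _) _; rewrite !normrM /l1 /=.
by apply: l1_product_bound.
Qed.

End kernel.
Global Opaque G.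

(** * Strict differentiability *)

Section strict_differentiability.
Variable R : realType.
Notation plane := (R * R)%type.
Implicit Types (x y z w a : plane) (f g : plane -> R).

(* Strict differentiability: unlike plain differentiability, at all points it
   gives a continuous gradient. *)
Definition strict_diff f x a := forall e, 0 < e -> exists2 r, 0 < r &
  forall y z, l1 (y - x) < r -> l1 (z - x) < r ->
  `|f y - f z - dot a (y - z)| <= e * l1 (y - z).

Lemma dot_bound a h (e : R) : `|a.1| <= e -> `|a.2| <= e -> `|dot a h| <= e * l1 h.
Proof.
move=> h1 h2; rewrite /dot /l1; apply: le_trans (ler_normD _ _) _.
by rewrite !normrM mulrDr lerD // ler_wpM2r.
Qed.

Lemma dotBr a y z : dot a (y - z) = dot a y - dot a z.
Proof. by rewrite /dot /=; ring. Qed.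

Lemma strict_diff_near f g x a (r : R) : 0 < r -> (forall y, l1 (y - x) < r -> f y = g y) ->
  strict_diff f x a -> strict_diff g x a.
Proof.
move=> r0 fg H e e0; have [r' r'0 h] := H e e0.
exists (Num.min r r'); first by rewrite lt_min r0.
move=> y z; rewrite !lt_min => /andP[y1 y2] /andP[z1 z2].
by rewrite -!fg //; exact: h.
Qed.

Lemma strict_diff_cst (c : R) x : strict_diff (fun=> c) x 0.
Proof.
move=> e e0; exists 1 => // y z _ _.
by rewrite /dot /= !mul0r addr0 !subrr normr0 mulr_ge0 ?l1_ge0 // ltW.
Qed.

Lemma strict_diff_dot x a : strict_diff (dot a) x a.
Proof.
move=> e e0; exists 1 => // y z _ _.
by rewrite dotBr subrr normr0 mulr_ge0 ?l1_ge0 // ltW.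
Qed.

Lemma strict_diff_add f g x a b : strict_diff f x a -> strict_diff g x b -> strict_diff (fun y => f y + g y) x (a + b).
Proof.
move=> H1 H2 e e0; have e2 : 0 < e / 2 by rewrite divr_gt0.
have [r1 r10 h1] := H1 _ e2; have [r2 r20 h2] := H2 _ e2.
exists (Num.min r1 r2); first by rewrite lt_min r10.
move=> y z; rewrite !lt_min => /andP[y1 y2] /andP[z1 z2].
have -> : f y + g y - (f z + g z) - dot (a + b) (y - z) =
  (f y - f z - dot a (y - z)) + (g y - g z - dot b (y - z)) by rewrite /dot /=; ring.
apply: le_trans (ler_normD _ _) _.
have -> : e * l1 (y - z) = e / 2 * l1 (y - z) + e / 2 * l1 (y - z) by field.
by apply: lerD; [exact: h1|exact: h2].
Qed.

Lemma strict_diff_scale (c : R) f x a : strict_diff f x a -> strict_diff (fun y => c * f y) x (c * a.1, c * a.2).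
Proof.
move=> H e e0; have c0 : 0 < `|c| + 1 by rewrite ltr_wpDl.
have [r r0 h] := H _ (divr_gt0 e0 c0); exists r => // y z yr zr.
have -> : c * f y - c * f z - dot (c * a.1, c * a.2) (y - z) =
  c * (f y - f z - dot a (y - z)) by rewrite /dot /=; ring.
rewrite normrM; apply: (@le_trans _ _ (`|c| * (e / (`|c| + 1) * l1 (y - z)))).
  by apply: ler_wpM2l => //; exact: h.
rewrite mulrA; apply: ler_wpM2r; first exact: l1_ge0.
by rewrite mulrCA ler_piMr ?(ltW e0) // ler_pdivrMr // mul1r lerDl.
Qed.

Lemma strict_diff_opp f x a : strict_diff f x a -> strict_diff (fun y => - f y) x (- a).
Proof.
move=> H e e0; have [r r0 h] := H _ e0; exists r => // y z yr zr.
have -> : - f y - - f z - dot (- a) (y - z) = - (f y - f z - dot a (y - z)).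
  by rewrite /dot /=; ring.
by rewrite normrN; exact: h.
Qed.

Lemma strict_diff_sub f g x a b : strict_diff f x a -> strict_diff g x b -> strict_diff (fun y => f y - g y) x (a - b).
Proof. by move=> H1 H2; apply: strict_diff_add H1 _; exact: strict_diff_opp. Qed.

Lemma strict_diff_shift f x h a : strict_diff f (x + h) a -> strict_diff (fun y => f (y + h)) x a.
Proof.
move=> H e e0; have [r r0 hr] := H e e0; exists r => // y z yr zr.
have E (u v : plane) : u + h - (v + h) = u - v by rewrite opprD addrACA subrr addr0.
by have := hr (y + h) (z + h); rewrite !E; apply.
Qed.

Lemma strict_diff_refl1 f x a : strict_diff f (- x.1, x.2) a -> strict_diff (fun y => f (- y.1, y.2)) x (- a.1, a.2).
Proof.
move=> H e e0; have [r r0 hr] := H e e0; exists r => // y z yr zr.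
have E (u v : plane) : l1 ((- u.1, u.2) - (- v.1, v.2)) = l1 (u - v).
  by rewrite /l1 /= -opprD normrN.
have := hr (- y.1, y.2) (- z.1, z.2); rewrite !E => /(_ yr zr).
by congr (`|_ - _| <= _); rewrite /dot /=; ring.
Qed.

Lemma strict_diff_lip f x a : strict_diff f x a -> exists2 r, 0 < r &
  forall y z, l1 (y - x) < r -> l1 (z - x) < r ->
  `|f y - f z| <= (`|a.1| + `|a.2| + 1) * l1 (y - z).
Proof.
move=> H; have [r r0 hr] := H 1 ltr01; exists r => // y z yr zr.
have -> : f y - f z = (f y - f z - dot a (y - z)) + dot a (y - z) by rewrite subrK.
apply: le_trans (ler_normD _ _) _; rewrite mulrDl addrC; apply: lerD; last exact: hr.
by apply: dot_bound; rewrite ?lerDl ?lerDr.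
Qed.

(** The outer estimate has the three-point form of [gam_C11]. Near [x] its last factor is small
    because [f] is locally Lipschitz. *)
Lemma strict_diff_comp (p dp : R -> R) (C : R) f x a : 0 <= C ->
  (forall u v t, `|p u - p v - dp t * (u - v)| <= C * `|u - v| * (`|u - t| + `|v - t|)) ->
  strict_diff f x a -> strict_diff (fun y => p (f y)) x (dp (f x) * a.1, dp (f x) * a.2).
Proof.
move=> C0 Hp H e e0; set D := dp (f x); set K := `|a.1| + `|a.2| + 1.
have K0 : 0 < K by rewrite /K ltr_wpDl // addr_ge0.
have [r1 r10 h1] := strict_diff_lip H; rewrite -/K in h1.
have D1 : 0 < 2 * (`|D| + 1) by rewrite mulr_gt0 // ltr_wpDl.
have [r2 r20 h2] := H _ (divr_gt0 e0 D1).
pose r3 := e / (4 * (C + 1) * K ^+ 2).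
have C1 : 0 < C + 1 by rewrite ltr_wpDl.
have r30 : 0 < r3 by rewrite divr_gt0 // !mulr_gt0 // exprn_gt0.
exists (Num.min r1 (Num.min r2 r3)); first by rewrite !lt_min r10 r20.
move=> y z; rewrite !lt_min => /andP[y1 /andP[y2 y3]] /andP[z1 /andP[z2 z3]].
have -> : p (f y) - p (f z) - dot (D * a.1, D * a.2) (y - z) =
  (p (f y) - p (f z) - D * (f y - f z)) + D * (f y - f z - dot a (y - z)).
  by rewrite /dot /=; ring.
apply: le_trans (ler_normD _ _) _.
have -> : e * l1 (y - z) = e / 2 * l1 (y - z) + e / 2 * l1 (y - z) by field.
have x1 : l1 (x - x) < r1 by rewrite subrr l1_0.
have fy := h1 _ _ y1 x1; have fz := h1 _ _ z1 x1; have fyz := h1 _ _ y1 z1.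
have L0 := l1_ge0 (y - z).
apply: lerD.
  apply: le_trans (Hp _ _ _) _.
  apply: (@le_trans _ _ ((C + 1) * (K * l1 (y - z)) * (K * r3 + K * r3))).
    apply: ler_pM; rewrite ?mulr_ge0 ?addr_ge0 //.
      by apply: ler_pM => //; rewrite lerDl.
    by apply: lerD; [apply: le_trans fy _|apply: le_trans fz _]; rewrite ler_pM2l // ltW.
  rewrite le_eqVlt; apply/orP; left; apply/eqP; rewrite /r3; field.
  by rewrite !gt_eqF.
rewrite normrM; apply: (@le_trans _ _ ((`|D| + 1) * (e / (2 * (`|D| + 1)) * l1 (y - z)))).
  by apply: ler_pM => //; [rewrite lerDl|exact: h2].
rewrite le_eqVlt; apply/orP; left; apply/eqP; field.
by rewrite gt_eqF // ltr_wpDl.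
Qed.

(** Increments along the two axes, inside both neighbourhoods, detect the components of [a - b]. *)
Lemma strict_diff_approx_eq a b x (e1 e2 r1 r2 : R) f : 0 < r1 -> 0 < r2 ->
  (forall y z, l1 (y - x) < r1 -> l1 (z - x) < r1 -> `|f y - f z - dot a (y - z)| <= e1 * l1 (y - z)) ->
  (forall y z, l1 (y - x) < r2 -> l1 (z - x) < r2 -> `|f y - f z - dot b (y - z)| <= e2 * l1 (y - z)) ->
  `|a.1 - b.1| <= e1 + e2 /\ `|a.2 - b.2| <= e1 + e2.
Proof.
move=> r10 r20 h1 h2; set t := Num.min r1 r2 / 2.
have t0 : 0 < t by rewrite divr_gt0 // lt_min r10.
have tr1 : t < r1.
  have : Num.min r1 r2 <= r1 by rewrite ge_min lexx.
  by rewrite /t; lra.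
have tr2 : t < r2.
  have : Num.min r1 r2 <= r2 by rewrite ge_min lexx orbT.
  by rewrite /t; lra.
have K (h : plane) : l1 h = t -> `|dot (a - b) h| <= (e1 + e2) * t.
  move=> ht; have xx : x + h - x = h by rewrite addrAC subrr add0r.
  have := h1 (x + h) x; rewrite xx subrr l1_0 ht => /(_ tr1 r10) A.
  have := h2 (x + h) x; rewrite xx subrr l1_0 ht => /(_ tr2 r20) B.
  have -> : dot (a - b) h = - (f (x + h) - f x - dot a h) + (f (x + h) - f x - dot b h).
    by rewrite /dot /=; ring.
  apply: le_trans (ler_normD _ _) _; rewrite normrN mulrDl; exact: lerD.
split.
  have := K (t, 0); rewrite /l1 /= normr0 addr0 gtr0_norm // => /(_ erefl).
  by rewrite /dot /= mulr0 addr0 normrM (gtr0_norm t0) ler_pM2r.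
have := K (0, t); rewrite /l1 /= normr0 add0r gtr0_norm // => /(_ erefl).
by rewrite /dot /= mulr0 add0r normrM (gtr0_norm t0) ler_pM2r.
Qed.

(** Approximate gradients with errors [e1] and [e2] differ by at most [e1 + e2] in each component,
    so they converge as the errors tend to zero. *)
Lemma strict_diff_of_approx f x :
  (forall e, 0 < e -> exists a, exists2 r, 0 < r & forall y z, l1 (y - x) < r -> l1 (z - x) < r ->
     `|f y - f z - dot a (y - z)| <= e * l1 (y - z)) -> exists a, strict_diff f x a.
Proof.
move=> H.
pose Q (e : R) a := 0 < e /\ exists2 r, 0 < r & forall y z, l1 (y - x) < r -> l1 (z - x) < r ->
     `|f y - f z - dot a (y - z)| <= e * l1 (y - z).
have QQ e1 a1 e2 a2 : Q e1 a1 -> Q e2 a2 -> `|a1.1 - a2.1| <= e1 + e2 /\ `|a1.2 - a2.2| <= e1 + e2.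
  by move=> [_ [r1 r10 h1]] [_ [r2 r20 h2]]; exact: (strict_diff_approx_eq r10 r20 h1 h2).
have lim (p : plane -> R) : (forall e1 a1 e2 a2, Q e1 a1 -> Q e2 a2 -> `|p a1 - p a2| <= e1 + e2) ->
    exists L, forall e a, Q e a -> `|p a - L| <= e.
  move=> PP; pose E := [set t | exists e a, Q e a /\ t = p a - e].
  have ub e a : Q e a -> ubound E (p a + e).
    move=> q t [e' [a' [q' ->]]]; have := PP _ _ _ _ q' q; rewrite ler_norml => /andP[_]; lra.
  have [a1 Q1] := H 1 ltr01.
  have qq : Q 1 a1 by split.
  have E0 : E !=set0 by exists (p a1 - 1); exists 1, a1.
  exists (sup E) => e a q; rewrite ler_norml; apply/andP; split.
    by have := ge_sup E0 (ub _ _ q); lra.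
  have : p a - e <= sup E.
    by apply: ub_le_sup; [exists (p a + e); exact: ub|exists e, a].
  lra.
have [L1 H1] := lim fst (fun e1 a1 e2 a2 q1 q2 => (QQ e1 a1 e2 a2 q1 q2).1).
have [L2 H2] := lim snd (fun e1 a1 e2 a2 q1 q2 => (QQ e1 a1 e2 a2 q1 q2).2).
exists (L1, L2) => e e0; have e2 : 0 < e / 2 by rewrite divr_gt0.
have [a [r r0 hr]] := H _ e2; have q : Q (e / 2) a by split=> //; exists r.
exists r => // y z yr zr.
have -> : f y - f z - dot (L1, L2) (y - z) = (f y - f z - dot a (y - z)) + dot (a - (L1, L2)) (y - z).
  by rewrite /dot /=; ring.
apply: le_trans (ler_normD _ _) _.
have -> : e * l1 (y - z) = e / 2 * l1 (y - z) + e / 2 * l1 (y - z) by field.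
apply: lerD; first exact: hr.
by apply: dot_bound; [exact: H1|exact: H2].
Qed.

(** Strict differentiability survives limits in the Lipschitz seminorm. It is applied to potentials,
    with the singular part of the kernel as error, and to the stream function, with the tail of the
    series as error. *)
Lemma strict_diff_pert f x : (forall e, 0 < e -> exists g, exists a, strict_diff g x a /\
    exists2 r, 0 < r & forall y z, l1 (y - x) < r -> l1 (z - x) < r ->
    `|(f y - g y) - (f z - g z)| <= e * l1 (y - z)) -> exists a, strict_diff f x a.
Proof.
move=> H; apply: strict_diff_of_approx => e e0; have e2 : 0 < e / 2 by rewrite divr_gt0.
have [g [a [G [r r0 hr]]]] := H _ e2; have [r' r'0 hr'] := G _ e2.
exists a, (Num.min r r'); first by rewrite lt_min r0.
move=> y z; rewrite !lt_min => /andP[y1 y2] /andP[z1 z2].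
have -> : f y - f z - dot a (y - z) = (f y - g y - (f z - g z)) + (g y - g z - dot a (y - z)) by ring.
apply: le_trans (ler_normD _ _) _.
have -> : e * l1 (y - z) = e / 2 * l1 (y - z) + e / 2 * l1 (y - z) by field.
by apply: lerD; [exact: hr|exact: hr'].
Qed.

Lemma l1_norm x : l1 x <= 2 * `|x|.
Proof.
rewrite prod_normE /l1 mulrDl mul1r.
by apply: lerD; rewrite le_max lexx ?orbT.
Qed.

Lemma norm_l1 x : `|x| <= l1 x.
Proof. by rewrite prod_normE /l1 ge_max lerDl lerDr !normr_ge0. Qed.

Lemma strict_diff_diff f x a : strict_diff f x a ->
  [/\ differentiable f x, 'D_e1 f x = a.1 & 'D_e2 f x = a.2].
Proof.
move=> H.
have lin : linear (dot a : plane -> R).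
  move=> c u v.
  have -> : c *: (dot a u : R) = c * dot a u by [].
  rewrite /dot.
  have -> : (c *: u + v).1 = c * u.1 + v.1 by [].
  have -> : (c *: u + v).2 = c * u.2 + v.2 by [].
  ring.
pose L : {linear plane -> R} := HB.pack (dot a : plane -> R) (GRing.isLinear.Build _ _ _ _ _ lin).
have cL : continuous L.
  pose K : R := Num.max `|a.1| `|a.2|.
  have K0 : 0 <= K by rewrite le_max normr_ge0.
  have K1 : 0 < 2 * (K + 1) by apply: mulr_gt0 => //; exact: ltr_wpDl.
  move=> y; apply/cvgrPdist_le => e e0.
  have eK : 0 < e / (2 * (K + 1)) by exact: divr_gt0.
  near=> z; rewrite /= -dotBr.
  apply: (@le_trans _ _ (K * l1 (y - z))).
    by apply: dot_bound; rewrite le_max lexx ?orbT.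
  apply: (@le_trans _ _ (K * (2 * `|y - z|))); first by apply: ler_wpM2l => //; exact: l1_norm.
  have h : `|y - z| <= e / (2 * (K + 1)).
    near: z; apply: cvgr_dist_le; first exact: cvg_id.
    exact: eK.
  rewrite ler_pdivlMr // in h.
  by have := normr_ge0 (y - z); nra.
have K : forall eps : R, 0 < eps -> \forall h \near (0 : plane), `|f (h + x) - (f x + L h)| <= eps * `|h|.
  move=> eps eps0; have e2 : 0 < eps / 2 by rewrite divr_gt0.
  have [r r0 hr] := H (eps / 2) e2.
  have r2 : 0 < r / 2 by rewrite divr_gt0.
  near=> h.
  have hx : h + x - x = h by rewrite addrK.
  have := hr (h + x) x; rewrite subrr l1_0 hx => B.
  have hs : `|h| < r / 2 by rewrite -normrN -sub0r; near: h; apply: cvgr_dist_lt; [exact: cvg_id|exact: r2].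
  have C : l1 h < r by apply: le_lt_trans (l1_norm _) _; lra.
  have {}B := B C r0.
  rewrite opprD addrA; apply: le_trans B _.
  by have := l1_norm h; nra.
have dL : 'd f x = L :> (plane -> R).
  by apply: diff_unique => //; apply/eqaddoP => eps eps0; exact: K.
have df : differentiable f x.
  by apply/diff_locallyP; rewrite dL; split=> //; apply/eqaddoP => eps eps0; exact: K.
split=> //; rewrite deriveE // dL /= /dot /e1 /e2 /=; ring.
Unshelve. all: by end_near. Qed.

(** The gradient at [x] is an approximate gradient at every nearby point as well, so
    [strict_diff_approx_eq] compares it with the gradient there. *)
Lemma C1_of_strict_diff f (a : plane -> plane) : (forall x, strict_diff f x (a x)) -> C1 f.
Proof.
move=> H; have K x := strict_diff_diff (H x).
have E1 : 'D_e1 f = (fun x => (a x).1) by apply/funext => x; have [] := K x.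
have E2 : 'D_e2 f = (fun x => (a x).2) by apply/funext => x; have [] := K x.
have C x e : 0 < e -> exists2 r, 0 < r & forall y, l1 (y - x) < r ->
    `|(a x).1 - (a y).1| <= e /\ `|(a x).2 - (a y).2| <= e.
  move=> e0; have e2 : 0 < e / 2 by rewrite divr_gt0.
  have [r r0 hr] := H x _ e2; exists r => // y yr.
  have [r' r'0 hr'] := H y _ e2.
  have -> : e = e / 2 + e / 2 by field.
  pose r'' := Num.min r' (r - l1 (y - x)).
  have r''0 : 0 < r'' by rewrite lt_min r'0 subr_gt0.
  have tri u : l1 (u - y) < r'' -> l1 (u - x) < r.
    rewrite lt_min => /andP[_ h]; rewrite -(subrK y u) -addrA.
    by apply: le_lt_trans (l1_triangle _ _) _; lra.
  apply: (@strict_diff_approx_eq _ _ y _ _ r'' r' f) => //.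
  by move=> u v uy vy; apply: hr; exact: tri.
split; first by move=> x; have [] := K x.
- rewrite E1 => x; apply/cvgrPdist_le => e e0; have [r r0 hr] := C x e e0.
  near=> y; have [] // := hr y; rewrite l1B; apply: le_lt_trans (l1_norm _) _.
  have : `|x - y| < r / 2 by near: y; apply: cvgr_dist_lt; [exact: cvg_id|rewrite divr_gt0].
  lra.
- rewrite E2 => x; apply/cvgrPdist_le => e e0; have [r r0 hr] := C x e e0.
  near=> y; have [] // := hr y; rewrite l1B; apply: le_lt_trans (l1_norm _) _.
  have : `|x - y| < r / 2 by near: y; apply: cvgr_dist_lt; [exact: cvg_id|rewrite divr_gt0].
  lra.
Unshelve. all: by end_near. Qed.

End strict_differentiability.

(** * Potentials of Lipschitz densities *)

Ltac nneg := repeat first [ assumption | apply: addr_ge0 | apply: mulr_ge0 | apply: powR_ge0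
  | apply: l1_ge0 | apply: sqr_ge0 | apply: normr_ge0 | (apply: ltW; assumption) | exact: ler0n | exact: ler01 ].

Lemma scaled_sum_le (R : realFieldType) (A B D e : R) : 0 <= D -> 0 <= A -> 0 <= B ->
  A * (2 * (D + 1)) < e -> B * (2 * (D + 1)) < e -> D * (A + B) <= e.
Proof. by move=> *; nra. Qed.

Section potential.
Variable R : realType.
Notation mR := (measurableTypeR R).
Notation plane := (mR * mR)%type.
Implicit Types (x y z w u v : plane) (f g : plane -> R).

Definition lip (K : R) f := forall x y, `|f x - f y| <= K * l1 (x - y).

Definition ratpt (n : nat) : plane :=
  let p := odflt (0, 0) (unpickle n : option (rat * rat)) in (ratr p.1, ratr p.2).

Lemma ratpt_dense x (e : R) : 0 < e -> exists n, l1 (x - ratpt n) < e.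
Proof.
move=> e0; have e2 : 0 < e / 2 by rewrite divr_gt0.
have D (t : R) : exists q : rat, `|t - ratr q| < e / 2.
  have : t - e / 2 < t + e / 2 by lra.
  move=> /rat_in_itvoo[q]; rewrite in_itv /= => /andP[h1 h2]; exists q.
  by rewrite ltr_norml; apply/andP; split; lra.
have [q1 h1] := D x.1; have [q2 h2] := D x.2.
exists (pickle (q1, q2)); rewrite /ratpt pickleK /= /l1 /=.
have -> : e = e / 2 + e / 2 by field.
exact: ltrD.
Qed.

(** A Lipschitz function is the infimum of the cones that touch it at the rational points, a
    countable family of measurable functions. *)
Lemma measurable_lip (K : R) f : 0 <= K -> lip K f ->
  measurable_fun [set: plane] (f : plane -> mR).
Proof.
move=> K0 Kf; pose h n x : R := f (ratpt n) + K * l1 (x - ratpt n).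
have fh n x : f x <= h n x.
  by rewrite /h -lerBlDl; apply: le_trans (Kf x (ratpt n)); exact: ler_norm.
have -> : f = (fun x => infs (h ^~ x) 0).
  apply/funext => x; rewrite /infs /=.
  have lb : lbound (sdrop (h ^~ x) 0) (f x) by move=> _ [k _ <-]; exact: fh.
  have ne : sdrop (h ^~ x) 0 !=set0 by exists (h 0%N x), 0%N.
  apply/eqP; rewrite eq_le lb_le_inf //=.
  rewrite leNgt; apply/negP => ab; pose e := inf (sdrop (h ^~ x) 0) - f x.
  have e0 : 0 < e by rewrite subr_gt0.
  have K1 : 0 < 2 * K + 1 by rewrite ltr_wpDl // mulr_ge0.
  have [n hn] := ratpt_dense x (divr_gt0 e0 K1).
  have : inf (sdrop (h ^~ x) 0) <= h n x by apply: ge_inf; [exists (f x)|exists n].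
  have h2 := Kf (ratpt n) x; rewrite l1B in h2.
  have h3 := le_trans (ler_norm _) h2.
  rewrite ltr_pdivlMr // in hn.
  rewrite leNgt; apply/negP; rewrite negbK /h -subr_gt0.
  by have := l1_ge0 (x - ratpt n); rewrite /e in hn e0 *; nra.
apply: measurable_fun_infs.
  by move=> x _; exists (f x) => _ [n _ <-]; exact: fh.
move=> n; apply: measurable_funD => //; apply: measurable_funM => //.
apply: measurable_funD; apply: measurableT_comp => //; exact: measurable_funB.
Qed.

Definition adm (z : plane) (r C K : R) f :=
  [/\ forall x, `|f x| <= C, lip K f & forall x, ~ box z r x -> f x = 0].

Variable s : R.
Hypotheses (s0 : 0 < s) (s1 : s <= 1).
Notation gam := (gam s).
Notation dgam := (dgam s).
Notation Greg := (Greg s).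
Notation Gsing := (Gsing s).
Notation gradG := (gradG s).

Lemma box_l1 z (r M : R) x u : box z M x -> box z r u ->
  l1 (x - u) <= 2 * (M + r) /\ dot (x - u) (x - u) <= (2 * (M + r)) ^+ 2.
Proof.
move=> /boxP[x1 x2] /boxP[u1 u2].
have h : l1 (x - u) <= 2 * (M + r).
  have e1 : (x - u).1 = (x.1 - z.1) - (u.1 - z.1) by rewrite /=; ring.
  have e2 : (x - u).2 = (x.2 - z.2) - (u.2 - z.2) by rewrite /=; ring.
  rewrite /l1 e1 e2.
  have := ler_normB (x.1 - z.1) (u.1 - z.1); have := ler_normB (x.2 - z.2) (u.2 - z.2); lra.
split=> //; apply: le_trans (n2_le_l1 _) _.
by rewrite ler_sqr ?nnegrE ?l1_ge0 // (le_trans _ h) ?l1_ge0.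
Qed.

(** The translation is moved from the kernel to the density: the difference is the integral of
    [Gsing] against an increment of [f], which is at most [K * l1 (x - y)]. Only the $L^1$ norm of
    [Gsing] enters. The translated density needs the larger box of half-side [r + rho]. *)
Lemma sing_lip z (r rho M eta : R) : 0 <= r -> 0 <= rho -> 0 < eta ->
  exists2 e, 0 < e <= 1 & forall C K f, 0 <= C -> 0 <= K -> adm z r C K f ->
  (forall x, box z M x -> ig (fun u => Gsing e (x - u) * f u)) /\
  forall x y, box z M x -> box z M y -> l1 (x - y) <= rho ->
  `|I (fun u => Gsing e (x - u) * f u) - I (fun u => Gsing e (y - u) * f u)| <= eta * K * l1 (x - y).
Proof.
move=> r0 rho0 eta0.
have rr0 : 0 <= r + rho by rewrite addr_ge0.
have [e e0 H] := Gsing_small s0 s1 ((2 * (M + (r + rho))) ^+ 2) rr0 eta0.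
exists e => // C K f C0 K0 [fC fK f0].
have mf := measurable_lip K0 fK.
have sub u : ~ box z (r + rho) u -> f u = 0.
  move=> nb; apply: f0 => b; apply: nb; apply/boxP; have [] := (boxP _ _ _).1 b.
  by move=> h1 h2; split; [apply: le_trans h1 _|apply: le_trans h2 _]; rewrite lerDl.
have xT x : box z M x -> forall u, box z (r + rho) u -> dot (x - u) (x - u) <= (2 * (M + (r + rho))) ^+ 2.
  by move=> bx u bu; have [] := box_l1 bx bu.
have igf x : box z M x -> ig (fun u => Gsing e (x - u) * f u).
  by move=> bx; have [] := H x z C f C0 (xT x bx) mf fC sub.
split=> // x y bx by_ xy.
have [i2 e2] := I_shift (y - x) (igf y by_).
have E : (fun u => Gsing e (y - (u + (y - x))) * f (u + (y - x))) = (fun u => Gsing e (x - u) * f (u + (y - x))).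
  by apply/funext => u; congr (Gsing e _ * _); rewrite opprD opprB addrCA (addrC y) subrK addrC.
rewrite E in i2 e2; rewrite -e2 -(IB (igf x bx) i2).
pose F u := f u - f (u + (y - x)).
have -> : (fun u => Gsing e (x - u) * f u - Gsing e (x - u) * f (u + (y - x))) = (fun u => Gsing e (x - u) * F u).
  by apply/funext => u; rewrite /F mulrBr.
have FC u : `|F u| <= K * l1 (x - y).
  by apply: le_trans (fK _ _) _; rewrite opprD addrA subrr sub0r opprB.
have mF : measurable_fun [set: plane] (F : plane -> mR).
  apply: measurable_funB => //; apply: (measurableT_comp mf).
  by apply: measurable_fun_pair; apply: measurable_funD.
have F0 u : ~ box z (r + rho) u -> F u = 0.
  move=> nb; rewrite /F (sub _ nb) (f0 (u + (y - x))) ?subrr // => /boxP[b1 b2].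
  apply: nb; apply/boxP; move: xy; rewrite /l1 /= => xy.
  have h1 := normr_ge0 (x.1 - y.1); have h2 := normr_ge0 (x.2 - y.2).
  have e1 : u.1 - z.1 = ((u + (y - x)).1 - z.1) + (x.1 - y.1) by rewrite /=; ring.
  have e3 : u.2 - z.2 = ((u + (y - x)).2 - z.2) + (x.2 - y.2) by rewrite /=; ring.
  rewrite e1 e3; split; apply: le_trans (ler_normD _ _) _; lra.
have KC : 0 <= K * l1 (x - y) by rewrite mulr_ge0 ?l1_ge0.
have [iF IF] := H x z (K * l1 (x - y)) F KC (xT x bx) mF FC F0.
apply: le_trans (I_abs iF) _; apply: le_trans IF _.
by rewrite le_eqVlt; apply/orP; left; apply/eqP; ring.
Qed.

Lemma measurable_Gregx e x : measurable_fun [set: plane] (fun u : plane => Greg e (x - u) : mR).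
Proof. exact: (measurableT_comp (@measurable_Greg R s e) (measurable_subx x)). Qed.

Lemma measurable_dgam : measurable_fun [set: mR] (dgam : mR -> mR).
Proof.
apply: (@measurableT_comp _ _ _ _ _ _ (-%R : mR -> mR)) => //.
by apply: measurable_funM => //; exact: measurable_powR.
Qed.

Lemma measurable_gradG e x :
  measurable_fun [set: plane] (fun u : plane => (gradG e (x - u)).1 : mR) /\
  measurable_fun [set: plane] (fun u : plane => (gradG e (x - u)).2 : mR).
Proof.
have md : measurable_fun [set: plane] (fun u : plane => 2 * dgam (dot (x - u) (x - u) + e) : mR).
  apply: measurable_funM => //.
  apply: (measurableT_comp measurable_dgam); apply: measurable_funD => //.
  exact: (measurableT_comp (@measurable_n2 R) (measurable_subx x)).
by split; apply: measurable_funM => //; exact: measurable_funB.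
Qed.

Section regular.
Variables (z : plane) (r C K M e : R) (f : plane -> R).
Hypotheses (r0 : 0 <= r) (C0 : 0 <= C) (K0 : 0 <= K) (M0 : 0 <= M) (e0 : 0 < e).
Hypothesis (af : adm z r C K f).
Let T := 2 * (M + r).
Let mf : measurable_fun [set: plane] (f : plane -> mR).
Proof. by case: af => _ fK _; exact: measurable_lip fK. Qed.
Let fC x : `|f x| <= C. Proof. by case: af. Qed.
Let f0 x : ~ box z r x -> f x = 0. Proof. by case: af => _ _; apply. Qed.

(* [q] is only controlled on the support of [f]. *)
Lemma I_weighted (q : plane -> R) (A : R) : 0 <= A ->
  measurable_fun [set: plane] (q : plane -> mR) ->
  (forall u, box z r u -> `|q u| <= A) ->
  ig (fun u => q u * f u) /\ `|I (fun u => q u * f u)| <= A * (C * (2 * r) ^+ 2).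
Proof.
move=> A0 mq qA.
have m1 : measurable_fun [set: plane] (fun u : plane => q u * f u : mR) by exact: measurable_funM.
have b1 u : `|q u * f u| <= A * C.
  rewrite normrM; case: (asboolP (box z r u)) => bu; last first.
    by rewrite (f0 bu) normr0 mulr0 mulr_ge0.
  by apply: ler_pM => //; exact: qA.
have z1 u : ~ box z r u -> q u * f u = 0 by move=> bu; rewrite (f0 bu) mulr0.
split; first exact: ig_bounded r0 m1 b1 z1.
by rewrite mulrA; exact: I_bounded r0 m1 b1 z1.
Qed.

Lemma reg_ig x : ig (fun u => Greg e (x - u) * f u).
Proof.
have [M' M'0 hM'] : exists2 M', 0 <= M' & box z M' x.
  exists (l1 (x - z)); first exact: l1_ge0.
  by apply/boxP; rewrite /l1 /= lerDl lerDr !normr_ge0.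
have [] := @I_weighted (fun u => Greg e (x - u)) (`|Greg e 0| + kap s * e `^ (s - 2) * (2 * (2 * (M' + r))) * (2 * (M' + r))).
- have := ltW (kap_gt0 s0 s1) => kp; nneg.
- exact: measurable_Gregx.
- move=> u bu; have [h1 _] := box_l1 hM' bu.
  have h0 : 0 <= 2 * (M' + r) by rewrite mulr_ge0 // addr_ge0.
  rewrite -[Greg e (x - u)](subrK (Greg e 0)) addrC; apply: le_trans (ler_normD _ _) _.
  apply: lerD => //.
  apply: le_trans (greg_lip s0 s1 e0 _ _ h1 _) _; rewrite ?l1_0 ?lerDr ?n2_ge0 //.
  rewrite subr0; apply: ler_wpM2l => //.
  by have := ltW (kap_gt0 s0 s1) => kp; nneg.
- by [].
Qed.

Lemma reg_lip x y : box z M x -> box z M y ->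
  `|I (fun u => Greg e (x - u) * f u) - I (fun u => Greg e (y - u) * f u)| <=
  kap s * e `^ (s - 2) * (2 * T) * (C * (2 * r) ^+ 2) * l1 (x - y).
Proof.
move=> bx by_; rewrite -(IB (reg_ig x) (reg_ig y)).
have -> : (fun u => Greg e (x - u) * f u - Greg e (y - u) * f u) = (fun u => (Greg e (x - u) - Greg e (y - u)) * f u).
  by apply/funext => u; rewrite mulrBl.
have T0 : 0 <= T by rewrite mulr_ge0 // addr_ge0.
have [] := @I_weighted (fun u => Greg e (x - u) - Greg e (y - u)) (kap s * e `^ (s - 2) * (2 * T) * l1 (x - y)).
- by have := ltW (kap_gt0 s0 s1) => kp; nneg.
- by apply: measurable_funB; exact: measurable_Gregx.
- move=> u bu; have [h1 _] := box_l1 bx bu; have [h2 _] := box_l1 by_ bu.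
  have -> : x - y = (x - u) - (y - u) by rewrite opprB addrA subrK.
  by apply: (greg_lip s0 s1 e0) => //; rewrite lerDr n2_ge0.
by move=> _ h; apply: le_trans h _; rewrite le_eqVlt; apply/orP; left; apply/eqP; ring.
Qed.

(** Differentiation under the integral: [greg_C11] linearizes the integrand uniformly on the
    support, so the error is quadratic in the distances. *)
Lemma reg_strict_diff x : l1 (x - z) < M ->
  exists a, strict_diff (fun x => I (fun u => Greg e (x - u) * f u)) x a.
Proof.
move=> xM.
have T0 : 0 <= T by rewrite mulr_ge0 // addr_ge0.
have kp := ltW (kap_gt0 s0 s1).
have inM y : l1 (y - x) < M - l1 (x - z) -> box z M y.
  move=> h; have : l1 (y - z) <= M.
    have -> : y - z = (y - x) + (x - z) by rewrite addrA subrK.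
    by apply: le_trans (l1_triangle _ _) _; lra.
  by move=> h'; apply/boxP; split; apply: le_trans h'; rewrite /l1 /= ?lerDl ?lerDr.
have xx : box z M x by apply: inM; rewrite subrr l1_0 subr_gt0.
have [mg1 mg2] := measurable_gradG e x.
have kb u : box z r u -> `|(gradG e (x - u)).1| <= 2 * (kap s * e `^ (s - 2)) * T /\
    `|(gradG e (x - u)).2| <= 2 * (kap s * e `^ (s - 2)) * T.
  move=> bu; have [h1 _] := box_l1 xx bu; rewrite -/T in h1.
  have dv : `|dgam (dot (x - u) (x - u) + e)| <= kap s * e `^ (s - 2).
    rewrite /dgam normrN ger0_norm; last by nneg.
    by apply: ler_wpM2l => //; apply: powS2_anti => //; rewrite lerDr n2_ge0.
  rewrite /gradG /= !normrM !(ger0_norm (ler0n _ 2)).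
  have l1a : `|x.1 - u.1| <= T by apply: le_trans h1; rewrite /l1 /= lerDl.
  have l1b : `|x.2 - u.2| <= T by apply: le_trans h1; rewrite /l1 /= lerDr.
  by split; apply: ler_pM => //; rewrite ?mulr_ge0 //; apply: ler_pM.
have [||ig1 _] := @I_weighted (fun u => (gradG e (x - u)).1) (2 * (kap s * e `^ (s - 2)) * T) _ mg1.
- by nneg.
- by move=> u /kb[].
have [||ig2 _] := @I_weighted (fun u => (gradG e (x - u)).2) (2 * (kap s * e `^ (s - 2)) * T) _ mg2.
- by nneg.
- by move=> u /kb[].
pose a : plane := (I (fun u => (gradG e (x - u)).1 * f u), I (fun u => (gradG e (x - u)).2 * f u)).
exists a => eps eps0.
pose D := (8 * kap s * e `^ (s - 3) * T ^+ 2 + 2 * kap s * e `^ (s - 2)) * (C * (2 * r) ^+ 2).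
have D0 : 0 <= D by rewrite /D; nneg.
have D1 : 0 < 2 * (D + 1) by rewrite mulr_gt0 // ltr_wpDl.
exists (Num.min (M - l1 (x - z)) (eps / (2 * (D + 1)))).
  by rewrite lt_min subr_gt0 xM divr_gt0.
move=> y w; rewrite !lt_min => /andP[y1 y2] /andP[w1 w2].
have by_ := inM _ y1; have bw := inM _ w1.
pose q u := Greg e (y - u) - Greg e (w - u) - ((gradG e (x - u)).1 * (y - w).1 + (gradG e (x - u)).2 * (y - w).2).
have E : I (fun u => Greg e (y - u) * f u) - I (fun u => Greg e (w - u) * f u) - dot a (y - w) = I (fun u => q u * f u).
  have -> : dot a (y - w) = I (fun u => (y - w).1 * ((gradG e (x - u)).1 * f u) + (y - w).2 * ((gradG e (x - u)).2 * f u)).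
    by rewrite (ID (igZ _ ig1) (igZ _ ig2)) (IZ _ ig1) (IZ _ ig2) /dot /=; ring.
  rewrite -(IB (reg_ig y) (reg_ig w)) -IB; last 2 first.
  - exact: igB (reg_ig y) (reg_ig w).
  - exact: igD (igZ _ ig1) (igZ _ ig2).
  by congr I; apply/funext => u; rewrite /q; ring.
rewrite E.
have mq : measurable_fun [set: plane] (q : plane -> mR).
  apply: measurable_funB; first by apply: measurable_funB; exact: measurable_Gregx.
  by apply: measurable_funD; apply: measurable_funM.
have L0 := l1_ge0 (y - w); have L1 := l1_ge0 (y - x); have L2 := l1_ge0 (w - x).
have [||_ h] := @I_weighted q ((8 * kap s * e `^ (s - 3) * T ^+ 2 + 2 * kap s * e `^ (s - 2)) *
    (l1 (y - w) * (l1 (y - x) + l1 (w - x)))) _ mq.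
- by nneg.
- move=> u bu; have [hx _] := box_l1 xx bu; have [hy _] := box_l1 by_ bu; have [hw _] := box_l1 bw bu.
  have S (p p' : plane) : p - p' = (p - u) - (p' - u) by rewrite opprB addrA subrK.
  have := @greg_C11 R s s0 s1 e e T (x - u) (y - u) (w - u) e0.
  rewrite !lerDr !n2_ge0 -!S => /(_ isT isT isT hx hy hw).
  by [].
apply: le_trans h _; rewrite mulrAC -/D.
rewrite ltr_pdivlMr // in y2; rewrite ltr_pdivlMr // in w2.
rewrite mulrCA (mulrC eps); apply: ler_wpM2l; first exact: L0.
exact: scaled_sum_le D0 L1 L2 y2 w2.
Qed.

End regular.

Definition pot f x : R := I (fun u => G s (x - u) * f u).

Lemma pot_split z (r C K e : R) f x : 0 <= r -> 0 <= C -> 0 <= K -> 0 < e -> adm z r C K f ->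
  ig (fun u => Gsing e (x - u) * f u) ->
  ig (fun u => G s (x - u) * f u) /\
  pot f x = I (fun u => Gsing e (x - u) * f u) + I (fun u => Greg e (x - u) * f u).
Proof.
move=> r0 C0 K0 e0 af iS; have iR := reg_ig r0 C0 K0 e0 af x.
have E : (fun u => G s (x - u) * f u) = (fun u => Gsing e (x - u) * f u + Greg e (x - u) * f u).
  by apply/funext => u; rewrite /Gsing -mulrDl subrK.
by rewrite /pot E; split; [exact: igD|exact: ID].
Qed.

(** The order of the quantifiers matters: [A] depends on [eta], but not on the size [C] and the
    Lipschitz constant [K] of the density. *)
Lemma pot_lip z (r M eta : R) : 0 <= r -> 0 <= M -> 0 < eta -> exists2 A, 0 <= A &
  forall C K f, 0 <= C -> 0 <= K -> adm z r C K f ->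
  forall x y, box z M x -> box z M y -> `|pot f x - pot f y| <= (eta * K + A * C) * l1 (x - y).
Proof.
move=> r0 M0 eta0.
have rho0 : 0 <= 2 * (M + M) by rewrite mulr_ge0 // addr_ge0.
have [e /andP[e0 e1] H] := @sing_lip z r (2 * (M + M)) M eta r0 rho0 eta0.
exists (kap s * e `^ (s - 2) * (2 * (2 * (M + r))) * (2 * r) ^+ 2).
  by have := ltW (kap_gt0 s0 s1) => kp; nneg.
move=> C K f C0 K0 af x y bx by_; have [iS L] := H C K f C0 K0 af.
have [_ ->] := pot_split r0 C0 K0 e0 af (iS x bx).
have [_ ->] := pot_split r0 C0 K0 e0 af (iS y by_).
rewrite opprD addrACA; apply: le_trans (ler_normD _ _) _; rewrite mulrDl; apply: lerD.
  by apply: L => //; have [] := box_l1 bx by_.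
apply: le_trans (reg_lip r0 C0 K0 M0 e0 af bx by_) _.
by rewrite le_eqVlt; apply/orP; left; apply/eqP; ring.
Qed.

(** The regular part is differentiable, and the singular part has arbitrarily small Lipschitz
    constant by [sing_lip]. *)
Lemma pot_strict_diff z (r C K : R) f x : 0 <= r -> 0 <= C -> 0 <= K -> adm z r C K f ->
  exists a, strict_diff (pot f) x a.
Proof.
move=> r0 C0 K0 af; apply: strict_diff_pert => eps eps0.
pose M := l1 (x - z) + 1; have M0 : 0 <= M by rewrite addr_ge0 ?l1_ge0.
have xM : l1 (x - z) < M by rewrite ltrDl.
have rho0 : 0 <= 2 * (M + M) by rewrite mulr_ge0 // addr_ge0.
have K1 : 0 < K + 1 by rewrite ltr_wpDl.
have [e /andP[e0 e1] H] := @sing_lip z r (2 * (M + M)) M (eps / (K + 1)) r0 rho0 (divr_gt0 eps0 K1).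
have [iS L] := H C K f C0 K0 af.
have [a Ha] := reg_strict_diff r0 C0 K0 M0 e0 af xM.
exists (fun x => I (fun u => Greg e (x - u) * f u)), a; split=> //.
exists 1 => // y w y1 w1.
have inM v : l1 (v - x) < 1 -> box z M v.
  move=> h; have : l1 (v - z) <= M.
    have -> : v - z = (v - x) + (x - z) by rewrite addrA subrK.
    by apply: le_trans (l1_triangle _ _) _; rewrite /M; lra.
  by move=> h'; apply/boxP; split; apply: le_trans h'; rewrite /l1 /= ?lerDl ?lerDr.
have by_ := inM _ y1; have bw := inM _ w1.
have [_ ->] := pot_split r0 C0 K0 e0 af (iS y by_).
have [_ ->] := pot_split r0 C0 K0 e0 af (iS w bw).
have K4 (p t p' t' : R) : (p + t - t) - (p' + t' - t') = p - p' by ring.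
rewrite K4; apply: le_trans (L _ _ by_ bw _) _; first exact: (box_l1 by_ bw).1.
apply: ler_wpM2r; first exact: l1_ge0.
by rewrite -mulrA ler_piMr ?(ltW eps0) // mulrC ler_pdivrMr // mul1r lerDl.
Qed.

End potential.

(** * Symmetric sums over the periods *)

Section symsum.
Variable R : realType.
Implicit Types (F H : int -> R).

Lemma symsum0 F : symsum 0 F = F 0.
Proof. by rewrite /symsum big_ord_recl big_ord0 addr0. Qed.

Lemma symsumS N F : symsum N.+1 F = symsum N F + (F N.+1%:Z + F (- N.+1%:Z)).
Proof.
rewrite {1}/symsum doubleS big_ord_recl big_ord_recr /= addrCA; congr (_ + _).
  by rewrite /symsum; apply: eq_bigr => i _; congr F; rewrite /bump /= add1n; lia.
rewrite addrC; congr (F _ + F _); last by lia.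
by rewrite /bump /= add1n; lia.
Qed.

Lemma symsumD N F H : symsum N (fun k => F k + H k) = symsum N F + symsum N H.
Proof. by rewrite /symsum big_split. Qed.
Lemma symsumZ N (c : R) F : symsum N (fun k => c * F k) = c * symsum N F.
Proof. by rewrite /symsum mulr_sumr. Qed.
Lemma symsumN N F : symsum N (fun k => - F k) = - symsum N F.
Proof. by rewrite /symsum sumrN. Qed.
Lemma symsumB N F H : symsum N (fun k => F k - H k) = symsum N F - symsum N H.
Proof. by rewrite symsumD symsumN. Qed.
Lemma symsum_opp N F : symsum N (fun k => F (- k)) = symsum N F.
Proof.
elim: N => [|N IH]; first by rewrite !symsum0 oppr0.
by rewrite !symsumS IH opprK [F (- _) + _]addrC.
Qed.
Lemma eq_symsum N F H : F =1 H -> symsum N F = symsum N H.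
Proof. by move=> e; rewrite /symsum; apply: eq_bigr. Qed.

(** Telescoping: $(P+1)^{-2} \le P^{-1} - (P+1)^{-1}$, twice because of the two signs of [k]. *)
Lemma symsum_tail (C : R) (n : nat) F : 0 <= C -> (0 < n)%N ->
  (forall k : int, (n < `|k|)%N -> `|F k| <= C / k%:~R ^+ 2) ->
  forall N M, (n <= N)%N -> (N <= M)%N -> `|symsum M F - symsum N F| <= 2 * C / N%:R - 2 * C / M%:R.
Proof.
move=> C0 n0 H N M nN /subnK <-; elim: (M - N)%N => [|m IH].
  by rewrite add0n !subrr normr0.
rewrite addSn symsumS addrAC; apply: le_trans (ler_normD _ _) _.
set P := (m + N)%N in IH *.
have P0 : 0 < P%:R :> R by rewrite ltr0n; lia.
have nP : (n < `|P.+1%:Z|)%N by lia.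
have nP' : (n < `|- P.+1%:Z|)%N by lia.
have h1 := H _ nP; have h2 := H _ nP'.
have e1 : (P.+1%:Z)%:~R = P%:R + 1 :> R by rewrite natr1.
rewrite mulrNz sqrrN e1 in h2; rewrite e1 in h1.
have : `|F P.+1 + F (- P.+1%:Z)| <= C / (P%:R + 1) ^+ 2 + C / (P%:R + 1) ^+ 2.
  by apply: le_trans (ler_normD _ _) _; exact: lerD.
have : 2 * (C / (P%:R + 1) ^+ 2) <= 2 * C / P%:R - 2 * C / P.+1%:R.
  have -> : P.+1%:R = P%:R + 1 :> R by rewrite natr1.
  rewrite -!mulrA -!mulrBr ler_pM2l // ler_wpM2l //.
  rewrite -subr_ge0.
  have -> : (P%:R)^-1 - (P%:R + 1)^-1 - ((P%:R + 1) ^+ 2)^-1 = (P%:R)^-1 * ((P%:R + 1) ^+ 2)^-1 :> R.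
    by field; rewrite !gt_eqF // ltr_wpDl // ltW.
  by rewrite mulr_ge0 // invr_ge0 ?sqr_ge0 // ltW.
move: IH; move: `|symsum P F - _| `|_ + F _| => x1 x2; move: (_ / N%:R) (_ / P%:R) (_ / P.+1%:R) (_ / _ ^+ 2) => x3 x4 x5 x6; lra.
Qed.

Lemma symsum_cvg (C : R) (n : nat) F : 0 <= C -> (0 < n)%N ->
  (forall k : int, (n < `|k|)%N -> `|F k| <= C / k%:~R ^+ 2) ->
  cvgn (fun N => symsum N F) /\
  forall N, (n <= N)%N -> `|limn (fun N => symsum N F) - symsum N F| <= 2 * C / N%:R.
Proof.
move=> C0 n0 H; have T := symsum_tail C0 n0 H.
have T' N M : (n <= N)%N -> (N <= M)%N -> `|symsum M F - symsum N F| <= 2 * C / N%:R.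
  move=> h1 h2; apply: le_trans (T N M h1 h2) _.
  by rewrite gerBl divr_ge0 // mulr_ge0.
have cv : cvgn (fun N => symsum N F).
  apply: cauchy_cvg; apply: cauchy_exP => e e0.
  pose N := maxn n (Num.truncn (4 * C / e + 1)).+1.
  have nN : (n <= N)%N by rewrite leq_maxl.
  exists (symsum N F), N => // M /= NM.
  rewrite /ball /= distrC; apply: le_lt_trans (T' N M nN NM) _.
  have hk2 : 4 * C / e + 1 < N%:R.
    by apply: lt_le_trans (truncnS_gt _) _; rewrite ler_nat leq_maxr.
  have C4 : 0 <= 4 * C / e by rewrite divr_ge0 ?mulr_ge0 // ltW.
  have k0 : 0 < N%:R :> R by apply: le_lt_trans hk2; rewrite addr_ge0.
  rewrite ltr_pdivrMr //.
  have : 4 * C < N%:R * e by rewrite -ltr_pdivrMr //; lra.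
  by have := C0; lra.
split=> // N nN; rewrite ler_distl; apply/andP; split.
  apply: limr_ge => //; near=> M.
  have : `|symsum M F - symsum N F| <= 2 * C / N%:R by apply: T' => //; near: M; exact: nbhs_infty_ge.
  by rewrite ler_distl => /andP[].
apply: limr_le => //; near=> M.
have : `|symsum M F - symsum N F| <= 2 * C / N%:R by apply: T' => //; near: M; exact: nbhs_infty_ge.
by rewrite ler_distl => /andP[].
Unshelve. all: by end_near. Qed.

(** The terms [k = 1] and [k = -1] give [2 * C], the tail after them another [2 * C]. *)
Lemma symsum_bound (C : R) F : 0 <= C -> (forall k : int, k != 0 -> `|F k| <= C / k%:~R ^+ 2) ->
  `|limn (fun N => symsum N F)| <= `|F 0| + 4 * C.
Proof.
move=> C0 H.
have H1 (k : int) : (1 < `|k|)%N -> `|F k| <= C / k%:~R ^+ 2.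
  by move=> k1; apply: H; apply/eqP => k0; rewrite k0 in k1.
have [cv T] := symsum_cvg C0 (ltn0Sn 0) H1.
have := T 1%N (leqnn _); rewrite symsumS symsum0 => h.
have h1 : `|F 1| <= C by have := H 1 isT; rewrite expr1n divr1.
have h2 : `|F (- 1)| <= C by have := H (-1) isT; rewrite mulrNz sqrrN expr1n divr1.
rewrite -[X in `|X|](subrK (F 0 + (F 1%:Z + F (- 1%:Z)))).
apply: le_trans (ler_normD _ _) _; rewrite addrC.
have : `|F 0 + (F 1%:Z + F (- 1%:Z))| <= `|F 0| + (C + C).
  apply: le_trans (ler_normD _ _) _; rewrite lerD2l.
  by apply: le_trans (ler_normD _ _) _; exact: lerD.
by rewrite divr1 in h; lra.
Qed.

End symsum.

Lemma int_sq_ge1 (R : realType) (k : int) : k != 0 -> 1 <= (k%:~R : R) ^+ 2.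
Proof.
move=> k0; rewrite -[leLHS](expr1n _ 2) -(real_normK (num_real (k%:~R : R))).
rewrite ler_sqr ?nnegrE // -intr_norm ler1z.
by move: k0; lia.
Qed.

Lemma int_abs_ge1 (R : realType) (k : int) : k != 0 -> 1 <= (`|k|%:~R : R).
Proof. by move=> k0; rewrite ler1z; move: k0; lia. Qed.

(** * Decay of the distant copies of the kernel *)

Section periodic_kernel.
Variable R : realType.
Notation plane := (R * R)%type.
Implicit Types (x y z w u v p : plane).
Variables (s l : R).
Hypotheses (s0 : 0 < s) (s1 : s <= 1) (l0 : 0 < l).
Notation gam := (gam s).
Notation dgam := (dgam s).
Notation Greg := (Greg s).
Notation gradG := (gradG s).
Notation sh := (shift2 l).

Definition mirror y : plane := (- y.1, y.2).

Lemma shE k p : sh k p = (p.1, p.2 + k%:~R * l).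
Proof.
apply: injective_projections.
  by rewrite /shift2 /e2 /= scaler0 addr0.
by rewrite /shift2 /e2 /= /GRing.scale /= mulr1.
Qed.

Lemma l1_sh k u v : l1 (sh k u - sh k v) = l1 (u - v).
Proof. by rewrite !shE /l1 /=; congr (_ + `|_|); ring. Qed.

Lemma G_Greg p : G s p = Greg 0 p.
Proof. by rewrite G_gam // /Greg addr0. Qed.

(* The gain [k^-2] makes the series of differences converge absolutely. *)
Lemma periodic_C11 (A T : R) : 0 <= A -> 0 <= T -> exists2 C, 0 <= C &
  forall (k : int) u v w, k != 0 -> T <= `|k|%:~R * (l / 2) ->
  `|u.1| <= A -> `|v.1| <= A -> `|w.1| <= A -> `|u.2| <= T -> `|v.2| <= T -> `|w.2| <= T ->
  `|G s (sh k u) - G s (sh k v) - dot (gradG 0 (sh k w)) (u - v)| <=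
  C / k%:~R ^+ 2 * (l1 (u - v) * (l1 (u - w) + l1 (v - w))).
Proof.
move=> A0 T0; have kp := ltW (kap_gt0 s0 s1).
pose b := (l / 2) ^+ 2; have b0 : 0 < b by rewrite exprn_gt0 // divr_gt0.
exists (8 * kap s * b `^ (s - 3) * (A + T + l) ^+ 2 + 2 * kap s * b `^ (s - 2)).
  by nneg.
move=> k u v w k0 Tk u1 v1 w1 u2 v2 w2.
have k2 := int_sq_ge1 R k0; set K := (k%:~R : R) ^+ 2 in k2 *.
have K0 : 0 < K by apply: lt_le_trans k2.
have aK : (`|k|%:~R : R) ^+ 2 = K by rewrite intr_norm real_normK // num_real.
have ak1 := int_abs_ge1 R k0.
have far p : `|p.2| <= T -> K * b <= dot (sh k p) (sh k p) + 0.
  move=> p2; rewrite addr0 n2E shE /=; apply: (@le_trans _ _ ((p.2 + k%:~R * l) ^+ 2)); last by rewrite lerDr sqr_ge0.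
  rewrite /b -aK -exprMn -(real_normK (num_real (p.2 + _))) ler_sqr ?nnegrE //; last first.
    by rewrite mulr_ge0 // ?divr_ge0 ?(ltW l0) // (le_trans _ ak1).
  have := lerB_normD (k%:~R * l) p.2; rewrite addrC normrM (gtr0_norm l0) -intr_norm [X in _ <= `|X|]addrC.
  by move=> h; apply: le_trans h; move: Tk p2; lra.
have lT p : `|p.1| <= A -> `|p.2| <= T -> l1 (sh k p) <= `|k|%:~R * (A + T + l).
  move=> p1 p2; rewrite shE /l1 /=; have := ler_normD p.2 (k%:~R * l).
  rewrite normrM (gtr0_norm l0) -intr_norm => h.
  have : A + T <= `|k|%:~R * (A + T) by rewrite ler_peMl // addr_ge0.
  by move: h p1 p2; rewrite !mulrDr; lra.
have Kb0 : 0 < K * b by rewrite mulr_gt0.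
rewrite !G_Greg.
have e1 p p' : l1 (sh k p - sh k p') = l1 (p - p') := l1_sh k p p'.
have e2 : u - v = sh k u - sh k v.
  by rewrite !shE; apply: injective_projections => /=; ring.
rewrite {1}e2 -(e1 u v) -(e1 u w) -(e1 v w).
apply: le_trans (greg_C11 s0 s1 Kb0 (far _ w2) (far _ u2) (far _ v2) (lT _ w1 w2) (lT _ u1 u2) (lT _ v1 v2)) _.
apply: ler_wpM2r; first by nneg.
(* Since [1 <= K] and [s - 2 <= -1], the power of [K] is at most its inverse, which is the factor
   $k^{-2}$. In [p3] the squared distance adds one power of [K] and the exponent loses one. *)
have p2 : (K * b) `^ (s - 2) <= b `^ (s - 2) / K.
  rewrite powRM ?(ltW K0) ?(ltW b0) // mulrC; apply: ler_wpM2l; first exact: powR_ge0.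
  rewrite -powR_inv1 ?(ltW K0) //; apply: ler_powR => //; move: s0 s1; lra.
have p3 : (K * b) `^ (s - 3) * (`|k|%:~R * (A + T + l)) ^+ 2 <= b `^ (s - 3) * (A + T + l) ^+ 2 / K.
  rewrite exprMn aK powRM ?(ltW K0) ?(ltW b0) //.
  have -> : K `^ (s - 3) * b `^ (s - 3) * (K * (A + T + l) ^+ 2) =
    b `^ (s - 3) * (A + T + l) ^+ 2 * (K `^ (s - 3) * K) by ring.
  apply: ler_wpM2l; first by nneg.
  rewrite -[X in _ * X](powRr1 (ltW K0)) -powRD ?(gt_eqF K0) ?implybT // -powR_inv1 ?(ltW K0) //.
  by apply: ler_powR => //; move: s0 s1; lra.
rewrite [leRHS]mulrDl; apply: lerD.
  rewrite [leRHS](_ : _ = 8 * kap s * (b `^ (s - 3) * (A + T + l) ^+ 2 / K)); last by rewrite !mulrA.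
  by rewrite -mulrA; apply: ler_wpM2l; first nneg.
by rewrite -[leRHS]mulrA; apply: ler_wpM2l; first nneg.
Qed.

Lemma four_sum_le (A T a1 a2 a3 a4 : R) : 0 <= A -> 0 <= T ->
  a1 <= 2 * A + T -> a2 <= 2 * A + T -> a3 <= 2 * A + T -> a4 <= 2 * A + T ->
  a1 + a2 + (a3 + a4) <= 8 * (A + T) * (2 * A + 1).
Proof. by move=> *; apply: (@le_trans _ _ (4 * (2 * A + T))); [lra|nra]. Qed.

(** The [k]-th copy of a unit vortex at [y] together with its opposite at the mirror point. Only
    this combination is summable over [k] for every [s]. *)
Definition mirror_term (k : int) x y : R := G s (sh k (x - y)) - G s (sh k (x - mirror y)).

Lemma G_opp p : G s (- p) = G s p.
Proof. by rewrite !G_gam // /dot /= !mulrNN. Qed.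
Lemma G_mirror p : G s (mirror p) = G s p.
Proof. by rewrite !G_gam // /dot /= mulrNN. Qed.

Lemma mirror_term_sym k x y : mirror_term k x y = mirror_term (- k) y x.
Proof.
have E1 : G s (sh k (x - y)) = G s (sh (- k) (y - x)).
  rewrite -G_opp; congr (G s _); rewrite !shE; apply: injective_projections => /=; rewrite ?mulrNz; ring.
have E2 : G s (sh k (x - mirror y)) = G s (sh (- k) (y - mirror x)).
  rewrite -G_opp -G_mirror; congr (G s _); rewrite !shE; apply: injective_projections => /=; rewrite ?mulrNz; ring.
by rewrite /mirror_term E1 E2.
Qed.

(** The vortex and its mirror image differ in the first coordinate only, and at the reference point
    [sh k 0] the first component of the gradient vanishes. So the linear term of [periodic_C11]
    disappears and the decay $k^{-2}$ remains. *)
Lemma mirror_term_bounds (A T : R) : 0 <= A -> 0 <= T -> exists2 C, 0 <= C &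
  forall (k : int), k != 0 -> T <= `|k|%:~R * (l / 2) ->
  forall x x' y, `|x.1| <= A -> `|x'.1| <= A -> `|y.1| <= A ->
  `|x.2 - y.2| <= T -> `|x'.2 - y.2| <= T ->
  `|mirror_term k x y| <= C / k%:~R ^+ 2 /\ `|mirror_term k x y - mirror_term k x' y| <= C / k%:~R ^+ 2 * l1 (x - x').
Proof.
move=> A0 T0; have AA0 : 0 <= 2 * A by rewrite mulr_ge0.
have [C C0 H] := periodic_C11 AA0 T0.
exists (C * (8 * (A + T)) * (2 * A + 1)); first by nneg.
move=> k k0 Tk x x' y x1 x1' y1 x2 x2'.
have k2 := int_sq_ge1 R k0; have kk : 0 <= C / k%:~R ^+ 2 by rewrite divr_ge0 // sqr_ge0.
have z0 : (0 : plane).2 = 0 by [].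
have b1 p : `|p.1| <= A -> `|(p - y).1| <= 2 * A.
  by move=> h; apply: le_trans (ler_normB _ _) _; move: h y1; lra.
have b2 p : `|p.1| <= A -> `|(p - mirror y).1| <= 2 * A.
  by move=> h; rewrite /= opprK; apply: le_trans (ler_normD _ _) _; move: h y1; lra.
have zA : `|(0 : plane).1| <= 2 * A by rewrite normr0.
have zT : `|(0 : plane).2| <= T by rewrite normr0.
have L p : `|p.1| <= 2 * A -> `|p.2| <= T -> l1 (p - 0) <= 2 * A + T.
  by move=> h1 h2; rewrite subr0 /l1; exact: lerD.
have g1 : (gradG 0 (sh k 0)).1 = 0 by rewrite shE /= mulr0.
split.
  have := H k (x - y) (x - mirror y) 0 k0 Tk (b1 _ x1) (b2 _ x1) zA x2 x2 zT.
  have -> : x - y - (x - mirror y) = (- (2 * y.1), 0).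
    by apply: injective_projections => /=; ring.
  rewrite /dot g1 /= mul0r mulr0 addr0 subr0 => h; apply: le_trans h _.
  have -> : C * (8 * (A + T)) * (2 * A + 1) / k%:~R ^+ 2 = C / k%:~R ^+ 2 * (8 * (A + T) * (2 * A + 1)) by ring.
  apply: ler_wpM2l => //.
  have h1 : l1 ((- (2 * y.1), 0) : plane) <= 2 * A.
    by rewrite /l1 /= normr0 addr0 normrN normrM ger0_norm //; move: y1; lra.
  have h2 := L (x - y) (b1 _ x1) x2; have h3 := L (x - mirror y) (b2 _ x1) x2.
  apply: le_trans (ler_pM (l1_ge0 _) _ h1 (lerD h2 h3)) _; first by nneg.
  by nra.
have h1 := H k (x - y) (x' - y) 0 k0 Tk (b1 _ x1) (b1 _ x1') zA x2 x2' zT.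
have h2 := H k (x - mirror y) (x' - mirror y) 0 k0 Tk (b2 _ x1) (b2 _ x1') zA x2 x2' zT.
have E (q : plane) : x - q - (x' - q) = x - x' by rewrite opprB addrA subrK.
rewrite !E in h1 h2.
(* Moving [x] shifts both arguments by the same vector, so the linear terms of the two expansions
   cancel. *)
set g := dot _ _ in h1 h2.
have -> : mirror_term k x y - mirror_term k x' y = (G s (sh k (x - y)) - G s (sh k (x' - y)) - g) -
   (G s (sh k (x - mirror y)) - G s (sh k (x' - mirror y)) - g).
  by rewrite /mirror_term; move: (G s _) (G s _) (G s _) (G s _) => a1 a2 a3 a4; ring.
apply: le_trans (ler_normB _ _) _; apply: le_trans (lerD h1 h2) _.
have a1 := L (x - y) (b1 _ x1) x2; have a2 := L (x - mirror y) (b2 _ x1) x2.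
have a3 := L (x' - y) (b1 _ x1') x2'; have a4 := L (x' - mirror y) (b2 _ x1') x2'.
rewrite -!mulrDr.
have -> : C * (8 * (A + T)) * (2 * A + 1) / k%:~R ^+ 2 * l1 (x - x') =
  C / k%:~R ^+ 2 * (l1 (x - x') * (8 * (A + T) * (2 * A + 1))) by ring.
apply: ler_wpM2l => //; apply: ler_wpM2l; first exact: l1_ge0.
apply: four_sum_le => //.
Qed.

End periodic_kernel.

(** * Compactly supported Lipschitz densities *)

Section fubini_real.
Context d1 d2 (T1 : measurableType d1) (T2 : measurableType d2) (R : realType).
Variables (m1 : {sigma_finite_measure set T1 -> \bar R}) (m2 : {sigma_finite_measure set T2 -> \bar R}).
Variables (F : T1 -> T2 -> R) (h : T1 -> R).
Hypothesis mF : measurable_fun [set: T1 * T2] (fun z : T1 * T2 => F z.1 z.2).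
Hypothesis iF : forall x, m2.-integrable setT (EFin \o F x).
Hypothesis ih : m1.-integrable setT (EFin \o h).
Hypothesis Fh : forall x, \int[m2]_y `|F x y| <= h x.

Let f (z : T1 * T2) : \bar R := (F z.1 z.2)%:E.

Lemma fubini_integrable : (m1 \x m2)%E.-integrable setT f.
Proof.
have mf : measurable_fun setT f by exact/measurable_EFinP.
apply/(integrable12ltyP m1 m2 mf).
have := integrable_abse ih => /integrableP[_].
rewrite /= => h1; apply: le_lt_trans h1; apply: ge0_le_integral => //.
- by move=> x _; apply: integral_ge0.
- by apply: (measurable_fun_fubini_tonelli_F (abse \o f)) => //=; exact: measurableT_comp.
- have mh : measurable_fun setT h by exact/measurable_EFinP/(measurable_int m1 ih).
  by apply/measurable_EFinP; apply: measurableT_comp => //; apply: measurableT_comp.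
- move=> x _; rewrite normr_id.
  have i1 : m2.-integrable setT (EFin \o (fun y => `|F x y|)) by apply: (integrable_abse (iF x)).
  rewrite -[leLHS]fineK; last exact: integrable_fin_num.
  by rewrite lee_fin; apply: le_trans (Fh x) (ler_norm _).
Qed.

Lemma fubini_real :
  m1.-integrable setT (EFin \o (fun x => \int[m2]_y F x y)) /\
  ((forall y, m1.-integrable setT (EFin \o (F ^~ y))) ->
   \int[m1]_x (\int[m2]_y F x y) = \int[m2]_y (\int[m1]_x F x y)).
Proof.
have iff := fubini_integrable.
have E : (fun x => (\int[m2]_y F x y)%:E) = fubini_F m2 f.
  apply/funext => x; rewrite /fubini_F /Rintegral fineK //.
  by apply: integrable_fin_num => //; exact: iF.
split; first by rewrite /comp E; exact: integrable_fubini_F.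
move=> iF2.
have E' : (fun y => (\int[m1]_x F x y)%:E) = fubini_G m1 f.
  apply/funext => x; rewrite /fubini_G /Rintegral fineK //.
  by apply: integrable_fin_num => //; exact: iF2.
rewrite [LHS]/Rintegral [RHS]/Rintegral; congr fine.
under eq_integral => x _ do rewrite -[(_%:E)]/((fun x => (\int[m2]_y F x y)%:E) x) E.
under [RHS]eq_integral => x _ do rewrite -[(_%:E)]/((fun y => (\int[m1]_x F x y)%:E) x) E'.
exact: Fubini.
Qed.

End fubini_real.

Section nice.
Variable R : realType.
Notation mR := (measurableTypeR R).
Notation plane := (mR * mR)%type.
Implicit Types (x y z w u v : plane) (f g h : plane -> R).

Lemma leb2_sigma_finite : sigma_finite [set: plane] (leb2 R).
Proof.
exists (fun n : nat => box 0 n%:R).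
  apply/seteqP; split => // x _; exists (Num.truncn (l1 x)).+1 => //=.
  have := truncnS_gt (l1 x); rewrite /l1 => h; apply/boxP; rewrite !subr0.
  by have := normr_ge0 x.1; have := normr_ge0 x.2; split; lra.
move=> n; split; first exact: measurable_box.
by rewrite leb2_box // ltry.
Qed.

(** The same measure, equipped with the structure that Fubini's theorem asks for. *)
Definition leb2s : {sigma_finite_measure set plane -> \bar R} :=
  HB.pack_for {sigma_finite_measure set plane -> \bar R} (leb2 R : set plane -> \bar R) (Measure.class (leb2 R))
  (Measure_isSigmaFinite.Build _ _ _ (leb2 R) leb2_sigma_finite).

Lemma I_fubini (F : plane -> plane -> R) h :
  measurable_fun [set: plane * plane] (fun z : plane * plane => F z.1 z.2 : mR) ->
  (forall x, ig (F x)) -> (forall y, ig (F ^~ y)) -> ig h ->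
  (forall x, I (fun y => `|F x y|) <= h x) ->
  ig (fun x => I (F x)) /\ I (fun x => I (F x)) = I (fun y => I (F ^~ y)).
Proof.
move=> mF i1 i2 ih Fh.
have := @fubini_real _ _ plane plane R leb2s leb2s F h mF.
have j1 x : (leb2 R).-integrable setT (EFin \o F x) by apply/igP.
have j2 y : (leb2 R).-integrable setT (EFin \o F ^~ y) by apply/igP.
have jh : (leb2 R).-integrable setT (EFin \o h) by apply/igP.
have Fh' x : \int[leb2 R]_y `|F x y| <= h x := Fh x.
by move=> /(_ j1 jh Fh')[k1 k2]; split; [exact/igP|exact: k2].
Qed.

Definition nice f := exists M C K : R, [/\ 0 <= M, 0 <= C, 0 <= K & adm (0 : plane) M C K f].

(** The multipliers of [nice] functions (see [niceM]): potentials, coordinates and the wall belong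
    to this class. *)
Definition loclip h := forall M : R, 0 <= M -> exists2 L : R, 0 <= L &
  forall x y, box 0 M x -> box 0 M y -> `|h x - h y| <= L * l1 (x - y).

Lemma box_0 (M : R) : 0 <= M -> box (0 : plane) M 0.
Proof. by move=> M0; apply/boxP; rewrite subrr normr0. Qed.

Lemma box_mono (M N : R) x : M <= N -> box (0 : plane) M x -> box 0 N x.
Proof. by move=> MN /boxP[h1 h2]; apply/boxP; split; apply: le_trans MN. Qed.

Lemma box0_l1 (M : R) x : box 0 M x -> l1 x <= 2 * M.
Proof. by move=> /boxP[]; rewrite !subr0 /l1; lra. Qed.

Lemma loclip_bound h : loclip h -> forall M : R, 0 <= M -> exists2 B : R, 0 <= B &
  forall x, box 0 M x -> `|h x| <= B.
Proof.
move=> hh M M0; have [L L0 HL] := hh M M0.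
exists (`|h 0| + L * (2 * M)); first by rewrite addr_ge0 // mulr_ge0 // mulr_ge0.
move=> x bx; have := HL x 0 bx (box_0 M0).
rewrite subr0 => h1; have h2 := ler_wpM2l L0 (box0_l1 bx).
by have := lerB_dist (h x) (h 0) => h3; lra.
Qed.

Lemma nice_lip f : nice f -> exists2 K : R, 0 <= K & lip K f.
Proof. by case=> M [C [K [_ _ K0 [_ h _]]]]; exists K. Qed.

Lemma nice_measurable f : nice f -> measurable_fun [set: plane] (f : plane -> mR).
Proof. by case/nice_lip => K K0; exact: measurable_lip. Qed.

Lemma nice_ig f : nice f -> ig f.
Proof.
move=> nf; have := nf; case=> M [C [K [M0 _ K0 [h1 h2 h3]]]].
exact: (ig_bounded M0 (nice_measurable nf) h1 h3).
Qed.

Lemma nice_loclip f : nice f -> loclip f.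
Proof. by move=> /nice_lip[K K0 h] M M0; exists K => // x y _ _; exact: h. Qed.

Lemma lip_loclip (K : R) f : 0 <= K -> lip K f -> loclip f.
Proof. by move=> K0 h M M0; exists K => // x y _ _; exact: h. Qed.

Lemma loclipD g h : loclip g -> loclip h -> loclip (fun x => g x + h x).
Proof.
move=> hg hh M M0; have [L L0 HL] := hg M M0; have [L' L'0 HL'] := hh M M0.
exists (L + L'); first exact: addr_ge0.
move=> x y bx b_y; rewrite opprD addrACA mulrDl; apply: le_trans (ler_normD _ _) _.
by apply: lerD; [exact: HL|exact: HL'].
Qed.

Lemma loclipN h : loclip h -> loclip (fun x => - h x).
Proof.
move=> hh M M0; have [L L0 HL] := hh M M0; exists L => // x y bx b_y.
by rewrite -opprD normrN; exact: HL.
Qed.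

Lemma mul_lip_aux (K C L B fx fy hx hy n : R) : 0 <= n -> 0 <= K -> 0 <= C -> 0 <= L -> 0 <= B ->
  `|fx - fy| <= K * n -> `|hx - hy| <= L * n -> `|fx| <= C -> `|hy| <= B ->
  `|fx * hx - fy * hy| <= (C * L + K * B) * n.
Proof.
move=> n0 K0 C0 L0 B0 h1 h2 h3 h4.
have -> : fx * hx - fy * hy = fx * (hx - hy) + (fx - fy) * hy by ring.
apply: le_trans (ler_normD _ _) _; rewrite !normrM.
have a1 := ler_pM (normr_ge0 _) (normr_ge0 _) h3 h2.
have a2 := ler_pM (normr_ge0 _) (normr_ge0 _) h1 h4.
by apply: le_trans (lerD a1 a2) _; rewrite mulrDl mulrA lerD2l mulrAC.
Qed.

Lemma niceM f h : nice f -> loclip h -> nice (fun x => f x * h x).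
Proof.
move=> [M [C [K [M0 C0 K0 [f1 f2 f3]]]]] hh.
have [L L0 HL] := hh M M0; have [B B0 HB] := loclip_bound hh M0.
exists M, (C * B), (C * L + K * B); split; rewrite ?addr_ge0 ?mulr_ge0 //; split.
- move=> x; have [bx|nb] := pselect (box 0 M x); last by rewrite f3 // mul0r normr0 mulr_ge0.
  by rewrite normrM; apply: ler_pM => //; exact: HB.
- move=> x y; have n0 := l1_ge0 (x - y).
  have [bx|nx] := pselect (box 0 M x); have [b_y|ny] := pselect (box 0 M y).
  + exact: (mul_lip_aux n0 K0 C0 L0 B0 (f2 x y) (HL _ _ bx b_y) (f1 x) (HB _ b_y)).
  + have := f2 x y; rewrite (f3 y) // mul0r !subr0 => h1; rewrite normrM.
    apply: le_trans (ler_pM (normr_ge0 _) (normr_ge0 _) h1 (HB _ bx)) _.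
    by rewrite mulrAC; apply: ler_wpM2r => //; rewrite lerDr mulr_ge0.
  + have := f2 x y; rewrite (f3 x) // mul0r !sub0r !normrN => h1; rewrite normrM.
    apply: le_trans (ler_pM (normr_ge0 _) (normr_ge0 _) h1 (HB _ b_y)) _.
    by rewrite mulrAC; apply: ler_wpM2r => //; rewrite lerDr mulr_ge0.
  + by rewrite !f3 // !mul0r subrr normr0 mulr_ge0 // addr_ge0 // mulr_ge0.
- by move=> x nb; rewrite f3 // mul0r.
Qed.

Lemma niceD f g : nice f -> nice g -> nice (fun x => f x + g x).
Proof.
move=> [M [C [K [M0 C0 K0 [f1 f2 f3]]]]] [M' [C' [K' [M0' C0' K0' [g1 g2 g3]]]]].
exists (M + M'), (C + C'), (K + K'); split; rewrite ?addr_ge0 //; split.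
- by move=> x; apply: le_trans (ler_normD _ _) _; exact: lerD.
- move=> x y; rewrite opprD addrACA mulrDl; apply: le_trans (ler_normD _ _) _.
  by apply: lerD; [exact: f2|exact: g2].
- move=> x nb; rewrite f3 ?g3 ?addr0 // => bx; apply: nb; apply: box_mono bx; lra.
Qed.

Lemma nice_comp (g : R -> R) (L : R) f : 0 <= L -> g 0 = 0 ->
  (forall a b, `|g a - g b| <= L * `|a - b|) -> nice f -> nice (fun x => g (f x)).
Proof.
move=> L0 g0 gL [M [C [K [M0 C0 K0 [f1 f2 f3]]]]].
exists M, (L * C), (L * K); split; rewrite ?mulr_ge0 //; split.
- move=> x; have := gL (f x) 0; rewrite g0 !subr0 => h; apply: le_trans h _.
  exact: ler_wpM2l.
- by move=> x y; apply: le_trans (gL _ _) _; rewrite -mulrA; exact: ler_wpM2l.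
- by move=> x nb; rewrite f3.
Qed.

Lemma nice_abs f : nice f -> nice (fun x => `|f x|).
Proof.
move=> nf; apply: (nice_comp ler01 (normr0 _)) nf => a b.
by rewrite mul1r; exact: ler_dist_dist.
Qed.

Lemma niceZ c f : nice f -> nice (fun x => c * f x).
Proof.
move=> nf; apply: (nice_comp (normr_ge0 c) (mulr0 _)) nf => a b.
by rewrite -mulrBr normrM.
Qed.

Lemma niceN f : nice f -> nice (fun x => - f x).
Proof. by move=> nf; have := niceZ (-1) nf; under eq_fun do rewrite mulN1r. Qed.

Lemma niceB f g : nice f -> nice g -> nice (fun x => f x - g x).
Proof. by move=> nf ng; apply: niceD => //; exact: niceN. Qed.

Lemma niceX f g : nice f -> nice g -> nice (fun x => f x * g x).
Proof. by move=> nf ng; apply: niceM => //; exact: nice_loclip. Qed.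

Lemma nice_shift f v : nice f -> nice (fun x => f (x + v)).
Proof.
move=> [M [C [K [M0 C0 K0 [f1 f2 f3]]]]].
exists (M + l1 v), C, K; split; rewrite ?addr_ge0 ?l1_ge0 //; split => //.
- by move=> x y; apply: le_trans (f2 _ _) _; rewrite opprD addrACA subrr addr0.
- move=> x nb; apply: f3 => bx; apply: nb; move: bx => /boxP[]; rewrite !subr0 /= => h1 h2.
  apply/boxP; rewrite !subr0 /l1.
  have := ler_normB (x.1 + v.1) v.1; have := ler_normB (x.2 + v.2) v.2; rewrite !addrK.
  by have := normr_ge0 v.1; have := normr_ge0 v.2; split; lra.
Qed.

Lemma nice_common f g : nice f -> nice g -> exists M C K : R,
  [/\ 0 <= M, 0 <= C, 0 <= K, adm (0 : plane) M C K f & adm (0 : plane) M C K g].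
Proof.
move=> [M [C [K [M0 C0 K0 [f1 f2 f3]]]]] [M' [C' [K' [M0' C0' K0' [g1 g2 g3]]]]].
exists (M + M'), (C + C'), (K + K'); split; rewrite ?addr_ge0 //; split.
- by move=> x; apply: le_trans (f1 _) _; rewrite lerDl.
- by move=> x y; apply: le_trans (f2 _ _) _; apply: ler_wpM2r; rewrite ?l1_ge0 ?lerDl.
- by move=> x nb; apply: f3 => bx; apply: nb; apply: box_mono bx; rewrite lerDl.
- by move=> x; apply: le_trans (g1 _) _; rewrite lerDr.
- by move=> x y; apply: le_trans (g2 _ _) _; apply: ler_wpM2r; rewrite ?l1_ge0 ?lerDr.
- by move=> x nb; apply: g3 => bx; apply: nb; apply: box_mono bx; rewrite lerDr.
Qed.

End nice.

(** * Potentials with a bounded kernel *)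

Definition ry (R : realType) (x : R * R) : R * R := (x.1, - x.2).

(** The bounded part of the interaction, added to the singular kernel [G]. Evenness makes potentials
    of even densities even, so that the symmetry in [x_2] can be imposed as a constraint. *)
Record kernel (R : realType) (B : R * R -> R * R -> R) (CB LB : R) : Prop := Kernel {
  kernel_sym : forall x y, B x y = B y x;
  kernel_even : forall x y, B (ry x) (ry y) = B x y;
  kernel_bound0 : 0 <= CB;
  kernel_lip0 : 0 <= LB;
  kernel_bounded : forall x y, `|B x y| <= CB;
  kernel_lip : forall y, lip LB (B ^~ y);
  kernel_meas : measurable_fun [set: (measurableTypeR R * measurableTypeR R) * (measurableTypeR R * measurableTypeR R)]
    (fun z : (measurableTypeR R * measurableTypeR R) * (measurableTypeR R * measurableTypeR R) =>
      B z.1 z.2 : measurableTypeR R) }.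

Section forms.
Variable R : realType.
Notation mR := (measurableTypeR R).
Notation plane := (mR * mR)%type.
Implicit Types (x y z w u v : plane) (f g h : plane -> R).
Variable s : R.
Hypotheses (s0 : 0 < s) (s1 : s <= 1).
Notation pot := (pot s).

Lemma pot_ig f x : nice f -> ig (fun u => G s (x - u) * f u).
Proof.
case=> M [C [K [M0 C0 K0 af]]].
have [e /andP[e0 _] H] := @sing_lip R s s0 s1 0 M (2 * (l1 x + l1 x)) (l1 x) 1 M0
  (mulr_ge0 (ler0n _ 2) (addr_ge0 (l1_ge0 x) (l1_ge0 x))) ltr01.
have [iS _] := H C K f C0 K0 af.
have bx : box 0 (l1 x) x by apply/boxP; rewrite !subr0 /l1; split; rewrite ?lerDl ?lerDr.
by have [] := pot_split s0 s1 M0 C0 K0 e0 af (iS x bx).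
Qed.

Lemma pot_loclip f : nice f -> loclip (pot f).
Proof.
case=> M [C [K [M0 C0 K0 af]]] N N0.
have [A A0 H] := pot_lip s0 s1 0 M0 N0 ltr01.
exists (1 * K + A * C); first by rewrite addr_ge0 // mulr_ge0.
by move=> x y bx by_; exact: H.
Qed.

Lemma potD f g x : nice f -> nice g -> pot (fun y => f y + g y) x = pot f x + pot g x.
Proof.
move=> nf ng; rewrite /pot -ID; [|exact: pot_ig|exact: pot_ig].
by congr I; apply/funext => y; rewrite mulrDr.
Qed.

Lemma potZ c f x : nice f -> pot (fun y => c * f y) x = c * pot f x.
Proof. move=> nf; rewrite /pot -IZ; last exact: pot_ig. by congr I; apply/funext => y; rewrite mulrCA. Qed.

Lemma pot_shift f v x : nice f -> pot (fun y => f (y + v)) x = pot f (x + v).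
Proof.
move=> nf; have [_ E] := I_shift v (pot_ig (x + v) nf).
rewrite /pot -E; congr I; apply/funext => y.
by rewrite [y + v]addrC opprD addrA addrK.
Qed.

Lemma pot_bound (M : R) : 0 <= M -> exists2 P : R, 0 <= P & forall C f x, 0 <= C -> nice f ->
  (forall y, `|f y| <= C) -> (forall y, ~ box 0 M y -> f y = 0) -> box 0 M x ->
  I (fun y => `|G s (x - y) * f y|) <= C * P.
Proof.
move=> M0; have [P P0 H] := G_pot_bound s0 s1 (8 * M ^+ 2) M0.
exists P => // C f x C0 nf fC f0 bx.
have [] // := H x 0 C f C0 _ (nice_measurable nf) fC f0.
move=> y b_y; rewrite n2E /=.
move: bx b_y => /boxP[] + + /boxP[]; rewrite !subr0 !ler_norml => /andP[a1 a2] /andP[a3 a4] /andP[a5 a6] /andP[a7 a8].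
have a (p q : R) : - M <= p -> p <= M -> - M <= q -> q <= M -> (p - q) ^+ 2 <= 4 * M ^+ 2.
  by move=> *; rewrite -[4]/(2 ^ 2)%:R natrX -exprMn -[leLHS]real_normK ?num_real // ler_sqr ?nnegrE ?mulr_ge0 // ler_norml; apply/andP; split; lra.
by have := a _ _ a1 a2 a5 a6; have := a _ _ a3 a4 a7 a8; lra.
Qed.

Lemma measurable_Gsub : measurable_fun [set: plane * plane] (fun z : plane * plane => G s (z.1 - z.2) : mR).
Proof.
have m : measurable_fun [set: plane * plane] (fun z : plane * plane => z.1 - z.2 : plane).
  by apply: measurable_fun_pair; apply: measurable_funB; apply: measurableT_comp => //; exact: measurableT_comp.
exact: (measurableT_comp (measurable_G s) m).
Qed.

Lemma Gsym x y : G s (x - y) = G s (y - x).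
Proof. by rewrite -G_opp opprB. Qed.

(** Fubini for the singular kernel. The inner integral is bounded uniformly on a box that contains
    both supports, which yields a multiple of [g] as integrable majorant. *)
Lemma pot_sym f g : nice f -> nice g -> I (fun x => g x * pot f x) = I (fun x => f x * pot g x).
Proof.
move=> nf ng; have [M [C [K [M0 C0 K0 af ag]]]] := nice_common nf ng.
have [P P0 HP] := pot_bound M0.
pose F x y := g x * (G s (x - y) * f y).
have mF : measurable_fun [set: plane * plane] (fun z : plane * plane => F z.1 z.2 : mR).
  apply: measurable_funM; first exact: (measurableT_comp (nice_measurable ng)).
  apply: measurable_funM; first exact: measurable_Gsub.
  exact: (measurableT_comp (nice_measurable nf)).
have i1 x : ig (F x) by apply: igZ; exact: pot_ig.
have i2 y : ig (F ^~ y).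
  have := igZ (f y) (pot_ig y ng); congr ig; apply/funext => x.
  by rewrite /F Gsym; ring.
have ih : ig (fun x => C * P * `|g x|) by apply: igZ; apply: ig_abs; exact: nice_ig.
have [|_ E] := I_fubini mF i1 i2 ih.
  move=> x; have [bx|nx] := pselect (box 0 M x).
    have -> : (fun y => `|F x y|) = (fun y => `|g x| * `|G s (x - y) * f y|).
      by apply/funext => y; rewrite /F normrM.
    rewrite IZ; last exact: ig_abs (pot_ig x nf).
    rewrite mulrC; apply: ler_wpM2r => //; apply: HP => //; by case: af.
  have [_ _ g0] := ag.
  have -> : (fun y => `|F x y|) = (fun _ => 0) by apply/funext => y; rewrite /F g0 // mul0r normr0.
  by rewrite I0 mulr_ge0 // mulr_ge0.
have -> : (fun x => g x * pot f x) = (fun x => I (F x)).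
  by apply/funext => x; rewrite /pot -(IZ (g x) (pot_ig x nf)).
rewrite E; congr I; apply/funext => y; rewrite /pot -IZ; last exact: pot_ig.
congr I; apply/funext => x; by rewrite /F Gsym; ring.
Qed.

Variables (B : plane -> plane -> R) (CB LB : R).
Hypothesis hB : kernel B CB LB.
Let Bsym := kernel_sym hB.
Let CB0 := kernel_bound0 hB.
Let LB0 := kernel_lip0 hB.
Let BC := kernel_bounded hB.
Let BL := kernel_lip hB.
Let mB := kernel_meas hB.

Definition bpot f x : R := I (fun y => B x y * f y).

Lemma bpot_ig f x : nice f -> ig (fun y => B x y * f y).
Proof.
move=> nf; apply: nice_ig.
have -> : (fun y => B x y * f y) = (fun y => f y * B y x) by apply/funext => y; rewrite Bsym mulrC.
by apply: niceM => //; exact: lip_loclip LB0 (BL x).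
Qed.

Lemma bpotD f g x : nice f -> nice g -> bpot (fun y => f y + g y) x = bpot f x + bpot g x.
Proof.
move=> nf ng; rewrite /bpot -ID; [|exact: bpot_ig|exact: bpot_ig].
by congr I; apply/funext => y; rewrite mulrDr.
Qed.

Lemma bpotZ c f x : nice f -> bpot (fun y => c * f y) x = c * bpot f x.
Proof. move=> nf; rewrite /bpot -IZ; last exact: bpot_ig. by congr I; apply/funext => y; rewrite mulrCA. Qed.

Lemma bpot_bound f x : nice f -> `|bpot f x| <= CB * I (fun y => `|f y|).
Proof.
move=> nf; apply: le_trans (I_abs (bpot_ig x nf)) _; rewrite -IZ; last exact: ig_abs (nice_ig nf).
apply: I_mono; [exact: ig_abs (bpot_ig x nf)|apply: igZ; exact: ig_abs (nice_ig nf)|].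
by move=> y; rewrite normrM; apply: ler_wpM2r.
Qed.

Lemma bpot_lip f : nice f -> lip (LB * I (fun y => `|f y|)) (bpot f).
Proof.
move=> nf x x'; rewrite /bpot -IB; [|exact: bpot_ig..].
have iBB := igB (bpot_ig x nf) (bpot_ig x' nf).
apply: le_trans (I_abs iBB) _; rewrite mulrAC -IZ; last exact: ig_abs (nice_ig nf).
apply: I_mono; [exact: ig_abs|apply: igZ; exact: ig_abs (nice_ig nf)|].
by move=> y; rewrite -mulrBl normrM; apply: ler_wpM2r => //; exact: BL.
Qed.

Lemma bpot_loclip f : nice f -> loclip (bpot f).
Proof.
move=> nf; apply: lip_loclip (bpot_lip nf); rewrite mulr_ge0 //.
by apply: I_ge0.
Qed.

Lemma bpot_sym f g : nice f -> nice g -> I (fun x => g x * bpot f x) = I (fun x => f x * bpot g x).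
Proof.
move=> nf ng.
pose F x y := g x * (B x y * f y).
have mF : measurable_fun [set: plane * plane] (fun z : plane * plane => F z.1 z.2 : mR).
  apply: measurable_funM; first exact: (measurableT_comp (nice_measurable ng)).
  apply: measurable_funM; first exact: mB.
  exact: (measurableT_comp (nice_measurable nf)).
have i1 x : ig (F x) by apply: igZ; exact: bpot_ig.
have i2 y : ig (F ^~ y).
  have := igZ (f y) (bpot_ig y ng); congr ig; apply/funext => x.
  by rewrite /F Bsym; ring.
have ih : ig (fun x => CB * I (fun y => `|f y|) * `|g x|) by apply: igZ; apply: ig_abs; exact: nice_ig.
have [|_ E] := I_fubini mF i1 i2 ih.
  move=> x; have -> : (fun y => `|F x y|) = (fun y => `|g x| * `|B x y * f y|).
    by apply/funext => y; rewrite /F normrM.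
  rewrite IZ; last exact: ig_abs (bpot_ig x nf).
  rewrite mulrC; apply: ler_wpM2r => //; rewrite -IZ; last exact: ig_abs (nice_ig nf).
  apply: I_mono; [exact: ig_abs (bpot_ig x nf)|apply: igZ; exact: ig_abs (nice_ig nf)|].
  by move=> y; rewrite normrM; apply: ler_wpM2r.
have -> : (fun x => g x * bpot f x) = (fun x => I (F x)).
  by apply/funext => x; rewrite /bpot -(IZ (g x) (bpot_ig x nf)).
rewrite E; congr I; apply/funext => y; rewrite /bpot -IZ; last exact: bpot_ig.
congr I; apply/funext => x; by rewrite /F Bsym; ring.
Qed.

Definition U f x : R := pot f x + bpot f x.

Lemma UD f g x : nice f -> nice g -> U (fun y => f y + g y) x = U f x + U g x.
Proof. by move=> nf ng; rewrite /U potD // bpotD // addrACA. Qed.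
Lemma UZ c f x : nice f -> U (fun y => c * f y) x = c * U f x.
Proof. by move=> nf; rewrite /U potZ // bpotZ // mulrDr. Qed.
Lemma U_loclip f : nice f -> loclip (U f).
Proof. by move=> nf; apply: loclipD; [exact: pot_loclip|exact: bpot_loclip]. Qed.

Definition Q f g : R := I (fun x => g x * U f x).

Lemma Q_nice f g : nice f -> nice g -> nice (fun x => g x * U f x).
Proof. by move=> nf ng; apply: niceM => //; exact: U_loclip. Qed.

Lemma Q_split f g : nice f -> nice g -> Q f g = I (fun x => g x * pot f x) + I (fun x => g x * bpot f x).
Proof.
move=> nf ng; rewrite -ID; last 2 first.
- by apply/nice_ig/niceM => //; exact: pot_loclip.
- by apply/nice_ig/niceM => //; exact: bpot_loclip.
by congr I; apply/funext => x; rewrite mulrDr.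
Qed.

Lemma Q_sym f g : nice f -> nice g -> Q f g = Q g f.
Proof. by move=> nf ng; rewrite (Q_split nf ng) (Q_split ng nf) (pot_sym nf ng) (bpot_sym nf ng). Qed.

Lemma QDl f g h : nice f -> nice g -> nice h -> Q (fun x => f x + g x) h = Q f h + Q g h.
Proof.
move=> nf ng nh; rewrite -ID; [|exact/nice_ig/Q_nice..].
by congr I; apply/funext => x; rewrite UD // mulrDr.
Qed.
Lemma QDr f g h : nice f -> nice g -> nice h -> Q h (fun x => f x + g x) = Q h f + Q h g.
Proof.
move=> nf ng nh; rewrite -ID; [|exact/nice_ig/Q_nice..].
by congr I; apply/funext => x; rewrite mulrDl.
Qed.

Lemma Q_expand f g : nice f -> nice g ->
  Q (fun x => f x + g x) (fun x => f x + g x) = Q f f + 2 * Q f g + Q g g.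
Proof.
move=> nf ng; have nfg := niceD nf ng.
rewrite (QDl nf ng nfg) (QDr nf ng nf) (QDr nf ng ng) (Q_sym ng nf).
by move: (Q _ _) (Q _ _) (Q _ _) => *; ring.
Qed.

End forms.

(** * The vorticity profile and a Schur bound *)

Section profile.
Variable R : realType.
Implicit Types (t a b p q c u lam : R).

Definition clamp t := if t <= 0 then 0 else if t <= 1 then t else 1.

Lemma clamp01 t : 0 <= clamp t <= 1.
Proof. by rewrite /clamp; case: (leP t 0) => h1; [|case: (leP t 1) => h2]; apply/andP; split; lra. Qed.
Lemma clamp_id t : 0 <= t -> t <= 1 -> clamp t = t.
Proof. by rewrite /clamp; case: (leP t 0) => h1; [|case: (leP t 1) => h2]; lra. Qed.
Lemma clamp_le0 t : t <= 0 -> clamp t = 0.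
Proof. by rewrite /clamp => ->. Qed.
Lemma clamp_ge1 t : 1 <= t -> clamp t = 1.
Proof. by rewrite /clamp; case: (leP t 0) => h1; [|case: (leP t 1) => h2]; lra. Qed.
Lemma clamp_gt0 t : (0 < clamp t) = (0 < t).
Proof. by rewrite /clamp; case: (leP t 0) => h1; [rewrite ltxx|case: (leP t 1) => h2; rewrite ?ltr01]. Qed.
Lemma clamp_lip a b : `|clamp a - clamp b| <= `|a - b|.
Proof.
wlog ab : a b / a <= b.
  by move=> H; case: (leP a b) => [|/ltW] /H //; rewrite distrC [leRHS]distrC.
rewrite !(distrC _ b) (distrC (clamp a)) (ger0_norm (_ : 0 <= b - a)) ?subr_ge0 // ger0_norm.
  by rewrite /clamp; case: (leP a 0) => h1; [|case: (leP a 1) => h2]; (case: (leP b 0) => h3; [|case: (leP b 1) => h4]); lra.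
by rewrite /clamp; case: (leP a 0) => h1; [|case: (leP a 1) => h2]; (case: (leP b 0) => h3; [|case: (leP b 1) => h4]); lra.
Qed.

(* [entropy' t = t * smoothstep' t] makes [p = clamp u] the Euler-Lagrange equation
   of the energy below, and [smoothstep' 0 = smoothstep' 1 = 0] makes the
   vorticity a C^1 function of [u]. *)
Definition cubic t := 3 * t ^+ 2 - 2 * t ^+ 3.
Definition quartic t := 2 * t ^+ 3 - 3 / 2 * t ^+ 4.
Definition smoothstep t := cubic (clamp t).
Definition entropy t := quartic (clamp t).

Lemma cubic_lip a b : 0 <= a -> a <= 1 -> 0 <= b -> b <= 1 -> `|cubic a - cubic b| <= 3 / 2 * `|a - b|.
Proof.
move=> a0 a1 b0 b1; have -> : cubic a - cubic b = (3 * (a + b) - 2 * (a ^+ 2 + a * b + b ^+ 2)) * (a - b).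
  by rewrite /cubic; ring.
rewrite normrM; apply: ler_wpM2r => //; rewrite ger0_norm.
  have : 0 <= (a - b) ^+ 2 + 3 * (a + b - 1) ^+ 2 by apply: addr_ge0; [exact: sqr_ge0|apply: mulr_ge0; [exact: ler0n|exact: sqr_ge0]].
  by lra.
have : 0 <= a * (1 - b) + b * (1 - a) by apply: addr_ge0; apply: mulr_ge0; lra.
have : 0 <= a * (1 - a) + b * (1 - b) by apply: addr_ge0; apply: mulr_ge0; lra.
by lra.
Qed.

Lemma quartic_lip a b : 0 <= a -> a <= 1 -> 0 <= b -> b <= 1 -> `|quartic a - quartic b| <= 12 * `|a - b|.
Proof.
move=> a0 a1 b0 b1; have -> : quartic a - quartic b = (2 * (a ^+ 2 + a * b + b ^+ 2) - 3 / 2 * ((a ^+ 2 + b ^+ 2) * (a + b))) * (a - b).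
  by rewrite /quartic; field.
have aa : 0 <= a ^+ 2 <= 1 by apply/andP; split; nra.
have bb : 0 <= b ^+ 2 <= 1 by apply/andP; split; nra.
have ab : 0 <= a * b <= 1 by apply/andP; split; nra.
rewrite normrM ler_wpM2r // ler_norml; move: aa bb ab => /andP[a2 a3] /andP[b2 b3] /andP[c2 c3].
have : 0 <= (a ^+ 2 + b ^+ 2) * (a + b) by rewrite mulr_ge0 // addr_ge0.
have : (a ^+ 2 + b ^+ 2) * (a + b) <= 2 * 2 by apply: ler_pM; lra.
by move=> *; apply/andP; split; lra.
Qed.

Lemma smoothstep_lip a b : `|smoothstep a - smoothstep b| <= 3 / 2 * `|a - b|.
Proof.
have /andP[? ?] := clamp01 a; have /andP[? ?] := clamp01 b.
apply: le_trans (cubic_lip _ _ _ _) _ => //; rewrite ler_pM2l ?clamp_lip //; lra.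
Qed.

Lemma entropy_lip a b : `|entropy a - entropy b| <= 12 * `|a - b|.
Proof.
have /andP[? ?] := clamp01 a; have /andP[? ?] := clamp01 b.
by apply: le_trans (quartic_lip _ _ _ _) _ => //; rewrite ler_pM2l ?clamp_lip.
Qed.

Lemma smoothstep0 : smoothstep 0 = 0. Proof. by rewrite /smoothstep clamp_le0 // /cubic; ring. Qed.
Lemma entropy0 : entropy 0 = 0. Proof. by rewrite /entropy clamp_le0 // /quartic; ring. Qed.
Lemma smoothstep1 : smoothstep 1 = 1. Proof. by rewrite /smoothstep clamp_ge1 // /cubic; ring. Qed.

Lemma smoothstep01 t : 0 <= smoothstep t <= 1.
Proof.
rewrite /smoothstep; have /andP[] := clamp01 t; move: (clamp t) => p p0 p1; rewrite /cubic.
have -> : 3 * p ^+ 2 - 2 * p ^+ 3 = p ^+ 2 * (3 - 2 * p) by ring.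
apply/andP; split; first by apply: mulr_ge0; [exact: sqr_ge0|lra].
rewrite -subr_ge0; have -> : 1 - p ^+ 2 * (3 - 2 * p) = (1 - p) ^+ 2 * (1 + 2 * p) by ring.
by apply: mulr_ge0; [exact: sqr_ge0|lra].
Qed.

Lemma entropy01 t : 0 <= entropy t <= 1.
Proof.
rewrite /entropy; have /andP[] := clamp01 t; move: (clamp t) => p p0 p1; rewrite /quartic.
have p2 : 0 <= p ^+ 2 <= 1 by apply/andP; split; nra.
have -> : 2 * p ^+ 3 - 3 / 2 * p ^+ 4 = p ^+ 2 * (p * (2 - 3 / 2 * p)) by ring.
move: p2 => /andP[p2 p3].
have q0 : 0 <= p * (2 - 3 / 2 * p) by apply: mulr_ge0; lra.
have q1 : p * (2 - 3 / 2 * p) <= 1 by nra.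
by apply/andP; split; [exact: mulr_ge0|rewrite -[leRHS]mulr1; exact: ler_pM].
Qed.

Lemma cubic_inj a b : 0 <= a -> a <= 1 -> 0 <= b -> b <= 1 -> cubic a = cubic b -> a = b.
Proof.
move=> a0 a1 b0 b1 /eqP; rewrite -subr_eq0.
have -> : cubic a - cubic b = (3 * (a + b) - 2 * (a ^+ 2 + a * b + b ^+ 2)) * (a - b) by rewrite /cubic; ring.
rewrite mulf_eq0 subr_eq0 => /orP[/eqP h|/eqP h]; last by rewrite -(subrK b a) h; lra.
have h1 : 0 <= a * (1 - b) by apply: mulr_ge0; lra.
have h2 : 0 <= b * (1 - a) by apply: mulr_ge0; lra.
have h3 : 0 <= a * (1 - a) by apply: mulr_ge0; lra.
have h4 : 0 <= b * (1 - b) by apply: mulr_ge0; lra.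
have h5 : a * (1 - b) + b * (1 - a) + 2 * (a * (1 - a)) + 2 * (b * (1 - b)) = 0 by lra.
have /eqP : a * (1 - a) = 0 by lra.
have /eqP : b * (1 - b) = 0 by lra.
have h6 : a * (1 - b) = 0 by lra.
have h7 : b * (1 - a) = 0 by lra.
rewrite !mulf_eq0 => /orP[] /eqP hb /orP[] /eqP ha; move: h6 h7; rewrite ?ha ?hb; lra.
Qed.

(** Since $dJ = t\,d\varphi$ for the quartic $J$ and the cubic $\varphi$, the factor $t$ may be
    replaced by its largest value on the interval; [gain_down] uses the smallest. *)
Lemma gain_up a b : 0 <= a -> a <= b -> b <= 1 -> quartic b - quartic a <= b * (cubic b - cubic a).
Proof.
move=> a0 ab b1; rewrite -subr_ge0.
have -> : b * (cubic b - cubic a) - (quartic b - quartic a) =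
  (b - a) ^+ 2 * (b + 2 * a - 3 / 2 * a ^+ 2 - a * b - b ^+ 2 / 2) by rewrite /cubic /quartic; field.
by apply: mulr_ge0; [exact: sqr_ge0|nra].
Qed.

Lemma gain_down a b : 0 <= a -> a <= b -> b <= 1 -> a * (cubic b - cubic a) <= quartic b - quartic a.
Proof.
move=> a0 ab b1; rewrite -subr_ge0.
have -> : quartic b - quartic a - a * (cubic b - cubic a) =
  (b - a) ^+ 2 * (a + 2 * b - 3 / 2 * b ^+ 2 - a * b - a ^+ 2 / 2) by rewrite /cubic /quartic; field.
by apply: mulr_ge0; [exact: sqr_ge0|nra].
Qed.

Lemma cubic_mono a b : 0 <= a -> a <= b -> b <= 1 -> cubic a <= cubic b.
Proof.
move=> a0 ab b1; rewrite -subr_ge0.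
have -> : cubic b - cubic a = (3 * (a + b) - 2 * (a ^+ 2 + a * b + b ^+ 2)) * (b - a) by rewrite /cubic; ring.
apply: mulr_ge0; last lra.
have : 0 <= a * (1 - b) + b * (1 - a) by apply: addr_ge0; apply: mulr_ge0; lra.
have : 0 <= a * (1 - a) + b * (1 - b) by apply: addr_ge0; apply: mulr_ge0; lra.
by lra.
Qed.

(** The function $t \mapsto u\varphi(t) - J(t)$ has derivative $(u-t)\varphi'(t)$ and increases on
    the way to [clamp u]. A step that covers the fraction [lam] of this way keeps $|u - t|$ at least
    [(1 - lam)] times the initial distance. *)
Lemma gain u p lam c p' : 0 <= p -> p <= 1 -> 0 <= lam -> lam <= 1 ->
  c = clamp u -> p' = p + lam * (c - p) ->
  (1 - lam) * `|c - p| * `|smoothstep p' - smoothstep p| <= u * (smoothstep p' - smoothstep p) - (entropy p' - entropy p).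
Proof.
move=> p0 p1 l0 l1 cE p'E; have /andP[c0 c1] := clamp01 u; rewrite -cE in c0 c1.
have p'0 : 0 <= p' by rewrite p'E; nra.
have p'1 : p' <= 1 by rewrite p'E; nra.
rewrite /smoothstep /entropy !clamp_id //.
case: (leP p c) => pc.
  have pp : p <= p' by rewrite p'E lerDl mulr_ge0 // subr_ge0.
  have h1 := cubic_mono p0 pp p'1; have h2 := gain_up p0 pp p'1.
  rewrite !ger0_norm ?subr_ge0 //.
  have [e|ne] := eqVneq c p.
    by rewrite p'E e subrr !(mulr0, mul0r, addr0, subrr).
  have uc : c <= u.
    move: ne pc; rewrite cE /clamp; case: (leP u 0) => g1; last by case: (leP u 1) => g2; lra.
    by move=> /eqP ne pc; exfalso; apply: ne; lra.
  have : (u - p') * (cubic p' - cubic p) >= (c - p') * (cubic p' - cubic p) by apply: ler_wpM2r; lra.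
  have -> : c - p' = (1 - lam) * (c - p) by rewrite p'E; ring.
  by rewrite mulrBl; lra.
have pp : p' <= p by rewrite p'E; nra.
have h1 := cubic_mono p'0 pp p1; have h2 := gain_down p'0 pp p1.
rewrite distrC (distrC (cubic p')) !ger0_norm ?subr_ge0 ?(ltW pc) //.
have uc : u <= c.
  by move: pc; rewrite cE /clamp; case: (leP u 0) => g1; last case: (leP u 1) => g2; lra.
have : (p' - u) * (cubic p - cubic p') >= (p' - c) * (cubic p - cubic p') by apply: ler_wpM2r; lra.
have -> : p' - c = (1 - lam) * (p - c) by rewrite p'E; ring.
by rewrite mulrBl; lra.
Qed.

End profile.

(** * Cut-off functions and a lower bound for the self-interaction *)

Section energy.
Variable R : realType.
Notation mR := (measurableTypeR R).
Notation plane := (mR * mR)%type.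
Implicit Types (x y z w u v : plane) (f g h p : plane -> R).

Definition cut (a : R) x := clamp (2 - Num.max `|x.1| `|x.2| / a).

Lemma max_abs_lip (a b c e : R) : `|Num.max `|a| `|b| - Num.max `|c| `|e| | <= `|a - c| + `|b - e|.
Proof.
have h1 := lerB_dist a c; have h2 := lerB_dist b e.
have h3 := lerB_dist c a; have h4 := lerB_dist e b; rewrite ![`|c - a|]distrC ![`|e - b|]distrC in h3 h4.
have n1 := normr_ge0 (a - c); have n2 := normr_ge0 (b - e).
rewrite ler_norml /Num.max; case: ltP => k1; case: ltP => k2; apply/andP; split; lra.
Qed.

Lemma cut_lip (a : R) : 0 < a -> lip a^-1 (cut a).
Proof.
move=> a0 x y; apply: le_trans (clamp_lip _ _) _.
rewrite opprD opprK addrACA subrr add0r -mulNr -mulrDl normrM (gtr0_norm (_ : 0 < a^-1)) ?invr_gt0 // mulrC.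
apply: ler_wpM2l; first by rewrite invr_ge0 ltW.
by rewrite addrC distrC; exact: max_abs_lip.
Qed.

Lemma box0E (r : R) x : box 0 r x <-> Num.max `|x.1| `|x.2| <= r.
Proof.
rewrite ge_max; split; first by move=> /boxP[]; rewrite !subr0 => -> ->.
by move=> /andP[h1 h2]; apply/boxP; rewrite !subr0.
Qed.

Lemma cut_off (a : R) x : 0 < a -> ~ box 0 (2 * a) x -> cut a x = 0.
Proof.
move=> a0 nb; apply: clamp_le0; rewrite subr_le0 ler_pdivlMr //.
by rewrite leNgt; apply/negP => h; apply: nb; apply/box0E; exact: ltW.
Qed.

Lemma cut_on (a : R) x : 0 < a -> box 0 a x -> cut a x = 1.
Proof.
move=> a0 /box0E bx; apply: clamp_ge1.
have : Num.max `|x.1| `|x.2| / a <= 1 by rewrite ler_pdivrMr // mul1r.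
lra.
Qed.

Lemma cut_nice (a : R) : 0 < a -> nice (cut a).
Proof.
move=> a0; exists (2 * a), 1, a^-1; split; rewrite ?mulr_ge0 ?invr_ge0 ?(ltW a0) //; split.
- by move=> x; have /andP[h1 h2] := clamp01 (2 - Num.max `|x.1| `|x.2| / a); rewrite ger0_norm.
- exact: cut_lip.
- by move=> x; exact: cut_off.
Qed.

Variable s : R.
Hypotheses (s0 : 0 < s) (s1 : s <= 1).
Notation pot := (pot s).

Lemma box_sub_dot (r : R) x y : box 0 r x -> box 0 r y -> dot (x - y) (x - y) <= 8 * r ^+ 2.
Proof.
move=> /boxP[] + + /boxP[]; rewrite !subr0 n2E /= !ler_norml => /andP[a1 a2] /andP[a3 a4] /andP[b1 b2] /andP[b3 b4].
have H (c e : R) : - r <= c -> c <= r -> - r <= e -> e <= r -> (c - e) ^+ 2 <= 4 * r ^+ 2.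
  move=> *; have : 0 <= (2 * r - (c - e)) * (2 * r + (c - e)) by apply: mulr_ge0; lra.
  by lra.
by have := H _ _ a1 a2 b1 b2; have := H _ _ a3 a4 b3 b4; lra.
Qed.

Lemma G_ge0 (r : R) x y : 8 * r ^+ 2 <= 1 -> box 0 r x -> box 0 r y -> 0 <= G s (x - y).
Proof.
move=> r1 bx b_y; have h := le_trans (box_sub_dot bx b_y) r1.
rewrite G_gam; have [->|ne] := eqVneq (dot (x - y) (x - y)) 0; first by rewrite gam0.
by apply: (gam_ge0 s0 s1) => //; rewrite lt_neqAle eq_sym ne n2_ge0.
Qed.

(** The Cauchy-Schwarz inequality on the box, obtained by integrating $(|f| - S/D)^2 \ge 0$. *)
Lemma I_abs_sq f (r : R) : 0 < r -> nice f -> (forall x, ~ box 0 r x -> f x = 0) ->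
  I (fun x => `|f x|) ^+ 2 <= (2 * r) ^+ 2 * I (fun x => f x ^+ 2).
Proof.
move=> r0 nf f0; set S := I _; set D := (2 * r) ^+ 2.
have D0 : 0 < D by rewrite exprn_gt0 // mulr_gt0.
have nf2 : nice (fun x => f x ^+ 2) by apply: niceX.
have i1 := nice_ig nf2; have i2 := ig_abs (nice_ig nf).
have i3 := ig_indic_box (0 : plane) (ltW r0).
have : I (fun x => 2 * S / D * `|f x|) <= I (fun x => f x ^+ 2 + (S / D) ^+ 2 * \1_(box (0 : plane) r) x).
  apply: I_mono; [exact: igZ|by apply: igD => //; exact: igZ|move=> x].
  rewrite indicE; have [bx|nb] := pselect (box 0 r x).
    rewrite mem_set // mulr1 -(real_normK (num_real (f x))) -subr_ge0.
    have -> : `|f x| ^+ 2 + (S / D) ^+ 2 - 2 * S / D * `|f x| = (`|f x| - S / D) ^+ 2 by ring.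
    exact: sqr_ge0.
  by rewrite memNset // (f0 _ nb) normr0 !mulr0 expr0n addr0.
rewrite IZ // ID //; last exact: igZ.
rewrite IZ // I_indic_box ?(ltW r0) // -/S -/D.
have -> : 2 * S / D * S = 2 * (S ^+ 2 / D) by ring.
have -> : (S / D) ^+ 2 * D = S ^+ 2 / D by field; rewrite gt_eqF.
by move=> h; rewrite mulrC -ler_pdivrMr //; lra.
Qed.

(** Schur test: $-2f(x)f(y) \le f(x)^2 + f(y)^2$, weighted with the kernel. The hypothesis on [r]
    makes the kernel nonnegative on the doubled box, where the cut-off lives; the cut-off stands for
    the indicator of the box and stays Lipschitz. *)
Lemma pot_schur (r : R) : 0 < r -> 32 * r ^+ 2 <= 1 -> exists2 P : R, 0 <= P &
  forall f, nice f -> (forall x, ~ box 0 r x -> f x = 0) ->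
  - (P * I (fun x => f x ^+ 2)) <= I (fun x => f x * pot f x).
Proof.
move=> r0 r1; have r20 : 0 <= 2 * r by rewrite mulr_ge0 // ltW.
have r2' : 8 * (2 * r) ^+ 2 <= 1 by lra.
have [P P0 HP] := pot_bound s0 s1 r20; exists P => // f nf f0.
have nc := cut_nice r0; have nf2 : nice (fun x => f x ^+ 2) by apply: niceX.
have c01 x : 0 <= cut r x <= 1 by exact: clamp01.
have n1 : nice (fun x => f x ^+ 2 * pot (cut r) x) by apply: niceM => //; exact: pot_loclip.
have n2 : nice (fun x => cut r x * pot (fun y => f y ^+ 2) x) by apply: niceM => //; exact: pot_loclip.
have n3 : nice (fun x => f x * pot f x) by apply: niceM => //; exact: pot_loclip.
have S := pot_sym s0 s1 nc nf2.
have le2r : r <= 2 * r by rewrite ler_peMl ?(ltW r0) // ler1n.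
have B2 x : ~ box 0 (2 * r) x -> ~ box 0 r x by move=> h b; exact: h (box_mono le2r b).
have h2 : 0 <= 2^-1 :> R by rewrite invr_ge0.
have key x : - (f x * pot f x) <= 2^-1 * (f x ^+ 2 * pot (cut r) x) + 2^-1 * (cut r x * pot (fun y => f y ^+ 2) x).
  have [bx|nb] := pselect (box 0 (2 * r) x); last first.
    by rewrite (f0 _ (B2 _ nb)) (cut_off r0 nb) expr0n /= !mul0r !mulr0 oppr0 addr0.
  have fx2 := sqr_ge0 (f x); have i1 := pot_ig s0 s1 x nc; have i2 := pot_ig s0 s1 x nf2; have i3 := pot_ig s0 s1 x nf.
  have -> : - (f x * pot f x) = I (fun y => - f x * (G s (x - y) * f y)) by rewrite (IZ _ i3) mulNr.
  have -> : 2^-1 * (f x ^+ 2 * pot (cut r) x) = I (fun y => 2^-1 * f x ^+ 2 * (G s (x - y) * cut r y)).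
    by rewrite (IZ _ i1) mulrA.
  have -> : 2^-1 * (cut r x * pot (fun y => f y ^+ 2) x) = I (fun y => 2^-1 * cut r x * (G s (x - y) * f y ^+ 2)).
    by rewrite (IZ _ i2) mulrA.
  rewrite -ID; [|exact: igZ..].
  apply: I_mono; [exact: igZ|by apply: igD; exact: igZ|move=> y].
  have [b_y|nb] := pselect (box 0 r y); last first.
    rewrite (f0 _ nb) expr0n /= !mulr0 addr0.
    have [b2|nb2] := pselect (box 0 (2 * r) y); last by rewrite cut_off // !mulr0.
    have g := G_ge0 r2' bx b2; have /andP[c0 _] := c01 y.
    by nneg.
  have b2 := box_mono le2r b_y.
  have fy2 := sqr_ge0 (f y); rewrite (cut_on r0 b_y) mulr1; have g := G_ge0 r2' bx b2.
  have [bx'|nx] := pselect (box 0 r x); last first.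
    rewrite (f0 _ nx) expr0n /= oppr0 mulr0 !mul0r add0r; have /andP[c0 _] := c01 x.
    by nneg.
  rewrite (cut_on r0 bx') mulr1.
  have : 0 <= G s (x - y) * (f x + f y) ^+ 2 by exact: (mulr_ge0 g (sqr_ge0 _)).
  by move: (G s _) (f x) (f y) => a b c; clear; lra.
have j1 := nice_ig n1; have j2 := nice_ig n2.
have := I_mono (nice_ig (niceN n3)) (igD (igZ _ j1) (igZ _ j2)) key.
rewrite (ID (igZ _ j1) (igZ _ j2)) (IZ _ j1) (IZ _ j2) -S => H.
have h1 : I (fun x => - (f x * pot f x)) = - I (fun x => f x * pot f x).
  by rewrite -[RHS]mulN1r -IZ; [congr I; apply/funext => x; rewrite mulN1r|exact: nice_ig].
rewrite h1 in H.
have h3 : I (fun x => f x ^+ 2 * pot (cut r) x) <= P * I (fun x => f x ^+ 2).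
  rewrite -IZ; last exact: nice_ig.
  apply: I_mono; [exact: nice_ig|exact/igZ/nice_ig|move=> x].
  have [bx|nb] := pselect (box 0 (2 * r) x); last by rewrite f0 ?expr0n ?mul0r ?mulr0 //; exact: B2.
  rewrite mulrC; apply: ler_wpM2r; first exact: sqr_ge0.
  apply: le_trans (ler_norm _) _; apply: le_trans (I_abs (pot_ig s0 s1 x nc)) _.
  rewrite -[leRHS]mul1r; apply: (HP 1 (cut r) x ler01 nc _ _ bx) => y; last exact: cut_off.
  by have /andP[c0 c1] := c01 y; rewrite ger0_norm.
move: H h3; move: (I (fun x => f x * pot f x)) (I (fun x => f x ^+ 2 * _)) (P * _) => a b c.
by clear; lra.
Qed.

End energy.

(** * Existence of maximizers *)

Section scalar.
Variable R : realType.
Implicit Types (r t a b : R).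

(** Zero on the middle half of the interval, where the vortex will be found, and at least one from
    the ends on. *)
Definition wall r t : R := Num.max 0 (2 * `|t| / r - 1).
Definition clip r t : R := if t <= - r then - r else if t <= r then t else r.

Lemma wall_ge0 r t : 0 <= wall r t. Proof. by rewrite /wall le_max lexx. Qed.
Lemma wall_in r t : 0 < r -> `|t| <= r / 2 -> wall r t = 0.
Proof.
move=> r0 h; apply/max_idPl; rewrite subr_le0 ler_pdivrMr //; lra.
Qed.
Lemma wall_le1 r t : 0 < r -> `|t| <= r -> wall r t <= 1.
Proof.
move=> r0 h; rewrite /wall ge_max ler01 /=.
have : 2 * `|t| / r <= 2 by rewrite ler_pdivrMr //; lra.
lra.
Qed.
Lemma wall_edge r t : 0 < r -> r <= `|t| -> 1 <= wall r t.
Proof.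
move=> r0 h; rewrite /wall le_max; apply/orP; right.
have : 2 <= 2 * `|t| / r by rewrite ler_pdivlMr //; lra.
lra.
Qed.
Lemma wall_mono r a b : 0 < r -> `|a| <= `|b| -> wall r a <= wall r b.
Proof.
move=> r0 ab; rewrite /wall ge_max le_max lexx /= le_max; apply/orP; right.
have : 2 * `|a| / r <= 2 * `|b| / r by apply: ler_wpM2r; rewrite ?invr_ge0; lra.
lra.
Qed.
Lemma wallN r t : wall r (- t) = wall r t. Proof. by rewrite /wall normrN. Qed.
Lemma max0_lip a b : `|Num.max 0 a - Num.max 0 b| <= `|a - b|.
Proof.
have := ler_norm (a - b); have := ler_norm (b - a); rewrite distrC ler_norml /Num.max.
by case: ltP => h1; case: ltP => h2; move=> *; apply/andP; split; lra.
Qed.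
Lemma wall_lip r a b : 0 < r -> `|wall r a - wall r b| <= 2 / r * `|a - b|.
Proof.
move=> r0; apply: le_trans (max0_lip _ _) _.
have -> : 2 * `|a| / r - 1 - (2 * `|b| / r - 1) = 2 / r * (`|a| - `|b|) by ring.
rewrite normrM ger0_norm.
  by apply: ler_wpM2l; [rewrite divr_ge0 // ltW|exact: ler_dist_dist].
by rewrite divr_ge0 // ltW.
Qed.
Lemma clip_id r t : `|t| <= r -> clip r t = t.
Proof. by rewrite ler_norml /clip => /andP[h1 h2]; rewrite h2; case: ifP => // h; lra. Qed.
Lemma clip_box r t : 0 <= r -> `|clip r t| <= r.
Proof.
by rewrite /clip ler_norml => r0; case: (leP t (- r)) => h1; [|case: (leP t r) => h2]; apply/andP; split; lra.
Qed.
Lemma clip_out r t : 0 <= r -> r <= `|t| -> `|clip r t| = r.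
Proof.
move=> r0 rt; rewrite /clip; case: (leP t (- r)) => h1; first by rewrite normrN ger0_norm.
case: (leP t r) => h2; last by rewrite ger0_norm.
by move: rt; rewrite ler_normr => /orP[] h; [rewrite ger0_norm; lra|lra].
Qed.
Lemma clip_lip r a b : 0 <= r -> `|clip r a - clip r b| <= `|a - b|.
Proof.
move=> r0; wlog ab : a b / a <= b.
  by move=> H; case: (leP a b) => [|/ltW] /H //; rewrite distrC [leRHS]distrC.
rewrite !(distrC _ b) (distrC (clip r a)) (ger0_norm (_ : 0 <= b - a)) ?subr_ge0 // ger0_norm.
  by rewrite /clip; case: (leP a (- r)) => h1; [|case: (leP a r) => h2]; (case: (leP b (- r)) => h3; [|case: (leP b r) => h4]); lra.
by rewrite /clip; case: (leP a (- r)) => h1; [|case: (leP a r) => h2]; (case: (leP b (- r)) => h3; [|case: (leP b r) => h4]); lra.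
Qed.
Lemma clipN r t : 0 <= r -> clip r (- t) = - clip r t.
Proof.
by move=> r0; rewrite /clip; case: (leP (- t) (- r)) => h1; case: (leP t (- r)) => h2; case: (leP t r) => h3; case: (leP (- t) r) => h4; lra.
Qed.

End scalar.

Lemma closed_dist_le (R : realType) (T : topologicalType) (f g : T -> R) (k : R) :
  continuous f -> continuous g -> closed [set t | `|f t - g t| <= k].
Proof.
move=> cf cg; have ct : continuous (fun t => `|f t - g t|).
  by move=> t; apply: cvg_norm; apply: cvgB; [exact: cf|exact: cg].
have -> : [set t | `|f t - g t| <= k] = (fun t => `|f t - g t|) @^-1` [set u | u <= k] by [].
by apply: preimage_closed; [move=> t _; exact: ct|exact: closed_le].
Qed.

Lemma schur_arith (R : realType) (P C D a b c e : R) : - (P * a) <= c -> - (C * b) <= e ->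
  C * b <= C * (D * a) -> - ((P + C * D) * a) <= c + e.
Proof. by move=> *; lra. Qed.

(** * The variational problem and its Euler-Lagrange equation *)

Section existence.
Variable R : realType.
Notation mR := (measurableTypeR R).
Notation plane := (mR * mR)%type.
Implicit Types (x y z w u v : plane) (f g h p c : plane -> R).
Variable s : R.
Hypotheses (s0 : 0 < s) (s1 : s <= 1).
Notation pot := (pot s).
Variables (B : plane -> plane -> R) (CB LB : R).
Hypothesis hB : kernel B CB LB.
Let CB0 := kernel_bound0 hB.
Let LB0 := kernel_lip0 hB.
Variables (r Lam : R).
Hypotheses (r0 : 0 < r) (r1 : 32 * r ^+ 2 <= 1) (Lam0 : 0 < Lam).
Notation U := (U s B).
Notation Q := (Q s B).

Definition vort p x : R := Lam * smoothstep (p x).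
Definition V (MV : R) x : R := MV * (wall r x.1 + wall r x.2).
Definition ball (K : R) p := [/\ forall x, 0 <= p x <= 1, lip K p,
  forall x, ~ box 0 r x -> p x = 0 & forall x, p (ry x) = p x].
Definition energy (MV : R) p : R := 2^-1 * Q (vort p) (vort p) - I (fun x => vort p x * V MV x) - Lam * I (fun x => entropy (p x)).

Lemma ball_nice K p : 0 <= K -> ball K p -> nice p.
Proof.
move=> K0 [h1 h2 h3 _]; exists r, 1, K; split; rewrite ?(ltW r0) //; split => // x.
by have /andP[a b] := h1 x; rewrite ger0_norm.
Qed.

Lemma vort_nice p : nice p -> nice (vort p).
Proof.
move=> np; have L0 : 0 <= 3 / 2 :> R by lra.
exact: niceZ (nice_comp L0 (smoothstep0 R) (@smoothstep_lip R) np).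
Qed.

Lemma entropy_nice p : nice p -> nice (fun x => entropy (p x)).
Proof. by move=> np; exact: nice_comp (ler0n _ 12) (entropy0 R) (@entropy_lip R) np. Qed.

Lemma vort_bound p x : 0 <= vort p x <= Lam.
Proof.
have /andP[a b] := smoothstep01 (p x); rewrite /vort mulr_ge0 ?(ltW Lam0) //=.
by rewrite -[leRHS]mulr1; apply: ler_wpM2l => //; exact: ltW.
Qed.

Lemma vort_0 p x : p x = 0 -> vort p x = 0.
Proof. by rewrite /vort => ->; rewrite smoothstep0 mulr0. Qed.

Lemma vort_lip p p' x : `|vort p' x - vort p x| <= Lam * (3 / 2) * `|p' x - p x|.
Proof.
rewrite /vort -mulrBr normrM gtr0_norm // -mulrA; apply: ler_wpM2l; [exact: ltW|exact: smoothstep_lip].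
Qed.

Lemma vort_lipx K p : lip K p -> lip (Lam * (3 / 2) * K) (vort p).
Proof.
move=> pl x y; rewrite /vort -mulrBr normrM gtr0_norm // -2!mulrA; apply: ler_wpM2l; first exact: ltW.
by apply: le_trans (smoothstep_lip _ _) _; apply: ler_wpM2l; [lra|exact: pl].
Qed.

Lemma V_loclip MV : loclip (V MV).
Proof.
have k0 : 0 <= `|MV| * (2 / r) by rewrite mulr_ge0 // divr_ge0 // ltW.
apply: (@lip_loclip _ (`|MV| * (2 / r))) => // x y.
rewrite /V -mulrBr normrM -mulrA; apply: ler_wpM2l => //.
rewrite opprD addrACA; apply: le_trans (ler_normD _ _) _; rewrite /l1 mulrDr.
by apply: lerD; exact: wall_lip.
Qed.

Lemma loU f : nice f -> loclip (U f).
Proof. by move=> nf; apply: (U_loclip s0 s1 hB). Qed.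

(** An exact expansion, since the interaction is quadratic in the vorticity: the potential is frozen
    at [p], and one quadratic remainder is left. *)
Lemma energy_diff MV p p' : nice p -> nice p' ->
  let D x := vort p' x - vort p x in
  energy MV p' - energy MV p = I (fun x => D x * (U (vort p) x - V MV x) - Lam * (entropy (p' x) - entropy (p x))) + 2^-1 * Q D D.
Proof.
move=> np np' D; have no := vort_nice np; have no' := vort_nice np'; have nD : nice D by exact: niceB.
have nj := entropy_nice np; have nj' := entropy_nice np'.
have nU : nice (fun x => D x * U (vort p) x) by apply: niceM => //; exact: loU.
have nV f : nice f -> nice (fun x => f x * V MV x) by move=> nf; apply: niceM => //; exact: V_loclip.
have -> : I (fun x => D x * (U (vort p) x - V MV x) - Lam * (entropy (p' x) - entropy (p x))) =
  I (fun x => D x * U (vort p) x) - (I (fun x => vort p' x * V MV x) - I (fun x => vort p x * V MV x))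
  - Lam * (I (fun x => entropy (p' x)) - I (fun x => entropy (p x))).
  have n1 := nV _ no'; have n2 := nV _ no; have n3 := niceB n1 n2; have n4 := niceB nj' nj.
  rewrite -(IB (nice_ig n1) (nice_ig n2)) -(IB (nice_ig nj') (nice_ig nj)).
  rewrite -(IZ _ (nice_ig n4)) -(IB (nice_ig nU) (nice_ig n3)).
  rewrite -(IB (nice_ig (niceB nU n3)) (nice_ig (niceZ _ n4))).
  by congr I; apply/funext => x; rewrite /D mulrBr !mulrBl.
have -> : I (fun x => D x * U (vort p) x) = Q (vort p) D by [].
have E : vort p' = (fun x => vort p x + D x) by apply/funext => x; rewrite /D addrC subrK.
have X := Q_expand s0 s1 hB no nD; rewrite -E in X.
rewrite /energy X; move: (Q _ _) (Q _ _) (Q _ _) (I _) (I _) (I _) (I _) => *; by field.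
Qed.

(** A positive value would persist, halved, on a small box around [x] by the Lipschitz bound. *)
Lemma nice_I0 f x : nice f -> (forall y, 0 <= f y) -> I f <= 0 -> f x = 0.
Proof.
move=> nf f0 I0; apply/eqP; rewrite eq_le f0 andbT leNgt; apply/negP => fx.
have [K K0 HK] := nice_lip nf.
have K1 : 0 < 4 * (K + 1) by rewrite mulr_gt0 // ltr_wpDl.
pose e := f x / (4 * (K + 1)); have e0 : 0 < e by rewrite divr_gt0.
have : I (fun y => f x / 2 * \1_(box x e) y) <= I f.
  apply: I_mono; [by apply: igZ; apply: ig_indic_box; exact: ltW|exact: nice_ig|move=> y].
  rewrite indicE; have [b_y|nb] := pselect (box x e y); last by rewrite memNset // mulr0.
  rewrite mem_set // mulr1; have := HK x y; rewrite ler_norml => /andP[_].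
  have : l1 (x - y) <= 2 * e.
    by move: b_y => /boxP[]; rewrite /l1 /= ![`|y.1 - _|]distrC ![`|y.2 - _|]distrC; lra.
  have h : (K + 1) * (4 * e) = f x by rewrite /e; field; rewrite gt_eqF // ltr_wpDl.
  by move=> h1 h2; have := ler_wpM2l K0 h1; lra.
rewrite IZ ?I_indic_box ?(ltW e0) //; last by apply: ig_indic_box; exact: ltW.
have : 0 < f x / 2 * (2 * e) ^+ 2 by rewrite mulr_gt0 ?divr_gt0 // exprn_gt0 // mulr_gt0.
by move: I0; move: (I f) (_ * _) => *; lra.
Qed.

(** Limits the loss caused by the quadratic remainder of [energy_diff]. *)
Lemma Q_schur : exists2 M : R, 0 <= M & forall f, nice f -> (forall x, ~ box 0 r x -> f x = 0) ->
  - (M * I (fun x => f x ^+ 2)) <= Q f f.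
Proof.
have [P P0 HP] := pot_schur s0 s1 r0 r1.
exists (P + CB * (2 * r) ^+ 2); first by nneg.
move=> f nf f0; rewrite (Q_split s0 s1 hB) //.
have h1 := HP f nf f0.
have nb : nice (fun x => f x * bpot B f x) by apply: niceM => //; exact: (bpot_loclip hB).
have h2 : `|I (fun x => f x * bpot B f x)| <= CB * I (fun x => `|f x|) ^+ 2.
  apply: le_trans (I_abs (nice_ig nb)) _; rewrite expr2 mulrA -IZ; last exact: ig_abs (nice_ig nf).
  apply: I_mono; [exact: ig_abs (nice_ig nb)|exact: igZ _ (ig_abs (nice_ig nf))|move=> x].
  rewrite normrM mulrC; apply: ler_wpM2r => //; exact: (bpot_bound hB).
have h3 := ler_wpM2l CB0 (I_abs_sq r0 nf f0).
move: h2; rewrite ler_norml => /andP[h2 _]; exact: schur_arith h1 h2 h3.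
Qed.

Lemma U_bound : exists2 M : R, 0 <= M & forall f (F : R) x, 0 <= F -> nice f -> (forall y, `|f y| <= F) ->
  (forall y, ~ box 0 r y -> f y = 0) -> box 0 r x -> `|U f x| <= F * M.
Proof.
have [P P0 HP] := pot_bound s0 s1 (ltW r0).
exists (P + CB * (2 * r) ^+ 2); first by nneg.
move=> f F x F0 nf fF f0 bx; apply: le_trans (ler_normD _ _) _; rewrite mulrDr; apply: lerD.
  by apply: le_trans (I_abs (pot_ig s0 s1 x nf)) _; exact: HP.
apply: le_trans (bpot_bound hB x nf) _; rewrite mulrCA; apply: ler_wpM2l => //.
apply: le_trans (ler_norm _) _; apply: (@I_bounded R 0 r F (fun y => `|f y|) (ltW r0)).
- exact: (nice_measurable (nice_abs nf)).
- by move=> y; rewrite normr_id.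
- by move=> y /f0 ->; rewrite normr0.
Qed.

Definition clip2 x : plane := (clip r x.1, clip r x.2).
Lemma clip2_box x : box 0 r (clip2 x).
Proof. by apply/boxP; rewrite !subr0; split; apply: clip_box; exact: ltW. Qed.
Lemma clip2_id x : box 0 r x -> clip2 x = x.
Proof. by move=> /boxP[]; rewrite !subr0 => h1 h2; rewrite /clip2 !clip_id // -surjective_pairing. Qed.
Lemma clip2_lip x y : l1 (clip2 x - clip2 y) <= l1 (x - y).
Proof. by rewrite /l1 /=; apply: lerD; apply: clip_lip; exact: ltW. Qed.
Lemma clip2_ry x : clip2 (ry x) = ry (clip2 x).
Proof. by rewrite /clip2 /ry /= clipN // ltW. Qed.

Lemma U_ry f x : nice f -> (forall y, f (ry y) = f y) -> U f (ry x) = U f x.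
Proof.
move=> nf fe; rewrite /U; suff [-> ->] : pot f (ry x) = pot f x /\ bpot B f (ry x) = bpot B f x by []; split.
  have [_ E] := I_refl2 (pot_ig s0 s1 (ry x) nf).
  rewrite /pot -E; congr I; apply/funext => y; rewrite -[f (_, _)]/(f (ry y)) fe; apply: (congr1 (fun a => a * f y)).
  by rewrite !G_gam // /dot /=; congr gam; ring.
have [_ E] := I_refl2 (bpot_ig hB (ry x) nf).
rewrite /bpot -E; congr I; apply/funext => y; rewrite -[f (_, _)]/(f (ry y)) fe; congr (_ * _).
exact: (kernel_even hB).
Qed.

Definition excess MV p x : R := U (vort p) x - V MV x.
(** Projecting to the box first means that estimates are needed only there; outside, the reply
    repeats its boundary values, which the wall makes zero. *)
Definition best_reply MV p x : R := clamp (excess MV p (clip2 x)).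

(** The vorticity is [Lam * (3 / 2) * K]-Lipschitz, so [eta = (3 * Lam)^-1] in [pot_lip] contributes
    [K / 2]. The other contributions [K1] do not depend on [K], and [2 * K1 <= K] closes the
    estimate. The wall height bounds every potential on the box, hence the excess is nonpositive on
    its boundary. *)
Lemma best_reply_ball (K0 : R) : exists MV K : R, [/\ 0 <= MV, 0 <= K, K0 <= K & forall p, ball K p -> ball K (best_reply MV p)].
Proof.
have [M M0 HM] := U_bound; have Lam0' := ltW Lam0.
have eta0 : 0 < (3 * Lam)^-1 by rewrite invr_gt0 mulr_gt0.
have [A A0 HA] := pot_lip s0 s1 0 (ltW r0) (ltW r0) eta0.
pose MV := Lam * M; have MV0 : 0 <= MV by rewrite mulr_ge0.
have ri : 0 <= 2 / r by rewrite divr_ge0 // ltW.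
pose K1 := A * Lam + LB * (Lam * (2 * r) ^+ 2) + MV * (2 / r).
have K10 : 0 <= K1 by rewrite /K1; nneg.
exists MV, (2 * K1 + `|K0|); split => //; first by nneg.
  by have := ler_norm K0; lra.
set K := 2 * K1 + _; have K0' : 0 <= K by rewrite /K; nneg.
move=> p pb; have np := ball_nice K0' pb; have no := vort_nice np.
have [p01 pl poff pev] := pb.
have o0 x : ~ box 0 r x -> vort p x = 0 by move=> /poff; exact: vort_0.
have oL x : `|vort p x| <= Lam by have /andP[a b] := vort_bound p x; rewrite ger0_norm.
have oadm : adm 0 r Lam (Lam * (3 / 2) * K) (vort p) by split => //; exact: vort_lipx.
have oK0 : 0 <= Lam * (3 / 2) * K by rewrite mulr_ge0 // mulr_ge0 // divr_ge0.
split.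
- by move=> x; exact: clamp01.
- move=> x y; apply: le_trans (clamp_lip _ _) _.
  apply: (@le_trans _ _ (K * l1 (clip2 x - clip2 y))); last by apply: ler_wpM2l => //; exact: clip2_lip.
  have bx := clip2_box x; have b_y := clip2_box y; move: (clip2 x) (clip2 y) bx b_y => x' y' bx b_y.
  have h1 := HA _ _ _ Lam0' oK0 oadm x' y' bx b_y.
  have h2 := bpot_lip hB no x' y'.
  have h3 : `|V MV x' - V MV y'| <= MV * (2 / r) * l1 (x' - y').
    rewrite /V -mulrBr normrM (ger0_norm MV0) -mulrA; apply: ler_wpM2l => //.
    rewrite opprD addrACA; apply: le_trans (ler_normD _ _) _; rewrite /l1 mulrDr.
    by apply: lerD; exact: wall_lip.
  have h4 : I (fun y => `|vort p y|) <= Lam * (2 * r) ^+ 2.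
    apply: le_trans (ler_norm _) _; apply: (@I_bounded R 0 r Lam (fun y => `|vort p y|) (ltW r0)).
    - exact: (nice_measurable (nice_abs no)).
    - by move=> z; rewrite normr_id.
    - by move=> z /o0 ->; rewrite normr0.
  have n0 := l1_ge0 (x' - y').
  have -> : excess MV p x' - excess MV p y' = (pot (vort p) x' - pot (vort p) y') + (bpot B (vort p) x' - bpot B (vort p) y') - (V MV x' - V MV y').
    by rewrite /excess /U; move: (pot _ _) (pot _ _) (bpot _ _ _) (bpot _ _ _) (V _ _) (V _ _) => *; ring.
  apply: le_trans (ler_normB _ _) _; apply: le_trans (lerD (ler_normD _ _) (lexx _)) _.
  apply: le_trans (lerD (lerD h1 h2) h3) _; rewrite -!mulrDl; apply: ler_wpM2r => //.
  have h5 := ler_wpM2l LB0 h4.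
  have -> : (3 * Lam)^-1 * (Lam * (3 / 2) * K) = K / 2 by field; rewrite gt_eqF.
  have k0 : 0 <= `|K0| by [].
  move: h5 k0; rewrite /K /K1; move: (I _) (_ * (2 * r) ^+ 2) (MV * _) (A * _) `|K0| => *; lra.
- move=> x nb; apply: clamp_le0; rewrite /excess subr_le0.
  apply: le_trans (ler_norm _) _; apply: le_trans (HM _ Lam _ Lam0' no oL o0 (clip2_box x)) _.
  rewrite /V -/MV -[leLHS]mulr1; apply: ler_wpM2l => //.
  have := wall_ge0 r (clip r x.1); have := wall_ge0 r (clip r x.2).
  have : (r <= `|x.1|) || (r <= `|x.2|).
    case: (leP r `|x.1|) => //= h1; case: (leP r `|x.2|) => //= h2.
    by exfalso; apply: nb; apply/boxP; rewrite !subr0; split; exact: ltW.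
  move=> /orP[] h a1 a2.
    have : 1 <= wall r (clip r x.1) by apply: wall_edge => //; rewrite clip_out // ltW.
    by rewrite /clip2 /=; lra.
  have : 1 <= wall r (clip r x.2) by apply: wall_edge => //; rewrite clip_out // ltW.
  by rewrite /clip2 /=; lra.
- move=> x; rewrite /best_reply /excess clip2_ry U_ry //; last by move=> y; rewrite /vort pev.
  by rewrite /V /= wallN.
Qed.

(** The ball is convex, so [p] may move the fraction [lam] towards its reply. The linear gain and
    the quadratic loss are both controlled by the integral of the same function [w], the loss with
    an extra factor [lam]; maximality then forces [w] to vanish. *)
Lemma fixed_point MV K p : 0 <= K -> ball K p -> ball K (best_reply MV p) ->
  (forall p', ball K p' -> energy MV p' <= energy MV p) ->
  forall x, p x = best_reply MV p x.
Proof.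
move=> K0 pb cb Emax x; have [M M0 HM] := Q_schur.
have ML : 0 <= M * Lam by rewrite mulr_ge0 // ltW.
(* Small enough for the linear gain to exceed the Schur bound of the remainder. *)
pose lam := (2 * (1 + M * Lam))^-1.
have lam0 : 0 < lam by rewrite invr_gt0 mulr_gt0 // ltr_wpDr.
have lamE : lam * (1 + M * Lam) = 2^-1 by rewrite /lam; field; rewrite gt_eqF // ltr_wpDr.
have lam1 : lam <= 1 by have := mulr_ge0 (ltW lam0) ML; rewrite mulrDr mulr1 in lamE; lra.
set c := best_reply MV p in cb *.
pose p' x := p x + lam * (c x - p x).
have [p01 pl poff pev] := pb; have [c01 cl coff cev] := cb.
have p'b : ball K p'.
  split.
  - move=> y; have /andP[a1 a2] := p01 y; have /andP[b1 b2] := c01 y; rewrite /p'.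
    have : 0 <= lam * c y by rewrite mulr_ge0 // ltW.
    have : 0 <= (1 - lam) * p y by rewrite mulr_ge0 // subr_ge0.
    have : 0 <= lam * (1 - c y) by rewrite mulr_ge0 ?(ltW lam0) // subr_ge0.
    have : 0 <= (1 - lam) * (1 - p y) by rewrite mulr_ge0 // subr_ge0.
    by move=> *; apply/andP; split; lra.
  - move=> y z; have h1 := ler_wpM2l (ltW lam0) (cl y z).
    have l1' : 0 <= 1 - lam by rewrite subr_ge0.
    have h2 := ler_wpM2l l1' (pl y z).
    have -> : p' y - p' z = (1 - lam) * (p y - p z) + lam * (c y - c z) by rewrite /p'; ring.
    apply: le_trans (ler_normD _ _) _; rewrite !normrM (gtr0_norm lam0) (ger0_norm l1').
    by apply: le_trans (lerD h2 h1) _; rewrite -mulrDl subrK mul1r.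
  - by move=> y nb; rewrite /p' poff // coff // subrr mulr0 addr0.
  - by move=> y; rewrite /p' pev cev.
have np := ball_nice K0 pb; have np' := ball_nice K0 p'b; have nc := ball_nice K0 cb.
have nphp (q : plane -> R) : nice q -> nice (fun x => smoothstep (q x)).
  by move=> nq; apply: (nice_comp _ (smoothstep0 R) (@smoothstep_lip R) nq); lra.
have nw : nice (fun x => `|c x - p x| * `|smoothstep (p' x) - smoothstep (p x)|).
  by apply: niceX; apply: nice_abs; apply: niceB => //; exact: nphp.
set w := (fun x => _) in nw.
have no := vort_nice np; have no' := vort_nice np'.
have := energy_diff MV np np'; set D := (fun x => vort p' x - vort p x) => /= ED.
have nD : nice D by exact: niceB.
have Doff y : ~ box 0 r y -> D y = 0 by move=> nb; rewrite /D !vort_0 ?subrr // ?poff // /p' poff // coff // subrr mulr0 addr0.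
have h1 := HM D nD Doff.
have h2 : I (fun x => D x ^+ 2) <= Lam ^+ 2 * (3 / 2 * lam) * I w.
  rewrite -IZ; last exact: nice_ig.
  apply: I_mono; [by apply: nice_ig; exact: niceX|exact/igZ/nice_ig|move=> y].
  have -> : D y ^+ 2 = Lam ^+ 2 * (`|smoothstep (p' y) - smoothstep (p y)| * `|smoothstep (p' y) - smoothstep (p y)|).
    by rewrite /D /vort -mulrBr exprMn -expr2 real_normK // num_real.
  rewrite /w -mulrA; apply: ler_wpM2l; first exact: sqr_ge0.
  rewrite mulrA; apply: ler_wpM2r => //; apply: le_trans (smoothstep_lip _ _) _; rewrite -[leRHS]mulrA; apply: ler_wpM2l; first lra.
  by rewrite /p' addrAC subrr add0r normrM gtr0_norm.
have h3 : Lam * (1 - lam) * I w <= I (fun x => D x * (U (vort p) x - V MV x) - Lam * (entropy (p' x) - entropy (p x))).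
  rewrite -IZ; last exact: nice_ig.
  apply: I_mono; [exact/igZ/nice_ig| |move=> y].
    apply: nice_ig; apply: niceB; last by apply: niceZ; apply: niceB; exact: entropy_nice.
    apply: niceM => //; apply: loclipD; first exact: loU.
    by apply: loclipN; exact: V_loclip.
  have [b_y|nb] := pselect (box 0 r y); last first.
    have e1 : p' y = p y by rewrite /p' poff // coff // subrr mulr0 addr0.
    by rewrite /w e1 (Doff _ nb) !subrr normr0 !mulr0 mul0r subrr.
  have cE : c y = clamp (excess MV p y) by rewrite /c /best_reply clip2_id.
  have /andP[a1 a2] := p01 y.
  have := gain a1 a2 (ltW lam0) lam1 cE (erefl (p' y)).
  rewrite /D /vort /w -mulrBr -[in X in _ -> X]mulrA -/(excess MV p y) => g.
  have := ler_wpM2l (ltW Lam0) g; rewrite -/(p' y).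
  by rewrite -/(excess MV p y); move: (excess _ _ _) (entropy _) (entropy _) (smoothstep _) (smoothstep _) => *; lra.
have Iw0 : 0 <= I w by apply: I_ge0 => y; rewrite /w mulr_ge0.
have Iw : I w <= 0.
  have e := Emax _ p'b; rewrite -subr_le0 ED in e.
  have h4 := ler_wpM2l M0 h2.
  have : Lam * (1 - lam) * I w - 2^-1 * (M * (Lam ^+ 2 * (3 / 2 * lam) * I w)) <= 0.
    by move: e h1 h3 h4; move: (I w) (I _) (Q _ _) (I _) => a b q e; lra.
  have -> : Lam * (1 - lam) * I w - 2^-1 * (M * (Lam ^+ 2 * (3 / 2 * lam) * I w)) =
    Lam * ((1 - lam * (1 + M * Lam)) + lam * (M * Lam) / 4) * I w by field.
  rewrite lamE => h5; rewrite -(pmulr_rle0 _ (_ : 0 < Lam * (1 - 2^-1 + lam * (M * Lam) / 4))) //.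
  apply: mulr_gt0 => //; have := mulr_ge0 (ltW lam0) ML; lra.
have wp y : 0 <= w y by rewrite /w mulr_ge0.
(* In the remaining case the vorticity does not change along the step; injectivity of the cubic then
   gives [p' x = p x], hence [c x = p x]. *)
have := nice_I0 x nw wp Iw; rewrite /w => /eqP; rewrite mulf_eq0 !normr_eq0 !subr_eq0 => /orP[/eqP->//|/eqP h].
have [p'01 _ _ _] := p'b; have /andP[a1 a2] := p01 x; have /andP[b1 b2] := p'01 x.
rewrite /smoothstep !clamp_id // in h; have := cubic_inj b1 b2 a1 a2 h; rewrite /p' => h'.
have : lam * (c x - p x) = 0 by lra.
by move=> /eqP; rewrite mulf_eq0 gt_eqF //= subr_eq0 => /eqP.
Qed.

Lemma V_bound MV x : 0 <= MV -> box 0 r x -> 0 <= V MV x <= 2 * MV.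
Proof.
move=> M0 /boxP[]; rewrite !subr0 => h1 h2; rewrite /V.
have := wall_ge0 r x.1; have := wall_ge0 r x.2; have := wall_le1 r0 h1; have := wall_le1 r0 h2.
move=> a1 a2 a3 a4; apply/andP; split; first by rewrite mulr_ge0 // addr_ge0.
by rewrite mulrC; apply: ler_wpM2r => //; lra.
Qed.

Lemma energy_cont MV K : 0 <= MV -> 0 <= K -> exists2 C : R, 0 <= C &
  forall p p' (e : R), ball K p -> ball K p' -> 0 <= e -> (forall x, `|p' x - p x| <= e) ->
  `|energy MV p' - energy MV p| <= C * e.
Proof.
move=> MV0 K0; have [M M0 HM] := U_bound; have Lam0' := ltW Lam0.
have k32 : 0 <= Lam * (3 / 2) by rewrite mulr_ge0 // divr_ge0.
exists ((Lam * (3 / 2) * (Lam * M + 2 * MV) + Lam * 12) * (2 * r) ^+ 2 + Lam * (3 / 2) * M * Lam * (2 * r) ^+ 2).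
  by nneg.
move=> p p' e pb pb' e0 pe; have np := ball_nice K0 pb; have np' := ball_nice K0 pb'.
have no := vort_nice np; have no' := vort_nice np'.
have := energy_diff MV np np'; set D := (fun x => vort p' x - vort p x) => /= ->.
have nD : nice D by exact: niceB.
have [_ _ po _] := pb; have [_ _ po' _] := pb'.
have o0 x : ~ box 0 r x -> vort p x = 0 by move=> /po; exact: vort_0.
have Do x : ~ box 0 r x -> D x = 0 by move=> nb; rewrite /D !vort_0 ?subrr //; [exact: po|exact: po'].
have oL x : `|vort p x| <= Lam by have /andP[a b] := vort_bound p x; rewrite ger0_norm.
have De x : `|D x| <= Lam * (3 / 2) * e by apply: le_trans (vort_lip _ _ _) _; exact: ler_wpM2l.
have DL x : `|D x| <= Lam.
  have /andP[a b] := vort_bound p x; have /andP[a' b'] := vort_bound p' x.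
  by rewrite ler_norml /D; apply/andP; split; move: (vort p x) (vort p' x) a b a' b' => *; lra.
have nU := loU no.
have nT : nice (fun x => D x * (U (vort p) x - V MV x) - Lam * (entropy (p' x) - entropy (p x))).
  apply: niceB; last by apply: niceZ; apply: niceB; exact: entropy_nice.
  by apply: niceM => //; apply: loclipD => //; apply: loclipN; exact: V_loclip.
have nDD : nice (fun x => D x * U D x) by apply: niceM => //; exact: loU.
have h1 : `|I (fun x => D x * (U (vort p) x - V MV x) - Lam * (entropy (p' x) - entropy (p x)))| <=
  (Lam * (3 / 2) * (Lam * M + 2 * MV) + Lam * 12) * e * (2 * r) ^+ 2.
  apply: (@I_bounded R 0 r _ _ (ltW r0) (nice_measurable nT)) => x; last first.
    by move=> nb; rewrite (Do _ nb) mul0r po // po' // subrr mulr0 subrr.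
  have [bx|nb] := pselect (box 0 r x); last first.
    by rewrite (Do _ nb) mul0r po // po' // subrr mulr0 subrr normr0; nneg.
  apply: le_trans (ler_normB _ _) _; rewrite [leRHS]mulrDl; apply: lerD; last first.
    rewrite normrM gtr0_norm // -mulrA; apply: ler_wpM2l => //.
    by apply: le_trans (entropy_lip _ _) _; apply: ler_wpM2l.
  rewrite normrM mulrAC; apply: ler_pM => //; apply: le_trans (ler_normB _ _) _.
  apply: lerD; first exact: HM.
  by have /andP[a b] := V_bound MV0 bx; rewrite ger0_norm.
have h2 : `|Q D D| <= Lam * (3 / 2) * e * M * Lam * (2 * r) ^+ 2.
  apply: (@I_bounded R 0 r _ _ (ltW r0) (nice_measurable nDD)) => x; last by move=> nb; rewrite (Do _ nb) mul0r.
  have [bx|nb] := pselect (box 0 r x); last by rewrite (Do _ nb) mul0r normr0; nneg.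
  rewrite normrM mulrC; apply: ler_pM => //; apply: HM => //; by nneg.
apply: le_trans (ler_normD _ _) _; rewrite normrM ger0_norm ?invr_ge0 //.
have h3 := normr_ge0 (Q D D).
move: h1 h2 h3; move: `|I _| `|Q _ _| => a b; lra.
Qed.

Lemma grid_point (n : nat) (t : R) : (0 < n)%N -> `|t| <= r ->
  exists i : 'I_n.+1, `|t - (- r + i%:R * (2 * r / n%:R))| <= 2 * r / n%:R.
Proof.
move=> n0; rewrite ler_norml => /andP[t0 t1].
have N0 : 0 < n%:R :> R by rewrite ltr0n.
pose h := 2 * r / n%:R; have h0 : 0 < h by rewrite divr_gt0 // mulr_gt0.
have q0 : 0 <= (t + r) / h by apply: divr_ge0; [lra|exact: ltW].
have /andP[k1 k2] := truncn_itv q0; set k := Num.truncn _ in k1 k2.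
have kn : (k < n.+1)%N.
  rewrite ltnS -(ler_nat R); apply: le_trans k1 _; rewrite ler_pdivrMr // /h.
  by rewrite mulrCA divff ?gt_eqF // mulr1; lra.
exists (Ordinal kn) => /=; rewrite -/h.
rewrite ler_pdivlMr // in k1; rewrite ltr_pdivrMr // -natr1 in k2.
by rewrite ler_norml; apply/andP; split; lra.
Qed.

(** Compactness comes from Tychonoff's theorem in the topology of pointwise convergence, in which
    the ball is closed. On Lipschitz functions supported in a box, closeness on a finite grid
    implies uniform closeness, so the energy is continuous there. *)
Lemma maximizer_exists MV K : 0 <= MV -> 0 <= K ->
  exists2 p, ball K p & forall p', ball K p' -> energy MV p' <= energy MV p.
Proof.
move=> MV0 K0; have [C C0 HC] := energy_cont MV0 K0.
pose T : topologicalType := prod_topology (fun _ : plane => R : topologicalType).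
pose A (x : plane) : set R := if pselect (box 0 r x) then `[0, 1]%classic else [set 0].
have A01 x t : A x t -> 0 <= t <= 1.
  by rewrite /A; case: pselect => h /=; [rewrite in_itv|move->; rewrite lexx ler01].
have cA : compact [set f : T | forall x, A x (f x)].
  apply: tychonoff => x; rewrite /A; case: pselect => h; [exact: segment_compact|exact: compact_set1].
pose tilted : set T := [set p | ball K p].
have pc (x : plane) : continuous (fun f : T => f x) by exact: proj_continuous.
have cl2 (x y : plane) (k : R) : closed [set f : T | `|f x - f y| <= k].
  exact: (@closed_dist_le R T (fun f => f x) (fun f => f y) k (pc x) (pc y)).
have E : tilted = [set f : T | forall x, A x (f x)] `&` (\bigcap_(z in [set: plane * plane]) [set f : T | `|f z.1 - f z.2| <= K * l1 (z.1 - z.2)]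
   `&` \bigcap_(x in [set: plane]) [set f : T | `|f (ry x) - f x| <= 0]).
  apply/seteqP; split => [p [h1 h2 h3 h4]|p [h1 [h2 h3]]].
    split; first by move=> x; rewrite /A; case: pselect => h /=; [rewrite in_itv /=; exact: h1|exact: h3].
    by split => [[x y] _|x _] /=; [exact: h2|rewrite h4 subrr normr0].
  split => [x|x y|x nb|x]; first exact: A01 (h1 x).
  - exact: (h2 (x, y)).
  - by have := h1 x; rewrite /A; case: pselect.
  - by have := h3 x Logic.I; rewrite /= normr_le0 subr_eq0 => /eqP.
have cB : compact tilted.
  rewrite E; apply: compact_closedI => //; apply: closedI; apply: closed_bigI => z _; exact: cl2.
have B0 : tilted !=set0.
  exists (fun _ => 0); split => //; first by move=> x; rewrite lexx ler01.
  by move=> x y; rewrite subrr normr0 mulr_ge0 // l1_ge0.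
have ctE : {within tilted, continuous (energy MV : T -> R)}.
  apply/subspace_continuousP => p pb; apply/cvgrPdist_le => e e0.
  have C1 : 0 < 4 * (C + 1) by rewrite mulr_gt0 // ltr_wpDl.
  pose de := e / (4 * (C + 1)); have de0 : 0 < de by rewrite divr_gt0.
  (* A mesh so fine that passing to the nearest grid point changes [p] and [q] together by at most
     [de]. *)
  pose n := (Num.truncn (8 * r * K / de)).+1.
  have n0 : (0 < n)%N by [].
  have N0 : 0 < n%:R :> R by rewrite ltr0n.
  have nK : 8 * r * K / n%:R <= de.
    rewrite ler_pdivrMr // [leRHS]mulrC -ler_pdivrMr //; apply: ltW; exact: truncnS_gt.
  pose g (i j : 'I_n.+1) : plane := (- r + i%:R * (2 * r / n%:R), - r + j%:R * (2 * r / n%:R)).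
  have near_g : nbhs p [set q : T | forall ij : 'I_n.+1 * 'I_n.+1, `|p (g ij.1 ij.2) - q (g ij.1 ij.2)| < de].
    apply: (@filter_forall T _ (fun ij => [set q : T | `|p (g ij.1 ij.2) - q (g ij.1 ij.2)| < de]) (nbhs p) _) => ij.
    exact: (@cvgr_dist_lt _ _ _ (nbhs p) _ _ _ (pc (g ij.1 ij.2) p) _ de0).
  apply: filterS near_g => q H' qb.
  have H i j : `|p (g i j) - q (g i j)| < de := H' (i, j).
  have [_ pl po _] := pb; have [_ ql qo _] := qb.
  have pq x : `|p x - q x| <= 2 * de.
    have [/boxP[]|nb] := pselect (box 0 r x); last by rewrite po // qo // subrr normr0 mulr_ge0 // ltW.
    rewrite !subr0 => x1 x2; have [i hi] := grid_point n0 x1; have [j hj] := grid_point n0 x2.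
    have h1 := pl x (g i j); have h2 := ql (g i j) x; rewrite l1B in h2; have h3 := ltW (H i j).
    have h4 : l1 (x - g i j) <= 2 * (2 * r / n%:R) by rewrite /l1 /=; lra.
    have h5 := ler_wpM2l K0 h4.
    have -> : p x - q x = (p x - p (g i j)) + (p (g i j) - q (g i j)) + (q (g i j) - q x) by ring.
    apply: le_trans (ler_normD _ _) _; apply: le_trans (lerD (ler_normD _ _) (lexx _)) _.
    have h6 : K * (2 * (2 * r / n%:R)) * 2 <= de.
      by apply: le_trans nK; rewrite le_eqVlt; apply/orP; left; apply/eqP; ring.
    by lra.
  have := HC q p (2 * de) qb pb _ pq; rewrite mulr_ge0 ?(ltW de0) // => /(_ isT) h.
  apply: le_trans h _.
  have -> : C * (2 * de) = e * (C / (2 * (C + 1))) by rewrite /de; field; rewrite gt_eqF // ltr_wpDl.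
  rewrite -[leRHS]mulr1; apply: ler_wpM2l; first exact: ltW.
  by rewrite ler_pdivrMr ?mulr_gt0 // ?ltr_wpDl // mul1r; lra.
have [p pb pm] := compact_EVT_max B0 cB ctE.
exists p; first by move: pb; rewrite inE.
by move=> p' pb'; apply: pm; rewrite inE.
Qed.

(** The lower bound [K0] for the Lipschitz constant is there to admit a prescribed competitor. *)
Theorem maximizer (K0 : R) : exists MV K p, [/\ 0 <= MV, 0 <= K, K0 <= K, ball K p &
  (forall p', ball K p' -> energy MV p' <= energy MV p) /\ (forall x, p x = best_reply MV p x)].
Proof.
have [MV [K [MV0 Kg0 KK H]]] := best_reply_ball K0.
have [p pb pm] := maximizer_exists MV0 Kg0.
exists MV, K, p; split => //; split => //.
exact: fixed_point Kg0 pb (H _ pb) pm.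
Qed.

End existence.

(** * Diameter of the support *)

Section pieces.
Variable R : realType.
Notation plane := (R * R)%type.
Implicit Types (x y z v : plane) (f g p : plane -> R).

Definition part (c : plane -> bool) p x : R := if c x then p x else 0.

(** With nonnegative functions of disjoint supports the increments never add up, so the constant
    stays [K] and the rearranged density stays in the ball. *)
Lemma disj_lip (K : R) f g : 0 <= K -> (forall x, 0 <= f x) -> (forall x, 0 <= g x) ->
  (forall x, f x = 0 \/ g x = 0) -> lip K f -> lip K g -> lip K (fun x => f x + g x).
Proof.
move=> K0 f0 g0 fg fl gl x y; have := fl x y; have := gl x y; have := f0 x; have := f0 y; have := g0 x; have := g0 y.
rewrite !ler_norml => a1 a2 a3 a4 /andP[b1 b2] /andP[b3 b4].
by case: (fg x) => e1; case: (fg y) => e2; rewrite e1 e2 in a1 a2 a3 a4 b1 b2 b3 b4 *; apply/andP; split; lra.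
Qed.

(** Cutting along a set of zeros costs nothing: a zero no farther from [x] than [y] is can replace
    [y]. *)
Lemma part_lip (K : R) (c : plane -> bool) p : 0 <= K -> lip K p ->
  (forall x y, c x -> ~~ c y -> exists z, [/\ p z = 0 & l1 (x - z) <= l1 (x - y)]) ->
  lip K (part c p).
Proof.
move=> K0 pl H x y; have n0 : 0 <= K * l1 (x - y) by rewrite mulr_ge0 // l1_ge0.
rewrite /part; case: (boolP (c x)) => cx; case: (boolP (c y)) => cy.
- exact: pl.
- have [z [pz lz]] := H x y cx cy; rewrite subr0 -[p x]subr0 -pz.
  by apply: le_trans (pl _ _) _; exact: ler_wpM2l.
- have [z [pz lz]] := H y x cy cx; rewrite sub0r normrN -[p y]subr0 -pz.
  by apply: le_trans (pl _ _) _; rewrite -(l1B x y) in lz; exact: ler_wpM2l.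
- by rewrite subrr normr0.
Qed.

Lemma between_dist (a t u : R) : (t <= a /\ a <= u) \/ (u <= a /\ a <= t) -> `|t - a| <= `|t - u|.
Proof.
have := ler_norm (t - u); have := ler_norm (u - t); rewrite distrC => h1 h2.
by move=> [[ta au]|[ua at_]]; [rewrite distrC ger0_norm|rewrite ger0_norm]; lra.
Qed.

Lemma part_line1 (a : R) x y : (x.1 <= a /\ a <= y.1) \/ (y.1 <= a /\ a <= x.1) -> l1 (x - (a, x.2)) <= l1 (x - y).
Proof. by move=> /between_dist h; rewrite /l1 /= subrr normr0; apply: lerD. Qed.

Lemma part_line2 (a : R) x y : (x.2 <= a /\ a <= y.2) \/ (y.2 <= a /\ a <= x.2) -> l1 (x - (x.1, a)) <= l1 (x - y).
Proof. by move=> /between_dist h; rewrite /l1 /= subrr normr0; apply: lerD. Qed.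

End pieces.

Lemma energy_arith1 (R : realType) (a b e h k n j L : R) : h <= e -> 2 * k - 2 * n <= b - a ->
  k - n <= 2^-1 * b - h - L * j - (2^-1 * a - e - L * j).
Proof. by move=> *; lra. Qed.

Lemma energy_arith2 (R : realType) (L l i j c d e : R) : - (L * (2 * l) * i * i) <= d ->
  - (L * l * i * j) <= e -> 0 <= L * l * (j * (i + j)) ->
  2 * c - 2 * (L * l * (i + j) ^+ 2) <= 2 * c + d + 2 * e.
Proof. by move=> *; lra. Qed.

Lemma move_sq (R : realType) (X a rho z t : R) : 0 < rho -> z <= - (a + 2 * rho) -> - a <= t ->
  X + (z - (- rho) - t) * (z - (- rho) - t) <= X + (z - t) * (z - t).
Proof.
move=> r0 h1 h2; rewrite lerD2l.
have h3 : 2 * rho <= t - z by lra.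
by have := ler_wpM2l (ltW r0) h3; have := sqr_ge0 rho; lra.
Qed.

Lemma mul_zero_le (R : realType) (a b c : R) : c = 0 -> a * c <= b * c.
Proof. by move=> ->; rewrite !mulr0. Qed.

Lemma abs_sub_le (R : realType) (a t x : R) : 0 <= a -> 0 < t -> a + 2 * t <= x -> `|x - t| <= `|x|.
Proof. by move=> a0 t0 h; rewrite !ger0_norm; lra. Qed.

Lemma abs_add_le (R : realType) (a t x : R) : 0 <= a -> 0 < t -> x <= - (a + 2 * t) -> `|x + t| <= `|x|.
Proof. by move=> a0 t0 h; rewrite !ler0_norm; lra. Qed.

Lemma below_contra (R : realType) (a t x : R) : 0 < t -> x <= - (a + 2 * t) -> - a <= x -> False.
Proof. by move=> t0 h1 h2; lra. Qed.

Lemma below_contra2 (R : realType) (a t x : R) : 0 < t -> x - t <= - (a + 2 * t) -> - a <= x -> False.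
Proof. by move=> t0 h1 h2; lra. Qed.

Lemma abs_up (R : realType) (a rho z : R) : 0 <= a -> 0 < rho -> a + 2 * rho <= z + rho -> `|z| <= `|z + rho|.
Proof. by move=> *; rewrite !ger0_norm; lra. Qed.

Lemma abs_dn (R : realType) (a rho z : R) : 0 <= a -> 0 < rho -> z + (- rho) <= - (a + 2 * rho) -> `|z| <= `|z + (- rho)|.
Proof. by move=> *; rewrite !ler0_norm; lra. Qed.

Lemma two_moves_arith (R : realType) (e0 e1 e2 c1 c2 L : R) : e2 <= e0 -> c1 - L <= e1 - e0 -> c2 - L <= e2 - e1 ->
  0 <= c2 -> c1 <= 2 * L.
Proof. by move=> *; lra. Qed.

(** * Moving one piece of the vortex *)

Section moves.
Variable R : realType.
Notation mR := (measurableTypeR R).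
Notation plane := (mR * mR)%type.
Implicit Types (x y z w u v : plane) (f g h p c : plane -> R).
Variable s : R.
Hypotheses (s0 : 0 < s) (s1 : s <= 1).
Notation pot := (pot s).
Variables (B : plane -> plane -> R) (CB LB : R).
Hypothesis hB : kernel B CB LB.
Let LB0 := kernel_lip0 hB.
Variables (r Lam MV : R).
Hypotheses (r0 : 0 < r) (r1 : 32 * r ^+ 2 <= 1) (Lam0 : 0 < Lam) (MV0 : 0 <= MV).
Notation U := (U s B).
Notation Q := (Q s B).
Notation vort := (vort Lam).
Notation V := (V r MV).
Notation energy := (energy s B r Lam MV).

Lemma vort_ge0 p x : 0 <= vort p x.
Proof. by have /andP[] := vort_bound Lam0 p x. Qed.

Definition mass f := I (fun x => vort f x).

Lemma mass_ge0 f : 0 <= mass f.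
Proof. by apply: I_ge0 => x; exact: vort_ge0. Qed.

Lemma vort_sum f g x : (f x = 0 \/ g x = 0) -> vort (fun y => f y + g y) x = vort f x + vort g x.
Proof. by rewrite /vort => -[] ->; rewrite ?add0r ?addr0 smoothstep0 ?mulr0 ?add0r ?addr0. Qed.

Lemma entropy_sum (a b : R) : (a = 0 \/ b = 0) -> entropy (a + b) = entropy a + entropy b.
Proof. by move=> [] ->; rewrite ?add0r ?addr0 entropy0 ?add0r ?addr0. Qed.

(** The change of the singular interaction between the two pieces when [f] moves by [- v] and [g]
    stays. *)
Definition cross f g v := I (fun x => vort g x * (pot (vort f) (x + v) - pot (vort f) x)).

Lemma bpot_shift f v x y : nice f -> (forall z, 0 <= f z) ->
  `|bpot B (fun z => f (z + v)) x - bpot B f y| <= LB * (l1 v + l1 (x - y)) * I f.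
Proof.
move=> nf f0; have ns := nice_shift v nf.
have [i1 E1] := I_shift (- v) (bpot_ig hB x ns).
have e1 : bpot B (fun z => f (z + v)) x = I (fun z => B x (z - v) * f z).
  by rewrite /bpot -E1; congr I; apply/funext => z; rewrite subrK.
have i2 : ig (fun z => B x (z - v) * f z).
  by move: i1; congr ig; apply/funext => z; rewrite subrK.
have i3 := bpot_ig hB y nf; have iF := nice_ig nf.
rewrite e1 /bpot -IB //; apply: le_trans (I_abs (igB i2 i3)) _; rewrite -IZ //.
apply: I_mono; [exact: ig_abs (igB i2 i3)|exact: igZ|move=> z].
rewrite -mulrBl normrM (ger0_norm (f0 z)); apply: ler_wpM2r => //.
rewrite -[B x _](subrK (B y (z - v))) -addrA; apply: le_trans (ler_normD _ _) _; rewrite mulrDr [leRHS]addrC; apply: lerD.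
  exact: (kernel_lip hB).
rewrite (kernel_sym hB y (z - v)) (kernel_sym hB y z).
apply: le_trans (kernel_lip hB _ _ _) _; apply: ler_wpM2l => //.
by rewrite addrAC subrr add0r l1N.
Qed.

(** A translated piece keeps its entropy and its singular self-interaction, and the wall term does
    not grow. Besides [cross], only the bounded kernel changes, by at most its Lipschitz constant
    times the displacement. *)
Lemma move_energy f g v : nice f -> nice g -> (forall x, 0 <= f x) -> (forall x, 0 <= g x) ->
  (forall x, f x = 0 \/ g x = 0) -> (forall x, f (x + v) = 0 \/ g x = 0) ->
  (forall x, 0 < f x -> V (x - v) <= V x) ->
  let p := fun x => f x + g x in let p' := fun x => f (x + v) + g x in
  [/\ cross f g v - LB * l1 v * mass p ^+ 2 <= energy p' - energy p & mass p' = mass p].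
Proof.
move=> nf ng f0 g0 fg fvg Vm p p'.
have no := vort_nice Lam nf; have ni := vort_nice Lam ng; have nfv := nice_shift v nf.
have no' := nice_shift v no.
pose o := vort f; pose i := vort g; pose o' x := o (x + v).
have ep : vort p = (fun x => o x + i x) by apply/funext => x; exact: vort_sum.
have ep' : vort p' = (fun x => o' x + i x) by apply/funext => x; rewrite (@vort_sum (fun x => f (x + v)) g).
have [_ Eo] := I_shift v (nice_ig no).
have mp : mass p = I o + I i by rewrite /mass ep ID //; exact: nice_ig.
have mp' : mass p' = mass p by rewrite mp /mass ep' ID ?Eo //; exact: nice_ig.
split=> //.
have jf := entropy_nice nf; have jg := entropy_nice ng; have jfv := nice_shift v jf.
have ej : I (fun x => entropy (p' x)) = I (fun x => entropy (p x)).
  have [_ Ej] := I_shift v (nice_ig jf).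
  have -> : (fun x => entropy (p x)) = (fun x => entropy (f x) + entropy (g x)) by apply/funext => x; exact: entropy_sum.
  have -> : (fun x => entropy (p' x)) = (fun x => entropy (f (x + v)) + entropy (g x)) by apply/funext => x; exact: entropy_sum.
  by rewrite (ID (nice_ig jfv) (nice_ig jg)) (ID (nice_ig jf) (nice_ig jg)) Ej.
have nV h : nice h -> nice (fun x => h x * V x) by move=> nh; apply: niceM => //; exact: V_loclip.
have eV : I (fun x => vort p' x * V x) <= I (fun x => vort p x * V x).
  have -> : (fun x => vort p x * V x) = (fun x => o x * V x + i x * V x) by apply/funext => x; rewrite ep mulrDl.
  have -> : (fun x => vort p' x * V x) = (fun x => o' x * V x + i x * V x) by apply/funext => x; rewrite ep' mulrDl.
  rewrite !ID; [|by apply/nice_ig/nV..]; rewrite lerD2r.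
  have [j1 j2] := I_shift (- v) (nice_ig (nV _ no')); rewrite -j2.
  apply: I_mono => //; first exact/nice_ig/nV.
  move=> x; rewrite /o' subrK; have [fx|/eqP] := eqVneq (f x) 0; first by rewrite /o vort_0 // !mul0r.
  by move=> /eqP fx; apply: ler_wpM2l; [exact: vort_ge0|apply: Vm; rewrite lt_neqAle eq_sym fx f0].
have nQ h k : nice h -> nice k -> nice (fun x => k x * pot h x) by move=> nh nk; apply: niceM => //; exact: pot_loclip.
have nb h k : nice h -> nice k -> nice (fun x => k x * bpot B h x) by move=> nh nk; apply: niceM => //; exact: (bpot_loclip hB).
have Qp : Q (vort p') (vort p') - Q (vort p) (vort p) =
  2 * cross f g v + (I (fun x => o' x * bpot B o' x) - I (fun x => o x * bpot B o x))
  + 2 * I (fun x => i x * (bpot B o' x - bpot B o x)).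
  rewrite ep ep' (Q_expand s0 s1 hB no' ni) (Q_expand s0 s1 hB no ni).
  rewrite !(Q_split s0 s1 hB) //.
  have -> : I (fun x => o' x * pot o' x) = I (fun x => o x * pot o x).
    have [_ <-] := I_shift v (nice_ig (nQ _ _ no no)); congr I; apply/funext => x.
    by rewrite pot_shift.
  have -> : cross f g v = I (fun x => i x * pot o' x) - I (fun x => i x * pot o x).
    rewrite -IB; [|exact/nice_ig/nQ|exact/nice_ig/nQ]; congr I; apply/funext => x.
    by rewrite -mulrBr pot_shift.
  have -> : I (fun x => i x * (bpot B o' x - bpot B o x)) = I (fun x => i x * bpot B o' x) - I (fun x => i x * bpot B o x).
    rewrite -IB; [|exact/nice_ig/nb|exact/nice_ig/nb]; congr I; apply/funext => x.
    by rewrite -mulrBr.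
  by move: (I _) (I _) (I _) (I _) (I _) (I _) (I _) (I _) => *; ring.
have o0 x : 0 <= o x := vort_ge0 f x; have i0 x : 0 <= i x := vort_ge0 g x.
have Io0 : 0 <= I o := mass_ge0 f; have Ii0 : 0 <= I i := mass_ge0 g.
have lv := l1_ge0 v.
have h1 : - (LB * (2 * l1 v) * I o * I o) <= I (fun x => o' x * bpot B o' x) - I (fun x => o x * bpot B o x).
  have [j1 <-] := I_shift (- v) (nice_ig (nb _ _ no' no')).
  rewrite -IB //; last exact/nice_ig/nb.
  rewrite -mulNr -(IZ (- (LB * (2 * l1 v) * I o)) (nice_ig no)).
  apply: I_mono; [exact/igZ/nice_ig|by apply: igB => //; exact/nice_ig/nb|move=> x].
  rewrite subrK -mulrBr mulrC; apply: ler_wpM2l => //.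
  have := bpot_shift v (x - v) x no o0.
  have -> : l1 (x - v - x) = l1 v by rewrite addrAC subrr add0r l1N.
  by rewrite ler_norml => /andP[h _]; move: h; have -> : l1 v + l1 v = 2 * l1 v by ring.
have h2 : - (LB * l1 v * I o * I i) <= I (fun x => i x * (bpot B o' x - bpot B o x)).
  rewrite -mulNr -(IZ (- (LB * l1 v * I o)) (nice_ig ni)).
  apply: I_mono; [exact/igZ/nice_ig| |move=> x].
    have := igB (nice_ig (nb _ _ no' ni)) (nice_ig (nb _ _ no ni)).
    by congr ig; apply/funext => x; rewrite -mulrBr.
  rewrite mulrC; apply: ler_wpM2l => //.
  have := bpot_shift v x x no o0; rewrite subrr l1_0 addr0.
  by rewrite ler_norml => /andP[h _].
have lvo : 0 <= LB * l1 v * (I i * (I o + I i)) by nneg.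
rewrite /energy ej mp.
suff : 2 * cross f g v - 2 * (LB * l1 v * (I o + I i) ^+ 2) <= Q (vort p') (vort p') - Q (vort p) (vort p).
  by move=> h; exact: energy_arith1.
rewrite Qp; exact: energy_arith2 h1 h2 lvo.
Qed.

(** Disjointness after the move keeps the new distance positive, away from the conventional value of
    the kernel at the origin. *)
Lemma cross_pointwise f g v x y : (forall x, f (x + v) = 0 \/ g x = 0) ->
  (forall x y, 0 < f x -> 0 < g y -> dot (x - v - y) (x - v - y) <= dot (x - y) (x - y)) ->
  (forall x, f x = 0 \/ g x = 0) ->
  0 < f y -> 0 < g x ->
  [/\ 0 < dot (x + v - y) (x + v - y), dot (x + v - y) (x + v - y) <= dot (x - y) (x - y) &
      dot (x + v - y) (x + v - y) = dot (y - v - x) (y - v - x)].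
Proof.
move=> fvg fd fg fy gx.
have E : dot (x + v - y) (x + v - y) = dot (y - v - x) (y - v - x) by rewrite /dot /=; ring.
have E2 : dot (x - y) (x - y) = dot (y - x) (y - x) by rewrite /dot /=; ring.
split => //; last by rewrite E E2; exact: fd.
apply: n2_gt0; apply/eqP => e.
have e' : y = x + v by apply/eqP; rewrite eq_sym -subr_eq0; apply/eqP.
by case: (fvg x) => h; [rewrite -e' in h; rewrite h ltxx in fy|rewrite h ltxx in gx].
Qed.

Lemma cross_ge0 f g v : nice f -> nice g -> (forall x, 0 <= f x) -> (forall x, 0 <= g x) ->
  (forall x, f x = 0 \/ g x = 0) -> (forall x, f (x + v) = 0 \/ g x = 0) ->
  (forall x y, 0 < f x -> 0 < g y -> dot (x - v - y) (x - v - y) <= dot (x - y) (x - y)) ->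
  0 <= cross f g v.
Proof.
move=> nf ng f0 g0 fg fvg fd; apply: I_ge0 => x.
have [gx|gx] := eqVneq (g x) 0; first by rewrite vort_0 // mul0r.
have gx0 : 0 < g x by rewrite lt_neqAle eq_sym gx g0.
apply: mulr_ge0; first exact: vort_ge0.
have no := vort_nice Lam nf.
rewrite subr_ge0; apply: I_mono; [exact: pot_ig|exact: pot_ig|move=> y].
have [fy|fy] := eqVneq (f y) 0; first exact: mul_zero_le (vort_0 Lam fy).
have fy0 : 0 < f y by rewrite lt_neqAle eq_sym fy f0.
apply: ler_wpM2r; first exact: vort_ge0.
by rewrite !G_gam; have [h1 h2 _] := cross_pointwise fvg fd fg fy0 gx0; exact: gam_anti.
Qed.

Definition lmass p z (rho : R) := I (fun x => \1_(box z rho) x * vort p x).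

Lemma lmass_ig p z rho : nice p -> ig (fun x => \1_(box z rho) x * vort p x).
Proof.
move=> np; have no := vort_nice Lam np.
apply: ig_le (nice_ig no) _.
  apply: measurable_funM; last exact: nice_measurable.
  by apply: measurable_indic; exact: measurable_box.
by move=> x; rewrite normrM (ger0_norm (vort_ge0 _ _)) indicE; case: (_ \in _); rewrite ?normr1 ?normr0 ?mul1r ?mul0r ?vort_ge0.
Qed.

Lemma lmass_ge0 p z rho : 0 <= lmass p z rho.
Proof. by apply: I_ge0 => x; rewrite mulr_ge0 ?vort_ge0 // indicE. Qed.

(** No pair of points gets farther apart, and pairs from the two boxes come closer by [de] in
    squared distance. The slope of [gam] is at least its value at [8 * r ^+ 2], which bounds the
    squared distances in the box. *)
Lemma cross_gain f g v (zf zg : plane) (rho de : R) : 0 <= de -> nice f -> nice g -> (forall x, 0 <= f x) -> (forall x, 0 <= g x) ->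
  (forall x, f x = 0 \/ g x = 0) -> (forall x, f (x + v) = 0 \/ g x = 0) ->
  (forall x, 0 < f x -> box 0 r x) -> (forall x, 0 < g x -> box 0 r x) ->
  (forall x y, 0 < f x -> 0 < g y -> dot (x - v - y) (x - v - y) <= dot (x - y) (x - y)) ->
  (forall x y, 0 < f x -> 0 < g y -> box zf rho x -> box zg rho y ->
     dot (x - v - y) (x - v - y) <= dot (x - y) (x - y) - de) ->
  kap s * (8 * r ^+ 2) `^ (s - 2) * de * lmass f zf rho * lmass g zg rho <= cross f g v.
Proof.
move=> de0 nf ng f0 g0 fg fvg fr gr fd fd'.
have no := vort_nice Lam nf; have ni := vort_nice Lam ng.
set k := kap s * _ * de; have k0 : 0 <= k by rewrite /k; have kp := ltW (kap_gt0 s0 s1); nneg.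
have iO := lmass_ig zf rho nf; have iI := lmass_ig zg rho ng.
rewrite {2}/lmass -IZ //; apply: I_mono; first exact: igZ.
  have nQ h : nice h -> nice (fun x => vort g x * pot h x) by move=> nh; apply: niceM => //; exact: pot_loclip.
  have := igB (nice_ig (nQ _ (nice_shift v no))) (nice_ig (nQ _ no)).
  by congr ig; apply/funext => x; rewrite -mulrBr pot_shift.
move=> x; have [gx|gx] := eqVneq (g x) 0; first by rewrite vort_0 // !(mul0r, mulr0).
have gx0 : 0 < g x by rewrite lt_neqAle eq_sym gx g0.
rewrite [leRHS]mulrC mulrA; apply: ler_wpM2r; first exact: vort_ge0.
rewrite indicE; have [bx|nb] := pselect (box zg rho x); last first.
  rewrite memNset // mulr0 subr_ge0; apply: I_mono; [exact: pot_ig|exact: pot_ig|move=> y].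
  have [fy|fy] := eqVneq (f y) 0; first exact: mul_zero_le (vort_0 Lam fy).
  have fy0 : 0 < f y by rewrite lt_neqAle eq_sym fy f0.
  apply: ler_wpM2r; first exact: vort_ge0.
  by rewrite !G_gam; have [h1 h2 _] := cross_pointwise fvg fd fg fy0 gx0; exact: gam_anti.
rewrite mem_set // mulr1 /lmass /pot -IB; [|exact: pot_ig|exact: pot_ig].
rewrite -IZ //; apply: I_mono; [exact: igZ|by apply: igB; exact: pot_ig|move=> y].
have [fy|fy] := eqVneq (f y) 0; first by rewrite vort_0 // !(mul0r, mulr0) subrr.
have fy0 : 0 < f y by rewrite lt_neqAle eq_sym fy f0.
rewrite -mulrBl mulrA; apply: ler_wpM2r; first exact: vort_ge0.
have [h1 h2 h3] := cross_pointwise fvg fd fg fy0 gx0; rewrite !G_gam.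
rewrite indicE; have [b_y|nb] := pselect (box zf rho y); last first.
  by rewrite memNset // mulr0 subr_ge0; exact: gam_anti.
rewrite mem_set // mulr1; have /andP[h4 _] := gam_bounds s0 s1 h1 h2; apply: le_trans h4.
have h5 := box_sub_dot (gr _ gx0) (fr _ fy0).
have h6 : de <= dot (x - y) (x - y) - dot (x + v - y) (x + v - y).
  have E2 : dot (x - y) (x - y) = dot (y - x) (y - x) by rewrite /dot /=; ring.
  by rewrite h3 E2; have := fd' _ _ fy0 gx0 b_y bx; lra.
have kp := ltW (kap_gt0 s0 s1).
rewrite /k; apply: ler_pM => //; first by nneg.
apply: ler_wpM2l => //; apply: powS2_anti => //; exact: lt_le_trans h2.
Qed.

Definition amass p (A : set plane) := I (fun x => \1_A x * vort p x).

Lemma amass_ig p (A : set plane) : nice p -> measurable A -> ig (fun x => \1_A x * vort p x).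
Proof.
move=> np mA; have no := vort_nice Lam np.
apply: ig_le (nice_ig no) _.
  by apply: measurable_funM; [exact: measurable_indic|exact: nice_measurable].
by move=> x; rewrite normrM (ger0_norm (vort_ge0 _ _)) indicE; case: (_ \in _); rewrite ?normr1 ?normr0 ?mul1r ?mul0r ?vort_ge0.
Qed.

Lemma amass_le p (A : set plane) : nice p -> measurable A -> amass p A <= mass p.
Proof.
move=> np mA; apply: I_mono; [exact: amass_ig|exact: nice_ig (vort_nice Lam np)|move=> x].
by rewrite indicE; case: (_ \in _); rewrite ?mul1r ?mul0r ?vort_ge0.
Qed.

Lemma amass_add p (A A' C : set plane) : nice p -> measurable A -> measurable A' -> measurable C ->
  A `<=` C -> A' `<=` C -> (forall x, A x -> A' x -> False) -> amass p A + amass p A' <= amass p C.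
Proof.
move=> np mA mA' mC AC A'C AA'; rewrite -ID; [|exact: amass_ig|exact: amass_ig].
apply: I_mono; [by apply: igD; exact: amass_ig|exact: amass_ig|move=> x].
rewrite -mulrDl; apply: ler_wpM2r; first exact: vort_ge0.
rewrite !indicE; have [Ax|nA] := pselect (A x); have [A'x|nA'] := pselect (A' x).
- by case: (AA' x Ax A'x).
- by rewrite (mem_set Ax) (memNset nA') (mem_set (AC _ Ax)) addr0.
- by rewrite (mem_set A'x) (memNset nA) (mem_set (A'C _ A'x)) add0r.
- by rewrite (memNset nA) (memNset nA') addr0; case: (_ \in _).
Qed.

(** * A maximizer has no gaps *)

Section gaps.
Variables (K : R) (p : plane -> R) (be rho : R).
Hypotheses (K0 : 0 <= K) (pb : ball r K p) (Emax : forall p', ball r K p' -> energy p' <= energy p)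
  (m0 : 0 < mass p) (be0 : 0 < be) (rho0 : 0 < rho)
  (conc : forall x, 0 < p x -> be * mass p <= lmass p x rho)
  (gapc : 2 * LB < kap s * (8 * r ^+ 2) `^ (s - 2) * rho * be ^+ 2).
Let p01 x : 0 <= p x. Proof. by case: pb => /(_ x) /andP[]. Qed.
Let np : nice p. Proof. exact: (ball_nice r0 K0 pb). Qed.
Let pbox x : 0 < p x -> box 0 r x.
Proof. by case: pb => _ _ h _ px; apply: contrapT => nb; rewrite h // ltxx in px. Qed.
Let ppos x : p x <> 0 -> 0 < p x.
Proof. by move=> h; rewrite lt_neqAle p01 andbT eq_sym; apply/eqP. Qed.

Lemma part_nice (c : plane -> bool) : lip K (part c p) -> nice (part c p).
Proof.
case: pb => h1 _ h3 _ pl; exists r, 1, K; split; rewrite ?(ltW r0) //; split => // x.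
  by rewrite /part; case: ifP; rewrite ?normr0 // => _; have /andP[a b] := h1 x; rewrite ger0_norm.
by move=> nb; rewrite /part h3 // if_same.
Qed.

Lemma part_ge0 (c : plane -> bool) x : 0 <= part c p x.
Proof. by rewrite /part; case: ifP. Qed.

Lemma part_le1 (c : plane -> bool) x : part c p x <= 1.
Proof. by rewrite /part; case: ifP => // _; case: pb => /(_ x) /andP[]. Qed.

Lemma lmass_eq f g z : (forall x, box z rho x -> f x = g x) -> lmass f z rho = lmass g z rho.
Proof.
move=> h; congr I; apply/funext => x; rewrite indicE; have [bx|nb] := pselect (box z rho x).
  by rewrite /vort h.
by rewrite memNset // !mul0r.
Qed.

(** Here [gapc] enters: closing a gap by [rho] gains more than the bounded kernel can take back. The
    factor [2] allows for two successive moves. *)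
Lemma gap_contra (c X : R) : 0 <= c -> c <= 2 * (LB * rho * mass p ^+ 2) ->
  kap s * (8 * r ^+ 2) `^ (s - 2) * rho ^+ 2 * X <= c -> (be * mass p) ^+ 2 <= X -> False.
Proof.
move=> c0 h1 h2 h3; have kp := ltW (kap_gt0 s0 s1).
move: gapc h2; set k := kap s * _ => gc h2; have k0 : 0 <= k by rewrite /k; nneg.
have h4 : k * rho ^+ 2 * (be * mass p) ^+ 2 <= k * rho ^+ 2 * X by apply: ler_wpM2l => //; nneg.
have h5 : 0 < rho * mass p ^+ 2 by rewrite mulr_gt0 // exprn_gt0.
have : 2 * LB * (rho * mass p ^+ 2) < k * rho * be ^+ 2 * (rho * mass p ^+ 2) by rewrite ltr_pM2r.
have -> : k * rho * be ^+ 2 * (rho * mass p ^+ 2) = k * rho ^+ 2 * (be * mass p) ^+ 2 by ring.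
have -> : 2 * LB * (rho * mass p ^+ 2) = 2 * (LB * rho * mass p ^+ 2) by ring.
by move: h1 h2 h4; move: (LB * rho * mass p ^+ 2) (k * rho ^+ 2 * X) (k * rho ^+ 2 * (be * mass p) ^+ 2) => *; lra.
Qed.

(** If the strip were empty, the piece beyond it could move inwards by [rho]. The sign [sg] chooses
    the side, and [0 <= a + rho] ensures that the move is towards the axis, where the wall is
    lower. *)
Lemma no_gap1 (sg a : R) x y : sg = 1 \/ sg = -1 -> 0 <= a + rho -> 0 < p x -> sg * x.1 <= a ->
  0 < p y -> a + 2 * rho <= sg * y.1 -> exists z, 0 < p z /\ a < sg * z.1 < a + 2 * rho.
Proof.
move=> sgE a0 px xa py ya; apply: contrapT => ng.
have sg2 : sg * sg = 1 by case: sgE => ->; rewrite ?mulrNN mulr1.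
have ns t : `|sg * t| = `|t| by case: sgE => ->; rewrite ?mulN1r ?normrN ?mul1r.
have gap z : p z <> 0 -> sg * z.1 <= a \/ a + 2 * rho <= sg * z.1.
  move=> /ppos pz; case: (leP (sg * z.1) a) => h1; first by left.
  right; rewrite leNgt; apply/negP => h2; apply: ng; exists z; split => //; exact/andP.
pose c z := a + rho < sg * z.1.
pose f := part c p; pose g := part (fun z => ~~ c z) p.
have p0 z : sg * z.1 = a + rho -> p z = 0.
  by move=> h; apply: contrapT => /gap; rewrite h => -[] h'; have := rho0; lra.
have line (z w : plane) : c z -> ~~ c w -> (z.1 <= sg * (a + rho) /\ sg * (a + rho) <= w.1) \/ (w.1 <= sg * (a + rho) /\ sg * (a + rho) <= z.1).
  by rewrite /c -leNgt; case: sgE => ->; rewrite ?mul1r ?mulN1r => h1 h2; [right|left]; lra.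
have z0 (w : plane) : p (sg * (a + rho), w.2) = 0 by apply: p0; rewrite /= mulrA sg2 mul1r.
have [h1 pl h3 pe] := pb.
have fl : lip K f.
  by apply: part_lip => // z w cz cw; exists (sg * (a + rho), z.2); split => //; apply: part_line1; exact: line.
have gl : lip K g.
  apply: part_lip => // z w cz; rewrite negbK => cw; exists (sg * (a + rho), z.2); split => //; apply: part_line1.
  by have := line _ _ cw cz; tauto.
have nf := part_nice fl; have ng' := part_nice gl.
have f0 := part_ge0 c; have g0 := part_ge0 (fun z => ~~ c z); rewrite -/f in f0; rewrite -/g in g0.
have pE : p = (fun z => f z + g z).
  by apply/funext => z; rewrite /f /g /part; case: (c z); rewrite /= ?addr0 ?add0r.
pose v : plane := (sg * rho, 0).
have fsup z : f z <> 0 -> 0 < p z /\ a + 2 * rho <= sg * z.1.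
  rewrite /f /part; case: ifP => //; rewrite /c => cz pz; split; first exact: ppos.
  by case: (gap _ pz) => // h; have := rho0; lra.
have gsup z : g z <> 0 -> 0 < p z /\ sg * z.1 <= a.
  rewrite /g /part; case: ifP => //; rewrite /c -leNgt => cz pz; split; first exact: ppos.
  by case: (gap _ pz) => // h; have := rho0; lra.
have lt_ne (q : plane -> R) z : 0 < q z -> q z <> 0 by move=> h h'; rewrite h' ltxx in h.
have sv z : sg * (z + v).1 = sg * z.1 + rho by rewrite /= mulrDr mulrA sg2 mul1r.
have fg z : f z = 0 \/ g z = 0 by rewrite /f /g /part; case: (c z); [right|left].
have fvg z : f (z + v) = 0 \/ g z = 0.
  have [|/eqP fz] := eqVneq (f (z + v)) 0; [by left|right].
  apply: contrapT => /gsup[_ gz]; have [_] := fsup _ fz; rewrite sv => fz'; have := rho0; lra.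
have dd z w : 0 < f z -> 0 < g w -> dot (z - v - w) (z - v - w) <= dot (z - w) (z - w) - rho ^+ 2.
  move=> /lt_ne/fsup[_ fz] /lt_ne/gsup[_ gw]; rewrite /dot /=.
  have D : 2 * rho <= sg * z.1 - sg * w.1 by lra.
  have -> : (z.1 - sg * rho - w.1) * (z.1 - sg * rho - w.1) + (z.2 - 0 - w.2) * (z.2 - 0 - w.2) =
    (z.1 - w.1) * (z.1 - w.1) + (z.2 - w.2) * (z.2 - w.2) - (2 * rho * (sg * z.1 - sg * w.1) - (sg * sg) * rho ^+ 2) by ring.
  by rewrite sg2 mul1r; have := ler_wpM2l (ltW rho0) D; have := sqr_ge0 rho; lra.
have dd0 z w : 0 < f z -> 0 < g w -> dot (z - v - w) (z - v - w) <= dot (z - w) (z - w).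
  by move=> fz gw; have := dd z w fz gw; have := sqr_ge0 rho; lra.
have Vm z : 0 < f z -> V (z - v) <= V z.
  move=> /lt_ne/fsup[_ fz]; rewrite /V; apply: ler_wpM2l => //; rewrite /= subr0 lerD2r; apply: wall_mono => //.
  have -> : `|z.1| = `|sg * z.1| by case: sgE => ->; rewrite ?mul1r // mulN1r normrN.
  have -> : `|z.1 - sg * rho| = `|sg * z.1 - rho|.
    by case: sgE => ->; rewrite ?mul1r // !mulN1r opprK -opprD normrN.
  rewrite !ger0_norm; have := rho0; lra.
have [] := move_energy nf ng' f0 g0 fg fvg Vm; rewrite -pE => E _.
set p' := fun z => f (z + v) + g z in E.
have bp' : ball r K p'.
  split.
  - move=> z; rewrite /p'; case: (fvg z) => ->; rewrite ?add0r ?addr0 ?f0 ?g0 /=; exact: part_le1.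
  - apply: disj_lip => // z w.
    by have := fl (z + v) (w + v); rewrite opprD addrACA subrr addr0.
  - move=> z nb; have -> : p' z = f (z + v) by rewrite /p' /g /part h3 // if_same addr0.
    apply: contrapT => /fsup[/pbox/boxP[]]; rewrite !subr0 sv /= addr0 => b1 b2 b3; apply: nb; apply/boxP; rewrite !subr0; split => //.
    have : `|sg * (z.1 + sg * rho)| <= r by rewrite ns.
    rewrite mulrDr mulrA sg2 mul1r ler_norml => /andP[_ b4].
    have -> : `|z.1| = `|sg * z.1| by case: sgE => ->; rewrite ?mul1r // mulN1r normrN.
    by rewrite ger0_norm; have := rho0; lra.
  - have fe t : f (ry t) = f t by rewrite /f /part /c /= pe.
    have ge t : g (ry t) = g t by rewrite /g /part /c /= pe.
    have rv z : ry z + v = ry (z + v) by rewrite /ry /v; apply: injective_projections => /=; ring.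
    by move=> z; rewrite /p' rv fe ge.
have Em := Emax bp'.
have fr z : 0 < f z -> box 0 r z by move=> /lt_ne/fsup[/pbox].
have gr z : 0 < g z -> box 0 r z by move=> /lt_ne/gsup[/pbox].
have C := cross_gain (zf := y) (zg := x) (rho := rho) (sqr_ge0 rho) nf ng' f0 g0 fg fvg fr gr dd0 (fun z w fz gw _ _ => dd z w fz gw).
have bs (z w : plane) : box z rho w -> `|sg * w.1 - sg * z.1| <= rho.
  by move=> /boxP[h _]; rewrite -mulrBr; case: sgE => ->; rewrite ?mul1r // mulN1r normrN.
have lf : lmass f y rho = lmass p y rho.
  apply: lmass_eq => z /bs; rewrite ler_norml => /andP[b1 b2]; rewrite /f /part; case: ifP => // /negbT; rewrite -leNgt => cz.
  by apply/esym; apply: contrapT => /gap[] h; have := rho0; lra.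
have lg : lmass g x rho = lmass p x rho.
  apply: lmass_eq => z /bs; rewrite ler_norml => /andP[b1 b2]; rewrite /g /part; case: ifP => // /negbT; rewrite negbK => cz.
  by apply/esym; apply: contrapT => /gap[] h; have := rho0; rewrite /c in cz; lra.
rewrite lf lg in C.
have lv : l1 v = rho.
  by rewrite /l1 /= normr0 addr0; case: sgE => ->; rewrite ?mul1r ?mulN1r ?normrN gtr0_norm.
rewrite lv in E.
have bm : 0 <= be * mass p by rewrite mulr_ge0 // ltW.
have P2 : (be * mass p) ^+ 2 <= lmass p y rho * lmass p x rho.
  by rewrite expr2; apply: ler_pM => //; exact: conc.
have c0 : 0 <= cross f g v by exact: cross_ge0.
apply: (gap_contra c0 _ _ P2); last by rewrite mulrA.
have : 0 <= LB * rho * mass p ^+ 2 by have := ltW rho0; have := mass_ge0 p => *; nneg.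
by move: Em E; move: (energy _) (energy _) (cross _ _ _) (LB * _ * _) => *; lra.
Qed.

(** Evenness in [x_2] must be preserved, so the upper and the lower outer pieces both move towards
    the axis, one after the other. The first move has a strict gain, the second a nonnegative
    one. *)
Lemma no_gap2 (a : R) y : 0 <= a -> 0 < p y -> a + 2 * rho <= `|y.2| ->
  exists z, 0 < p z /\ a < `|z.2| < a + 2 * rho.
Proof.
have [h1 pl h3 pe] := pb.
move=> a0 py0 ya0; have [y' [py ya]] : exists y', 0 < p y' /\ a + 2 * rho <= y'.2.
  case: (leP 0 y.2) => h; first by exists y; rewrite ger0_norm // in ya0.
  by exists (ry y); rewrite pe; split => //; rewrite ltr0_norm // in ya0.
move: y' py ya {py0 ya0 y} => y py ya; apply: contrapT => ng.
have rp := rho0.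
have gap z : p z <> 0 -> `|z.2| <= a \/ a + 2 * rho <= `|z.2|.
  move=> /ppos pz; case: (leP `|z.2| a) => h; first by left.
  right; rewrite leNgt; apply/negP => h2; apply: ng; exists z; split => //; exact/andP.
pose cu z := a + rho < z.2; pose cm z := `|z.2| <= a + rho.
pose u := part cu p; pose w x := u (ry x); pose m := part cm p.
have p0 z : `|z.2| = a + rho -> p z = 0.
  by move=> h; apply: contrapT => /gap; rewrite h => -[] h'; lra.
have ar : 0 <= a + rho by lra.
have pz1 t : p (t, a + rho) = 0 by apply: p0; rewrite /= ger0_norm.
have pz2 t : p (t, - (a + rho)) = 0 by apply: p0; rewrite /= normrN ger0_norm.
have ul : lip K u.
  apply: part_lip => // z t; rewrite /cu -leNgt => cz ct; exists (z.1, a + rho); split => //.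
  by apply: part_line2; right; lra.
have ml : lip K m.
  apply: part_lip => // z t; rewrite /cm -ltNge ler_norml => /andP[c1 c2].
  rewrite lter_normr => /orP[] ct.
    by exists (z.1, a + rho); split => //; apply: part_line2; left; lra.
  by exists (z.1, - (a + rho)); split => //; apply: part_line2; right; lra.
have ryl z t : l1 (ry z - ry t) = l1 (z - t) by rewrite /l1 /= -opprD normrN.
have wl : lip K w by move=> z t; apply: le_trans (ul _ _) _; rewrite ryl.
have ryK z : ry (ry z) = z by rewrite /ry /= opprK -surjective_pairing.
have nu := part_nice ul; have nm := part_nice ml; rewrite -/u in nu; rewrite -/m in nm.
have nw : nice w.
  have [M [C [L [M0 C0 L0 [u1 u2 u3]]]]] := nu; exists M, C, L; split=> //; split => [z|z t|z nb]; first exact: u1.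
    by apply: le_trans (u2 _ _) _; rewrite ryl.
  apply: u3 => /boxP[]; rewrite !subr0 normrN => b1 b2; apply: nb; apply/boxP; rewrite !subr0; split => //.
have u0 z : 0 <= u z := part_ge0 cu z; have mm0 z : 0 <= m z := part_ge0 cm z; have w0 z : 0 <= w z := u0 (ry z).
have usup z : u z <> 0 -> 0 < p z /\ a + 2 * rho <= z.2.
  rewrite /u /part; case: ifP => //; rewrite /cu => cz pz; split; first exact: ppos.
  by case: (gap _ pz) => //; rewrite ger0_norm; lra.
have wsup z : w z <> 0 -> 0 < p z /\ z.2 <= - (a + 2 * rho).
  by move=> /usup[]; rewrite pe /= => h; lra.
have msup z : m z <> 0 -> 0 < p z /\ `|z.2| <= a.
  rewrite /m /part; case: ifP => //; rewrite /cm => cz pz; split; first exact: ppos.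
  by case: (gap _ pz) => // h; lra.
have lt_ne (q : plane -> R) z : 0 < q z -> q z <> 0 by move=> h h'; rewrite h' ltxx in h.
have cases z : [\/ [/\ u z = p z, w z = 0 & m z = 0], [/\ u z = 0, w z = p z & m z = 0] | [/\ u z = 0, w z = 0 & m z = p z]].
  case: (leP z.2 (a + rho)) => c1; last first.
    constructor 1; rewrite /w /u /m /part /cu /cm /= c1 [in _ = 0]ifF; last by apply/negbTE; rewrite -leNgt; lra.
    by split=> //; rewrite ifF //; apply/negbTE; rewrite -ltNge lter_normr c1.
  case: (leP (- (a + rho)) z.2) => c2; last first.
    constructor 2; rewrite /w /u /m /part /cu /cm /= ifF; last by apply/negbTE; rewrite -leNgt.
    rewrite ifT; last by lra.
    by split=> //; rewrite ifF //; apply/negbTE; rewrite -ltNge lter_normr; apply/orP; right; lra.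
  constructor 3; rewrite /w /u /m /part /cu /cm /= ifF; last by apply/negbTE; rewrite -leNgt.
  rewrite ifF; last by apply/negbTE; rewrite -leNgt; lra.
  by rewrite ifT // ler_norml; apply/andP.
pose g z := w z + m z; pose v : plane := (0, rho).
have pE : p = (fun z => u z + g z).
  by apply/funext => z; rewrite /g; case: (cases z) => -[-> -> ->]; rewrite ?addr0 ?add0r.
have ng' : nice g by exact: niceD.
have g0 z : 0 <= g z by rewrite addr_ge0.
have wm z : w z = 0 \/ m z = 0 by case: (cases z) => -[_ ? ?]; tauto.
have gsup z : g z <> 0 -> 0 < p z /\ z.2 <= a.
  rewrite /g; case: (wm z) => ->; rewrite ?add0r ?addr0; [move=> /msup|move=> /wsup] => -[h h']; split => //; last by lra.
  by move: h'; rewrite ler_norml => /andP[].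
have ug z : u z = 0 \/ g z = 0.
  by rewrite /g; case: (cases z) => -[h5 h6 h7]; [right|left|left]; rewrite ?h6 ?h7 ?addr0.
have uvg z : u (z + v) = 0 \/ g z = 0.
  have [|/eqP fz] := eqVneq (u (z + v)) 0; [by left|right].
  apply: contrapT => /gsup[_ gz]; have [_] := usup _ fz; rewrite /= => fz'; lra.
have lf : lmass u y rho = lmass p y rho.
  apply: lmass_eq => z /boxP[_]; rewrite ler_norml => /andP[b1 b2]; rewrite /u /part; case: ifP => // /negbT; rewrite /cu -leNgt => cz.
  by apply/esym; apply: contrapT => /gap; rewrite ger0_norm; [move=> [] ?; lra|lra].
have lg : lmass g (ry y) rho = lmass p (ry y) rho.
  apply: lmass_eq => z /boxP[_]; rewrite /= ler_norml => /andP[b1 b2].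
  have uz : u z = 0 by rewrite /u /part /cu; case: ifP => // ?; lra.
  by rewrite [in RHS]pE uz add0r.
have D2 (b c : R) : 2 * rho <= b - c -> (b - rho - c) * (b - rho - c) <= (b - c) * (b - c) - rho ^+ 2.
  by move=> h; have := ler_wpM2l (ltW rp) h; have := sqr_ge0 rho; lra.
have dd z t : 0 < u z -> 0 < g t -> dot (z - v - t) (z - v - t) <= dot (z - t) (z - t) - rho ^+ 2.
  move=> /lt_ne/usup[_ fz] /lt_ne/gsup[_ gt]; rewrite /dot /= subr0.
  have zt : 2 * rho <= z.2 - t.2 by lra.
  by have := D2 _ _ zt; lra.
have dd0 z t : 0 < u z -> 0 < g t -> dot (z - v - t) (z - v - t) <= dot (z - t) (z - t).
  by move=> fz gt; have := dd z t fz gt; have := sqr_ge0 rho; lra.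
have Vm z : 0 < u z -> V (z - v) <= V z.
  move=> /lt_ne/usup[_ fz]; rewrite /V; apply: ler_wpM2l => //; rewrite /= subr0 lerD2l; apply: wall_mono => //.
  exact: abs_sub_le a0 rp fz.
have [] := move_energy nu ng' u0 g0 ug uvg Vm; rewrite -pE => E1 M1.
(* The intermediate density [p1] is not even and hence not in the ball; it is compared through
   [move_energy] only, and maximality is used for [p2]. *)
pose h z := m z + u (z + v); pose p1 z := u (z + v) + g z.
have p1E : p1 = (fun z => w z + h z) by apply/funext => z; rewrite /p1 /g /h; ring.
have mu z : m z = 0 \/ u (z + v) = 0.
  case: (uvg z) => //; [by right|rewrite /g => hz; left].
  by have := w0 z; have := mm0 z; lra.
have nh : nice h by apply: niceD => //; exact: nice_shift.
have h0 z : 0 <= h z by rewrite addr_ge0.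
have hsup z : h z <> 0 -> - a <= z.2.
  rewrite /h; case: (mu z) => ->; rewrite ?add0r ?addr0; [move=> /usup|move=> /msup] => -[_]; rewrite /=; first by lra.
  by rewrite ler_norml => /andP[].
have wh z : w z = 0 \/ h z = 0.
  have [|/eqP wz] := eqVneq (w z) 0; [by left|right]; apply: contrapT => /hsup h9; have [_ h8] := wsup _ wz; exact: below_contra rp h8 h9.
have wvh z : w (z + (0, - rho)) = 0 \/ h z = 0.
  have [|/eqP wz] := eqVneq (w (z + (0, - rho))) 0; [by left|right]; apply: contrapT => /hsup h9; have [_ h8] := wsup _ wz; exact: below_contra2 rp h8 h9.
have Vm2 z : 0 < w z -> V (z - (0, - rho)) <= V z.
  move=> /lt_ne/wsup[_ fz]; rewrite /V; apply: ler_wpM2l => //; rewrite /= subr0 lerD2l opprK; apply: wall_mono => //.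
  exact: abs_add_le a0 rp fz.
have [] := move_energy nw nh w0 h0 wh wvh Vm2; rewrite -p1E => E2 M2.
set p2 := fun z => _ in E2.
have C2 : 0 <= cross w h (0, - rho).
  apply: cross_ge0 => // z t /lt_ne/wsup[_ wz] /lt_ne/hsup ht.
  by rewrite /dot /= subr0; exact: move_sq rp wz ht.
have bp2 : ball r K p2.
  have hl : lip K h.
    apply: disj_lip => // z t.
    by have := ul (z + v) (t + v); rewrite opprD addrACA subrr addr0.
  split.
  - move=> z; rewrite /p2; case: (wvh z) => ->; rewrite ?add0r ?addr0 ?h0 ?w0 /=; last exact: part_le1.
    rewrite /h; case: (mu z) => ->; rewrite ?add0r ?addr0; exact: part_le1.
  - apply: disj_lip => // z t.
    by have := wl (z + (0, - rho)) (t + (0, - rho)); rewrite opprD addrACA subrr addr0.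
  - have off z t : 0 < p (z + (0, t)) -> `|z.2| <= `|z.2 + t| -> box 0 r z.
      by move=> /pbox/boxP[]; rewrite !subr0 /= addr0 => b1 b2 b3; apply/boxP; rewrite !subr0; split => //; exact: le_trans b2.
    move=> z nb; apply: contrapT; rewrite /p2; case: (wvh z) => ->; rewrite ?add0r ?addr0.
      rewrite /h; case: (mu z) => ->; rewrite ?add0r ?addr0; last first.
        by move=> /msup[/pbox].
      move=> /usup[pz tz]; apply: nb; apply: (off z rho pz); move: tz => /= tz.
      exact: abs_up a0 rp tz.
    move=> /wsup[pz tz]; apply: nb; apply: (off z (- rho) pz); move: tz => /= tz.
    exact: abs_dn a0 rp tz.
  - move=> z; rewrite /p2 /h.
    have me : m (ry z) = m z by rewrite /m /part /cm /= normrN pe.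
    have e1 : w (ry z + (0, - rho)) = u (z + v) by rewrite /w; congr u; rewrite /ry /v; apply: injective_projections => /=; ring.
    have e2 : u (ry z + v) = w (z + (0, - rho)) by rewrite /w; congr u; rewrite /ry /v; apply: injective_projections => /=; ring.
    by rewrite me e1 e2; ring.
have Em := Emax bp2.
have fr z : 0 < u z -> box 0 r z by move=> /lt_ne/usup[/pbox].
have gr z : 0 < g z -> box 0 r z by move=> /lt_ne/gsup[/pbox].
have C := cross_gain (zf := y) (zg := ry y) (rho := rho) (sqr_ge0 rho) nu ng' u0 g0 ug uvg fr gr dd0 (fun z t fz gt _ _ => dd z t fz gt).
rewrite lf lg in C.
have lv : l1 v = rho by rewrite /l1 /= normr0 add0r gtr0_norm.
have lv2 : l1 ((0, - rho) : plane) = rho by rewrite /l1 /= normr0 add0r normrN gtr0_norm.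
have M1' : mass p1 = mass p by [].
rewrite lv in E1; rewrite lv2 M1' in E2.
have bm : 0 <= be * mass p by rewrite mulr_ge0 // ltW.
have P2 : (be * mass p) ^+ 2 <= lmass p y rho * lmass p (ry y) rho.
  by rewrite expr2; apply: ler_pM => //; apply: conc; rewrite ?pe.
have c0 : 0 <= cross u g v by exact: cross_ge0.
apply: (gap_contra c0 _ _ P2); last by rewrite mulrA.
exact: two_moves_arith Em E1 E2 C2.
Qed.

(** Mass counting: a long support without gaps contains points whose boxes of half-side [rho] are
    disjoint, and each box carries the fraction [be] of the mass. *)
Lemma chain (h : plane -> R) (c0 : R) (N : nat) : measurable_fun [set: plane] (h : plane -> mR) ->
  (forall y z, box y rho z -> `|h z - h y| <= rho) ->
  (forall y, 0 < p y -> 4 * rho <= h y - c0 -> exists z, 0 < p z /\ h y - 4 * rho < h z < h y - 2 * rho) ->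
  1 < N%:R * be -> forall y, 0 < p y -> h y - c0 < 4 * rho * N%:R.
Proof.
move=> mh hL gap Nb; pose A t := [set z : plane | h z <= t].
have mA t : measurable (A t).
  have -> : A t = setT `&` h @^-1` `]-oo, t] by rewrite setTI; apply/seteqP; split => z; rewrite /A /= in_itv.
  by apply: mh => //; exact: measurable_itv.
have mb y : measurable (box y rho) := measurable_box y rho.
(* The next point lies more than [2 * rho] below the level of [y], so the sublevel set around it
   misses the box around [y]; it lies less than [4 * rho] below, so the count drops by one only. *)
have P k : forall y, 0 < p y -> 4 * rho * k%:R <= h y - c0 -> k.+1%:R * (be * mass p) <= amass p (A (h y + rho)).
  elim: k => [|k IH] y py hy.
    rewrite mul1r; apply: le_trans (conc py) _; apply: I_mono; [exact: amass_ig|exact: amass_ig|move=> z].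
    apply: ler_wpM2r; first exact: vort_ge0.
    rewrite !indicE; have [bz|nz] := pselect (box y rho z); last by rewrite memNset.
    rewrite mem_set // mem_set //; have := hL _ _ bz; rewrite /A /= ler_norml => /andP[]; lra.
  have e1 : k.+1%:R = k%:R + 1 :> R by rewrite natr1.
  have hy' : 4 * rho <= h y - c0.
    by apply: le_trans hy; rewrite e1 mulrDr mulr1 lerDr; have := ltW rho0 => ?; nneg.
  have [z [pz /andP[z1 z2]]] := gap y py hy'.
  have hz : 4 * rho * k%:R <= h z - c0 by move: hy; rewrite e1 mulrDr mulr1; lra.
  have := IH z pz hz; have := conc py; have -> : k.+2%:R = k.+1%:R + 1 :> R by rewrite natr1.
  rewrite mulrDl mul1r => g1 g2.
  apply: le_trans (lerD g2 g1) _; apply: amass_add => //.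
  - by move=> t; rewrite /A /=; have := rho0; lra.
  - by move=> t /hL; rewrite /A /= ler_norml => /andP[]; lra.
  - by move=> t; rewrite /A /= => t1 /hL; rewrite ler_norml => /andP[]; lra.
move=> y py; rewrite ltNge; apply/negP => hy.
have h1 := P N y py hy; have h2 := amass_le np (mA (h y + rho)).
have := le_trans h1 h2; have -> : N.+1%:R = N%:R + 1 :> R by rewrite natr1.
rewrite mulrDl mul1r mulrA.
have : mass p < N%:R * be * mass p by rewrite ltr_pMl.
have : 0 < be * mass p by rewrite mulr_gt0.
lra.
Qed.

Lemma extent1 (N : nat) : 1 < N%:R * be -> forall x y, 0 < p x -> 0 < p y -> `|x.1 - y.1| < 4 * rho * N%:R.
Proof.
move=> Nb; have rp := rho0; have H x y : 0 < p x -> 0 < p y -> y.1 - x.1 < 4 * rho * N%:R.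
  move=> px; apply: (@chain fst x.1 N) => // [y' z /boxP[]//|y' py' hy].
  (* The piece to be moved has to approach the axis: the right one in the first case, the left one
     in the second. *)
  case: (leP 0 (y'.1 - 4 * rho + rho)) => h.
    have [||z [pz]] := @no_gap1 1 (y'.1 - 4 * rho) x y' (or_introl erefl) h px _ py'; rewrite ?mul1r; try lra.
    by move=> /andP[z1 z2]; exists z; split => //; apply/andP; split; lra.
  have h' : 0 <= - (y'.1 - 4 * rho + 2 * rho) + rho by lra.
  have [||z [pz]] := @no_gap1 (-1) _ y' x (or_intror erefl) h' py' _ px; rewrite ?mulN1r; try lra.
  by move=> /andP[z1 z2]; exists z; split => //; apply/andP; split; lra.
move=> x y px py; have := H x y px py; have := H y x py px.
by rewrite ltr_norml => h1 h2; apply/andP; split; lra.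
Qed.

Lemma extent2 (N : nat) : 1 < N%:R * be -> forall y, 0 < p y -> `|y.2| < 4 * rho * N%:R.
Proof.
move=> Nb y py; have rp := rho0; rewrite -[`|y.2|]subr0; apply: (@chain (fun z => `|z.2|) 0 N) => //.
- exact: measurableT_comp.
- by move=> z t /boxP[_ h]; apply: le_trans h; exact: ler_dist_dist.
- move=> z pz; rewrite subr0 => hz.
  have a0 : 0 <= `|z.2| - 4 * rho by lra.
  have [|t [pt /andP[t1 t2]]] := no_gap2 a0 pz; first by lra.
  by exists t; split => //; apply/andP; split; lra.
Qed.

End gaps.
End moves.

(** * Mass and concentration *)

Section potential_upper.
Variable R : realType.
Notation mR := (measurableTypeR R).
Notation plane := (mR * mR)%type.
Implicit Types (x y z w u v : plane) (f g h p : plane -> R).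
Variable s : R.
Hypotheses (s0 : 0 < s) (s1 : s <= 1).

Lemma expRN1_le1 : expR (-1) <= 1 :> R.
Proof. by rewrite -[leRHS]expR0 ler_expR; lra. Qed.

Lemma box_sub x y (t : R) : box x t y <-> box 0 t (x - y).
Proof. by split => /boxP[h1 h2]; apply/boxP; move: h1 h2; rewrite !subr0 /= ![`|x.1 - _|]distrC ![`|x.2 - _|]distrC. Qed.

Lemma indic_vort_ig f z (t : R) : nice f -> (forall y, 0 <= f y) -> ig (fun y => \1_(box z t) y * f y).
Proof.
move=> nf f0; apply: ig_le (nice_ig nf) _.
  by apply: measurable_funM; [apply: measurable_indic; exact: measurable_box|exact: nice_measurable].
by move=> y; rewrite normrM (ger0_norm (f0 _)) indicE; case: (_ \in _); rewrite ?normr1 ?normr0 ?mul1r ?mul0r.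
Qed.

Lemma indic_box_sub x y (t : R) : \1_(box x t) y = \1_(box 0 t) (x - y) :> R.
Proof.
rewrite !indicE; have [b|nb] := pselect (box x t y).
  by rewrite (mem_set b) (mem_set (iffLR (box_sub x y t) b)).
by rewrite (memNset nb) memNset // => b'; apply: nb; exact/box_sub.
Qed.

Lemma sum3_le (g A B C : R) : 0 <= A -> 0 <= B -> 0 <= C -> g <= A \/ g <= B \/ g <= C -> g <= A + B + C.
Proof. by move=> A0 B0 C0 [|[|]] h; lra. Qed.

(** Three zones: inside [b] the density bound [F] is used against the singularity, between [b] and
    [t] the local mass, beyond [t] the total mass. *)
Lemma G_upper (b t c F : R) w : 0 < b -> b <= t -> t ^+ 2 <= expR (-1) -> 0 <= c -> c <= F ->
  G s w * c <= 4 * gam s (b ^+ 2) * F * sing_major (sing_exp s) b w + gam s (b ^+ 2) * (\1_(box 0 t) w * c) + gam s (t ^+ 2) * c.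
Proof.
move=> b0 bt te c0 cF; have t0 : 0 < t := lt_le_trans b0 bt; have F0 := le_trans c0 cF.
have b2t : b ^+ 2 <= t ^+ 2 by rewrite ler_sqr ?nnegrE ?(ltW b0) ?(ltW t0).
have gt0 : 0 <= gam s (t ^+ 2) by apply: gam_ge0; rewrite ?exprn_gt0 //; exact: le_trans te expRN1_le1.
have gb0 : 0 <= gam s (b ^+ 2) by apply: gam_ge0; rewrite ?exprn_gt0 //; exact: le_trans (le_trans b2t te) expRN1_le1.
have S0 : 0 <= sing_major (sing_exp s) b w by exact: sing_major_ge0.
have i0 : 0 <= \1_(box 0 t) w :> R by exact: indic_ge0.
apply: sum3_le; [by nneg|by nneg|by nneg|].
have [bw|nb] := pselect (box 0 b w).
  left; have [->|w0] := eqVneq w 0; first by rewrite Gs_0 // mul0r; have := sing_major_ge0 (sing_exp s) b (0 : plane) => ?; nneg.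
  have /andP[g0 g1] := G_near s0 s1 b0 (le_trans b2t te) bw w0.
  by rewrite mulrAC; apply: ler_pM.
right; have w2 := nbox_n2 (ltW b0) nb.
have [bt'|nt] := pselect (box 0 t w).
  left; rewrite indicE mem_set // mul1r; apply: ler_wpM2r => //; rewrite G_gam; apply: gam_anti => //.
  by rewrite exprn_gt0.
right; apply: ler_wpM2r => //; rewrite G_gam; apply: gam_anti => //; first by rewrite exprn_gt0.
exact: nbox_n2 (ltW t0) nt.
Qed.

Lemma pot_upper f (F b t : R) x : 0 <= F -> nice f -> (forall y, 0 <= f y <= F) -> 0 < b -> b <= t ->
  t ^+ 2 <= expR (-1) ->
  pot s f x <= 4 * gam s (b ^+ 2) * F * (sing_mass (sing_exp s) * b ^+ 2) +
    gam s (b ^+ 2) * I (fun y => \1_(box x t) y * f y) + gam s (t ^+ 2) * I f.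
Proof.
move=> F0 nf fF b0 bt te.
have f0 y : 0 <= f y by have /andP[] := fF y.
have b2t : b ^+ 2 <= t ^+ 2 by rewrite ler_sqr ?nnegrE ?(ltW b0) // (le_trans (ltW b0)).
have gb0 : 0 <= gam s (b ^+ 2) by apply: gam_ge0; rewrite ?exprn_gt0 //; exact: le_trans (le_trans b2t te) expRN1_le1.
have [iS IS] := int_sing_major (sing_exp_gt0 s1) (sing_exp_lt1 s0 s1) b0.
have [iS' ES] := I_subx x iS.
have i1 := igZ (4 * gam s (b ^+ 2) * F) iS'.
have i2' := indic_vort_ig x t nf f0.
have i2 := igZ (gam s (b ^+ 2)) i2'.
have i3 := igZ (gam s (t ^+ 2)) (nice_ig nf).
have k0 : 0 <= 4 * gam s (b ^+ 2) * F by exact: mulr_ge0 (mulr_ge0 (ler0n _ 4) gb0) F0.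
have h1 : I (fun y => 4 * gam s (b ^+ 2) * F * sing_major (sing_exp s) b (x - y)) <= 4 * gam s (b ^+ 2) * F * (sing_mass (sing_exp s) * b ^+ 2).
  by rewrite (IZ _ iS') ES; exact: ler_wpM2l.
rewrite -(IZ (gam s (b ^+ 2)) i2') -(IZ _ (nice_ig nf)).
apply: le_trans (lerD (lerD h1 (lexx _)) (lexx _)).
rewrite -(ID i1 i2) -(ID (igD i1 i2) i3).
apply: I_mono; [exact: pot_ig|exact: igD (igD i1 i2) i3|move=> y].
have /andP[c0 cF] := fF y.
by rewrite indic_box_sub; exact: G_upper.
Qed.

End potential_upper.

Section arith.
Variable R : realFieldType.

(** Half of the self-interaction survives the subtraction of [mu]; the summand [128] pays for the
    entropy. *)
Lemma competitor_arith (q g CB1 mu m0 Q J : R) : mu = q / 2 -> q <= g -> 0 <= CB1 -> 8 * CB1 + 128 <= q ->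
  4^-1 <= m0 -> (g - CB1 - mu) * m0 * m0 <= Q -> J <= 1 -> q / 128 <= 2^-1 * Q - J.
Proof.
move=> -> h1 h2 h3 h4 h5 h6.
have c0 : 0 <= g - CB1 - q / 2 by lra.
have h7 : (g - CB1 - q / 2) * 4^-1 <= (g - CB1 - q / 2) * m0 by apply: ler_wpM2l.
have h8 : (g - CB1 - q / 2) * 4^-1 * 4^-1 <= (g - CB1 - q / 2) * m0 * m0.
  by apply: ler_pM => //; rewrite mulr_ge0.
lra.
Qed.

Lemma mass_arith (w q C m : R) : 1 <= w -> 0 < q -> 0 <= C -> 0 <= m -> q / 128 <= 2^-1 * ((C / 4 * (w * q) + 2 * (w * q) * m) * m) ->
  (64 * w * (C / 4 + 2))^-1 <= m.
Proof.
move=> w1 g0 C0 m0 h; have d0 : 2 <= C / 4 + 2 by lra.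
have w0 : 0 < w by lra.
have D1 : 1 <= 64 * w * (C / 4 + 2).
  have e1 : 64 * 1 <= 64 * w by rewrite ler_pM2l.
  have e2 : 64 * w * 2 <= 64 * w * (C / 4 + 2) by rewrite ler_pM2l ?mulr_gt0.
  lra.
have D0 : 0 < 64 * w * (C / 4 + 2) by lra.
case: (leP 1 m) => m1; first by apply: le_trans m1; rewrite invf_le1.
rewrite -[_^-1]mul1r ler_pdivrMr //.
have h3 : q * 1 <= q * (64 * w * ((C / 4 + 2 * m) * m)).
  have -> : q * (64 * w * ((C / 4 + 2 * m) * m)) = 128 * (2^-1 * ((C / 4 * (w * q) + 2 * (w * q) * m) * m)) by field.
  by lra.
rewrite ler_pM2l // in h3; apply: le_trans h3 _.
have -> : m * (64 * w * (C / 4 + 2)) = 64 * w * ((C / 4 + 2) * m) by ring.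
apply: ler_wpM2l; first by rewrite mulr_ge0 // ltW.
by apply: ler_wpM2r => //; lra.
Qed.

(** Of [q * m / 2], three eighths of [q * m] go to the bounded kernel, the inner zone and the far
    zone; the remaining eighth must come from the local mass. *)
Lemma conc_arith (w q gb gR CB1 mu m mlow Nq inner loc : R) : mu = q / 2 -> 0 < w -> 0 < m -> mlow <= m -> 0 < Nq -> 0 <= loc ->
  8 * CB1 <= q -> 8 * gR <= q -> gb <= 4 * (w * q) * Nq -> 0 < q -> inner <= q * mlow / 8 ->
  (mu - CB1) * m <= inner + gb * loc + gR * m -> (32 * w * Nq)^-1 * m <= loc.
Proof.
move=> -> w0 m0 ml N0 l0 h1 h2 h3 g0 h4 h5.
have a1 : gb * loc <= 4 * (w * q) * Nq * loc by apply: ler_wpM2r.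
have a2 : q * mlow <= q * m by apply: ler_wpM2l => //; exact: ltW.
have a3 : 8 * gR * m <= q * m by apply: ler_wpM2r => //; exact: ltW.
have a4 : 8 * CB1 * m <= q * m by apply: ler_wpM2r => //; exact: ltW.
have a5 : q * m <= q * (32 * w * Nq * loc).
  have -> : q * (32 * w * Nq * loc) = 8 * (4 * (w * q) * Nq * loc) by ring.
  move: h5 a1 a2 a3 a4 h4; rewrite mulrBl; move: (gb * loc) (_ * loc) => *; lra.
rewrite ler_pM2l // in a5.
by rewrite mulrC ler_pdivrMr ?mulr_gt0 // mulrC.
Qed.

End arith.

(** * Mass and concentration of a maximizer *)

Section solution.
Variable R : realType.
Notation mR := (measurableTypeR R).
Notation plane := (mR * mR)%type.
Implicit Types (x y z w u v : plane) (f g h : plane -> R).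
Variable s : R.
Hypotheses (s0 : 0 < s) (s1 : s <= 1).
Notation pot := (pot s).
Variables (B : plane -> plane -> R) (CB LB CB1 mu1 : R).
Hypothesis hB : kernel B CB LB.
Hypotheses (Bup : forall x y, B x y <= CB1 - mu1) (Blow : forall x y, - CB1 - mu1 <= B x y) (C10 : 0 <= CB1).
Variables (r a MV K : R) (p : plane -> R).
Hypotheses (r0 : 0 < r) (r1 : 32 * r ^+ 2 <= 1) (a0 : 0 < a) (a2r : 4 * a <= r) (ae : 32 * a ^+ 2 <= expR (-1)).
(** At full density the box of half-side [2 * a], which contains the support of the competitor
    [cut a], has mass [1], and the box of half-side [a] has mass [1 / 4]. *)
Let Lam := (16 * a ^+ 2)^-1.
Notation vort := (vort Lam).
Hypotheses (MV0 : 0 <= MV) (K0 : 0 <= K) (aK : a^-1 <= K) (pb : ball r K p)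
  (Emax : forall p', ball r K p' -> energy s B r Lam MV p' <= energy s B r Lam MV p)
  (pc : forall x, p x = best_reply s B r Lam MV p x).
Let ga := gam s (a ^+ 2).
Variables (w q : R).
Hypotheses (wE : w = 4 * 32) (gaE : ga = w * q) (muE : mu1 = q / 2) (qL : 8 * CB1 + 128 <= q).
Let m := mass Lam p.
Let a20 : 0 < a ^+ 2. Proof. by rewrite exprn_gt0. Qed.
Lemma Lam_gt0 : 0 < Lam. Proof. by rewrite invr_gt0 mulr_gt0. Qed.
Let L0 := Lam_gt0.
Let np : nice p. Proof. exact: (ball_nice r0 K0 pb). Qed.
Let no : nice (vort p). Proof. exact: vort_nice. Qed.
Let om0 f x : 0 <= vort f x := vort_ge0 L0 f x.
Let m0 : 0 <= m. Proof. exact: (mass_ge0 L0). Qed.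
Let LamE : Lam * a ^+ 2 = 16^-1.
Proof. by rewrite /Lam; field; rewrite gt_eqF. Qed.
Let q0 : 0 < q.
Proof. by move: qL C10; lra. Qed.
Let w1 : 1 <= w.
Proof. by rewrite wE; lra. Qed.
Let w0 : 0 < w.
Proof. by move: w1; lra. Qed.
Let ga0 : 0 < ga.
Proof. by rewrite gaE mulr_gt0. Qed.

Lemma pos_facts x : 0 < p x -> box 0 r x /\ 0 < U s B (vort p) x - V r MV x.
Proof.
move=> px; have bx : box 0 r x.
  by case: pb => _ _ h _; apply: contrapT => nb; rewrite h // ltxx in px.
by split => //; move: px; rewrite pc /best_reply clip2_id // clamp_gt0.
Qed.

Lemma bpot_vort_upper x : bpot B (vort p) x <= (CB1 - mu1) * m.
Proof.
rewrite /m /mass -IZ; last exact: nice_ig.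
by apply: I_mono; [exact: (bpot_ig hB)|exact/igZ/nice_ig|move=> y; apply: ler_wpM2r].
Qed.

Lemma CB1_le_mu : CB1 <= mu1.
Proof. by rewrite muE; move: C10 qL; lra. Qed.

Lemma cut_ball : ball r K (cut a).
Proof.
split=> [x|x y|x nb|x]; first exact: clamp01.
- apply: le_trans (cut_lip a0 x y) _; apply: ler_wpM2r => //; exact: l1_ge0.
- by apply: cut_off => // b; apply: nb; apply: box_mono b; move: a2r a0; lra.
- by rewrite /cut /= normrN.
Qed.

Lemma cut_mass : 4^-1 <= mass Lam (cut a).
Proof.
have nc := vort_nice Lam (cut_nice a0).
have -> : 4^-1 = I (fun x => Lam * \1_(box (0 : plane) a) x).
  rewrite IZ ?I_indic_box ?(ltW a0) //; last by apply: ig_indic_box; exact: ltW.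
  by rewrite exprMn mulrCA LamE; field.
apply: I_mono; [by apply/igZ/ig_indic_box/ltW|exact: nice_ig|move=> x].
rewrite indicE; have [bx|nb] := pselect (box 0 a x); last by rewrite memNset // mulr0.
by rewrite mem_set // /vort cut_on // smoothstep1.
Qed.

Lemma cut_entropy : Lam * I (fun x => entropy (cut a x)) <= 1.
Proof.
have a20' : 0 <= 2 * a by rewrite mulr_ge0 // ltW.
have nj := entropy_nice (cut_nice a0).
have -> : 1 = Lam * I (\1_(box (0 : plane) (2 * a))).
  rewrite I_indic_box //; have -> : Lam * (2 * (2 * a)) ^+ 2 = 16 * (Lam * a ^+ 2) by ring.
  by rewrite LamE; field.
apply: ler_wpM2l; first exact: ltW.
apply: I_mono; [exact: nice_ig|exact: ig_indic_box|move=> x].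
rewrite indicE; have [bx|nb] := pselect (box 0 (2 * a) x).
  by rewrite mem_set //; have /andP[] := entropy01 (cut a x).
by rewrite memNset // cut_off // entropy0.
Qed.

(** Squared distances in the support of [cut a] are at most [32 * a ^+ 2]. By [gam_growth] the
    kernel there is at least [gam s (a ^+ 2)] divided by [w = 4 * 32], that is, at least [q]. *)
Lemma cut_energy : q / 128 <= energy s B r Lam MV (cut a).
Proof.
have nc := cut_nice a0; have noc := vort_nice Lam nc.
have V0 : I (fun x => vort (cut a) x * V r MV x) = 0.
  rewrite -[RHS](I0 R); congr I; apply/funext => x.
  have [/boxP[]|nb] := pselect (box 0 (2 * a) x); last by rewrite vort_0 ?mul0r // cut_off.
  rewrite !subr0 => h1 h2; rewrite /V !wall_in ?addr0 ?mulr0 //; move: a2r h1 h2; lra.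
pose g := gam s (32 * a ^+ 2).
have g128 : q <= g.
  rewrite -(ler_pM2l w0) -gaE.
  have h : a ^+ 2 <= 4 * (32 * a ^+ 2) by have := ltW a20; lra.
  apply: le_trans (gam_growth s0 s1 a20 h ae) _.
  have -> : 32 * a ^+ 2 / a ^+ 2 = 32 by field; rewrite gt_eqF.
  have g0 : 0 <= g by apply: gam_ge0 => //; [rewrite mulr_gt0|exact: le_trans ae (expRN1_le1 R)].
  have h32 : (32 : R) `^ sing_exp s <= 32.
    by rewrite -[leRHS](powRr1 (ler0n _ 32)); apply: ler_powR; [lra|exact: ltW (sing_exp_lt1 s0 s1)].
  have -> : w * g = 4 * g * 32 by rewrite wE; ring.
  by apply: ler_wpM2l => //; rewrite mulr_ge0.
have Qlow : (g - CB1 - mu1) * mass Lam (cut a) * mass Lam (cut a) <= Q s B (vort (cut a)) (vort (cut a)).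
  set m' := mass Lam _.
  have nU : nice (fun x => vort (cut a) x * U s B (vort (cut a)) x) by apply: niceM => //; exact: (loU s0 s1 hB).
  rewrite {2}/m' /mass -IZ; last exact: nice_ig.
  apply: I_mono; [exact/igZ/nice_ig|exact: nice_ig|move=> x].
  have [bx|nb] := pselect (box 0 (2 * a) x); last by rewrite vort_0 ?mulr0 ?mul0r // cut_off.
  rewrite mulrC; apply: ler_wpM2l => //.
  have h1 : (- CB1 - mu1) * m' <= bpot B (vort (cut a)) x.
    rewrite /m' /mass -IZ; last exact: nice_ig.
    by apply: I_mono; [exact/igZ/nice_ig|exact: (bpot_ig hB)|move=> y; apply: ler_wpM2r].
  have [ip Ip] := I_point x.
  have h2 : g * m' <= pot (vort (cut a)) x.
    have -> : g * m' = I (fun y => g * vort (cut a) y - g * Lam * \1_[set x] y).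
      by rewrite IB; [rewrite (IZ _ (nice_ig noc)) (IZ _ ip) Ip mulr0 subr0|exact/igZ/nice_ig|exact: igZ].
    apply: I_mono; [by apply: igB; [exact/igZ/nice_ig|exact: igZ]|exact: pot_ig|move=> y].
    have g0 : 0 <= g by apply: gam_ge0 => //; [rewrite mulr_gt0|exact: le_trans ae (expRN1_le1 R)].
    have [e|ne] := eqVneq y x.
      rewrite e indicE mem_set // mulr1 subrr Gs_0 // mul0r -mulrBr.
      by apply: mulr_ge0_le0 => //; rewrite subr_le0; have /andP[] := vort_bound L0 (cut a) x.
    rewrite indicE memNset ?mulr0 ?subr0; last by move=> /= e; rewrite e eqxx in ne.
    have [b_y|nb] := pselect (box 0 (2 * a) y); last by rewrite vort_0 ?mulr0 // cut_off.
    apply: ler_wpM2r => //; rewrite G_gam; apply: gam_anti => //.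
      by apply: n2_gt0; rewrite subr_eq0 eq_sym.
    by have := box_sub_dot bx b_y; lra.
  by rewrite /U; lra.
rewrite /energy V0 subr0.
exact: competitor_arith muE g128 C10 qL cut_mass Qlow cut_entropy.
Qed.

Lemma pot_a_bound x : pot (vort p) x <= sing_mass (sing_exp s) / 4 * ga + 2 * ga * m.
Proof.
have ae' : a ^+ 2 <= expR (-1) by move: ae (ltW a20); lra.
have h := pot_upper s0 s1 x (ltW L0) no (fun y => vort_bound L0 p y) a0 (lexx a) ae'.
have h2 : I (fun y => \1_(box x a) y * vort p y) <= m.
  apply: I_mono; [exact: indic_vort_ig|exact: nice_ig|move=> y].
  by rewrite indicE; case: (_ \in _); rewrite ?mul1r ?mul0r.
apply: le_trans h _; rewrite -/ga.
have h3 := ler_wpM2l (ltW ga0) h2.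
have -> : 4 * ga * Lam * (sing_mass (sing_exp s) * a ^+ 2) = 4 * ga * sing_mass (sing_exp s) * (Lam * a ^+ 2) by ring.
rewrite LamE -[I (vort p)]/m; move: h3; move: (ga * I _) => u; lra.
Qed.

(** The energy is at least a fixed multiple of [q] by comparison with [cut a], and at most a
    multiple of [q] that is small with [m]. After division by [q] the bound depends neither on [a]
    nor on [r]. *)
Lemma mass_low : (64 * w * (sing_mass (sing_exp s) / 4 + 2))^-1 <= m.
Proof.
have Cq0 : 0 <= sing_mass (sing_exp s) by exact: sqr_ge0.
apply: (mass_arith w1 q0 Cq0 m0); rewrite -gaE; apply: le_trans cut_energy _; apply: le_trans (Emax cut_ball) _.
have nU : nice (fun x => vort p x * U s B (vort p) x) by apply: niceM => //; exact: (loU s0 s1 hB).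
have V0 : 0 <= I (fun x => vort p x * V r MV x).
  apply: I_ge0 => x; apply: mulr_ge0 => //; rewrite /V; apply: mulr_ge0 => //.
  by rewrite addr_ge0 // wall_ge0.
have J0 : 0 <= Lam * I (fun x => entropy (p x)).
  by apply: mulr_ge0; [exact: ltW|apply: I_ge0 => x; have /andP[] := entropy01 (p x)].
have h : Q s B (vort p) (vort p) <= (sing_mass (sing_exp s) / 4 * ga + 2 * ga * m) * m.
  rewrite /m /mass -IZ; last exact: nice_ig.
  apply: I_mono; [exact: nice_ig|exact/igZ/nice_ig|move=> x].
  rewrite mulrC; apply: ler_wpM2r => //; rewrite /U -[leRHS]addr0; apply: lerD; first exact: pot_a_bound.
  apply: le_trans (bpot_vort_upper x) _; rewrite mulr_le0_ge0 // subr_le0; exact: CB1_le_mu.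
by rewrite /energy; move: h V0 J0; move: (Q _ _ _ _) (I _) (Lam * _) (_ * m) => *; lra.
Qed.

Lemma mass_gt0 : 0 < m.
Proof.
have Cq0 : 0 <= sing_mass (sing_exp s) by exact: sqr_ge0.
by apply: lt_le_trans mass_low; rewrite invr_gt0 mulr_gt0 ?mulr_gt0 // ltr_wpDl // divr_ge0.
Qed.

(** On the support the potential exceeds [V], so its singular part is at least [(mu1 - CB1) * m].
    Very close vorticity contributes little because the density is bounded, distant vorticity at
    most [gam s (t ^+ 2) * m]; the rest lies within [t]. *)
Lemma concentration (th t : R) : 0 < th -> th <= 1 ->
  w * (th `^ (1 - sing_exp s) * sing_mass (sing_exp s)) <= (64 * w * (sing_mass (sing_exp s) / 4 + 2))^-1 / 8 ->
  a <= t -> t ^+ 2 <= expR (-1) -> 8 * gam s (t ^+ 2) <= q ->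
  forall x, 0 < p x -> (32 * w * (th^-1) `^ sing_exp s)^-1 * m <= lmass Lam p x t.
Proof.
move=> th0 th1 thC at_ te gt x px; have [bx ux] := pos_facts px.
set mlow := (64 * w * _)^-1 in thC; have ml : mlow <= m := mass_low.
set N := (th^-1) `^ sing_exp s; have N0 : 0 < N by rewrite powR_gt0 // invr_gt0.
(* The area shrinks by [th], the kernel grows at most like [th] to the power [- sing_exp s]; as this
   exponent exceeds [-1], the inner zone is negligible for small [th]. *)
pose b := a * Num.sqrt th; have b0 : 0 < b by rewrite mulr_gt0 // sqrtr_gt0.
have b2E : b ^+ 2 = a ^+ 2 * th by rewrite exprMn sqr_sqrtr // ltW.
have ba : b <= a by rewrite ger_pMr // -[leRHS]sqrtr1 ler_sqrt //.
have h := pot_upper s0 s1 x (ltW L0) no (fun y => vort_bound L0 p y) b0 (le_trans ba at_) te.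
have gb : gam s (b ^+ 2) <= 4 * (w * q) * N.
  rewrite -gaE.
  have b20 : 0 < b ^+ 2 by rewrite exprn_gt0.
  have bb : b ^+ 2 <= 4 * a ^+ 2.
    rewrite b2E mulrC; apply: ler_wpM2r; [exact: ltW|lra].
  have ae' : a ^+ 2 <= expR (-1) by move: ae (ltW a20); lra.
  apply: le_trans (gam_growth s0 s1 b20 bb ae') _.
  by rewrite b2E invfM mulrA divff ?gt_eqF // mul1r.
have Cq0 : 0 <= sing_mass (sing_exp s) by exact: sqr_ge0.
have Nth : N * th = th `^ (1 - sing_exp s).
  have -> : N = th `^ (- sing_exp s) by rewrite /N -powR_inv1 ?(ltW th0) // -powRrM mulN1r.
  rewrite -[X in _ * X](powRr1 (ltW th0)) -powRD ?(gt_eqF th0) ?implybT //.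
  by congr (_ `^ _); ring.
have inner : 4 * gam s (b ^+ 2) * Lam * (sing_mass (sing_exp s) * b ^+ 2) <= q * mlow / 8.
  have -> : 4 * gam s (b ^+ 2) * Lam * (sing_mass (sing_exp s) * b ^+ 2) = gam s (b ^+ 2) * (sing_mass (sing_exp s) * th * 4 * (Lam * a ^+ 2)) by rewrite b2E; ring.
  rewrite LamE; apply: (@le_trans _ _ (4 * (w * q) * N * (sing_mass (sing_exp s) * th * 4 / 16))).
    by apply: ler_wpM2r => //; have := ltW th0 => ?; rewrite divr_ge0 //; nneg.
  have -> : 4 * (w * q) * N * (sing_mass (sing_exp s) * th * 4 / 16) = w * q * ((N * th) * sing_mass (sing_exp s)) by field.
  have -> : w * q * (N * th * sing_mass (sing_exp s)) = q * (w * (th `^ (1 - sing_exp s) * sing_mass (sing_exp s))) by rewrite Nth; ring.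
  by rewrite -mulrA; apply: ler_wpM2l => //; exact: ltW.
have Vx : 0 <= V r MV x by rewrite /V mulr_ge0 // addr_ge0 // wall_ge0.
have key : (mu1 - CB1) * m <= 4 * gam s (b ^+ 2) * Lam * (sing_mass (sing_exp s) * b ^+ 2) + gam s (b ^+ 2) * lmass Lam p x t + gam s (t ^+ 2) * m.
  apply: le_trans h; have := bpot_vort_upper x; move: ux; rewrite /U; lra.
have C2400 : 8 * CB1 <= q by move: qL; lra.
have l0 : 0 <= lmass Lam p x t by exact: lmass_ge0.
exact: conc_arith muE w0 mass_gt0 ml N0 l0 C2400 gt gb q0 inner key.
Qed.

End solution.

(** * Centring *)

Lemma shift_arith (R : realFieldType) (r t u : R) : 0 < r -> 0 < t -> t <= r / 16 -> - (r / 8) <= u -> u <= r -> `|u - t| <= r.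
Proof. by move=> *; rewrite ler_norml; apply/andP; split; lra. Qed.

Lemma shift_arith2 (R : realFieldType) (t u : R) : 0 <= u - t -> 0 < t -> `|u - t| <= `|u|.
Proof. by move=> *; rewrite !ger0_norm; lra. Qed.

Lemma shift_arith3 (R : realFieldType) (r t u : R) : 0 < r -> t <= r / 16 -> - (r / 8) <= u -> u - t < 0 -> `|u - t| <= r / 2.
Proof. by move=> *; rewrite ltr0_norm //; lra. Qed.

Lemma box_half (R : realType) (r : R) (y : R * R) : 0 < r -> box 0 (r / 4) y -> box 0 r y.
Proof. by move=> r0; apply: box_mono; lra. Qed.

Lemma box_half2 (R : realType) (r : R) (y : R * R) : 0 < r -> box 0 (r / 2) y -> box 0 r y.
Proof. by move=> r0; apply: box_mono; lra. Qed.

Lemma quarter_arith (R : realType) (r X a b : R) : 0 < r -> `|X| <= r / 16 -> `|a - X| <= r / 8 -> `|b| <= r / 8 ->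
  `|a| <= r / 4 /\ `|b| <= r / 4.
Proof. by move=> r0 hX ha hb; have := lerB_dist a X; split; lra. Qed.

Lemma radius_arith (R : realType) (r e : R) : 0 < r -> r < 1 -> r < e / 32 -> e <= 1 ->
  [/\ 32 * r ^+ 2 <= e, 32 * r ^+ 2 <= 1 & 8 * r ^+ 2 <= 1].
Proof.
move=> r0 r1 re e1; have r2 : r ^+ 2 <= r by rewrite expr2 ger_pMr // ltW.
by have r20 := sqr_ge0 r; split; lra.
Qed.

Lemma core_radius_arith (R : realType) (r a e : R) : 32 * r ^+ 2 <= e -> 0 < a -> a <= r / 4 -> a <= 1 ->
  [/\ 4 * a <= r, a ^+ 2 <= a & 32 * a ^+ 2 <= e].
Proof.
move=> re a0 ar a1; have a2 : a ^+ 2 <= a by rewrite expr2 ger_pMr.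
have a2r : a ^+ 2 <= r ^+ 2 by rewrite ler_sqr ?nnegrE; lra.
by split; lra.
Qed.

Lemma level_arith (R : realType) (C g q : R) : 0 <= C -> 8 * C + 128 + 8 * `|g| <= q ->
  [/\ 8 * C + 128 <= q, 8 * g <= q & 0 <= q / 2].
Proof. by move=> C0 h; have h0 := normr_ge0 g; have h1 := ler_norm g; split; lra. Qed.

Lemma norm_addr_bounds (R : realType) (b mu C : R) : `|b + mu| <= C -> b <= C - mu /\ - C - mu <= b.
Proof. by rewrite ler_norml => /andP[h1 h2]; split; lra. Qed.

Lemma thin_arith (R : realType) (r e : R) (N : nat) : 0 < r -> (0 < N)%N -> 32 * r ^+ 2 <= e ->
  (r / (32 * N%:R)) ^+ 2 <= e.
Proof.
move=> r0 N0 re; have N1 : 1 <= N%:R :> R by rewrite ler1n.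
have : (r / (32 * N%:R)) ^+ 2 <= r ^+ 2.
  rewrite ler_sqr ?nnegrE ?divr_ge0 ?mulr_ge0 ?(ltW r0) // ler_pdivrMr; last lra.
  by rewrite ler_peMr ?(ltW r0) //; lra.
by have := sqr_ge0 r; lra.
Qed.

Lemma tilt_arith (R : realType) (C r X : R) : 0 < C -> `|X| <= r / 16 -> 16 * C * `|X| <= C * r.
Proof. by move=> C0 h; have := ler_wpM2l (ltW C0) h; lra. Qed.

Lemma translation_arith (R : realType) (W0 C2 r t LP sg x y a b : R) :
  - (C2 * r * t) <= a - b + 2 * - (sg * t) * W0 ->
  - (C2 * r * t) - LP * t ^+ 2 + LP * t * sg * x + LP * t * sg * y <=
  a - b + 2 * - (sg * t) * W0 + LP * t * sg * (x + y) - LP * t ^+ 2.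
Proof. by move=> h; lra. Qed.

Lemma balance_arith (R : realType) (c d j P P' B B' V V' : R) : c + d <= B' - B -> V' <= V -> P' = P ->
  2^-1 * (P' + B') - V' - j <= 2^-1 * (P + B) - V - j -> 0 <= - (c + d).
Proof. by move=> h1 h2 h3 h4; lra. Qed.

(** * The vortex core *)

Section core.
Variable R : realType.
Notation mR := (measurableTypeR R).
Notation plane := (mR * mR)%type.
Implicit Types (x y z w u v : plane) (f g h p : plane -> R).
Variable s : R.
Hypotheses (s0 : 0 < s) (s1 : s <= 1).
Variables (centered_image : plane -> plane -> R) (rH CH LH W0 C2 : R).
Hypotheses (rH0 : 0 < rH) (C20 : 0 < C2)
  (Hk : forall r, 0 < r -> r <= rH -> kernel (fun x y => centered_image (clip2 r x) (clip2 r y)) CH LH)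
  (Ht : forall (r : R) x y (t : R), 0 < r -> r <= rH -> box 0 r x -> box 0 r y ->
    box 0 r (x + (t, 0)) -> box 0 r (y + (t, 0)) ->
    `|centered_image (x + (t, 0)) (y + (t, 0)) - centered_image x y + 2 * t * W0| <= C2 * r * `|t|).

(** Both arguments are clipped because the image kernel is controlled near the centre only. *)
Definition tilted (r mu1 LP : R) x y : R := centered_image (clip2 r x) (clip2 r y) - mu1 +
  W0 * ((clip2 r x).1 + (clip2 r y).1) - LP * ((clip2 r x).1 * (clip2 r y).1).

Lemma tilted_bound (r mu1 LP : R) x y : 0 < r -> r <= rH -> r <= 1 -> 0 <= LP ->
  `|tilted r mu1 LP x y + mu1| <= CH + 2 * `|W0| + LP.
Proof.
move=> r0 rr r1 LP0; have := kernel_bounded (Hk r0 rr) x y.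
have /boxP[+ _] := clip2_box r0 x; have /boxP[+ _] := clip2_box r0 y; rewrite !subr0 => py px h.
have -> : tilted r mu1 LP x y + mu1 = centered_image (clip2 r x) (clip2 r y) + W0 * ((clip2 r x).1 + (clip2 r y).1) - LP * ((clip2 r x).1 * (clip2 r y).1) by rewrite /tilted; ring.
apply: le_trans (ler_normB _ _) _; apply: lerD.
  apply: le_trans (ler_normD _ _) _; apply: lerD => //; rewrite normrM mulrC; apply: ler_wpM2r => //.
  by apply: le_trans (ler_normD _ _) _; lra.
rewrite normrM ger0_norm // normrM -[leRHS]mulr1; apply: ler_wpM2l => //.
by apply: mulr_ile1 => //; exact: le_trans r1.
Qed.

(** The Lipschitz constant does not contain [mu1]: the gap condition can be met before the level is
    chosen. *)
Lemma tilted_kernel (r mu1 LP : R) : 0 < r -> r <= rH -> r <= 1 -> 0 <= mu1 -> 0 <= LP ->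
  kernel (tilted r mu1 LP) (CH + 2 * `|W0| + LP + mu1) (LH + `|W0| + LP).
Proof.
move=> r0 rr r1 mu0 LP0; have k := Hk r0 rr.
have l0 := kernel_lip0 k; have c0 := kernel_bound0 k.
have W00 := normr_ge0 W0.
split.
- by move=> x y; rewrite /tilted (kernel_sym k) [(clip2 r y).1 + _]addrC [(clip2 r y).1 * _]mulrC.
- by move=> x y; rewrite /tilted; have /= -> := kernel_even k x y.
- lra.
- lra.
- move=> x y; have h := tilted_bound mu1 x y r0 rr r1 LP0; rewrite -[tilted _ _ _ _ _](addrK mu1).
  by apply: le_trans (ler_normB _ _) _; rewrite (ger0_norm mu0); exact: lerD.
- move=> y x x'; have h := kernel_lip k y x x'; have n0 := l1_ge0 (x - x').
  have /boxP[+ _] := clip2_box r0 y; rewrite subr0 => py.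
  have h1 : `|(clip2 r x).1 - (clip2 r x').1| <= l1 (x - x').
    apply: le_trans (clip2_lip r0 x x'); by rewrite /l1 /= lerDl.
  have -> : tilted r mu1 LP x y - tilted r mu1 LP x' y = (centered_image (clip2 r x) (clip2 r y) - centered_image (clip2 r x') (clip2 r y)) +
    W0 * ((clip2 r x).1 - (clip2 r x').1) - LP * (((clip2 r x).1 - (clip2 r x').1) * (clip2 r y).1) by rewrite /tilted; ring.
  apply: le_trans (ler_normB _ _) _; rewrite [leRHS]mulrDl; apply: lerD.
    rewrite [leRHS]mulrDl; apply: le_trans (ler_normD _ _) _; apply: lerD => //.
    by rewrite normrM; apply: ler_wpM2l.
  rewrite normrM ger0_norm // normrM; apply: ler_wpM2l => //.
  rewrite -[leRHS]mulr1; apply: ler_pM => //; exact: le_trans r1.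
- have m1 : measurable_fun [set: plane] (fun x : plane => (clip2 r x).1 : mR).
    apply: (@measurable_lip _ 1) => // x y; rewrite mul1r; apply: le_trans (clip2_lip r0 x y).
    by rewrite /l1 /= lerDl.
  have ma : measurable_fun [set: plane * plane] (fun z : plane * plane => (clip2 r z.1).1 : mR) by exact: (measurableT_comp m1).
  have mb : measurable_fun [set: plane * plane] (fun z : plane * plane => (clip2 r z.2).1 : mR) by exact: (measurableT_comp m1).
  apply: measurable_funB; last by apply: measurable_funM => //; exact: measurable_funM.
  apply: measurable_funD; last by apply: measurable_funM => //; exact: measurable_funD.
  apply: measurable_funB => //; exact: (kernel_meas k).
Qed.

(** * Comparison with a translate *)

Section translation.
Variables (r mu1 LP Lam MV K : R) (p : plane -> R).
Hypotheses (r0 : 0 < r) (rr : r <= rH) (r1 : r <= 1) (mu0 : 0 <= mu1) (LPE : LP = 16 * C2) (Lam0 : 0 < Lam) (MV0 : 0 <= MV)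
  (K0 : 0 <= K) (pb : ball r K p).
Let LP0 : 0 < LP. Proof. by rewrite LPE mulr_gt0. Qed.
Let hB := tilted_kernel r0 rr r1 mu0 (ltW LP0).
Notation B := (tilted r mu1 LP).
Notation vort := (vort Lam).
Hypotheses (Emax : forall p', ball r K p' -> energy s B r Lam MV p' <= energy s B r Lam MV p)
  (m0 : 0 < mass Lam p) (ext : forall x y, 0 < p x -> 0 < p y -> `|x.1 - y.1| <= r / 8).
Let m := mass Lam p.
Definition centroid := I (fun x => x.1 * vort p x) / mass Lam p.
Let np : nice p := ball_nice r0 K0 pb.
Let no : nice (vort p) := vort_nice Lam np.
Let om0 x : 0 <= vort p x := vort_ge0 Lam0 p x.

Lemma loclip_fst : loclip (fun x => x.1 : R).
Proof. by apply: (@lip_loclip _ 1) => // x y; rewrite mul1r /l1 /= lerDl. Qed.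

Lemma fst_nice : nice (fun x => x.1 * vort p x).
Proof.
have : nice (fun x => vort p x * x.1) by apply: niceM => //; exact: loclip_fst.
by congr nice; apply/funext => x; rewrite mulrC.
Qed.

Lemma vort_pos x : vort p x != 0 -> 0 < p x.
Proof.
move=> h; case: pb => /(_ x) /andP[p0 _] _ _ _; rewrite lt_neqAle p0 andbT eq_sym.
by apply: contraNneq h => /(vort_0 Lam) ->.
Qed.

Lemma centroid_mass : I (fun x => x.1 * vort p x) = centroid * m.
Proof. by rewrite /centroid divfK // gt_eqF. Qed.

Lemma centroid_near x : 0 < p x -> `|x.1 - centroid| <= r / 8.
Proof.
move=> px; rewrite -(ler_pM2r m0) -[X in _ * X](gtr0_norm m0) -normrM mulrBl -/m -centroid_mass.
have -> : x.1 * m - I (fun y => y.1 * vort p y) = I (fun y => (x.1 - y.1) * vort p y).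
  rewrite /m /mass -(IZ _ (nice_ig no)) -(IB (igZ _ (nice_ig no)) (nice_ig fst_nice)).
  by congr I; apply/funext => y; rewrite mulrBl.
have i1 : ig (fun y => (x.1 - y.1) * vort p y).
  have := igB (igZ x.1 (nice_ig no)) (nice_ig fst_nice).
  by congr ig; apply/funext => y; rewrite mulrBl.
rewrite /m /mass -(IZ _ (nice_ig no)).
apply: le_trans (I_abs i1) _; apply: I_mono; [exact: ig_abs|exact/igZ/nice_ig|move=> y].
rewrite normrM (ger0_norm (om0 y)); have [->|/vort_pos py] := eqVneq (vort p y) 0; first by rewrite !mulr0.
by apply: ler_wpM2r => //; exact: ext.
Qed.

(** The maximizer is compared with its translate by [r / 16] towards the axis. The linear tilt
    cancels the first-order change of the image kernel up to [C2 * r * t], and the quadratic term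
    rewards the move in proportion to the centroid. *)
Lemma centroid_one_sided (sg : R) : sg = 1 \/ sg = -1 -> 0 <= sg * centroid -> sg * centroid <= r / 16.
Proof.
move=> sgE xi0; have sg2 : sg * sg = 1 by case: sgE => ->; rewrite ?mulrNN mulr1.
have ns t : `|sg * t| = `|t| by case: sgE => ->; rewrite ?mulN1r ?normrN ?mul1r.
(* Every point of the support lies at [sg * x.1 >= - (r / 8)], so a translate by [t] that crosses
   the axis stays in the region without wall. *)
pose t := r / 16; have t0 : 0 < t by rewrite divr_gt0.
have tr : t <= r / 16 by [].
pose v : plane := (sg * t, 0).
have rp := r0.
have S x : 0 < p x -> - (r / 8) <= sg * x.1.
  move=> /centroid_near; rewrite -ns mulrBr ler_norml => /andP[h _]; lra.
have bx x : 0 < p x -> box 0 r x.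
  by move=> px; case: pb => _ _ h _; apply: contrapT => nb; rewrite h // ltxx in px.
have bxv x : 0 < p x -> box 0 r (x - v).
  move=> px; have /boxP[] := bx _ px; rewrite !subr0 => h1 h2; have h3 := S _ px.
  apply/boxP; rewrite !subr0 /= subr0; split => //; rewrite -ns mulrBr mulrA sg2 mul1r.
  by rewrite -ns ler_norml in h1; move: h1 => /andP[_ h5]; exact: shift_arith rp t0 tr h3 h5.
pose p' x := p (x + v).
have [b1 b2 b3 b4] := pb.
have pb' : ball r K p'.
  split.
  - by move=> x; exact: b1.
  - by move=> x y; have := b2 (x + v) (y + v); rewrite opprD addrACA subrr addr0.
  - move=> x nb; apply: contrapT => px; apply: nb.
    have : 0 < p (x + v) by rewrite lt_neqAle eq_sym; have /andP[-> _] := b1 (x + v); rewrite andbT; apply/eqP.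
    by move=> /bxv; rewrite addrK.
  - move=> x; rewrite /p' -(b4 (x + v)); congr p; rewrite /ry /v; apply: injective_projections => /=; ring.
have Em := Emax pb'.
have np' : nice p' := nice_shift v np.
have no' : nice (vort p') := vort_nice Lam np'.
have nV h : nice h -> nice (fun x => h x * V r MV x) by move=> nh; apply: niceM => //; exact: V_loclip.
have eV : I (fun x => vort p' x * V r MV x) <= I (fun x => vort p x * V r MV x).
  have [j1 <-] := I_shift (- v) (nice_ig (nV _ no')).
  apply: I_mono => //; first exact/nice_ig/nV.
  move=> x; have -> : vort p' (x - v) = vort p x by rewrite /vort /p' subrK.
  have [->|/vort_pos px] := eqVneq (vort p x) 0; first by rewrite !mul0r.
  apply: ler_wpM2l => //; rewrite /V; apply: ler_wpM2l => //; rewrite /= subr0 lerD2r.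
  have h3 := S _ px.
  have -> : wall r (x.1 - sg * t) = wall r (sg * x.1 - t).
    rewrite /wall; congr (Num.max _ (2 * _ / _ - 1)); rewrite -ns mulrBr mulrA sg2 mul1r //.
  have -> : wall r x.1 = wall r (sg * x.1) by rewrite /wall ns.
  case: (leP 0 (sg * x.1 - t)) => h.
    by apply: wall_mono => //; exact: shift_arith2 h t0.
  rewrite wall_in //; first exact: wall_ge0.
  exact: shift_arith3 rp tr h3 h.
have ej : I (fun x => entropy (p' x)) = I (fun x => entropy (p x)).
  by have [_ <-] := I_shift v (nice_ig (entropy_nice np)).
have nb h k : nice h -> nice k -> nice (fun x => k x * bpot B h x) by move=> nh nk; apply: niceM => //; exact: (bpot_loclip hB).
have nQ h k : nice h -> nice k -> nice (fun x => k x * pot s h x) by move=> nh nk; apply: niceM => //; exact: pot_loclip.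
have eP : I (fun x => vort p' x * pot s (vort p') x) = I (fun x => vort p x * pot s (vort p) x).
  have [_ <-] := I_shift v (nice_ig (nQ _ _ no no)); congr I; apply/funext => x.
  by rewrite -(pot_shift s0 s1 v x no).
pose c := - (C2 * r * t) - LP * t ^+ 2.
have eB : c * m ^+ 2 + 2 * (LP * t * (sg * centroid)) * m ^+ 2 <= I (fun x => vort p' x * bpot B (vort p') x) - I (fun x => vort p x * bpot B (vort p) x).
  have [j1 <-] := I_shift (- v) (nice_ig (nb _ _ no' no')).
  rewrite -(IB j1 (nice_ig (nb _ _ no no))).
  have -> : c * m ^+ 2 + 2 * (LP * t * (sg * centroid)) * m ^+ 2 =
    I (fun x => (c * m + LP * t * sg * centroid * m) * vort p x + LP * t * sg * m * (x.1 * vort p x)).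
    rewrite (ID (igZ _ (nice_ig no)) (igZ _ (nice_ig fst_nice))) (IZ _ (nice_ig no)) (IZ _ (nice_ig fst_nice)) centroid_mass.
    by rewrite -[I (vort p)]/m; ring.
  apply: I_mono; [exact: igD (igZ _ (nice_ig no)) (igZ _ (nice_ig fst_nice))|exact: (igB j1 (nice_ig (nb _ _ no no)))|move=> x].
  have -> : vort p' (x - v) = vort p x by rewrite /vort /p' subrK.
  have [->|/vort_pos px] := eqVneq (vort p x) 0; first by rewrite !(mulr0, mul0r) addr0 subrr.
  rewrite -mulrBr; have -> : (c * m + LP * t * sg * centroid * m) * vort p x + LP * t * sg * m * (x.1 * vort p x) =
    vort p x * (LP * t * sg * m * x.1 + (c * m + LP * t * sg * centroid * m)) by ring.
  apply: (ler_wpM2l (om0 x)).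
  have [k1 k2] := I_shift (- v) (bpot_ig hB (x - v) no').
  have e1 : bpot B (vort p') (x - v) = I (fun y => B (x - v) (y - v) * vort p y).
    by rewrite /bpot -k2; congr I; apply/funext => y; rewrite /vort /p' subrK.
  have i1 : ig (fun y => B (x - v) (y - v) * vort p y).
    by move: k1; congr ig; apply/funext => y; rewrite /vort /p' subrK.
  have i2 := bpot_ig hB x no.
  rewrite e1 /bpot -(IB i1 i2).
  have -> : LP * t * sg * m * x.1 + (c * m + LP * t * sg * centroid * m) =
    I (fun y => (c + LP * t * sg * x.1) * vort p y + LP * t * sg * (y.1 * vort p y)).
    rewrite (ID (igZ _ (nice_ig no)) (igZ _ (nice_ig fst_nice))) (IZ _ (nice_ig no)) (IZ _ (nice_ig fst_nice)) centroid_mass.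
    by rewrite -[I (vort p)]/m; ring.
  apply: I_mono; [exact: igD (igZ _ (nice_ig no)) (igZ _ (nice_ig fst_nice))|exact: igB i1 i2|move=> y].
  have [->|/vort_pos py] := eqVneq (vort p y) 0; first by rewrite !mulr0 addr0 subrr.
  rewrite mulrA -mulrDl -mulrBl; apply: (ler_wpM2r (om0 y)).
  have E : x - v = x + (- (sg * t), 0) by apply: injective_projections => /=; rewrite ?subr0 ?addr0.
  have E' : y - v = y + (- (sg * t), 0) by apply: injective_projections => /=; rewrite ?subr0 ?addr0.
  have := Ht r0 rr (bx _ px) (bx _ py); move=> /(_ (- (sg * t))); rewrite -E -E'.
  move=> /(_ (bxv _ px) (bxv _ py)); rewrite normrN ns (gtr0_norm t0) ler_norml => /andP[h _].
  rewrite /tilted (clip2_id (bx _ px)) (clip2_id (bx _ py)) (clip2_id (bxv _ px)) (clip2_id (bxv _ py)) /=.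
  have -> : forall a b : R, a - mu1 + W0 * (x.1 - sg * t + (y.1 - sg * t)) - LP * ((x.1 - sg * t) * (y.1 - sg * t)) -
     (b - mu1 + W0 * (x.1 + y.1) - LP * (x.1 * y.1)) =
     (a - b + 2 * - (sg * t) * W0) + LP * t * sg * (x.1 + y.1) - LP * ((sg * sg) * t ^+ 2) by move=> *; ring.
  by rewrite sg2 mul1r /c; exact: translation_arith h.
have hc : 0 <= - (c * m ^+ 2 + 2 * (LP * t * (sg * centroid)) * m ^+ 2).
  move: Em; rewrite /energy ej (Q_split s0 s1 hB no' no') (Q_split s0 s1 hB no no); exact: balance_arith eB eV eP.
(* With [LP = 16 * C2] and [t = r / 16] the two losses [C2 * r * t] and [LP * t ^+ 2] are equal, and
   together they give the threshold [r / 16]. *)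
have hE : 2 * (LP * t) * (r / 16 - sg * centroid) * m ^+ 2 = - (c * m ^+ 2 + 2 * (LP * t * (sg * centroid)) * m ^+ 2).
  by rewrite /c /t LPE; field.
have c0 : 0 < 2 * (LP * t) * m ^+ 2 := mulr_gt0 (mulr_gt0 (ltr0Sn R 1) (mulr_gt0 LP0 t0)) (exprn_gt0 2 m0).
by move: hc; rewrite -hE mulrAC (pmulr_rge0 _ c0) subr_ge0.
Qed.

Lemma centroid_small : `|centroid| <= r / 16.
Proof.
case: (leP 0 centroid) => h; last first.
  by rewrite ltr0_norm // -mulN1r; apply: centroid_one_sided; [right|rewrite mulN1r oppr_ge0 ltW].
by rewrite (ger0_norm h) -[leLHS]mul1r; apply: centroid_one_sided; [left|rewrite mul1r].
Qed.

End translation.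

Lemma small_power (q C e : R) : q < 1 -> 0 <= C -> 0 < e -> exists th : R, [/\ 0 < th, th <= 1 & th `^ (1 - q) * C <= e].
Proof.
move=> q1 C0 e0; pose d := Num.min 1 (e / (C + 1)).
have d0 : 0 < d by rewrite lt_min ltr01 divr_gt0 // ltr_wpDl.
have q0 : 0 < 1 - q by rewrite subr_gt0.
exists (d `^ (1 - q)^-1); split; first exact: powR_gt0.
  have {2}-> : (1 : R) = 1 `^ (1 - q)^-1 by rewrite powR1.
  apply: ge0_ler_powR; rewrite ?nnegrE ?invr_ge0 ?(ltW q0) ?(ltW d0) //.
  by rewrite ge_min lexx.
rewrite -powRrM mulVf ?gt_eqF // powRr1 ?(ltW d0) //.
have : d * (C + 1) <= e by rewrite -ler_pdivlMr ?ltr_wpDl // ge_min lexx orbT.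
by rewrite mulrDr mulr1; have := ltW d0; lra.
Qed.

(** As [2 - s >= 1], the slope at squared distance [8 * r ^+ 2] is at least of order $r^{-2}$. Times
    the step [r / (32 * N)] this is of order $1/r$, which beats any fixed [LB]. *)
Lemma gap_condition (r be k LB : R) (N : nat) : 0 < r -> 8 * r ^+ 2 <= 1 -> 0 < be -> 0 < k -> 0 <= LB -> (0 < N)%N ->
  r * (256 * N%:R * (2 * LB)) < k * be ^+ 2 ->
  2 * LB < k * (8 * r ^+ 2) `^ (s - 2) * (r / (32 * N%:R)) * be ^+ 2.
Proof.
move=> r0 r8 be0 k0 LB0 N0 h; have t0 : 0 < 8 * r ^+ 2 by rewrite mulr_gt0 // exprn_gt0.
have N1 : 0 < N%:R :> R by rewrite ltr0n.
have p1 : (8 * r ^+ 2)^-1 <= (8 * r ^+ 2) `^ (s - 2).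
  have -> : s - 2 = - (2 - s) by ring.
  rewrite powRN lef_pV2 ?posrE ?powR_gt0 // -[leRHS](powRr1 (ltW t0)).
  by apply: ger_powR => //; [rewrite t0|move: s1; lra].
apply: (@lt_le_trans _ _ (k * (8 * r ^+ 2)^-1 * (r / (32 * N%:R)) * be ^+ 2)).
  have -> : k * (8 * r ^+ 2)^-1 * (r / (32 * N%:R)) * be ^+ 2 = k * be ^+ 2 / (r * (256 * N%:R)).
    by field; rewrite !gt_eqF.
  have c0 : 0 < r * (256 * N%:R) by exact: mulr_gt0 r0 (mulr_gt0 (ltr0Sn R 255) N1).
  by rewrite (ltr_pdivlMr _ _ c0) [ltLHS]mulrC -mulrA.
have b2 : 0 <= be ^+ 2 by exact: sqr_ge0.
have rn : 0 <= r / (32 * N%:R) by rewrite divr_ge0 ?mulr_ge0 // ltW.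
apply: ler_wpM2r => //; apply: ler_wpM2r => //; apply: ler_wpM2l => //; exact: ltW.
Qed.

(** The constants [A], [c1], [c0] may degenerate as [r] tends to zero; only the speed is controlled
    uniformly. The equation is claimed in a box twice as large as the one containing the support,
    which later gives differentiability across the edge of the vortex. *)
Theorem core : exists2 rc : R, 0 < rc & forall r, 0 < r -> r < rc ->
  exists (f : plane -> R) (W A c1 c0 : R), [/\ nice f, forall x, 0 <= f x, I f = 1,
    forall x, ~ box 0 (r / 4) x -> f x = 0 & [/\ forall x, f (ry x) = f x, `|W - W0| <= C2 * r &
    forall x, box 0 (r / 2) x -> f x = A * smoothstep (c1 * (pot s f x + I (fun y => centered_image x y * f y) + W * x.1) + c0)]].
Proof.
pose w : R := 4 * 32; have w0 : 0 < w by rewrite mulr_gt0.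
pose q := sing_exp s; have q1 : q < 1 := sing_exp_lt1 s0 s1.
have Cq0 : 0 <= sing_mass q by exact: sqr_ge0.
pose mlow := (64 * w * (sing_mass q / 4 + 2))^-1.
have ml0 : 0 < mlow by rewrite invr_gt0 mulr_gt0 ?mulr_gt0 // ltr_wpDl // divr_ge0.
have e0 : 0 < mlow / 8 / w by rewrite !divr_gt0.
have [th [th0 th1 thC]] := small_power q1 Cq0 e0.
have thC' : w * (th `^ (1 - q) * sing_mass q) <= mlow / 8 by rewrite mulrC -ler_pdivlMr.
pose be := (32 * w * (th^-1) `^ q)^-1.
have be0 : 0 < be by rewrite invr_gt0 mulr_gt0 ?mulr_gt0 // powR_gt0 // invr_gt0.
(* At most [N] disjoint boxes can carry the fraction [be] of the mass each. *)
pose N := (Num.truncn be^-1).+1; have N0 : (0 < N)%N by [].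
have Nbe : 1 < N%:R * be by rewrite -ltr_pdivrMr // mul1r; exact: truncnS_gt.
have N1 : 0 < N%:R :> R by rewrite ltr0n.
pose LP := 16 * C2; have LP0 : 0 < LP by rewrite mulr_gt0.
have kH := Hk rH0 (lexx rH); have CH0 := kernel_bound0 kH; have LH0 := kernel_lip0 kH.
have W00 := normr_ge0 W0.
pose CB1 := CH + 2 * `|W0| + LP; have CB10 : 0 <= CB1 by rewrite /CB1; move: (ltW LP0) => ?; nneg.
pose LB := LH + `|W0| + LP; have LB0 : 0 <= LB by rewrite /LB; move: (ltW LP0) => ?; nneg.
have kp := kap_gt0 s0 s1.
have ex0 : 0 < expR (-1) :> R by exact: expR_gt0.
have D0 : 0 < 256 * N%:R * (2 * LB) + 1.
  exact: ltr_wpDl (mulr_ge0 (mulr_ge0 (ler0n R 256) (ler0n R N)) (mulr_ge0 (ler0n R 2) LB0)) ltr01.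
pose rc := Num.min (Num.min rH 1) (Num.min (expR (-1) / 32) (kap s * be ^+ 2 / (256 * N%:R * (2 * LB) + 1))).
have rc0 : 0 < rc by rewrite !lt_min rH0 ltr01 !divr_gt0 // mulr_gt0 // exprn_gt0.
exists rc => // r r0; rewrite !lt_min => /andP[/andP[rrH r1] /andP[re rk]].
have [r32e r32 r8] := radius_arith r0 r1 re (expRN1_le1 R).
(* Makes [4 * rho * N] equal to [r / 8], the diameter used in the centring. *)
pose rho := r / (32 * N%:R); have rho0 : 0 < rho by rewrite divr_gt0 // mulr_gt0.
have gapc : 2 * LB < kap s * (8 * r ^+ 2) `^ (s - 2) * rho * be ^+ 2.
  apply: gap_condition => //; move: rk; rewrite ltr_pdivlMr // mulrDr mulr1 => h.
  by apply: le_lt_trans h; rewrite lerDl ltW.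
(* The core radius comes last: the level has to dominate the bounded kernel and the interaction at
   distance [rho]. *)
have [u u0 hu] := gam_large s0 s1 (w * (8 * CB1 + 128 + 8 * `|gam s (rho ^+ 2)|)).
pose a := Num.min (r / 4) (Num.min rho (Num.min 1 u)).
have a0 : 0 < a by rewrite !lt_min divr_gt0 // rho0 ltr01.
have ar : a <= rho by rewrite !ge_min lexx orbT.
have a1 : a <= 1 by rewrite !ge_min lexx !orbT.
have au : a <= u by rewrite !ge_min lexx !orbT.
have [a4 a2a ae] : [/\ 4 * a <= r, a ^+ 2 <= a & 32 * a ^+ 2 <= expR (-1)].
  by apply: core_radius_arith r32e a0 _ a1; rewrite ge_min lexx.
have a20 : 0 < a ^+ 2 by rewrite exprn_gt0.
have ga := hu _ a20 (le_trans a2a au).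
pose qq := gam s (a ^+ 2) / w; have gaE : gam s (a ^+ 2) = w * qq by rewrite /qq mulrC divfK // gt_eqF.
have qqL : 8 * CB1 + 128 + 8 * `|gam s (rho ^+ 2)| <= qq by rewrite /qq ler_pdivlMr // mulrC.
have [qL gL mu0'] := level_arith CB10 qqL.
pose mu1 := qq / 2; have mu0 : 0 <= mu1 := mu0'.
have hB := tilted_kernel r0 (ltW rrH) (ltW r1) mu0 (ltW LP0).
pose Lam := (16 * a ^+ 2)^-1; have L0 : 0 < Lam by rewrite invr_gt0 mulr_gt0.
have [MV [K [p [MV0 K0 aK pb [Emax pc]]]]] := maximizer s0 s1 hB r0 r32 L0 a^-1.
have bb x y := tilted_bound mu1 x y r0 (ltW rrH) (ltW r1) (ltW LP0).
have Bup x y : tilted r mu1 LP x y <= CB1 - mu1 := proj1 (norm_addr_bounds (bb x y)).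
have Blow x y : - CB1 - mu1 <= tilted r mu1 LP x y := proj2 (norm_addr_bounds (bb x y)).
have wE : w = 4 * 32 by [].
have muE : mu1 = qq / 2 by [].
have m0 : 0 < mass Lam p := mass_gt0 s0 s1 hB Bup Blow CB10 r0 a0 a4 ae MV0 K0 aK pb Emax wE gaE muE qL.
have rhoe : rho ^+ 2 <= expR (-1) := thin_arith r0 N0 r32e.
have conc x : 0 < p x -> be * mass Lam p <= lmass Lam p x rho.
  exact: (concentration s0 s1 hB Bup Blow CB10 r0 a0 a4 ae MV0 K0 aK pb Emax pc wE gaE muE qL th0 th1 thC' ar rhoe gL).
have rN : 4 * rho * N%:R = r / 8 by rewrite /rho; field; rewrite gt_eqF.
have ext1 x y : 0 < p x -> 0 < p y -> `|x.1 - y.1| <= r / 8.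
  move=> px py; rewrite -rN; apply: ltW.
  exact: (extent1 s0 s1 hB r0 L0 MV0 K0 pb Emax m0 be0 rho0 conc gapc Nbe px py).
have ext2 y : 0 < p y -> `|y.2| <= r / 8.
  move=> py; rewrite -rN; apply: ltW.
  exact: (extent2 s0 s1 hB r0 L0 MV0 K0 pb Emax m0 be0 rho0 conc gapc Nbe py).
have LPE : LP = 16 * C2 by [].
have xs := centroid_small r0 (ltW rrH) (ltW r1) mu0 LPE L0 MV0 K0 pb Emax m0 ext1.
have xn := centroid_near r0 L0 K0 pb m0 ext1.
set X := centroid Lam p in xs xn; set m := mass Lam p in m0.
have np := ball_nice r0 K0 pb; have no := vort_nice Lam np.
pose f x := m^-1 * vort Lam p x; have nf : nice f by exact: niceZ.
have [p01 pl poff pev] := pb.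
have mi0 : 0 <= m^-1 by rewrite invr_ge0 ltW.
have mne : m != 0 by rewrite gt_eqF.
have omE x : vort Lam p x = m * f x by rewrite /f mulrA divff // mul1r.
have f0 x : ~ box 0 (r / 4) x -> f x = 0.
  move=> nb; rewrite /f vort_0 ?mulr0 //; apply: contrapT => px; apply: nb.
  have px' : 0 < p x by rewrite lt_neqAle eq_sym; have /andP[-> _] := p01 x; rewrite andbT; apply/eqP.
  by apply/boxP; rewrite !subr0; exact: quarter_arith r0 xs (xn _ px') (ext2 _ px').
(* Normalizing the mass to one multiplies the potential by [m]; the constant parts of the tilted
   kernel, integrated against [f], form [c0]. *)
exists f, (W0 - LP * X), (m^-1 * Lam), m, (m * (W0 * X - mu1)); split => //.
- by move=> x; rewrite /f mulr_ge0 // vort_ge0.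
- by rewrite /f (IZ _ (nice_ig no)) -[I _]/m mulVf.
split.
- by move=> x; rewrite /f /vort pev.
- have -> : W0 - LP * X - W0 = - (LP * X) by ring.
  by rewrite normrN normrM (gtr0_norm LP0); exact: tilt_arith C20 xs.
move=> x bx; have /boxP[] := bx; rewrite !subr0 => bx1 bx2.
have bxr : box 0 r x := box_half2 r0 bx.
have Vx : V r MV x = 0 by rewrite /V !wall_in // addr0 mulr0.
have pE : p x = clamp (U s (tilted r mu1 LP) (vort Lam p) x) by rewrite pc /best_reply clip2_id // /excess Vx subr0.
have phE t : smoothstep (clamp t) = smoothstep t :> R by rewrite /smoothstep; have /andP[h1 h2] := clamp01 t; rewrite (clamp_id h1 h2).
have nfx : nice (fun y => f y * y.1) by apply: niceM => //; exact: loclip_fst.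
have IfX : I (fun y => f y * y.1) = X.
  rewrite /X /centroid mulrC -(IZ _ (nice_ig (fst_nice Lam r0 K0 pb))); congr I; apply/funext => y; rewrite /f; ring.
have If : I f = 1 by rewrite /f (IZ _ (nice_ig no)) -[I _]/m mulVf.
have iH : ig (fun y => centered_image x y * f y).
  have := bpot_ig (Hk r0 (ltW rrH)) x nf; congr ig; apply/funext => y.
  have [b_y|nb] := pselect (box 0 r y); first by rewrite !clip2_id.
  by rewrite f0 ?mulr0 // => b; apply: nb; exact: box_half r0 b.
have UE : U s (tilted r mu1 LP) (vort Lam p) x = m * (pot s f x + I (fun y => centered_image x y * f y) + (W0 - LP * X) * x.1) + m * (W0 * X - mu1).
  have -> : vort Lam p = (fun y => m * f y) by apply/funext.
  rewrite (UZ s0 s1 hB) // /U -mulrDr; congr (_ * _); rewrite -!addrA; congr (_ + _).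
  rewrite /bpot; have -> : (fun y => tilted r mu1 LP x y * f y) =
    (fun y => centered_image x y * f y + (- mu1 + W0 * x.1) * f y + (W0 - LP * x.1) * (f y * y.1)).
    apply/funext => y; have [b_y|nb] := pselect (box 0 r y).
      by rewrite /tilted !clip2_id //; ring.
    rewrite (f0 y) ?(mulr0, mul0r, addr0) // => b; apply: nb; exact: box_half r0 b.
  have i2 := igZ (- mu1 + W0 * x.1) (nice_ig nf); have i3 := igZ (W0 - LP * x.1) (nice_ig nfx).
  rewrite (ID (igD iH i2) i3) (ID iH i2) (IZ _ (nice_ig nf)) (IZ _ (nice_ig nfx)) If IfX; ring.
by rewrite /f /vort pE phE UE mulrA.
Qed.

End core.

(** * The image kernel *)

Section ssum.
Variable R : realType.
Implicit Types (F H : int -> R).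

Definition ssum F := limn (fun N => symsum N F).
Definition quad (C : R) F := forall k : int, k != 0 -> `|F k| <= C / k%:~R ^+ 2.

Lemma quad_cvg C F : 0 <= C -> quad C F -> cvgn (fun N => symsum N F).
Proof.
move=> C0 q; have H (k : int) : (1 < `|k|)%N -> `|F k| <= C / k%:~R ^+ 2.
  by move=> k1; apply: q; apply/eqP => k0; rewrite k0 in k1.
by have [] := symsum_cvg C0 (ltn0Sn 0) H.
Qed.

Lemma ssumD F H : cvgn (fun N => symsum N F) -> cvgn (fun N => symsum N H) ->
  ssum (fun k => F k + H k) = ssum F + ssum H.
Proof.
move=> cF cH; rewrite /ssum (_ : (fun N => _) = (fun N => symsum N F) \+ (fun N => symsum N H)) ?limD //.
by apply/funext => N; exact: symsumD.
Qed.

Lemma ssumB F H : cvgn (fun N => symsum N F) -> cvgn (fun N => symsum N H) ->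
  ssum (fun k => F k - H k) = ssum F - ssum H.
Proof.
move=> cF cH; rewrite /ssum (_ : (fun N => _) = (fun N => symsum N F) \- (fun N => symsum N H)) ?limB //.
by apply/funext => N; exact: symsumB.
Qed.

Lemma ssumZ c F : cvgn (fun N => symsum N F) -> ssum (fun k => c * F k) = c * ssum F.
Proof.
move=> cF; rewrite /ssum (_ : (fun N => _) = (fun N => c * symsum N F)).
  by apply/cvg_lim => //; exact: cvgM (cvg_cst c) cF.
by apply/funext => N; exact: symsumZ.
Qed.

Lemma ssum_opp F : ssum (fun k => F (- k)) = ssum F.
Proof. by rewrite /ssum (_ : (fun N => symsum N (fun k => F (- k))) = fun N => symsum N F) //; apply/funext => N; exact: symsum_opp. Qed.

End ssum.

Lemma image_bound_arith (R : realType) (C M q1 q2 r p1 p2 p3 : R) : 0 <= C -> 0 <= M ->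
  `|p1 - p2| <= M * q1 -> `|p2 - p3| <= M * q2 -> M * q1 <= M * (2 * r) -> M * q2 <= M * (2 * r) ->
  `|p1| - `|p2| <= `|p1 - p2| -> `|p2| - `|p3| <= `|p2 - p3| -> `|p1| <= C + M + `|p3| + M * (4 * r).
Proof. by move=> C0 M0 h1 h2 h3 h4 h5 h6; lra. Qed.

Lemma image_arith (R : realType) (M C r a f : R) : 0 <= r * a -> f <= M * (16 * r * a) ->
  f + 4 * (C * (16 * r * a)) <= (16 * (M + 4 * C) + 1) * r * a.
Proof. by move=> h1 h2; lra. Qed.

(** * Mirror images and periodic copies *)

Section image_kernel.
Variable R : realType.
Notation mR := (measurableTypeR R).
Notation plane := (mR * mR)%type.
Implicit Types (x y z w u v p : plane).
Variables (s l d : R).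
Hypotheses (s0 : 0 < s) (s1 : s <= 1) (l0 : 0 < l) (d0 : 0 < d).
Notation sh := (shift2 l).
Notation mirror := (@mirror R).
Notation gradG := (gradG s).
Notation mirror_term := (mirror_term s l).

Definition center : plane := (- d, 0).
(** Keeps [x - mirror y] within [d / 2] of [-2 * d] in the first coordinate and vertical differences
    below [l / 4], hence both away from the singularities. *)
Definition rH : R := Num.min d l / 8.
(* The self-interaction [G (x - y)] is left out of the term [k = 0]. *)
Definition image_term (k : int) x y : R := if k == 0 then - G s (x - mirror y) else mirror_term k x y.
Definition H x y : R := ssum (fun k => image_term k x y).
Definition centered_image x y : R := H (center + x) (center + y).

Lemma image_term0 x y : image_term 0 x y = - G s (x - mirror y). Proof. by rewrite /image_term eqxx. Qed.

Lemma image_termE k x y : k != 0 -> image_term k x y = mirror_term k x y. Proof. by move=> /negbTE k0; rewrite /image_term k0. Qed.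

Lemma rH_gt0 : 0 < rH. Proof. by rewrite divr_gt0 // lt_min d0. Qed.

Lemma rH_d : rH <= d / 8.
Proof. by rewrite ler_pM2r ?invr_gt0 // ge_min lexx. Qed.

Lemma rH_l : rH <= l / 8.
Proof. by rewrite ler_pM2r ?invr_gt0 // ge_min lexx orbT. Qed.

Lemma period_far (k : int) : k != 0 -> l / 4 <= `|k|%:~R * (l / 2).
Proof.
move=> k0; have h := int_abs_ge1 R k0; apply: (@le_trans _ _ (1 * (l / 2))); first by move: l0; lra.
by apply: ler_wpM2r => //; rewrite divr_ge0 // ltW.
Qed.

Lemma near_bounds x : box 0 rH x -> [/\ `|(center + x).1| <= 2 * d, `|x.1| <= d / 8 & `|x.2| <= l / 8].
Proof.
move=> /boxP[]; rewrite !subr0 => h1 h2; have := rH_d; have := rH_l => hl hd.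
by split; [rewrite /=; move: h1; rewrite !ler_norml; lra|exact: le_trans hd|exact: le_trans hl].
Qed.

Lemma mirror_far u : `|u.1 + 2 * d| <= d / 2 -> `|u.2| <= l / 4 ->
  d ^+ 2 <= dot u u + 0 /\ l1 u <= 4 * d + l.
Proof.
rewrite addr0 ler_norml => /andP[h1 h2] h3; split.
  rewrite n2E; apply: (@le_trans _ _ (u.1 ^+ 2)); last by rewrite lerDl sqr_ge0.
  by rewrite -[leRHS]sqrrN ler_sqr ?nnegrE; lra.
rewrite /l1; apply: lerD; last by move: l0; lra.
by rewrite ler_norml; move: d0; lra.
Qed.

Lemma image_arg x y : box 0 rH x -> box 0 rH y ->
  `|(center + x - mirror (center + y)).1 + 2 * d| <= d / 2 /\ `|(center + x - mirror (center + y)).2| <= l / 4.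
Proof.
move=> /near_bounds[_ x1 x2] /near_bounds[_ y1 y2] /=; split.
  by move: x1 y1; rewrite !ler_norml; lra.
by rewrite !add0r; apply: le_trans (ler_normB _ _) _; lra.
Qed.

(** For [k = 0] only the mirror vortex is left, at distance at least [d]; for the other [k] the pair
    bounds apply. *)
Lemma image_term_bounds : exists2 C, 0 <= C & forall x x' y, box 0 rH x -> box 0 rH x' -> box 0 rH y ->
  [/\ quad C (fun k => image_term k (center + x) (center + y)), `|image_term 0 (center + x) (center + y)| <= C,
   quad (C * l1 (x - x')) (fun k => image_term k (center + x) (center + y) - image_term k (center + x') (center + y)) &
   `|image_term 0 (center + x) (center + y) - image_term 0 (center + x') (center + y)| <= C * l1 (x - x')].
Proof.
have A0 : 0 <= 2 * d by rewrite mulr_ge0 // ltW.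
have T0 : 0 <= l / 4 by rewrite divr_ge0 // ltW.
have [C1 C10 h1] := mirror_term_bounds s0 s1 l0 A0 T0.
have dd : 0 < d ^+ 2 by rewrite exprn_gt0.
have kp := ltW (kap_gt0 s0 s1).
pose M := kap s * (d ^+ 2) `^ (s - 2) * (2 * (4 * d + l)).
have M0 : 0 <= M.
  by apply: mulr_ge0; [rewrite mulr_ge0 ?powR_ge0|rewrite mulr_ge0 // addr_ge0 ?(ltW l0) // mulr_ge0 // ltW].
have r0 := ltW rH_gt0.
have key x x' y : box 0 rH x -> box 0 rH x' -> box 0 rH y ->
  `|image_term 0 (center + x) (center + y) - image_term 0 (center + x') (center + y)| <= M * l1 (x - x').
  move=> bx bx' b_y; rewrite !image_term0 opprK addrC distrC !G_Greg.
  have [a1 a2] := image_arg bx b_y; have [a1' a2'] := image_arg bx' b_y.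
  have [f1 f2] := mirror_far a1 a2; have [f1' f2'] := mirror_far a1' a2'.
  apply: le_trans (greg_lip s0 s1 dd f1 f1' f2 f2') _.
  have -> // : center + x - mirror (center + y) - (center + x' - mirror (center + y)) = x - x'.
  by apply: injective_projections => /=; ring.
pose g0 := `|image_term 0 (center + 0) (center + 0)|; have g00 : 0 <= g0 := normr_ge0 _.
have b00 := box_0 r0.
have lb x : box 0 rH x -> l1 (x - 0) <= 2 * rH by move=> b; rewrite subr0; exact: box0_l1.
exists (C1 + M + g0 + M * (4 * rH)).
  by rewrite !addr_ge0 // mulr_ge0 // mulr_ge0.
move=> x x' y bx bx' b_y.
have [x1 xa xb] := near_bounds bx; have [x1' xa' xb'] := near_bounds bx'; have [y1 ya yb] := near_bounds b_y.
have e2 (p q : plane) : `|p.2| <= l / 8 -> `|q.2| <= l / 8 -> `|(center + p).2 - (center + q).2| <= l / 4.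
  by move=> hp hq; rewrite /= !add0r; apply: le_trans (ler_normB _ _) _; lra.
have n0 := l1_ge0 (x - x').
have Mr : 0 <= M * (4 * rH) by rewrite mulr_ge0 // mulr_ge0.
have hh (k : int) : k != 0 -> 0 <= (k%:~R ^+ 2 : R)^-1 by move=> _; rewrite invr_ge0 sqr_ge0.
split.
- move=> k k0; rewrite !image_termE //.
  have [h _] := h1 k k0 (period_far k0) _ _ _ x1 x1 y1 (e2 _ _ xb yb) (e2 _ _ xb yb).
  by apply: le_trans h _; apply: ler_wpM2r; [exact: hh|rewrite -!addrA lerDl !addr_ge0].
- have a := key _ _ _ bx b00 b_y; have b := key _ _ _ b_y b00 b00.
  (* The Lipschitz bound concerns the first argument; symmetry lets the second one be moved to the
     centre as well. *)
  have sy : image_term 0 (center + 0) (center + y) = image_term 0 (center + y) (center + 0).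
    rewrite !image_term0; have <- : mirror (- (center + 0 - mirror (center + y))) = center + y - mirror (center + 0).
      by rewrite /mirror; apply: injective_projections => /=; ring.
    by rewrite G_mirror G_opp.
  rewrite sy in a; have lx := ler_wpM2l M0 (lb _ bx); have ly := ler_wpM2l M0 (lb _ b_y).
  have t1 := lerB_dist (image_term 0 (center + x) (center + y)) (image_term 0 (center + y) (center + 0)).
  have t2 := lerB_dist (image_term 0 (center + y) (center + 0)) (image_term 0 (center + 0) (center + 0)).
  exact: image_bound_arith C10 M0 a b lx ly t1 t2.
- move=> k k0; rewrite !image_termE //.
  have [_ h] := h1 k k0 (period_far k0) _ _ _ x1 x1' y1 (e2 _ _ xb yb) (e2 _ _ xb' yb).
  have E : center + x - (center + x') = x - x' by rewrite opprD addrACA subrr add0r.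
  rewrite E in h; apply: le_trans h _; rewrite mulrAC; apply: ler_wpM2r; first exact: hh.
  by apply: ler_wpM2r => //; rewrite -!addrA lerDl !addr_ge0.
by apply: le_trans (key _ _ _ bx bx' b_y) _; apply: ler_wpM2r => //; lra.
Qed.

Lemma H_cvg x y : box 0 rH x -> box 0 rH y -> cvgn (fun N => symsum N (fun k => image_term k (center + x) (center + y))).
Proof.
move=> bx b_y; have [C C0 h] := image_term_bounds; have [q _ _ _] := h _ _ _ bx bx b_y.
exact: quad_cvg q.
Qed.

(** Exchanging the arguments reverses the vertical offset; symmetric summation is invariant under
    this change of index. *)
Lemma image_term_sym k x y : image_term k x y = image_term (- k) y x.
Proof.
have [->|k0] := eqVneq k 0; last first.
  have nk : - k != 0 by rewrite oppr_eq0.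
  rewrite (image_termE x y k0) (image_termE y x nk); exact: mirror_term_sym.
rewrite oppr0 !image_term0; have <- : mirror (- (x - mirror y)) = y - mirror x.
  by rewrite /mirror; apply: injective_projections => /=; ring.
by rewrite G_mirror G_opp.
Qed.

Lemma H_sym x y : H x y = H y x.
Proof.
rewrite /H -[RHS]ssum_opp; apply: (congr1 (@ssum R)); apply/funext => k; exact: image_term_sym.
Qed.

Lemma G_ry p : G s (ry p) = G s p.
Proof. by rewrite !G_gam // /dot /= mulrNN. Qed.

Lemma image_term_even k x y : image_term k (ry x) (ry y) = image_term (- k) x y.
Proof.
have E1 : ry x - mirror (ry y) = ry (x - mirror y).
  by rewrite /mirror /ry; apply: injective_projections => /=; ring.
have [->|k0] := eqVneq k 0; first by rewrite oppr0 !image_term0 E1 G_ry.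
have nk : - k != 0 by rewrite oppr_eq0.
rewrite (image_termE (ry x) (ry y) k0) (image_termE x y nk) /mirror_term E1.
have E2 : ry x - ry y = ry (x - y) by rewrite /ry; apply: injective_projections => /=; ring.
have E3 p : sh k (ry p) = ry (sh (- k) p).
  by rewrite !shE /ry; apply: injective_projections => /=; rewrite ?mulrNz; ring.
by rewrite E2 !E3 !G_ry.
Qed.

Lemma H_even x y : H (ry x) (ry y) = H x y.
Proof.
rewrite /H -[RHS]ssum_opp; apply: (congr1 (@ssum R)); apply/funext => k; exact: image_term_even.
Qed.

Lemma measurable_G_pair dd (T : measurableType dd) (f g : T -> mR) :
  measurable_fun [set: T] f -> measurable_fun [set: T] g ->
  measurable_fun [set: T] (fun t => G s (f t, g t) : mR).
Proof. by move=> mf mg; apply: (measurableT_comp (measurable_G s)); exact: measurable_fun_pair. Qed.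

Lemma measurable_prp (r : R) : 0 < r ->
  [/\ measurable_fun [set: plane * plane] (fun z : plane * plane => (clip2 r z.1).1 : mR),
   measurable_fun [set: plane * plane] (fun z : plane * plane => (clip2 r z.1).2 : mR),
   measurable_fun [set: plane * plane] (fun z : plane * plane => (clip2 r z.2).1 : mR) &
   measurable_fun [set: plane * plane] (fun z : plane * plane => (clip2 r z.2).2 : mR)].
Proof.
move=> r0; have m1 : measurable_fun [set: plane] (fun x : plane => (clip2 r x).1 : mR).
  apply: (@measurable_lip _ 1) => // x y; rewrite mul1r; apply: le_trans (clip2_lip r0 x y).
  by rewrite /l1 /= lerDl.
have m2 : measurable_fun [set: plane] (fun x : plane => (clip2 r x).2 : mR).
  apply: (@measurable_lip _ 1) => // x y; rewrite mul1r; apply: le_trans (clip2_lip r0 x y).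
  by rewrite /l1 /= lerDr.
by split; [exact: (measurableT_comp m1)|exact: (measurableT_comp m2)|exact: (measurableT_comp m1)|exact: (measurableT_comp m2)].
Qed.

Lemma measurable_image_term (r : R) k : 0 < r -> measurable_fun [set: plane * plane]
  (fun z : plane * plane => image_term k (center + clip2 r z.1) (center + clip2 r z.2) : mR).
Proof.
move=> r0; have [m1 m2 m3 m4] := measurable_prp r0.
have a1 : measurable_fun [set: plane * plane] (fun z : plane * plane => (center + clip2 r z.1).1 - (center + clip2 r z.2).1 : mR).
  by apply: measurable_funB; apply: measurable_funD.
have a2 : measurable_fun [set: plane * plane] (fun z : plane * plane => (center + clip2 r z.1).1 - - (center + clip2 r z.2).1 : mR).
  apply: measurable_funB; first exact: measurable_funD.
  by apply: (@measurableT_comp _ _ _ _ _ _ (-%R : mR -> mR)) => //; exact: measurable_funD.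
have a3 : measurable_fun [set: plane * plane] (fun z : plane * plane => (center + clip2 r z.1).2 - (center + clip2 r z.2).2 : mR).
  by apply: measurable_funB; apply: measurable_funD.
have a4 : measurable_fun [set: plane * plane] (fun z : plane * plane => (center + clip2 r z.1).2 - (center + clip2 r z.2).2 + k%:~R * l : mR).
  by apply: measurable_funD.
rewrite /image_term; case: (k == 0).
  by apply: (@measurableT_comp _ _ _ _ _ _ (-%R : mR -> mR)) => //; exact: measurable_G_pair a2 a3.
have := measurable_funB (measurable_G_pair a1 a4) (measurable_G_pair a2 a4).
by congr measurable_fun; apply/funext => z; rewrite /mirror_term !shE.
Qed.

Lemma measurable_H (r : R) : 0 < r -> r <= rH -> measurable_fun [set: plane * plane]
  (fun z : plane * plane => centered_image (clip2 r z.1) (clip2 r z.2) : mR).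
Proof.
move=> r0 rr.
apply: (@measurable_fun_cvg _ _ _ _ (fun N (z : plane * plane) => symsum N (fun k => image_term k (center + clip2 r z.1) (center + clip2 r z.2)) : mR)).
  by move=> N; apply: measurable_sum => i; exact: measurable_image_term.
move=> z _; apply: H_cvg; apply: box_mono rr _; exact: clip2_box.
Qed.

Theorem H_kernel : exists CH LH : R, forall r, 0 < r -> r <= rH -> kernel (fun x y => centered_image (clip2 r x) (clip2 r y)) CH LH.
Proof.
have [C C0 h] := image_term_bounds; exists (C + 4 * C), (C + 4 * C) => r r0 rr.
have bp x : box 0 rH (clip2 r x) by apply: box_mono rr _; exact: clip2_box.
split.
- by move=> x y; exact: H_sym.
- have E p : center + ry p = ry (center + p) by rewrite /ry; apply: injective_projections => /=; ring.
  by move=> x y; rewrite /centered_image !(clip2_ry r0) !E H_even.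
- by rewrite addr_ge0 ?mulr_ge0.
- by rewrite addr_ge0 ?mulr_ge0.
- move=> x y; have [q1 q2 _ _] := h _ _ _ (bp x) (bp x) (bp y).
  by apply: le_trans (symsum_bound C0 q1) _; rewrite lerD2r.
- move=> y x x'; have [_ _ q1 q2] := h _ _ _ (bp x) (bp x') (bp y).
  rewrite /centered_image /H -(ssumB (H_cvg (bp x) (bp y)) (H_cvg (bp x') (bp y))).
  have n0 := l1_ge0 (clip2 r x - clip2 r x').
  apply: le_trans (symsum_bound (mulr_ge0 C0 n0) q1) _.
  apply: (@le_trans _ _ ((C + 4 * C) * l1 (clip2 r x - clip2 r x'))).
    by rewrite [leRHS]mulrDl -[4 * C * _]mulrA lerD2r.
  by apply: ler_wpM2l; [rewrite addr_ge0 ?mulr_ge0|exact: clip2_lip].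
- exact: measurable_H.
Qed.

Definition speed_term (k : int) : R := 2 * d / (4 * d ^+ 2 + k%:~R ^+ 2 * l ^+ 2) `^ (2 - s).

(** The velocity that the [k]-th vortex of the opposite row induces at [center]. *)
Lemma gradG_image k : (gradG 0 (sh k (- (2 * d), 0))).1 = Cs s * speed_term k.
Proof.
rewrite shE /= add0r addr0 /dgam /speed_term Cs_kap /dot /=.
have -> : - (2 * d) * - (2 * d) + k%:~R * l * (k%:~R * l) = 4 * d ^+ 2 + k%:~R ^+ 2 * l ^+ 2 by ring.
rewrite -powRN opprB; move: (_ `^ _) => t; ring.
Qed.

Lemma speed_term_quad : exists2 C, 0 <= C & quad C speed_term.
Proof.
exists (2 * d / (l ^+ 2) `^ (2 - s)); first by rewrite divr_ge0 ?powR_ge0 // mulr_ge0 // ltW.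
move=> k k0; rewrite /speed_term.
have k2 := int_sq_ge1 R k0; set K := k%:~R ^+ 2 in k2 *.
have K0 : 0 < K by exact: lt_le_trans k2.
have ll : 0 < l ^+ 2 by rewrite exprn_gt0.
have h : K * l ^+ 2 <= 4 * d ^+ 2 + K * l ^+ 2 by rewrite lerDr mulr_ge0 // sqr_ge0.
have Kl : 0 < K * l ^+ 2 by exact: mulr_gt0.
have p0 : 0 < (4 * d ^+ 2 + K * l ^+ 2) `^ (2 - s) by apply: powR_gt0; exact: lt_le_trans h.
rewrite ger0_norm; last by rewrite divr_ge0 ?(ltW p0) // mulr_ge0 // ltW.
rewrite -[leRHS]mulrA; apply: ler_wpM2l; first by rewrite mulr_ge0 // ltW.
have pl : 0 < (l ^+ 2) `^ (2 - s) * K := mulr_gt0 (powR_gt0 _ ll) K0.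
rewrite -invfM lef_pV2 ?posrE //.
apply: (@le_trans _ _ ((K * l ^+ 2) `^ (2 - s))).
  rewrite (powRM _ (ltW K0) (ltW ll)) mulrC; apply: ler_wpM2r; first exact: powR_ge0.
  by rewrite -[leLHS](powRr1 (ltW K0)); apply: ler_powR => //; move: s1; lra.
have q0 : 0 <= 2 - s by move: s1; lra.
by apply: (ge0_ler_powR q0) => //; rewrite nnegrE ?(ltW Kl) //; exact: le_trans (ltW Kl) h.
Qed.

(** Translating both arguments leaves [x - y] fixed and moves [x - mirror y] by [(2 * t, 0)]. Each
    term is linearized at the value of the latter for two arguments at the centre; the errors are of
    order [r * t] and decay like $k^{-2}$. *)
Theorem H_translation : exists2 C, 0 < C & forall (r : R) x y (t : R), 0 < r -> r <= rH -> box 0 r x -> box 0 r y ->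
  box 0 r (x + (t, 0)) -> box 0 r (y + (t, 0)) ->
  `|centered_image (x + (t, 0)) (y + (t, 0)) - centered_image x y + 2 * t * (Cs s * ssum speed_term)| <= C * r * `|t|.
Proof.
have A0 : 0 <= 4 * d by rewrite mulr_ge0 // ltW.
have T0 : 0 <= l / 4 by rewrite divr_ge0 // ltW.
have [C1 C10 h1] := periodic_C11 s0 s1 l0 A0 T0.
have dd : 0 < d ^+ 2 by rewrite exprn_gt0.
have kp := ltW (kap_gt0 s0 s1).
pose M := 8 * kap s * (d ^+ 2) `^ (s - 3) * (4 * d + l) ^+ 2 + 2 * kap s * (d ^+ 2) `^ (s - 2).
have kp2 : 0 <= 2 * kap s by rewrite mulr_ge0.
have kp8 : 0 <= 8 * kap s by rewrite mulr_ge0.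
have M0 : 0 <= M.
  by apply: addr_ge0; [apply: mulr_ge0; [rewrite mulr_ge0 // powR_ge0|exact: sqr_ge0]|rewrite mulr_ge0 // powR_ge0].
have [C3 C30 sq] := speed_term_quad.
exists (16 * (M + 4 * C1) + 1); first by rewrite ltr_wpDl // mulr_ge0 // addr_ge0 // mulr_ge0.
move=> r x y t r0 rr bx b_y bxt byt.
have up p : box 0 r p -> box 0 rH p by exact: box_mono.
pose w : plane := (- (2 * d), 0).
pose u : plane := center + x - mirror (center + y).
pose u' : plane := center + (x + (t, 0)) - mirror (center + (y + (t, 0))).
have [a1 a2] := image_arg (up _ bx) (up _ b_y).
have [a1' a2'] := image_arg (up _ bxt) (up _ byt).
have shift_diff : u' - u = (2 * t, 0) by rewrite /u' /u /mirror; apply: injective_projections => /=; ring.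
have luw (p q : plane) : box 0 r p -> box 0 r q -> l1 (center + p - mirror (center + q) - w) <= 4 * r.
  move=> /boxP[]; rewrite !subr0 => p1 p2 /boxP[]; rewrite !subr0 => q1 q2.
  have -> : center + p - mirror (center + q) - w = (p.1 + q.1, p.2 - q.2).
    by rewrite /mirror /w; apply: injective_projections => /=; ring.
  rewrite /l1 /=; have := ler_normD p.1 q.1; have := ler_normB p.2 q.2; lra.
have lu := luw _ _ bx b_y; have lu' := luw _ _ bxt byt; rewrite -/u in lu; rewrite -/u' in lu'.
have lt : l1 (u' - u) = 2 * `|t| by rewrite shift_diff /l1 /= normr0 addr0 normrM ger0_norm.
have dt g : dot g (u' - u) = 2 * t * g.1 by rewrite shift_diff /dot /= mulr0 addr0 mulrC.
pose F k := image_term k (center + (x + (t, 0))) (center + (y + (t, 0))) - image_term k (center + x) (center + y) + 2 * t * (Cs s * speed_term k).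
have t0 := normr_ge0 t.
have err (c : R) : 0 <= c -> c * (l1 (u' - u) * (l1 (u' - w) + l1 (u - w))) <= c * (16 * r * `|t|).
  move=> c0; apply: ler_wpM2l => //; rewrite lt.
  have -> : 16 * r * `|t| = 2 * `|t| * (4 * r + 4 * r) by ring.
  by apply: ler_wpM2l; [rewrite mulr_ge0|exact: lerD].
have FE k : `|F k| = `|G s (sh k u') - G s (sh k u) - dot (gradG 0 (sh k w)) (u' - u)|.
  rewrite dt gradG_image /F /image_term; have [->|k0] := eqVneq k 0.
    rewrite -normrN -/u -/u'; have s0E (p : plane) : sh 0 p = p by rewrite shE mul0r addr0 -surjective_pairing.
    by rewrite !s0E; congr `|_|; move: (G s _) (G s _) (Cs s * _) => g1 g2 g3; ring.
  rewrite /mirror_term -normrN -/u -/u'.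
  have -> : center + (x + (t, 0)) - (center + (y + (t, 0))) = center + x - (center + y).
    by apply: injective_projections => /=; ring.
  by congr `|_|; move: (G s _) (G s _) (G s _) (Cs s * _) => g1 g2 g3 g4; ring.
have m4 (p : plane) : `|p.1 + 2 * d| <= d / 2 -> `|p.1| <= 4 * d.
  by rewrite !ler_norml; move: d0; lra.
have w1 : `|w.1| <= 4 * d by rewrite /= normrN (gtr0_norm (mulr_gt0 (ltr0Sn R 1) d0)) (ler_pM2r d0) ler_nat.
have w2 : `|w.2| <= l / 4 by rewrite /= normr0.
have qF : quad (C1 * (16 * r * `|t|)) F.
  move=> k k0; rewrite FE; have := h1 k u' u w k0 (period_far k0) (m4 _ a1') (m4 _ a1) w1 a2' a2 w2.
  move=> h; apply: le_trans h _; rewrite [leRHS]mulrAC; apply: err.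
  by rewrite divr_ge0 // sqr_ge0.
have F0 : `|F 0| <= M * (16 * r * `|t|).
  rewrite FE; have s0E (p : plane) : sh 0 p = p by rewrite shE mul0r addr0 -surjective_pairing.
  rewrite !s0E !G_Greg.
  have w1' : `|w.1 + 2 * d| <= d / 2 by rewrite /= addNr normr0 divr_ge0 // ltW.
  have [f1 f2] := mirror_far a1' a2'; have [g1 g2] := mirror_far a1 a2; have [k1 k2] := mirror_far w1' w2.
  by apply: le_trans (greg_C11 s0 s1 dd k1 f1 g1 k2 f2 g2) _; exact: err.
have rt : 0 <= 16 * r * `|t| by rewrite !mulr_ge0 // ltW.
have c1 := H_cvg (up _ bxt) (up _ byt); have c2 := H_cvg (up _ bx) (up _ b_y).
have c3 := quad_cvg C30 sq.
have q4 : quad (`|2 * t * Cs s| * C3) (fun k => 2 * t * (Cs s * speed_term k)).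
  by move=> k k0; rewrite mulrA normrM -[leRHS]mulrA; apply: ler_wpM2l => //; exact: sq.
have c4 := quad_cvg (mulr_ge0 (normr_ge0 _) C30) q4.
have q5 : quad (C1 * (16 * r * `|t|) + `|2 * t * Cs s| * C3) (fun k => image_term k (center + (x + (t, 0))) (center + (y + (t, 0))) - image_term k (center + x) (center + y)).
  move=> k k0; have B := qF k k0; have A := q4 k k0; rewrite /F in B.
  rewrite [leRHS]mulrDl -[X in `|X|](addrK (2 * t * (Cs s * speed_term k))); apply: le_trans (ler_normB _ _) _; exact: lerD B A.
have c5 := quad_cvg (addr_ge0 (mulr_ge0 C10 rt) (mulr_ge0 (normr_ge0 _) C30)) q5.
have E : centered_image (x + (t, 0)) (y + (t, 0)) - centered_image x y + 2 * t * (Cs s * ssum speed_term) = ssum F.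
  rewrite /F (ssumD c5 c4) (ssumB c1 c2); congr (_ + _).
  have -> : (fun k => 2 * t * (Cs s * speed_term k)) = (fun k => 2 * t * Cs s * speed_term k) by apply/funext => k; rewrite mulrA.
  by rewrite (ssumZ _ c3) mulrA.
rewrite E; apply: le_trans (symsum_bound (mulr_ge0 C10 rt) qF) _.
have : 0 <= r * `|t| by rewrite mulr_ge0 // ltW.
by move=> h; exact: image_arith h F0.
Qed.

End image_kernel.

(** * Periodization *)

Section periodization.
Variable R : realType.
Notation mR := (measurableTypeR R).
Notation plane := (mR * mR)%type.
Implicit Types (x y z w u v : plane) (f g : plane -> R).

(** The product sigma-algebra contains the open sets, because an open set is a countable union of
    boxes with rational centres. *)
Lemma measurable_continuous2 (phi : plane -> R) : continuous (phi : R * R -> R) ->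
  measurable_fun [set: plane] (phi : plane -> mR).
Proof.
move=> cphi; apply: (measurability _ (RGenOInfty.measurableE R)).
move=> _ [_ [a ->] <-]; rewrite setTI.
pose D (n m : nat) : set plane := box (ratpt R n) m.+1%:R^-1.
pose S := phi @^-1` `]a, +oo[.
have -> : phi @^-1` `]a, +oo[ = \bigcup_n \bigcup_m (if pselect (D n m `<=` S) is left _ then D n m else set0).
  apply/seteqP; split => x; last first.
    by move=> [n _ [m _]]; case: pselect => // h; exact: h.
  move=> /= Sx; have oS : nbhs (x : R * R) S.
    apply: (cphi x); apply: open_nbhs_nbhs; split => //; exact: interval_open.
  have [e e0 he] : exists2 e : R, 0 < e & forall y, l1 (y - x) < e -> S y.
    move: oS => /nbhs_ballP[e /= e0 he]; exists e => // y hy; apply: he.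
    by rewrite -ball_normE /= distrC; apply: le_lt_trans (norm_l1 _) hy.
  pose m := Num.truncn (4 / e); have hm : 4 / e < m.+1%:R := truncnS_gt _.
  have m0 : 0 < m.+1%:R :> R by [].
  have m1 : 4 * m.+1%:R^-1 < e by rewrite ltr_pdivrMr // mulrC -ltr_pdivrMr.
  have mi : 0 < m.+1%:R^-1 :> R by rewrite invr_gt0.
  have [n hn] := ratpt_dense x mi.
  exists n => //; exists m => //; case: pselect => [_|[]].
    by apply/boxP; split; apply: le_trans (ltW hn); rewrite /l1 /= ?lerDl ?lerDr.
  move=> y /boxP[y1 y2]; apply: he; have := l1_triangle (y - ratpt R n) (ratpt R n - x).
  rewrite subrKA [l1 (ratpt R n - x)]l1B => h; apply: le_lt_trans h _.
  have h2 : l1 (y - ratpt R n) <= m.+1%:R^-1 + m.+1%:R^-1 by rewrite /l1; exact: lerD.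
  apply: lt_trans m1; move: h2 hn mi; move: (l1 _) (l1 _) m.+1%:R^-1 => a1 a2 a3; lra.
apply: bigcupT_measurable => n; apply: bigcupT_measurable => m.
by case: pselect => _; [exact: measurable_box|exact: measurable0].
Qed.

Lemma symsum_fsbig (F : int -> R) (n : nat) : (forall k : int, (n < `|k|)%N -> F k = 0) ->
  \sum_(k \in [set: int]) F k = symsum n F.
Proof.
move=> h; pose e (j : nat) : int := j%:Z - n%:Z.
have ue : uniq [seq e j | j <- iota 0 n.*2.+1] by rewrite map_inj_uniq ?iota_uniq // => i j; rewrite /e; lia.
rewrite (fsbigE [seq e j | j <- iota 0 n.*2.+1]) //; last first.
- move=> k _ kn; apply: h; rewrite ltnNge; apply: contra kn => kn.
  apply/mapP; exists (absz ((k : int) + n%:Z)%R); first by rewrite mem_iota; lia.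
  by rewrite /e; lia.
- under eq_bigl do rewrite in_setT.
  by rewrite big_map /symsum -(big_mkord xpredT (fun j => F (e j))) /index_iota subn0.
Qed.

Variable l : R.
Hypothesis l0 : 0 < l.
Notation sh := (shift2 l).

Lemma sh0 x : sh 0 x = x.
Proof. by rewrite shE mul0r addr0 -surjective_pairing. Qed.

Lemma shD j k x : sh j (sh k x) = sh (j + k) x.
Proof. by rewrite !shE /= intrD; congr pair; ring. Qed.

Lemma int_gap (k : int) : k != 0 -> l <= `|k%:~R * l|.
Proof.
move=> k0; rewrite normrM (gtr0_norm l0) -intr_norm ler_peMl ?(ltW l0) //; exact: int_abs_ge1.
Qed.

Lemma periodize_single f x (k0 : int) : (forall k, k != k0 -> f (sh k x) = 0) -> periodize l f x = f (sh k0 x).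
Proof.
move=> h; rewrite /periodize (fsbigE [:: k0]) //=; last by move=> k _; rewrite inE; exact: h.
by rewrite big_cons big_nil in_setT addr0.
Qed.

Lemma periodize0 f x : (forall k, f (sh k x) = 0) -> periodize l f x = 0.
Proof. by move=> h; rewrite /periodize fsbig1. Qed.

Lemma periodize_reindex f g x y (h h' : int -> int) : cancel h h' -> cancel h' h ->
  (forall k, g (sh k y) = f (sh (h k) x)) -> periodize l g y = periodize l f x.
Proof.
move=> c1 c2 e; rewrite /periodize [RHS](@reindex_fsbigT _ _ _ _ _ h); last by exists h'.
by apply: eq_fsbigr => k _; exact: e.
Qed.

Lemma periodize_symsum f x (n : nat) : (forall k : int, (n < `|k|)%N -> f (sh k x) = 0) ->
  periodize l f x = symsum n (fun k => f (sh k x)).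
Proof. exact: symsum_fsbig. Qed.

Lemma strict_diff_symsum (F : int -> plane -> R) x n : (forall k, exists a, strict_diff (F k) x a) ->
  exists a, strict_diff (fun y => symsum n (fun k => F k y)) x a.
Proof.
move=> h; elim: n => [|n [a ha]].
  by have [a ha] := h 0; exists a; apply: strict_diff_near ltr01 _ ha => y _; rewrite symsum0.
have [b hb] := h n.+1%:Z; have [c hc] := h (- n.+1%:Z).
exists (a + (b + c)); apply: strict_diff_near ltr01 _ (strict_diff_add ha (strict_diff_add hb hc)) => y _.
by rewrite symsumS.
Qed.

Lemma ig_symsum (F : int -> plane -> R) n : (forall k, ig (F k)) ->
  ig (fun y => symsum n (fun k => F k y)) /\ I (fun y => symsum n (fun k => F k y)) = symsum n (fun k => I (F k)).
Proof.
move=> h; elim: n => [|n [i1 i2]].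
  have -> : (fun y => symsum 0 (fun k => F k y)) = F 0 by apply/funext => y; rewrite symsum0.
  by rewrite symsum0.
have -> : (fun y => symsum n.+1 (fun k => F k y)) = (fun y => symsum n (fun k => F k y) + (F n.+1%:Z y + F (- n.+1%:Z) y)).
  by apply/funext => y; rewrite symsumS.
have i3 := igD (h n.+1%:Z) (h (- n.+1%:Z)).
split; first exact: igD.
by rewrite (ID i1 i3) (ID (h n.+1%:Z) (h (- n.+1%:Z))) i2 symsumS.
Qed.

End periodization.

(** * Regularity of the profile *)

Section profile_regularity.
Variable R : realType.
Implicit Types (t u v a b c : R).

(** It vanishes outside the unit interval and is continuous, so the kinks of [clamp] are invisible
    to [smoothstep]. *)
Definition dsmoothstep t : R := 6 * (clamp t * (1 - clamp t)).

Lemma clamp_excess_lip u v : `|(clamp u - clamp v) - (u - v)| <= `|u - v|.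
Proof.
wlog uv : u v / u <= v.
  move=> H; case: (leP u v) => [|/ltW] /H //.
  rewrite [`|v - u|]distrC; move=> h; apply: le_trans h; rewrite -normrN.
  by rewrite le_eqVlt; apply/orP; left; apply/eqP; congr `|_|; ring.
rewrite [`|u - v|]distrC [leRHS]ger0_norm ?subr_ge0 // ler_norml.
by rewrite /clamp; case: (leP u 0) => h1; [|case: (leP u 1) => h2]; (case: (leP v 0) => h3; [|case: (leP v 1) => h4]); lra.
Qed.

(** From [t] to a point outside the unit interval one has to cross an end, where the factor on the
    left vanishes. *)
Lemma clamp_outside u t : clamp u != u -> clamp t * (1 - clamp t) <= `|u - t|.
Proof.
move=> ne; have /andP[c0 c1] := clamp01 t; have h := clamp_lip u t.
have [u0|u0] := leP u 0.
  rewrite (clamp_le0 u0) sub0r normrN (ger0_norm c0) in h; apply: le_trans h.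
  by rewrite mulrBr mulr1 gerBl mulr_ge0.
have [u1|u1] := leP u 1; first by rewrite clamp_id ?eqxx // ltW in ne.
rewrite (clamp_ge1 (ltW u1)) in h; apply: le_trans (ler_norm _) _; apply: le_trans _ h.
by rewrite [leRHS]ger0_norm ?subr_ge0 // ger0_norm; nra.
Qed.

Lemma clamp_outside2 u v t : clamp t * (1 - clamp t) * `|(clamp u - clamp v) - (u - v)| <=
  `|u - v| * (`|u - t| + `|v - t|).
Proof.
have n1 := normr_ge0 (u - t); have n2 := normr_ge0 (v - t); have n3 := normr_ge0 (u - v).
have /andP[c0 c1] := clamp01 t.
have cc : 0 <= clamp t * (1 - clamp t) by rewrite mulr_ge0 // subr_ge0.
have E := clamp_excess_lip u v.
have [u1|u1] := eqVneq (clamp u) u; last first.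
  rewrite mulrC; apply: ler_pM => //; apply: le_trans (clamp_outside t u1) _; lra.
have [v1|v1] := eqVneq (clamp v) v; last first.
  rewrite mulrC; apply: ler_pM => //; apply: le_trans (clamp_outside t v1) _; lra.
by rewrite u1 v1 subrr normr0 mulr0 mulr_ge0 // addr_ge0.
Qed.

Lemma smoothstep_C11_arith a b c : 0 <= a -> a <= 1 -> 0 <= b -> b <= 1 -> 0 <= c -> c <= 1 ->
  `|3 * (a + b) - 2 * (a ^+ 2 + a * b + b ^+ 2) - 6 * (c * (1 - c))| <= 9 * (`|a - c| + `|b - c|).
Proof.
move=> a0 a1 b0 b1 c0 c1.
have -> : 3 * (a + b) - 2 * (a ^+ 2 + a * b + b ^+ 2) - 6 * (c * (1 - c)) =
  (3 - 2 * (a + c + b)) * (a - c) + (3 - 2 * (b + c + c)) * (b - c) by ring.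
apply: le_trans (ler_normD _ _) _; rewrite [leRHS]mulrDr !normrM; apply: lerD; apply: ler_wpM2r => //;
  rewrite ler_norml; apply/andP; split; lra.
Qed.

(** The cubic contributes [9]; the difference between [clamp u - clamp v] and [u - v] contributes
    [6] by [clamp_outside2]. *)
Lemma smoothstep_C11 u v t : `|smoothstep u - smoothstep v - dsmoothstep t * (u - v)| <= 15 * `|u - v| * (`|u - t| + `|v - t|).
Proof.
have /andP[a0 a1] := clamp01 u; have /andP[b0 b1] := clamp01 v; have /andP[c0 c1] := clamp01 t.
have hu := clamp_lip u t; have hv := clamp_lip v t; have huv := clamp_lip u v.
have o := clamp_outside2 u v t; have m := smoothstep_C11_arith a0 a1 b0 b1 c0 c1.
have cc : 0 <= clamp t * (1 - clamp t) by rewrite mulr_ge0 // subr_ge0.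
have -> : smoothstep u - smoothstep v - dsmoothstep t * (u - v) =
  (3 * (clamp u + clamp v) - 2 * (clamp u ^+ 2 + clamp u * clamp v + clamp v ^+ 2) - 6 * (clamp t * (1 - clamp t))) * (clamp u - clamp v) +
  6 * (clamp t * (1 - clamp t) * ((clamp u - clamp v) - (u - v))) by rewrite /smoothstep /cubic /dsmoothstep; ring.
apply: le_trans (ler_normD _ _) _.
have -> : 15 * `|u - v| * (`|u - t| + `|v - t|) = 9 * (`|u - t| + `|v - t|) * `|u - v| + 6 * (`|u - v| * (`|u - t| + `|v - t|)) by ring.
apply: lerD.
  rewrite normrM; apply: ler_pM => //; apply: le_trans m _; apply: ler_wpM2l => //; exact: lerD.
by rewrite normrM ger0_norm //; apply: ler_wpM2l => //; rewrite normrM (ger0_norm cc).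
Qed.

End profile_regularity.

(** * Shifting the index of a symmetric sum *)

Section sums.
Variable R : realType.

Lemma int_gt_neq0 (n : nat) (k : int) : (n < `|k|)%N -> k != 0.
Proof. by lia. Qed.

Lemma int_gt_norm (n : nat) (k : int) : (n < `|k|)%N -> n.+1%:R <= `|k|%:~R :> R.
Proof. by move=> h; rewrite -[leLHS]mulrz_nat ler_int; lia. Qed.

Implicit Types (F : int -> R).

Lemma symsum_delta (c : R) N : symsum N (fun k : int => if k == 0 then c else 0) = c.
Proof. by elim: N => [|N IH]; [rewrite symsum0 eqxx|rewrite symsumS IH /= !addr0]. Qed.

Lemma symsum_succ F N : symsum N (fun k => F (k + 1)) = symsum N F + F N.+1%:Z - F (- N%:Z).
Proof.
elim: N => [|N IH]; first by rewrite !symsum0 add0r oppr0; ring.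
rewrite !symsumS IH.
have -> : N.+1%:Z + 1 = N.+2%:Z by lia.
have -> : - N.+1%:Z + 1 = - N%:Z by lia.
ring.
Qed.

(** Symmetric limits are not shift invariant in general; here the two boundary terms tend to zero.
    This is the periodicity of the stream function. *)
Lemma ssum_succ F (C : R) (n : nat) : 0 <= C -> (0 < n)%N -> (forall k : int, (n < `|k|)%N -> `|F k| <= C / k%:~R ^+ 2) ->
  ssum (fun k => F (k + 1)) = ssum F.
Proof.
move=> C0 n0 h; have [cF _] := symsum_cvg C0 n0 h.
apply/cvg_lim => //; have -> : (fun N => symsum N (fun k => F (k + 1))) = (fun N => symsum N F + (F N.+1%:Z - F (- N%:Z))).
  by apply/funext => N; rewrite symsum_succ addrA.
rewrite -[X in _ --> X]addr0; apply: cvgD => //.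
apply/cvgrPdist_le => e e0; near=> N.
have nN : (n < N)%N by near: N; exact: nbhs_infty_gt.
have N1 : 1 <= N%:R :> R by rewrite ler1n; lia.
have hN : 2 * C / e <= N%:R.
  near: N; exists (Num.truncn (2 * C / e)).+1 => // m /= hm.
  by apply: le_trans (ltW (truncnS_gt _)) _; rewrite ler_nat.
have b (k : int) : (N <= `|k|)%N -> `|F k| <= C / N%:R.
  move=> kN; have nk : (n < `|k|)%N by apply: leq_trans nN kN.
  apply: le_trans (h k nk) _; apply: ler_wpM2l => //.
  have Nk : N%:R <= `|k%:~R| :> R by rewrite -intr_norm; move: kN; rewrite -(ler_nat R) => kN; apply: le_trans kN _; rewrite -[leLHS]mulrz_nat; rewrite ler_int; lia.
  have k1 := le_trans N1 Nk; have N0 : 0 < N%:R :> R := lt_le_trans ltr01 N1.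
  have k0 : 0 < `|k%:~R : R| := lt_le_trans ltr01 k1.
  rewrite -(real_normK (num_real (k%:~R : R))) lef_pV2 ?posrE ?exprn_gt0 //.
  by rewrite expr2; apply: le_trans Nk _; rewrite ler_peMl // ltW.
rewrite sub0r normrN; apply: le_trans (ler_normB _ _) _.
apply: le_trans (lerD (b _ _) (b _ _)) _; [lia|lia|].
have -> : C / N%:R + C / N%:R = 2 * C / N%:R by ring.
have N0 : 0 < N%:R :> R := lt_le_trans ltr01 N1.
by rewrite (ler_pdivrMr _ _ N0) [leRHS]mulrC -(ler_pdivrMr _ _ e0).
Unshelve. all: by end_near. Qed.

End sums.

(** * The vortex street *)

Lemma centered_imageE (R : realType) (s l d : R) x y : centered_image s l d x y = ssum (fun k => image_term s l k (center d + x) (center d + y)).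
Proof. by []. Qed.
Local Opaque centered_image.

Section wave.
Variable R : realType.
Notation mR := (measurableTypeR R).
Notation plane := (mR * mR)%type.
Implicit Types (x y z w u v p : plane).
Variables (s l d r W A c1 c0 : R) (f : plane -> R).
Hypotheses (s0 : 0 < s) (s1 : s <= 1) (l0 : 0 < l) (d0 : 0 < d) (r0 : 0 < r) (rr : r <= rH l d).
Hypotheses (nf : nice f) (f0 : forall x, 0 <= f x) (If : I f = 1)
  (foff : forall x, ~ box 0 (r / 4) x -> f x = 0) (fry : forall x, f (ry x) = f x)
  (fE : forall x, box 0 (r / 2) x ->
    f x = A * smoothstep (c1 * (pot s f x + I (fun y => centered_image s l d x y * f y) + W * x.1) + c0)).
Notation sh := (shift2 l).
Notation mirror := (@mirror R).
Notation center := (center d).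
Notation mirror_term := (mirror_term s l).
Notation image_term := (image_term s l).

Definition vortex1 x : R := f (x - center).
Definition vortex2 x : R := vortex1 (mirror x).
Definition street x : R := periodize l vortex1 x - periodize l vortex2 x.
Definition row_pot x : R := pot s vortex1 x.
(** The opposite vortex is accounted for by mirroring the point of evaluation. The two signs are
    combined before summation, since the potentials of one row alone need not be summable. *)
Definition pair_pot (k : int) x : R := row_pot (sh k x) - row_pot (sh k (mirror x)).
Definition psi x : R := ssum (fun k => pair_pot k x).

Let rd : r <= d / 8. Proof. exact: le_trans rr (rH_d l d). Qed.
Let rl : r <= l / 8. Proof. exact: le_trans rr (rH_l l d). Qed.

Lemma mirrorK x : mirror (mirror x) = x.
Proof. by rewrite /mirror /= opprK -surjective_pairing. Qed.

Lemma sh_mirror k x : sh k (mirror x) = mirror (sh k x).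
Proof. by rewrite !shE. Qed.

Lemma vortex1_nice : nice vortex1. Proof. exact: (nice_shift (- center) nf). Qed.

Lemma vortex1_ge0 x : 0 <= vortex1 x. Proof. exact: f0. Qed.

Lemma vortex1_supp x : vortex1 x != 0 -> `|x.1 + d| <= r / 4 /\ `|x.2| <= r / 4.
Proof.
move=> h; have : box 0 (r / 4) (x - center) by apply: contrapT => nb; rewrite /vortex1 foff // eqxx in h.
by move=> /boxP[]; rewrite !subr0 /= opprK subr0.
Qed.

Lemma vortex1_off x : r / 4 < `|x.2| -> vortex1 x = 0.
Proof. by move=> h; apply/eqP; apply: contraTT h => /vortex1_supp[_]; rewrite -leNgt. Qed.

Lemma vortex1_right x : - d + r / 4 < x.1 -> vortex1 x = 0.
Proof.
move=> h; apply/eqP; apply: contraTT h => /vortex1_supp[+ _]; rewrite -leNgt ler_norml => /andP[_].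
by lra.
Qed.

Lemma vortex1_mass : I vortex1 = 1.
Proof. by have [_ h] := I_shift (- center) (nice_ig nf); rewrite /vortex1 -If -h. Qed.

Lemma vortex1_average (F : plane -> R) (c : R) : 0 <= c -> ig (fun y => F y * vortex1 y) ->
  (forall y, vortex1 y != 0 -> `|F y| <= c) -> `|I (fun y => F y * vortex1 y)| <= c.
Proof.
move=> cc iF h; apply: le_trans (I_abs iF) _.
have ic := igZ c (nice_ig vortex1_nice).
apply: (@le_trans _ _ (I (fun y => c * vortex1 y))); last by rewrite (IZ _ (nice_ig vortex1_nice)) vortex1_mass mulr1.
apply: I_mono => //; first exact: ig_abs.
move=> y; rewrite normrM (ger0_norm (vortex1_ge0 y)).
have [->|ne] := eqVneq (vortex1 y) 0; first by rewrite !mulr0.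
by apply: ler_wpM2r; [exact: vortex1_ge0|exact: h].
Qed.

Lemma mulBl_eq (a b c : R) : a * c - b * c = (a - b) * c.
Proof. by rewrite mulrBl. Qed.

Lemma mul_eq_off (a b c : R) : (c != 0 -> a = b) -> a * c = b * c.
Proof. by have [->|c0' h] := eqVneq c 0; [rewrite !mulr0|rewrite h]. Qed.

Lemma sh_sub k x y : sh k x - y = sh k (x - y).
Proof. by rewrite !shE; apply: injective_projections => /=; ring. Qed.

Lemma G_sh_mirror k x y : G s (sh k (mirror x) - y) = G s (sh k (x - mirror y)).
Proof.
rewrite -[RHS]G_mirror; congr (G s _); rewrite !shE /mirror; apply: injective_projections => /=; ring.
Qed.

Lemma G_vortex1_ig k x : ig (fun y => G s (sh k (x - y)) * vortex1 y) /\ I (fun y => G s (sh k (x - y)) * vortex1 y) = row_pot (sh k x).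
Proof.
have h := pot_ig s0 s1 (sh k x) vortex1_nice; rewrite /row_pot /pot.
have -> : (fun y => G s (sh k (x - y)) * vortex1 y) = (fun y => G s (sh k x - y) * vortex1 y).
  by apply/funext => y; rewrite sh_sub.
by split.
Qed.

Lemma G_vortex1_ig_mirror k x : ig (fun y => G s (sh k (x - mirror y)) * vortex1 y) /\
  I (fun y => G s (sh k (x - mirror y)) * vortex1 y) = row_pot (sh k (mirror x)).
Proof.
have h := pot_ig s0 s1 (sh k (mirror x)) vortex1_nice; rewrite /row_pot /pot.
have -> : (fun y => G s (sh k (x - mirror y)) * vortex1 y) = (fun y => G s (sh k (mirror x) - y) * vortex1 y).
  by apply/funext => y; rewrite G_sh_mirror.
by split.
Qed.

Lemma pair_potE k x : ig (fun y => mirror_term k x y * vortex1 y) /\ pair_pot k x = I (fun y => mirror_term k x y * vortex1 y).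
Proof.
have [i1 e1] := G_vortex1_ig k x; have [i2 e2] := G_vortex1_ig_mirror k x.
rewrite /pair_pot -e1 -e2 -(IB i1 i2).
have -> : (fun y => mirror_term k x y * vortex1 y) = (fun y => G s (sh k (x - y)) * vortex1 y - G s (sh k (x - mirror y)) * vortex1 y).
  by apply/funext => y; rewrite /mirror_term mulrBl.
split; [exact: igB i1 i2|exact: erefl].
Qed.

(** The bounds for [mirror_term] are averaged over the vortex of unit mass; [n] depends on [M]
    because [x] may be far from the axis. *)
Lemma pair_pot_bounds (M : R) : 0 <= M -> exists (C : R) (n : nat), [/\ 0 <= C, (0 < n)%N &
  forall k : int, (n < `|k|)%N -> forall x x', box 0 M x -> box 0 M x' ->
  `|pair_pot k x| <= C / k%:~R ^+ 2 /\ `|pair_pot k x - pair_pot k x'| <= C / k%:~R ^+ 2 * l1 (x - x')].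
Proof.
move=> M0; have A0 : 0 <= M + 2 * d by rewrite addr_ge0 // mulr_ge0 // ltW.
have T0 : 0 <= M + l by rewrite addr_ge0 // ltW.
have [C C0 h] := mirror_term_bounds s0 s1 l0 A0 T0.
pose n := (Num.truncn (2 * (M + l) / l)).+1.
exists C, n; split => // k nk x x' /boxP[]; rewrite !subr0 => x1 x2 /boxP[]; rewrite !subr0 => x1' x2'.
have k0 := int_gt_neq0 nk.
have kf : M + l <= `|k|%:~R * (l / 2).
  have : 2 * (M + l) / l <= `|k|%:~R.
    apply: le_trans (ltW (truncnS_gt _)) _; apply: le_trans _ (int_gt_norm R nk); by rewrite ler_nat leqnSn.
  by rewrite ler_pdivrMr //; lra.
have cc : 0 <= C / k%:~R ^+ 2 by rewrite divr_ge0 // sqr_ge0.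
have bd (t : R) : `|t| <= M -> `|t| <= M + 2 * d by move=> ht; move: d0; lra.
have key y : vortex1 y != 0 -> `|mirror_term k x y| <= C / k%:~R ^+ 2 /\ `|mirror_term k x y - mirror_term k x' y| <= C / k%:~R ^+ 2 * l1 (x - x').
  move=> /vortex1_supp[y1 y2]; apply: h => //; try exact: bd.
  - by move: y1 M0 rd r0 d0; rewrite !ler_norml; lra.
  - by apply: le_trans (ler_normB _ _) _; move: y2 x2 rl r0 l0; lra.
  - by apply: le_trans (ler_normB _ _) _; move: y2 x2' rl r0 l0; lra.
have [i1 e1] := pair_potE k x; have [i2 e2] := pair_potE k x'.
split; first by rewrite e1; apply: vortex1_average => // y /key[].
rewrite e1 e2 -(IB i1 i2).
have -> : (fun y => mirror_term k x y * vortex1 y - mirror_term k x' y * vortex1 y) = (fun y => (mirror_term k x y - mirror_term k x' y) * vortex1 y).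
  by apply/funext => y; exact: mulBl_eq.
apply: vortex1_average; first by rewrite mulr_ge0 // l1_ge0.
  suff <- : (fun y => mirror_term k x y * vortex1 y - mirror_term k x' y * vortex1 y) = (fun y => (mirror_term k x y - mirror_term k x' y) * vortex1 y) by exact: igB i1 i2.
  by apply/funext => y; exact: mulBl_eq.
by move=> y /key[].
Qed.

Lemma box_of_l1 x (M : R) : l1 x <= M -> box 0 M x.
Proof.
move=> h; apply/boxP; rewrite !subr0; split; apply: le_trans h; by rewrite /l1 ?lerDl ?lerDr.
Qed.

Lemma psi_cvg x : cvgn (fun N => symsum N (fun k => pair_pot k x)).
Proof.
have [C [n [C0 n0 h]]] := pair_pot_bounds (l1_ge0 x); have b := box_of_l1 (lexx (l1 x)).
have H (k : int) : (n < `|k|)%N -> `|pair_pot k x| <= C / k%:~R ^+ 2 by move=> nk; have [] := h k nk x x b b.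
by have [] := symsum_cvg C0 n0 H.
Qed.

Lemma row_pot_strict_diff x : exists a, strict_diff row_pot x a.
Proof. have [M [C [K [M0 C0 K0 af]]]] := vortex1_nice; exact: (pot_strict_diff s0 s1 x M0 C0 K0 af). Qed.

Lemma pair_pot_strict_diff k x : exists a, strict_diff (pair_pot k) x a.
Proof.
pose h : plane := (0, k%:~R * l); have shh y : sh k y = y + h.
  by rewrite shE; apply: injective_projections => /=; rewrite ?addr0.
have [a ha] := row_pot_strict_diff (x + h); have [b hb] := row_pot_strict_diff (mirror (x + h)).
exists (a - (- b.1, b.2)).
have h1 := strict_diff_shift ha; have h2 := strict_diff_shift (strict_diff_refl1 hb).
apply: strict_diff_near ltr01 _ (strict_diff_sub h1 h2) => y _.
by rewrite /pair_pot sh_mirror !shh.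
Qed.

(** Finite partial sums are strictly differentiable, and the tail has Lipschitz constant at most
    [2 * C / N] near [x]. *)
Lemma psi_strict_diff x : exists a, strict_diff psi x a.
Proof.
apply: strict_diff_pert => e e0; pose M := l1 x + 1; have M0 : 0 <= M by rewrite addr_ge0 // l1_ge0.
have [C [n [C0 n0 h]]] := pair_pot_bounds M0.
pose N := maxn n (Num.truncn (2 * C / e)).+1.
have nN : (n <= N)%N by rewrite leq_maxl.
have N0 : 0 < N%:R :> R by rewrite ltr0n; exact: leq_trans nN.
have hN : 2 * C / N%:R <= e.
  rewrite (ler_pdivrMr _ _ N0) [leRHS]mulrC -(ler_pdivrMr _ _ e0); apply: le_trans (ltW (truncnS_gt _)) _.
  by rewrite ler_nat leq_maxr.
exists (fun y => symsum N (fun k => pair_pot k y)).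
have [a ha] := @strict_diff_symsum R pair_pot x N (fun k => pair_pot_strict_diff k x).
exists a; split => //; exists 1 => // y z yx zx.
have bb w : l1 (w - x) < 1 -> box 0 M w.
  move=> hw; apply: box_of_l1; rewrite -(subrK x w); apply: le_trans (l1_triangle _ _) _.
  by rewrite addrC /M lerD2l ltW.
have n1 := l1_ge0 (y - z).
have H (k : int) : (n < `|k|)%N -> `|pair_pot k y - pair_pot k z| <= C * l1 (y - z) / k%:~R ^+ 2.
  move=> nk; have [_] := h k nk y z (bb _ yx) (bb _ zx).
  by rewrite mulrAC.
have [_ T] := symsum_cvg (mulr_ge0 C0 n1) n0 H.
have := T N nN; have -> : limn (fun N => symsum N (fun k => pair_pot k y - pair_pot k z)) = psi y - psi z.
  exact: (ssumB (@psi_cvg y) (@psi_cvg z)).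
rewrite symsumB => hh; have E (a1 a2 b1 b2 : R) : a1 - b1 - (a2 - b2) = a1 - a2 - (b1 - b2) by ring.
rewrite E.
apply: le_trans hh _; rewrite mulrA mulrAC; exact: ler_wpM2r.
Qed.

Lemma psi_mirror x : psi (mirror x) = - psi x.
Proof.
rewrite /psi -mulN1r -(ssumZ _ (@psi_cvg x)); apply: (congr1 (@ssum R)); apply/funext => k.
by rewrite /pair_pot mirrorK mulN1r opprB.
Qed.

Lemma psi_sh1 x : psi (sh 1 x) = psi x.
Proof.
have [C [n [C0 n0 h]]] := pair_pot_bounds (l1_ge0 x); have b := box_of_l1 (lexx (l1 x)).
have H (k : int) : (n < `|k|)%N -> `|pair_pot k x| <= C / k%:~R ^+ 2 by move=> nk; have [] := h k nk x x b b.
apply: etrans (ssum_succ (F := fun k => pair_pot k x) C0 n0 H); apply: (congr1 (@ssum R)); apply/funext => k.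
by rewrite /pair_pot -sh_mirror !shD.
Qed.

Lemma psi_sh k x : psi (sh k x) = psi x.
Proof.
have E n : psi (sh n%:Z x) = psi x.
  elim: n => [|n IH]; first by rewrite sh0.
  by rewrite -IH -(psi_sh1 (sh n x)) shD; congr (psi (sh _ x)); lia.
case: k => n; first exact: E.
have := psi_sh1; have E2 m y : psi (sh m%:Z y) = psi y.
  elim: m => [|m IH]; first by rewrite sh0.
  by rewrite -IH -(psi_sh1 (sh m y)) shD; congr (psi (sh _ y)); lia.
by move=> _; rewrite -[LHS](E2 n.+1) shD -[RHS](congr1 psi (sh0 l x)); congr (psi (sh _ x)); lia.
Qed.

(** A region larger than the left half of a period cell, so that the identity holds in a
    neighbourhood of each of its points. *)
Lemma street_near y : y.1 < d - r / 4 -> `|y.2| < l - r / 4 -> street y = vortex1 y.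
Proof.
move=> y1 y2; rewrite /street (periodize0 (f := vortex2)); last first.
  by move=> k; rewrite /vortex2 -sh_mirror shE; apply: vortex1_right => /=; lra.
rewrite subr0 (periodize_single (k0 := 0)) ?sh0 // => k k0; apply: vortex1_off; rewrite shE /=.
have := int_gap l0 k0; have := lerB_normD (k%:~R * l) y.2; rewrite [y.2 + _]addrC; lra.
Qed.

(** Near the vortex the stream function is its own potential plus the integral of the image kernel.
    Sum and integral are exchanged by the tail bound of the image series, which is uniform on the
    support. *)
Lemma vortex1_eq x : box center (r / 2) x -> vortex1 x = A * smoothstep (c1 * (psi x + W * (x.1 + d)) + c0).
Proof.
move=> bx; pose xi := x - center; have xE : x = center + xi by rewrite addrC subrK.
have bxi : box 0 (r / 2) xi by move: bx => /boxP[h1 h2]; apply/boxP; rewrite !subr0.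
have rp := r0.
have r2 : r / 2 <= r by lra.
have r4 : r / 4 <= r by lra.
have bH y : box 0 r y -> box 0 (rH l d) y by exact: box_mono.
have bxH : box 0 (rH l d) xi := bH _ (box_mono r2 bxi).
have fH y : f y != 0 -> box 0 (rH l d) y.
  by move=> h; apply/bH/(box_mono r4); apply: contrapT => nb; rewrite foff ?eqxx // in h.
have hk0 y : mirror_term 0 x (center + y) = G s (xi - y) + image_term 0 x (center + y).
  have E : x - (center + y) = xi - y by rewrite opprD addrA.
  by rewrite image_term0 /mirror_term !sh0 E.
have thz y : vortex1 (center + y) = f y by rewrite /vortex1 [center + y]addrC addrK.
have iQ k : ig (fun y => image_term k x (center + y) * f y) /\
    pair_pot k x = (if k == 0 then pot s f xi else 0) + I (fun y => image_term k x (center + y) * f y).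
  have [i1 e1] := pair_potE k x; have [i2 e2] := I_shift center i1.
  have E : (fun y => mirror_term k x (y + center) * vortex1 (y + center)) = (fun y => mirror_term k x (center + y) * f y).
    by apply/funext => y; rewrite [y + center]addrC thz.
  rewrite E in i2 e2; have [k0|k0] := eqVneq k 0; last first.
    have -> : (fun y => image_term k x (center + y) * f y) = (fun y => mirror_term k x (center + y) * f y).
      by apply/funext => y; rewrite image_termE.
    by split=> //; rewrite add0r e1 e2.
  subst k; have i3 := pot_ig s0 s1 xi nf.
  have E2 : (fun y => image_term 0 x (center + y) * f y) = (fun y => mirror_term 0 x (center + y) * f y - G s (xi - y) * f y).
    by apply/funext => y; rewrite hk0; ring.
  rewrite E2; split; first exact: igB.
  by rewrite (IB i2 i3) e1 -e2 /pot addrC subrK.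
have iS N := ig_symsum N (fun k => (iQ k).1).
have SE N : symsum N (fun k => pair_pot k x) = pot s f xi + I (fun y => symsum N (fun k => image_term k x (center + y)) * f y).
  rewrite (eq_symsum N (fun k => (iQ k).2)) symsumD symsum_delta -(iS N).2; congr (_ + I _).
  apply/funext => y; rewrite mulrC -symsumZ; apply: eq_symsum => k; exact: mulrC.
have [CH [LH hK]] := H_kernel s0 s1 l0 d0.
have iH : ig (fun y => centered_image s l d xi y * f y).
  suff <- : (fun y => centered_image s l d (clip2 r xi) (clip2 r y) * f y) = (fun y => centered_image s l d xi y * f y).
    exact: (bpot_ig (hK r r0 rr) xi nf).
  apply/funext => y.
  apply: mul_eq_off => fy.
  have b_y : box 0 r y by apply: (box_mono r4); apply: contrapT => nb; rewrite foff ?eqxx // in fy.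
  exact: (congr2 (centered_image s l d) (clip2_id (box_mono r2 bxi)) (clip2_id b_y)).
have [C C0 hB] := image_term_bounds s0 s1 l0 d0.
have psiE : psi x = pot s f xi + I (fun y => centered_image s l d xi y * f y).
  apply/cvg_lim => //; have -> : (fun N => symsum N (fun k => pair_pot k x)) =
    (fun N => pot s f xi + I (fun y => symsum N (fun k => image_term k x (center + y)) * f y)) by apply/funext.
  apply: cvgD; first exact: cvg_cst.
  apply/cvgrPdist_le => e e0; near=> N.
  have N0 : (0 < N)%N by near: N; exact: nbhs_infty_gt.
  have hN : 2 * C / e <= N%:R.
    near: N; exists (Num.truncn (2 * C / e)).+1 => // m /= hm.
    by apply: le_trans (ltW (truncnS_gt _)) _; rewrite ler_nat.
  have Np : 0 < N%:R :> R by rewrite ltr0n.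
  have iN : ig (fun y => symsum N (fun k => image_term k x (center + y)) * f y).
    have := (iS N).1; congr ig; apply/funext => y.
    by rewrite mulrC -symsumZ; apply: eq_symsum => k; exact: mulrC.
  rewrite -(IB iH iN).
  have ie := igZ e (nice_ig nf).
  apply: le_trans (I_abs (igB iH iN)) _; apply: (@le_trans _ _ (I (fun y => e * f y))); last first.
    by rewrite (IZ _ (nice_ig nf)) If mulr1.
  apply: I_mono; [exact: ig_abs (igB iH iN)|exact: ie|move=> y].
  rewrite -mulrBl normrM (ger0_norm (f0 y)); have [->|fy] := eqVneq (f y) 0; first by rewrite !mulr0.
  apply: ler_wpM2r => //; have [q _ _ _] := hB _ _ _ bxH bxH (fH _ fy).
  have qq (k : int) : (1 < `|k|)%N -> `|image_term k (center + xi) (center + y)| <= C / k%:~R ^+ 2.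
    by move=> k1; apply: q; exact: int_gt_neq0 k1.
  have [_ T] := symsum_cvg C0 (ltn0Sn 0) qq.
  have := T N N0; rewrite -xE => h; apply: le_trans (_ : 2 * C / N%:R <= e).
    by rewrite centered_imageE -xE.
  by rewrite (ler_pdivrMr _ _ Np) [leRHS]mulrC -(ler_pdivrMr _ _ e0).
by rewrite {1}/vortex1 -/xi (fE bxi) psiE; congr (A * smoothstep (c1 * (_ + W * _) + c0)); rewrite /xi /= opprK.
Unshelve. all: by end_near. Qed.

Lemma mul_symsum N (c : R) (F : int -> R) : symsum N F * c = symsum N (fun k => F k * c).
Proof. by rewrite mulrC -symsumZ; apply: eq_symsum => k; exact: mulrC. Qed.

Lemma vortex1_row y : l / 2 <= `|y.2| -> vortex1 y = 0.
Proof. by move=> h; apply: vortex1_off; apply: lt_le_trans h; move: rl r0 l0; lra. Qed.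

Lemma street_strip y : strip l y -> street y = vortex1 y - vortex2 y.
Proof.
move=> /andP[y1 y2]; have far k : k != 0 -> l / 2 <= `|(sh k y).2|.
  move=> k0; rewrite shE /=; have := int_gap l0 k0; have := lerB_normD (k%:~R * l) y.2; rewrite [y.2 + _]addrC.
  have : `|y.2| < l / 2 by rewrite ltr_norml y1.
  lra.
rewrite /street (@periodize_single R l vortex1 y 0) ?(@periodize_single R l vortex2 y 0) ?sh0 // => k /far h.
  by rewrite /vortex2 vortex1_row.
exact: vortex1_row.
Qed.

Lemma strip_measurable : measurable (strip l : set plane).
Proof.
have -> : strip l = setT `*` `]- (l / 2), (l / 2)[ :> set plane.
  by apply/seteqP; split => y; rewrite /strip /= in_itv /=; [|case].
by apply: measurableX => //; exact: measurable_itv.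
Qed.

Lemma stream_psi : stream_function s l street psi.
Proof.
move=> x; pose F k y := G s (sh k (x - y)) * vortex1 y - G s (sh k (x - y)) * vortex2 y.
have iF k : ig (F k) /\ I (F k) = pair_pot k x.
  have [i1 e1] := G_vortex1_ig k x; have [i2 e2] := G_vortex1_ig_mirror k x.
  have [i3 e3] := I_refl1 i2.
  have E : (fun y => G s (sh k (x - mirror (- y.1, y.2))) * vortex1 (- y.1, y.2)) = (fun y => G s (sh k (x - y)) * vortex2 y).
    by apply/funext => y; rewrite -[(- y.1, y.2)]/(mirror y) mirrorK.
  rewrite E in i3 e3; split; first exact: igB i1 i3.
  by rewrite /F (IB i1 i3) e1 e3 e2.
have E N : (fun y => perG s l N (x - y) * street y) \_ (strip l) = (fun y => symsum N (fun k => F k y)).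
  apply/funext => y; rewrite patchE; case: ifPn => [|]; rewrite ?inE => hy.
    rewrite street_strip // /perG mul_symsum; apply: eq_symsum => k; exact: mulrBr.
  have h : l / 2 <= `|y.2|.
    rewrite leNgt; apply/negP => h; move: hy; rewrite notin_setE; apply.
    by move: h; rewrite ltr_norml.
  have h1 : vortex1 y = 0 := vortex1_row h.
  have h2 : vortex2 y = 0 by rewrite /vortex2 vortex1_row.
  rewrite (_ : (fun k => F k y) = (fun k => 0 * 0)); last by apply/funext => k; rewrite /F h1 h2 !mulr0 subrr.
  by rewrite symsumZ mul0r.
have S N := ig_symsum N (fun k => (iF k).1).
split=> [N|].
  apply/(integrable_mkcond _ strip_measurable); rewrite restrict_EFin; apply/igP; rewrite E; exact: (S N).1.
have -> : (fun N => \int[leb2 R]_(y in strip l) (perG s l N (x - y) * street y)) = (fun N => symsum N (fun k => pair_pot k x)).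
  apply/funext => N; rewrite Rintegral_mkcond E; rewrite -[LHS]/(I (fun y => symsum N (fun k => F k y))) (S N).2.
  by apply: eq_symsum => k; exact: (iF k).2.
exact: (@psi_cvg x).
Qed.

Lemma street_sh k x : street (sh k x) = street x.
Proof.
have E g : periodize l g (sh k x) = periodize l g x.
  apply: (periodize_reindex (h := fun j => j + k) (h' := fun j => j - k)).
  - by move=> j; rewrite addrK.
  - by move=> j; rewrite subrK.
  - by move=> j; rewrite shD.
by rewrite /street !E.
Qed.

Lemma street_mir x : street (mirror x) = - street x.
Proof.
have E1 : periodize l vortex1 (mirror x) = periodize l vortex2 x.
  by apply: (periodize_reindex (h := id) (h' := id)) => // k; rewrite sh_mirror.
have E2 : periodize l vortex2 (mirror x) = periodize l vortex1 x.
  by apply: (periodize_reindex (h := id) (h' := id)) => // k; rewrite sh_mirror /vortex2 mirrorK.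
by rewrite /street E1 E2 opprB.
Qed.

Lemma vortex1_ry x : vortex1 (ry x) = vortex1 x.
Proof.
rewrite /vortex1 -(fry (x - center)); congr f; rewrite /ry; apply: injective_projections => //=.
by rewrite !subr0.
Qed.

Lemma street_symmetric (k : int) : symmetric2 (k%:~R * l) street.
Proof.
move=> x; have E j : sh j (x.1, 2 * (k%:~R * l) - x.2) = ry (sh (- j - 2 * k) x).
  rewrite !shE /ry /= intrD !intrN intrM; congr pair; ring.
have hK : cancel (fun j : int => - j - 2 * k) (fun j => - j - 2 * k) by move=> j; ring.
have P1 : periodize l vortex1 (x.1, 2 * (k%:~R * l) - x.2) = periodize l vortex1 x.
  by apply: (periodize_reindex hK hK) => j; rewrite E vortex1_ry.
have P2 : periodize l vortex2 (x.1, 2 * (k%:~R * l) - x.2) = periodize l vortex2 x.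
  by apply: (periodize_reindex hK hK) => j; rewrite E /vortex2 -[RHS]vortex1_ry.
by rewrite /street P1 P2.
Qed.

Lemma street_periodic : periodic2 l street.
Proof. by move=> x; rewrite -[RHS](street_sh 1) /shift2 mul1r. Qed.

(** Where the vorticity is a function of [psi + W * (x_1 + d)], its gradient is parallel to that of
    this function, which is the travelling-wave equation; elsewhere it is locally zero. *)
Lemma vortex1_strict_diff x : exists a b, [/\ strict_diff vortex1 x a, strict_diff psi x b & b.2 * a.1 = (b.1 + W) * a.2].
Proof.
have [b hb] := psi_strict_diff x; have rp := r0.
(* Halfway between the support, in the box of half-side [r / 4], and the domain of the equation, of
   half-side [r / 2]; either way a neighbourhood of size [r / 8] is left. *)
have [h|h] := pselect (box center (3 * r / 8) x); last first.
  exists 0, b; split; rewrite ?mulr0 //.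
  have r8 : 0 < r / 8 by lra.
  apply: strict_diff_near r8 _ (strict_diff_cst 0 x) => y yx; apply/esym/eqP; apply: contrapT => /negP /vortex1_supp[y1 y2].
  apply: h; apply/boxP => /=; rewrite opprK subr0.
  have a1 : `|x.1 - y.1| <= l1 (y - x) by rewrite l1B /l1 /= lerDl.
  have a2 : `|x.2 - y.2| <= l1 (y - x) by rewrite l1B /l1 /= lerDr.
  have t1 := ler_normD (x.1 - y.1) (y.1 + d); have t2 := ler_normD (x.2 - y.2) y.2.
  rewrite addrA subrK in t1; rewrite subrK in t2.
  by split; lra.
pose D := dsmoothstep (c1 * (psi x + W * (x.1 + d)) + c0).
have w1 := strict_diff_scale W (strict_diff_add (strict_diff_dot x (1, 0)) (strict_diff_cst d x)).
have h1 := strict_diff_scale A (strict_diff_comp (ler0n R 15) (@smoothstep_C11 R) (strict_diff_add (strict_diff_scale c1 (strict_diff_add hb w1)) (strict_diff_cst c0 x))).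
have r8 : 0 < r / 8 by lra.
have h2 : strict_diff vortex1 x (A * (D * (c1 * (b.1 + W))), A * (D * (c1 * b.2))).
  have Ea (a a' : plane) : a = a' -> strict_diff vortex1 x a -> strict_diff vortex1 x a' by move=> ->.
  have dE y : dot (1, 0) y = y.1 by rewrite /dot /= mul1r mul0r addr0.
  rewrite dE -/D in h1; apply: Ea (strict_diff_near r8 _ h1).
    by apply: injective_projections => /=; ring.
  move=> y yx; rewrite dE vortex1_eq //; apply/boxP.
  have a1 : `|y.1 - x.1| <= l1 (y - x) by rewrite /l1 /= lerDl.
  have a2 : `|y.2 - x.2| <= l1 (y - x) by rewrite /l1 /= lerDr.
  have /boxP[h3 h4] := h.
  have t1 := ler_normD (y.1 - x.1) (x.1 - center.1); have t2 := ler_normD (y.2 - x.2) (x.2 - center.2).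
  rewrite subrKA in t1; rewrite subrKA in t2.
  by split; lra.
exists (A * (D * (c1 * (b.1 + W))), A * (D * (c1 * b.2))), b; split => //=; ring.
Qed.

(** Stated through strict gradients, so that one property yields both the equation and the $C^1$
    regularity. *)
Definition steady_at x := exists a b, [/\ strict_diff street x a, strict_diff psi x b & b.2 * a.1 = (b.1 + W) * a.2].

Lemma steady_left x : x.1 <= 0 -> `|x.2| <= l / 2 -> steady_at x.
Proof.
move=> x1 x2; have [a [b [ha hb E]]] := vortex1_strict_diff x; exists a, b; split => //.
have r8 : 0 < r / 8 by move: r0; lra.
apply: strict_diff_near r8 _ ha => y yx; apply/esym/street_near.
  have := ler_norm (y.1 - x.1); have : `|y.1 - x.1| <= l1 (y - x) by rewrite /l1 /= lerDl.
  by move: rd r0; lra.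
have t := ler_normD (y.2 - x.2) x.2; rewrite subrK in t.
have : `|y.2 - x.2| <= l1 (y - x) by rewrite /l1 /= lerDr.
by move: rl r0; lra.
Qed.

Lemma steady_sh k x : steady_at (sh k x) -> steady_at x.
Proof.
pose h : plane := (0, k%:~R * l); have shh y : sh k y = y + h.
  by rewrite shE; apply: injective_projections => /=; rewrite ?addr0.
rewrite shh => -[a [b [ha hb E]]]; exists a, b; split => //.
  by apply: strict_diff_near ltr01 _ (strict_diff_shift ha) => y _; rewrite -shh street_sh.
by apply: strict_diff_near ltr01 _ (strict_diff_shift hb) => y _; rewrite -shh psi_sh.
Qed.

Lemma steady_mirror x : steady_at (mirror x) -> steady_at x.
Proof.
move=> [a [b [ha hb E]]]; exists (- (- a.1, a.2)), (- (- b.1, b.2)); split.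
- by apply: strict_diff_near ltr01 _ (strict_diff_opp (strict_diff_refl1 ha)) => y _; rewrite -[(- y.1, y.2)]/(mirror y) street_mir opprK.
- by apply: strict_diff_near ltr01 _ (strict_diff_opp (strict_diff_refl1 hb)) => y _; rewrite -[(- y.1, y.2)]/(mirror y) psi_mirror opprK.
- by rewrite /= !opprK mulNr E mulrN.
Qed.

(** Vorticity and stream function are periodic, and both are odd in [x_1]; so the left half of one
    period decides. *)
Lemma steady_everywhere x : steady_at x.
Proof.
pose m := Num.floor (x.2 / l + 2^-1); have /andP[m1 m2] := floor_itv (x.2 / l + 2^-1).
rewrite -/m intrD in m1 m2; apply: (@steady_sh (- m)).
have x2 : `|(sh (- m) x).2| <= l / 2.
  rewrite shE /= mulrNz mulNr ler_norml.
  have e1 : x.2 = x.2 / l * l by rewrite divfK // gt_eqF.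
  have h1 : m%:~R * l <= (x.2 / l + 2^-1) * l by apply: ler_wpM2r => //; exact: ltW.
  have h2 : (x.2 / l + 2^-1) * l <= (m%:~R + 1) * l by apply: ler_wpM2r; exact: ltW.
  by rewrite mulrDl -e1 in h1 h2; apply/andP; split; lra.
have [h|h] := leP (sh (- m) x).1 0; first exact: steady_left.
by apply: steady_mirror; apply: steady_left => //=; rewrite oppr_le0 ltW.
Qed.

Lemma street_travelling : travelling_wave s l street (W *: e2).
Proof.
exists psi; split; first exact: stream_psi.
  by move=> x; have [a /strict_diff_diff[]] := psi_strict_diff x.
move=> x; have [a [b [/strict_diff_diff[_ a1 a2] /strict_diff_diff[_ b1 b2] E]]] := steady_everywhere x.
rewrite /dot /gradperp /grad /e2 /= a1 a2 b1 b2 /GRing.scale /= mulr0 mulr1 subr0 E; ring.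
Qed.

Lemma street_C1 : C1 street.
Proof.
have [a ha] := choice steady_everywhere; apply: (@C1_of_strict_diff R street a) => x; by have [b []] := ha x.
Qed.

Lemma vortex1_C1 : C1 vortex1.
Proof.
have [a ha] := choice vortex1_strict_diff; apply: (@C1_of_strict_diff R vortex1 a) => x; by have [b []] := ha x.
Qed.

Lemma vortex2_C1 : C1 vortex2.
Proof.
have [a ha] := choice vortex1_strict_diff; apply: (@C1_of_strict_diff R vortex2 (fun x => (- (a (mirror x)).1, (a (mirror x)).2))) => x.
by have [b [h _ _]] := ha (mirror x); exact: strict_diff_refl1 h.
Qed.

Lemma enorm_l1 x : enorm x <= l1 x.
Proof.
rewrite /enorm -[leRHS]ger0_norm ?l1_ge0 // -sqrtr_sqr ler_wsqrtr //; exact: n2_le_l1.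
Qed.

(** A point of the closure is within [r / 16] of a point of the set in each coordinate, and $2(r/4 +
    r/16) < r$. *)
Lemma supp_disc (g : plane -> R) (a : R) : (forall y, g y != 0 -> `|y.1 - a| <= r / 4 /\ `|y.2| <= r / 4) ->
  supp g `<=` disc (a, 0) r.
Proof.
move=> h x xs; have r16 : 0 < r / 16 by move: r0; lra.
have [y [/= gy yx]] := xs _ (nbhsx_ballx (x : R * R) (r / 16) r16).
have [y1 y2] := h y gy.
rewrite /disc /=; apply: le_lt_trans (enorm_l1 _) _; rewrite /l1 /= subr0.
have x1 : `|x.1 - y.1| < r / 16 by case: yx.
have x2 : `|x.2 - y.2| < r / 16 by case: yx.
have t1 := ler_normD (x.1 - y.1) (y.1 - a); have t2 := ler_normD (x.2 - y.2) y.2.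
rewrite subrKA in t1; rewrite subrK in t2; move: r0; lra.
Qed.

Lemma vortex1_disc : supp vortex1 `<=` disc (- d, 0) r.
Proof. by apply: supp_disc => y /vortex1_supp; rewrite opprK. Qed.

Lemma vortex2_disc : supp vortex2 `<=` disc (d, 0) r.
Proof.
by apply: supp_disc => y /vortex1_supp[] /=; rewrite -normrN opprD opprK => h1 h2; split.
Qed.

End wave.

(** * Convergence in the sense of measures *)

Section test_functions.
Variable R : realType.
Notation mR := (measurableTypeR R).
Notation plane := (mR * mR)%type.
Implicit Types (x y z w u v p : plane).

Lemma test_bounds (phi : plane -> R) : test_function phi -> exists B K : R,
  (forall x, `|phi x| <= B) /\ (forall x, K < `|x.2| -> phi x = 0).
Proof.
move=> [cphi csupp].
have off x : ~ supp phi x -> phi x = 0.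
  by move=> h; apply/eqP; apply: contrapT => /negP ne; apply: h; exact: subset_closure.
have cim : compact (phi @` supp phi).
  apply: continuous_compact => //; exact: continuous_subspaceT.
have [M [_ hM]] := compact_bounded cim; have [N [_ hN]] := compact_bounded csupp.
exists (`|M| + 1), (`|N| + 1); split.
  move=> x; have [sx|/off ->] := pselect (supp phi x); last by rewrite normr0 addr_ge0.
  apply: hM; last by exists x.
  by apply: le_lt_trans (ler_norm M) _; rewrite ltrDl.
move=> x hx; apply: off => sx; move: hx; apply/negP; rewrite -leNgt.
have h : `|x : R * R| <= `|N| + 1.
  by apply: hN => //; apply: le_lt_trans (ler_norm N) _; rewrite ltrDl.
by apply: le_trans h; rewrite prod_normE le_max lexx orbT.
Qed.

Lemma continuous_l1 (phi : plane -> R) p (e : R) : continuous (phi : R * R -> R) -> 0 < e ->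
  exists2 dl : R, 0 < dl & forall q, l1 (q - p) < dl -> `|phi q - phi p| <= e.
Proof.
move=> c e0; have /cvgrPdist_le/(_ e e0) := c p.
move=> /nbhs_ballP[dl /= dl0 h]; exists dl => // q hq; rewrite distrC; apply: h.
by rewrite -ball_normE /= distrC; apply: le_lt_trans (norm_l1 _) hq.
Qed.

(** The sign matches the periodization: the copy obtained from [shift2 l k] sits at height
    [- k l]. *)
Lemma int_dirac_row_symsum (l a : R) (phi : plane -> R) n : measurable_fun [set: plane] (phi : plane -> mR) ->
  (forall k : int, (n < `|k|)%N -> phi (a, k%:~R * l) = 0) ->
  int_dirac_row l a phi = symsum n (fun k => phi (a, - (k%:~R * l))).
Proof.
move=> mphi h.
have mE : measurable_fun [set: plane] (EFin \o phi) by exact/measurable_EFinP.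
rewrite /int_dirac_row (eq_fsbigr (fun k => phi (a, k%:~R * l))); last first.
  move=> k _; rewrite /Rintegral integral_dirac.
  - by rewrite diracT mul1e.
  - exact: measurableT.
  - exact: mE.
rewrite (symsum_fsbig h) -symsum_opp; apply: eq_symsum => k.
by rewrite mulrNz mulNr.
Qed.

Lemma cvg_symsum (T : Type) (Fl : set_system T) (FF : Filter Fl) (f : int -> T -> R) (v : int -> R) n :
  (forall k, f k t @[t --> Fl] --> v k) -> symsum n (fun k => f k t) @[t --> Fl] --> symsum n v.
Proof.
move=> h; elim: n => [|n IH].
  have -> : (fun t => symsum 0 (fun k => f k t)) = f 0 by apply/funext => t; rewrite symsum0.
  by rewrite symsum0; exact: h.
have -> : (fun t => symsum n.+1 (fun k => f k t)) = (fun t => symsum n (fun k => f k t) + (f n.+1%:Z t + f (- n.+1%:Z) t)).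
  by apply/funext => t; rewrite symsumS.
by rewrite symsumS; apply: cvgD => //; apply: cvgD; exact: h.
Qed.

End test_functions.

(** * Testing the street against a continuous function *)

Section test_integral.
Variable R : realType.
Notation mR := (measurableTypeR R).
Notation plane := (mR * mR)%type.
Implicit Types (x y z w u v p : plane).
Variables (l d r : R) (f phi : plane -> R) (B K : R) (n : nat).
Hypotheses (l0 : 0 < l) (r0 : 0 < r) (rr : r <= rH l d).
Hypotheses (nf : nice f) (f0 : forall x, 0 <= f x) (If : I f = 1) (foff : forall x, ~ box 0 (r / 4) x -> f x = 0).
Hypotheses (mphi : measurable_fun [set: plane] (phi : plane -> mR))
  (phiB : forall x, `|phi x| <= B) (phiK : forall x, K < `|x.2| -> phi x = 0) (nK : K <= n%:R * l).
Notation sh := (shift2 l).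
Notation mirror := (@mirror R).
Notation vortex1 := (vortex1 d f).
Notation vortex2 := (vortex2 d f).
Notation street := (street l d f).
Notation center := (center d).
Let period_shift (k : int) : plane := (0, k%:~R * l).
Definition row_test (k : int) : R := I (fun y => phi (y - period_shift k) * vortex1 y) - I (fun y => phi (mirror y - period_shift k) * vortex1 y).

Let n1 : nice vortex1. Proof. exact: vortex1_nice nf. Qed.

Lemma test_ig (g : plane -> plane) : measurable_fun [set: plane] (g : plane -> plane) ->
  ig (fun y => phi (g y) * vortex1 y).
Proof.
move=> mg; have [M [C [L [M0 C0 L0 [fC fL fM]]]]] := n1.
apply: (@ig_bounded _ 0 M (B * C)) => //.
- apply: measurable_funM; last exact: nice_measurable n1.
  exact: (measurableT_comp mphi mg).
- by move=> x; rewrite normrM; apply: ler_pM.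
- by move=> x nb; rewrite fM ?mulr0.
Qed.

Lemma measurable_subh k : measurable_fun [set: plane] (fun y : plane => y - period_shift k : plane).
Proof. by apply: measurable_fun_pair => /=; apply: measurable_funB. Qed.

Lemma measurable_mirh k : measurable_fun [set: plane] (fun y : plane => mirror y - period_shift k : plane).
Proof.
apply: measurable_fun_pair => /=; apply: measurable_funB => //.
by apply: (@measurableT_comp _ _ _ _ _ _ (-%R : mR -> mR)).
Qed.

Lemma sh_period_shift k y : sh k y = y + period_shift k.
Proof. by rewrite shE; apply: injective_projections => /=; rewrite ?addr0. Qed.

(** Only the copies that can meet the support of [phi] are kept; each is translated, and in the
    second row also reflected, back to [vortex1]. *)
Lemma street_test : ig (fun x => street x * phi x) /\ I (fun x => street x * phi x) = symsum n row_test.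
Proof.
pose F k x := vortex1 (sh k x) * phi x - vortex2 (sh k x) * phi x.
have iF k : ig (F k) /\ I (F k) = row_test k.
  have i1 := test_ig (measurable_subh k); have i2 := test_ig (measurable_mirh k).
  have [j1 e1] := I_shift (period_shift k) i1; have [j2 e2] := I_refl1 i2; have [j3 e3] := I_shift (period_shift k) j2.
  have E1 : (fun x => phi (x + period_shift k - period_shift k) * vortex1 (x + period_shift k)) = (fun x => vortex1 (sh k x) * phi x).
    by apply/funext => x; rewrite addrK sh_period_shift mulrC.
  have E3 : (fun x => phi (mirror (- (x + period_shift k).1, (x + period_shift k).2) - period_shift k) * vortex1 (- (x + period_shift k).1, (x + period_shift k).2)) = (fun x => vortex2 (sh k x) * phi x).
    by apply/funext => x; rewrite -[(- (x + period_shift k).1, (x + period_shift k).2)]/(mirror (x + period_shift k)) mirrorK addrK sh_period_shift mulrC.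
  rewrite E1 in j1 e1; rewrite E3 in j3 e3.
  split; first exact: igB j1 j3.
  by rewrite /F (IB j1 j3) e1 e3 e2.
have [i e] := ig_symsum n (fun k => (iF k).1).
have E : (fun x => street x * phi x) = (fun x => symsum n (fun k => F k x)).
  apply/funext => x; have FE k : F k x = (vortex1 (sh k x) - vortex2 (sh k x)) * phi x by rewrite /F mulrBl.
  rewrite (eq_symsum n FE) -mul_symsum.
  have [h|h] := leP `|x.2| K; last by rewrite (phiK h) !mulr0.
  have far (k : int) : (n < `|k|)%N -> r / 4 < `|(sh k x).2|.
    move=> nk; have h1 := int_gt_norm R nk; rewrite shE /=.
    have := lerB_normD (k%:~R * l) x.2; rewrite [x.2 + _]addrC normrM (gtr0_norm l0) -intr_norm.
    have : n.+1%:R * l <= `|k|%:~R * l by apply: ler_wpM2r => //; exact: ltW.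
    rewrite -natr1 mulrDl mul1r; have := le_trans rr (rH_l l d); move: nK h r0; lra.
  rewrite symsumB /street (@periodize_symsum R l vortex1 x n) ?(@periodize_symsum R l vortex2 x n) //.
    by move=> k /far h1; rewrite /vortex2 (vortex1_off _ foff).
  by move=> k /far h1; rewrite (vortex1_off _ foff).
rewrite E; split => //; rewrite e; apply: eq_symsum => k; exact: (iF k).2.
Qed.

(** Averages over a vortex of unit mass differ from the value at its centre by at most the
    oscillation of [phi]. *)
Lemma row_test_near k (e : R) : 0 <= e ->
  (forall y, l1 (y - (- d, - (k%:~R * l))) <= r -> `|phi y - phi (- d, - (k%:~R * l))| <= e) ->
  (forall y, l1 (y - (d, - (k%:~R * l))) <= r -> `|phi y - phi (d, - (k%:~R * l))| <= e) ->
  `|row_test k - (phi (- d, - (k%:~R * l)) - phi (d, - (k%:~R * l)))| <= 2 * e.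
Proof.
move=> e0 h1 h2; have i1 := test_ig (measurable_subh k); have i2 := test_ig (measurable_mirh k).
have key (g : plane -> plane) (c : R) : ig (fun y => phi (g y) * vortex1 y) ->
   (forall y, vortex1 y != 0 -> `|phi (g y) - c| <= e) -> `|I (fun y => phi (g y) * vortex1 y) - c| <= e.
  move=> ig1 h; have ic := igZ c (nice_ig n1).
  have cE : c = I (fun y => c * vortex1 y) by rewrite (IZ _ (nice_ig n1)) (vortex1_mass _ nf If) mulr1.
  have EE : (fun y => phi (g y) * vortex1 y - c * vortex1 y) = (fun y => (phi (g y) - c) * vortex1 y) by apply/funext => y; rewrite mulrBl.
  rewrite [X in `|_ - X|]cE -(IB ig1 ic) EE; apply: (vortex1_average nf f0 If) => //.
  by rewrite -EE; exact: igB ig1 ic.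
have near y : vortex1 y != 0 -> `|y.1 + d| + `|y.2| <= r.
  by move=> /(vortex1_supp foff)[y1 y2]; move: r0; lra.
have k1 := key _ (phi (- d, - (k%:~R * l))) i1 _; have k2 := key _ (phi (d, - (k%:~R * l))) i2 _.
rewrite /row_test; have -> (a b a' b' : R) : a - b - (a' - b') = (a - a') - (b - b') by ring.
apply: le_trans (ler_normB _ _) _; rewrite mulr2n mulrDl mul1r; apply: lerD.
  apply: k1 => y /near h; apply: h1; apply: le_trans h; rewrite /l1 /=.
  by rewrite subr0 !opprK subrK.
apply: k2 => y /near h; apply: h2; apply: le_trans h; rewrite /l1 /=.
by rewrite subr0 opprK subrK -opprD normrN.
Qed.

End test_integral.

(** * Conclusion *)

Record profile (R : realType) (s l d W0 C2 r : R) (f : R * R -> R) (W : R) : Prop := Profile {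
  profile_nice : nice f;
  profile_ge0 : forall x, 0 <= f x;
  profile_mass : I f = 1;
  profile_off : forall x, ~ box 0 (r / 4) x -> f x = 0;
  profile_ry : forall x, f (ry x) = f x;
  profile_speed : `|W - W0| <= C2 * r;
  profile_eq : exists A c1 c0, forall x, box 0 (r / 2) x ->
    f x = A * smoothstep (c1 * (pot s f x + I (fun y => centered_image s l d x y * f y) + W * x.1) + c0) }.

Lemma profile_exists (R : realType) (s l d : R) : 0 < s -> s <= 1 -> 0 < l -> 0 < d ->
  exists C2 rc : R, [/\ 0 < C2, 0 < rc, rc <= rH l d &
  forall r, 0 < r -> r < rc -> exists f W, profile s l d (Cs s * ssum (speed_term s l d)) C2 r f W].
Proof.
move=> s0 s1 l0 d0; have [CH [LH hK]] := H_kernel s0 s1 l0 d0.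
have [C2 C20 hT] := H_translation s0 s1 l0 d0.
have [rc rc0 h] := core s0 s1 (rH_gt0 l0 d0) C20 hK hT.
exists C2, (Num.min rc (rH l d)); split; rewrite ?lt_min ?rc0 ?rH_gt0 ?ge_min ?lexx ?orbT // => r r0.
rewrite lt_min => /andP[rr _].
have [f [W [A [c1 [c0 [nf f0 If foff [fry hW fE]]]]]]] := h r r0 rr.
by exists f, W; split => //; exists A, c1, c0.
Qed.

(** The number of relevant copies depends on the test function alone, so a finite sum of limits
    remains. *)
Lemma cvg_rows (R : realType) (l d eps0 : R) (rad : R -> R) (f : R -> R * R -> R) :
  0 < l -> 0 < eps0 ->
  (forall eps, 0 < eps < eps0 -> [/\ 0 < rad eps, rad eps <= eps, rad eps <= rH l d & nice (f eps)]) ->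
  (forall eps, 0 < eps < eps0 -> [/\ forall x, 0 <= f eps x, I (f eps) = 1 &
    forall x, ~ box 0 (rad eps / 4) x -> f eps x = 0]) ->
  cvg_dirac_rows l (- d) d (fun eps => street l d (f eps)).
Proof.
move=> l0 e0 h1 h2 phi tphi; have [cphi _] := tphi.
have [B [K [phiB phiK]]] := test_bounds tphi.
have mphi := measurable_continuous2 cphi.
pose n := Num.truncn (`|K| / l); have nK : K < n.+1%:R * l.
  by rewrite -ltr_pdivrMr //; apply: le_lt_trans (truncnS_gt _); rewrite ler_pM2r ?invr_gt0 // ler_norm.
have far (a : R) (k : int) : (n.+1 < `|k|)%N -> phi (a, k%:~R * l) = 0.
  move=> /(int_gt_norm R) kn; apply: phiK => /=; rewrite normrM (gtr0_norm l0) -intr_norm.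
  apply: lt_le_trans nK _; apply: ler_wpM2r; first exact: ltW.
  by apply: le_trans kn; rewrite ler_nat.
rewrite (int_dirac_row_symsum mphi (far (- d))) (int_dirac_row_symsum mphi (far d)) -symsumB.
have near0 (P : R -> Prop) : (forall eps, 0 < eps < eps0 -> P eps) -> \forall eps \near 0^'+, P eps.
  move=> hP; near=> eps; apply: hP; apply/andP; split; near: eps; [exact: nbhs_right_gt|exact: nbhs_right_lt].
have E : \forall eps \near 0^'+, symsum n.+1 (fun k => row_test l d (f eps) phi k) = \int[leb2 R]_x (street l d (f eps) x * phi x).
  apply: near0 => eps he; have [r0 re rr nf] := h1 _ he; have [f0 If foff] := h2 _ he.
  have [_ <-] := street_test l0 r0 rr nf foff mphi phiB phiK (ltW nK).
  by [].
apply: cvg_trans (near_eq_cvg E) _; apply: cvg_symsum => k.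
apply/cvgrPdist_le => e ep; have e2 : 0 < e / 2 by rewrite divr_gt0.
have [dl1 dl10 m1] := continuous_l1 (- d, - (k%:~R * l)) cphi e2.
have [dl2 dl20 m2] := continuous_l1 (d, - (k%:~R * l)) cphi e2.
near=> eps; have he : 0 < eps < eps0.
  by apply/andP; split; near: eps; [exact: nbhs_right_gt|exact: nbhs_right_lt].
have ed1 : eps < dl1 by near: eps; exact: nbhs_right_lt.
have ed2 : eps < dl2 by near: eps; exact: nbhs_right_lt.
have [r0 re rr nf] := h1 _ he; have [f0 If foff] := h2 _ he.
rewrite distrC (_ : e = 2 * (e / 2)); last by field.
apply: (row_test_near r0 nf f0 If foff mphi phiB (ltW e2)) => y hy.
  by apply: m1; apply: le_lt_trans (le_trans hy re) ed1.
by apply: m2; apply: le_lt_trans (le_trans hy re) ed2.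
Unshelve. all: by end_near. Qed.

Theorem theorem1p1 (R : realType) (s l d : R)
  (hs0 : 0 < s) (hs1 : s <= 1) (hl : 0 < l) (hd : 0 < d) :
  exists tau : R, 1 < tau <= 2 /\
  forall sigma : R -> R,
    (forall eps, 0 < eps -> 0 < sigma eps) ->
    (exists C : R, 0 < C /\ \forall eps \near 0^'+, sigma eps / eps <= C) ->
    (eps `^ tau / sigma eps @[eps --> 0^'+] --> 0) ->
  exists eps0 L : R, [/\ 0 < eps0, 0 < L &
  exists (theta0 theta1 theta2 : R -> R * R -> R) (W : R -> R),
    [/\ forall eps, 0 < eps < eps0 ->
          [/\ travelling_wave s l (theta0 eps) (W eps *: e2),
              periodic2 l (theta0 eps),
              [/\ C1 (theta0 eps), C1 (theta1 eps) & C1 (theta2 eps)],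
              forall k : int, symmetric2 (k%:~R * l) (theta0 eps)
            & [/\ forall x, theta0 eps x =
                    periodize l (theta1 eps) x - periodize l (theta2 eps) x,
                  supp (theta1 eps) `<=` disc (- d, 0) (L * eps)
                & supp (theta2 eps) `<=` disc (d, 0) (L * sigma eps)]],
        (W eps - Cs s * limn (fun N : nat => symsum N (fun k : int =>
            2 * d / (4 * d ^+ 2 + k%:~R ^+ 2 * l ^+ 2) `^ (2 - s))))
          @[eps --> 0^'+] --> 0
      & cvg_dirac_rows l (- d) d theta0]].
Proof.
exists 2; split; first by rewrite ltr1n lexx.
move=> sigma sigma0 _ _; have [C2 [rc [C20 rc0 rcH prof]]] := profile_exists hs0 hs1 hl hd.
pose rad eps := Num.min eps (sigma eps).
(* Conditional and with a dummy value outside the range, so that [choice] selects a profile for all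
   [eps] at once. *)
have sol eps : exists fW : (R * R -> R) * R, 0 < eps < rc ->
    profile s l d (Cs s * ssum (speed_term s l d)) C2 (rad eps) fW.1 fW.2.
  have [/andP[e0 ec]|ne] := pselect (0 < eps < rc); last by exists (fun=> 0, 0).
  have r0 : 0 < rad eps by rewrite lt_min e0 sigma0.
  have rr : rad eps < rc by rewrite gt_min ec.
  by have [f [W h]] := prof _ r0 rr; exists (f, W).
have [fW hfW] := choice sol; pose f eps := (fW eps).1; pose W eps := (fW eps).2.
have rad0 eps : 0 < eps < rc -> [/\ 0 < rad eps, rad eps <= eps, rad eps <= sigma eps & rad eps <= rH l d].
  move=> /andP[e0 ec]; split; rewrite ?lt_min ?e0 ?sigma0 ?ge_min ?lexx ?orbT //.
  by rewrite (le_trans (ltW ec) rcH).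
have disc_le (a : R * R) (r r' : R) : r <= r' -> disc a r `<=` disc a r'.
  by move=> h x /= hx; exact: lt_le_trans hx h.
(* Both vortices have radius [rad eps], which is at most [eps] and at most [sigma eps], so [L = 1]
   works. *)
exists rc, 1; split => //; exists (fun eps => street l d (f eps)), (fun eps => vortex1 d (f eps)), (fun eps => vortex2 d (f eps)), W.
split.
- move=> eps he; have [r0 re rs rr] := rad0 _ he.
  have [nf f0 If foff fry hW [A [c1 [c0 fE]]]] := hfW _ he.
  split.
  + exact: (street_travelling hs0 hs1 hl hd r0 rr nf f0 If foff fE).
  + exact: street_periodic.
  + split; [exact: (street_C1 hs0 hs1 hl hd r0 rr nf f0 If foff fE)|exact: (vortex1_C1 hs0 hs1 hl hd r0 rr nf f0 If foff fE)|exact: (vortex2_C1 hs0 hs1 hl hd r0 rr nf f0 If foff fE)].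
  + by move=> k; exact: street_symmetric.
  + split; rewrite ?mul1r //.
    * by apply: subset_trans (disc_le _ _ _ re); exact: vortex1_disc r0 foff.
    * by apply: subset_trans (disc_le _ _ _ rs); exact: vortex2_disc r0 foff.
- apply/cvgrPdist_le => e e0; near=> eps.
  have ep : 0 < eps by near: eps; exact: nbhs_right_gt.
  have ec : eps < rc by near: eps; exact: nbhs_right_lt.
  have ee : eps < e / C2 by near: eps; apply: nbhs_right_lt; rewrite divr_gt0.
  have he : 0 < eps < rc by rewrite ep.
  have [_ re _ _] := rad0 _ he; have hW := profile_speed (hfW _ he).
  rewrite sub0r normrN; apply: le_trans hW _; apply: (@le_trans _ _ (C2 * eps)).
    by apply: ler_wpM2l => //; exact: ltW.
  by rewrite mulrC -ler_pdivlMr // ltW.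
- apply: (@cvg_rows R l d rc rad f) => // eps he.
    by have [r0 re _ rr] := rad0 _ he; split => //; exact: profile_nice (hfW _ he).
  by have [_ f0 If foff _ _ _] := hfW _ he.
Unshelve. all: by end_near. Qed.
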